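(* For every $\rho\in(1/2,\infty)\setminus\{1\}$ there exist a probability measure $\Delta$ on $[0,2\pi)$, satisfying $\int_0^{2\pi}e^{i\rho\theta}\,d\Delta(\theta)=0$ in case $\rho\in\mathbb N$, and a nonempty open interval $J_{\rho,\Delta}\subset(0,\infty)$ such that for any positive sequence $\Lambda_{\mathbb R}$ with density $\mathcal D\in J_{\rho,\Delta}$, its $\Delta$-randomization $\widetilde\Lambda_\Delta$ is almost surely neither a zero set nor a uniqueness set for the Fock-type space $\mathcal F_\rho$.
   Context: The Fock-type space $\mathcal F_\rho$, $\rho>0$, consists of the entire functions $f$ with $\|f\|_\rho^2=\int_{\mathbb C}\left(|f(z)|e^{-|z|^\rho}\right)^2dm(z)<\infty$, $m$ being planar Lebesgue measure. A discrete set $\Lambda$ (with multiplicities) is a zero set for $\mathcal F_\rho$ if there is $f\in\mathcal F_\rho$ whose zeros, with multiplicities, are exactly the points of $\Lambda$; it is a uniqueness set for $\mathcal F_\rho$ if the only $f\in\mathcal F_\rho$ vanishing on $\Lambda$ (with at least the given multiplicities) is $f\equiv0$. $\Lambda_{\mathbb R}=\{l_k\}_{k\in\mathbb N}$ is a non-decreasing sequence of positive numbers with finite density (with respect to $\rho$) $\mathcal D=\lim_{R\to\infty}n_{\Lambda_{\mathbb R}}(R)/R^\rho<\infty$, where $n_{\Lambda_{\mathbb R}}(R)=\#\{k:l_k<R\}$. The $\Delta$-randomization of $\Lambda_{\mathbb R}$ is the random set $\widetilde\Lambda_\Delta=\{\lambda_k=l_ke^{i\theta_k}:\ l_k\in\Lambda_{\mathbb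 R}\}$, where the $\theta_k$ are independent random variables, all with distribution $\Delta$. *)

(* Defs.v *)
From HB Require Import structures.
From mathcomp Require Import all_boot all_order all_algebra finmap.
From mathcomp Require Import all_classical all_reals all_analysis.
From mathcomp Require Export complex.

Set Implicit Arguments.
Unset Strict Implicit.
Unset Printing Implicit Defensive.

Import Order.TTheory GRing.Theory Num.Theory.
Import numFieldNormedType.Exports.

Local Open Scope classical_set_scope.
Local Open Scope card_scope.
Local Open Scope ring_scope.
Local Open Scope complex_scope.

(* Complex differentiability and complex derivatives are taken in R[i]^o, the
   field R[i] seen as a normed module over itself. *)
Definition entire (R : realType) (f : R[i] -> R[i]) : Prop :=
  forall z : R[i], derivable (f : R[i]^o -> R[i]^o) z 1.

Definition cderiv (R : realType) (n : nat) (f : R[i] -> R[i]) : R[i] -> R[i] :=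
  derive1n n (f : R[i] -> R[i]^o).

Definition fock_norm_sq (R : realType) (rho : R) (f : R[i] -> R[i]) : \bar R :=
  (\int[(lebesgue_measure \x lebesgue_measure)]_(p in [set: R * R])
     (((Normc.normc (f (p.1 +i* p.2))
        * expR (- (Normc.normc (p.1 +i* p.2) `^ rho))) ^+ 2)%R)%:E)%E.

Definition fock_space (R : realType) (rho : R) : set (R[i] -> R[i]) :=
  [set f | entire f /\ (fock_norm_sq rho f < +oo)%E].

Definition vanishes_to_order (R : realType) (f : R[i] -> R[i]) (z : R[i])
    (m : nat) : Prop :=
  forall j, (j < m)%N -> cderiv j f z = 0.

(* For f = 0 no m satisfies this. *)
Definition exact_order (R : realType) (f : R[i] -> R[i]) (z : R[i])
    (m : nat) : Prop :=
  vanishes_to_order f z m /\ cderiv m f z <> 0.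

(* A set with multiplicities is given by an enumeration lam; the multiplicity
   of z is the cardinality of the fiber of lam above z. *)
Definition zero_set (R : realType) (rho : R) (lam : nat -> R[i]) : Prop :=
  exists2 f, fock_space rho f &
    forall z, exists2 m, [set k | lam k = z] #= `I_m & exact_order f z m.

Definition uniqueness_set (R : realType) (rho : R) (lam : nat -> R[i]) : Prop :=
  forall f, fock_space rho f ->
    (forall z m, `I_m #<= [set k | lam k = z] -> vanishes_to_order f z m) ->
    forall z, f z = 0.

Definition counting_function (R : realType) (l : nat -> R) (r : R) : \bar R :=
  counting [set k | l k < r].

(* The counting function is extended-real valued, so convergence to a finite D
   forces it to be finite. *)
Definition has_density (R : realType) (rho : R) (l : nat -> R) (D : R) : Prop :=
  (counting_function l r * ((r `^ rho)^-1)%:E)%E @[r --> +oo] --> D%:E.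

Definition expi (R : realType) (t : R) : R[i] := cos t +i* sin t.

Definition complex_integral d (T : measurableType d) (R : realType)
    (mu : {measure set T -> \bar R}) (A : set T) (g : T -> R[i]) : R[i] :=
  Rintegral mu A (fun x => complex.Re (g x))
  +i* Rintegral mu A (fun x => complex.Im (g x)).

Definition mutually_independent d (T : measurableType d) (R : realType)
    (P : probability T R) (X : nat -> {RV P >-> R}) : Prop :=
  forall (I : {fset nat}) (B : nat -> set R),
    (forall k, measurable (B k)) ->
    P (\bigcap_(k in [set` I]) (X k @^-1` B k)) =
    (\prod_(k <- I) P (X k @^-1` B k))%E.

Definition identically_distributed d (T : measurableType d) (R : realType)
    (P : probability T R) (X : nat -> {RV P >-> R}) (Delta : probability R R) :
    Prop :=
  forall k (B : set R), measurable B -> distribution P (X k) B = Delta B.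

Definition randomization (R : realType) (l theta : nat -> R) : nat -> R[i] :=
  fun k => (l k)%:C * expi (theta k).

(* Main.v *)
(* Let n = floor(rho) + 1, so that rho < n < 2 rho, let Delta be uniform on the angles 2 pi j / n, and
   let c be the supremum over x > 0 of x^-1 sum_{k >= 1} log(1 + (x / k)^(n / rho)).

   If f vanishes exactly on the randomized set, then the symmetrization prod_j f(w^j z), w a primitive
   n-th root of unity, has the zeros l_k w^j, all n of them for each k and with real n-th power; evaluated
   on the rays where z^n < 0 its size is at least prod_k (1 + |z|^n / l_k^n), of order exp(c D |z|^rho), up
   to a zero-free part which cannot be small on average.  Membership in the Fock space gives the upper bound
   exp(n |z|^rho), hence c D <= n.

   Conversely let c D be slightly larger than n.  Almost surely the numbers of points in the n directions
   differ from their mean by O(k^(5/6)), so that the canonical product of the randomized set has the growth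
   of the n-th root of prod_k (1 - z^n / l_k^n), which is less than exp((1 - h) |z|^rho) away from the n rays
   z^n < 0.  Multiplying by a sparse product with zeros on these rays, which decays exponentially there
   because n < 2 rho, gives a nonzero function of the Fock space.  Hence every D slightly larger than n / c
   has the required property. *)
Require Import Defs.
From HB Require Import structures.
From mathcomp Require Import all_boot all_order all_algebra finmap.
From mathcomp Require Import all_classical all_reals all_analysis.
From mathcomp Require Import measurable_realfun zify ring lra.
Import Order.TTheory GRing.Theory Num.Theory.
Import numFieldNormedType.Exports.
Local Open Scope classical_set_scope.
Local Open Scope ring_scope.
Local Open Scope complex_scope.
Set Implicit Arguments.
Unset Strict Implicit.
Unset Printing Implicit Defensive.

(** * Complex limits and derivatives *)

(** The inequality rho < n makes rotational averages insensitive to zero-free factors: averaging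
    keeps only powers of z divisible by n, of relative size (|z| / T)^n, while the logarithm of a
    zero-free quotient on the disc of radius T is O(T^rho). In the same way the polynomials in
    Weierstrass factors of genus n - 1 have rotational sum zero. The inequality n < 2 rho puts a = n
    / rho below 2, the borderline exponent, for which the product on the negative ray is a sine and
    has no exponential decay. The construction has to beat errors of the full order |z|^rho. The
    random errors are summed by parts against l_k^-rho, which is of order 1 / k; a discrepancy
    O(k^(5/6)) then leaves O(K^(-1/6)) when the summation starts at K. So K is taken large and the
    convergence factors of earlier points are dropped. Summation by parts also needs log |1 - u| to
    have bounded variation along rays, uniformly in the direction. It is therefore truncated near u
    = 1, at a level so low that the product over all n rotations keeps its upper bound 1 + |u|^n. *)

Section ComplexBasics.
Variable R : realType.
Local Notation C := (R[i]).
Local Notation nm := (@Normc.normc R).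
Local Notation Re := (@complex.Re R).
Local Notation Im := (@complex.Im R).
Implicit Types (z w : C) (x y e : R).

Lemma nm_ge0 z : 0 <= nm z.
Proof. by case: z => a b; exact: sqrtr_ge0. Qed.

Lemma nmE z : `|z| = (nm z)%:C.
Proof. by case: z. Qed.

Lemma nmM z w : nm (z * w) = nm z * nm w. Proof. exact: Normc.normcM. Qed.
Lemma nm0 : nm 0 = 0. Proof. exact: Normc.normc0. Qed.
Lemma nm1 : nm 1 = 1. Proof. exact: Normc.normc1. Qed.
Lemma nmV z : nm z^-1 = (nm z)^-1. Proof. exact: Normc.normcV. Qed.
Lemma nmN z : nm (- z) = nm z.
Proof. by case: z => a b; rewrite /= !sqrrN. Qed.
Lemma nmB z w : nm (z - w) = nm (w - z).
Proof. by rewrite -nmN opprB. Qed.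
Lemma nm_eq0 z : (nm z == 0) = (z == 0).
Proof.
by apply/eqP/eqP => [|->]; [exact: Normc.eq0_normc|exact: nm0].
Qed.
Lemma nm_gt0 z : (0 < nm z) = (z != 0).
Proof. by rewrite lt_neqAle nm_ge0 andbT eq_sym nm_eq0. Qed.

Lemma nmD z w : nm (z + w) <= nm z + nm w.
Proof.
have := ler_normD z w; rewrite !nmE -rmorphD /= lecE /=.
by case/andP.
Qed.

Lemma nm_triB z w v : nm (z - w) <= nm (z - v) + nm (v - w).
Proof.
have -> : z - w = (z - v) + (v - w) by ring.
exact: nmD.
Qed.

Lemma nm_subl z w : nm z - nm w <= nm (z - w).
Proof. by rewrite lerBlDr; have := nmD (z - w) w; rewrite subrK. Qed.

Lemma nmX z n : nm (z ^+ n) = nm z ^+ n.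
Proof. by elim: n => [|n IH]; rewrite ?expr0 ?nm1// !exprS nmM IH. Qed.

Lemma nm_real x : nm x%:C = `|x|.
Proof. by rewrite /= expr0n addr0 sqrtr_sqr. Qed.

Lemma nm_nat n : nm n%:R = n%:R.
Proof. by rewrite -(rmorph_nat (real_complex R)) nm_real normr_nat. Qed.

Lemma nm_i : nm 'i%C = 1.
Proof. by rewrite /= expr0n add0r expr1n sqrtr1. Qed.

Lemma nm_sum (I : Type) (s : seq I) (P : pred I) (F : I -> C) :
  nm (\sum_(i <- s | P i) F i) <= \sum_(i <- s | P i) nm (F i).
Proof.
elim/big_ind2 : _ => //; first by rewrite nm0.
by move=> a b c d ab cd; apply: le_trans (nmD _ _) _; exact: lerD.
Qed.

Lemma nm_prod (I : Type) (s : seq I) (P : pred I) (F : I -> C) :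
  nm (\prod_(i <- s | P i) F i) = \prod_(i <- s | P i) nm (F i).
Proof.
elim/big_ind2 : _ => //; first by rewrite nm1.
by move=> a b c d <- <-; rewrite nmM.
Qed.

Lemma Re_le_nm z : `|Re z| <= nm z.
Proof.
case: z => a b /=; rewrite -sqrtr_sqr ler_wsqrtr// lerDl; exact: sqr_ge0.
Qed.

Lemma Im_le_nm z : `|Im z| <= nm z.
Proof.
case: z => a b /=; rewrite -sqrtr_sqr ler_wsqrtr// lerDr; exact: sqr_ge0.
Qed.

Lemma nm_sqr z : nm z ^+ 2 = Re z ^+ 2 + Im z ^+ 2.
Proof. by case: z => a b /=; rewrite sqr_sqrtr// addr_ge0 ?sqr_ge0. Qed.

Lemma nm_le z : nm z <= `|Re z| + `|Im z|.
Proof.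
rewrite -ler_sqr ?nnegrE ?nm_ge0 ?addr_ge0// nm_sqr sqrrD.
rewrite !real_normK ?num_real//.
have := mulr_ge0 (normr_ge0 (Re z)) (normr_ge0 (Im z)); lra.
Qed.

Lemma ReD z w : Re (z + w) = Re z + Re w. Proof. by case: z; case: w. Qed.
Lemma ImD z w : Im (z + w) = Im z + Im w. Proof. by case: z; case: w. Qed.
Lemma ReN z : Re (- z) = - Re z. Proof. by case: z. Qed.
Lemma ImN z : Im (- z) = - Im z. Proof. by case: z. Qed.
Lemma ReM z w : Re (z * w) = Re z * Re w - Im z * Im w.
Proof. by case: z; case: w. Qed.
Lemma ImM z w : Im (z * w) = Re z * Im w + Im z * Re w.
Proof. by case: z; case: w. Qed.

Lemma Re_inv z : Re z^-1 = Re z / nm z ^+ 2.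
Proof. by rewrite nm_sqr; case: z. Qed.
Lemma Im_inv z : Im z^-1 = - Im z / nm z ^+ 2.
Proof. by rewrite nm_sqr; case: z => a b /=; rewrite mulNr. Qed.

Lemma complex_eq z w : Re z = Re w -> Im z = Im w -> z = w.
Proof. by case: z w => a b [c d] /= -> ->. Qed.

(** Coordinatewise convergence inherits the limit rules of the reals. It also avoids the norm of
    [C^o], whose values and radii are complex numbers. *)
Definition ccvg (T : Type) (F : set_system T) (f : T -> C) (l : C) :=
  (fun t => Re (f t)) @ F --> Re l /\ (fun t => Im (f t)) @ F --> Im l.

Lemma ccvgP (T : Type) (F : set_system T) {FF : Filter F} (f : T -> C) l :
  ccvg F f l <-> forall e : R, 0 < e -> \forall t \near F, nm (f t - l) < e.
Proof.
split.
  move=> [/cvgrPdist_lt h1 /cvgrPdist_lt h2] e e0.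
  have e2 : 0 < e / 2 by rewrite divr_gt0.
  near=> t.
  apply: le_lt_trans (nm_le _) _.
  rewrite [ltRHS](splitr e) ReD ImD ReN ImN.
  by apply: ltrD; rewrite distrC; near: t; [exact: h1|exact: h2].
move=> h; split; apply/cvgrPdist_lt => e e0; have := h e e0;
  apply: filterS => t; apply: le_lt_trans; rewrite distrC.
- by rewrite -ReN -ReD Re_le_nm.
- by rewrite -ImN -ImD Im_le_nm.
Unshelve. all: by end_near.
Qed.

Lemma ccvg_cst (T : Type) (F : set_system T) {FF : Filter F} c :
  ccvg F (fun=> c) c.
Proof. by split; exact: cvg_cst. Qed.

Lemma ccvgD (T : Type) (F : set_system T) {FF : Filter F} f g a b :
  ccvg F f a -> ccvg F g b -> ccvg F (fun t => f t + g t) (a + b).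
Proof.
move=> [f1 f2] [g1 g2]; split.
- by rewrite ReD; under eq_fun do rewrite ReD; exact: cvgD.
- by rewrite ImD; under eq_fun do rewrite ImD; exact: cvgD.
Qed.

Lemma ccvgN (T : Type) (F : set_system T) {FF : Filter F} f a :
  ccvg F f a -> ccvg F (fun t => - f t) (- a).
Proof.
move=> [f1 f2]; split.
- by rewrite ReN; under eq_fun do rewrite ReN; exact: cvgN.
- by rewrite ImN; under eq_fun do rewrite ImN; exact: cvgN.
Qed.

Lemma ccvgB (T : Type) (F : set_system T) {FF : Filter F} f g a b :
  ccvg F f a -> ccvg F g b -> ccvg F (fun t => f t - g t) (a - b).
Proof. by move=> fa gb; apply: ccvgD => //; exact: ccvgN. Qed.

Lemma ccvgM (T : Type) (F : set_system T) {FF : Filter F} f g a b :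
  ccvg F f a -> ccvg F g b -> ccvg F (fun t => f t * g t) (a * b).
Proof.
move=> [f1 f2] [g1 g2]; split.
- by rewrite ReM; under eq_fun do rewrite ReM; apply: cvgB; exact: cvgM.
- by rewrite ImM; under eq_fun do rewrite ImM; apply: cvgD; exact: cvgM.
Qed.

Lemma ccvg_nm (T : Type) (F : set_system T) {FF : Filter F} f a :
  ccvg F f a -> (fun t => nm (f t)) @ F --> nm a.
Proof.
move=> /ccvgP h; apply/cvgrPdist_lt => e e0.
have := h e e0; apply: filterS => t; apply: le_lt_trans.
rewrite ler_norml; apply/andP; split.
  by rewrite lerNl opprB; exact: nm_subl.
by rewrite nmB; exact: nm_subl.
Qed.

Lemma ccvgV (T : Type) (F : set_system T) {FF : Filter F} f a :
  a != 0 -> ccvg F f a -> ccvg F (fun t => (f t)^-1) a^-1.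
Proof.
move=> a0 fa; have [f1 f2] := fa.
have h : nm (f t) @[t --> F] --> nm a by exact: ccvg_nm.
have n0 : nm a ^+ 2 != 0 by rewrite sqrf_eq0 nm_eq0.
have h2 : (nm (f t) ^+ 2)^-1 @[t --> F] --> (nm a ^+ 2)^-1.
  by apply: cvgV => //; exact: (cvgM h h).
split.
- by rewrite Re_inv; under eq_fun do rewrite Re_inv; exact: cvgM.
- rewrite Im_inv; under eq_fun do rewrite Im_inv.
  by apply: cvgM => //; exact: cvgN.
Qed.

Lemma ccvg_real (T : Type) (F : set_system T) {FF : Filter F} (f : T -> R) (a : R) :
  f @ F --> a -> ccvg F (fun t => (f t)%:C) a%:C.
Proof. by move=> h; split => //=; exact: cvg_cst. Qed.

Lemma ccvgX (T : Type) (F : set_system T) {FF : Filter F} f a n :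
  ccvg F f a -> ccvg F (fun t => f t ^+ n) (a ^+ n).
Proof.
move=> h; elim: n => [|n IH].
  by under eq_fun do rewrite expr0; exact: ccvg_cst.
by rewrite exprS; under eq_fun do rewrite exprS; exact: ccvgM.
Qed.

Definition cnbhs (z : C) : set_system C := nbhs (z : C^o).

#[global] Instance cnbhs_filter z : ProperFilter (cnbhs z).
Proof. rewrite /cnbhs. refine (nbhs_pfilter (z : C^o)). Qed.

Lemma cnbhsP (z : C) (P : set C) :
  cnbhs z P <-> exists2 e : R, 0 < e & forall w, nm (w - z) < e -> P w.
Proof.
rewrite /cnbhs -nbhs_ballE; split.
  move=> [e /= e0 h]; have := e0; rewrite ltcE /= => /andP[/eqP ei e0'].
  exists (Re e) => // w wz; apply: h; rewrite -ball_normE /= distrC nmE.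
  by rewrite ltcE /= wz -ei eqxx.
move=> [e e0 h]; exists e%:C => /=; first by rewrite ltcR.
move=> w; rewrite -ball_normE /= distrC nmE ltcR; exact: h.
Qed.

Definition ccont (f : C -> C) z := ccvg (cnbhs z) f (f z).

Lemma ccontP (f : C -> C) z : ccont f z <->
  forall e, 0 < e -> exists2 d, 0 < d & forall w, nm (w - z) < d -> nm (f w - f z) < e.
Proof.
rewrite /ccont ccvgP; split => h e e0.
  by have /cnbhsP := h e e0.
by apply/cnbhsP; exact: h.
Qed.

Lemma ccont_id z : ccont id z.
Proof. by apply/ccontP => e e0; exists e. Qed.

Lemma ccontD f g z : ccont f z -> ccont g z -> ccont (fun w => f w + g w) z.
Proof. by move=> cf cg; exact: (ccvgD cf cg). Qed.

Lemma ccontM f g z : ccont f z -> ccont g z -> ccont (fun w => f w * g w) z.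
Proof. by move=> cf cg; exact: (ccvgM cf cg). Qed.

Lemma ccont_cst c z : ccont (fun=> c) z.
Proof. by rewrite /ccont; apply: ccvg_cst. Qed.

Definition pcont (f : R -> C) (t : R) := ccvg (nbhs t) f (f t).

Lemma pcont_comp (f : C -> C) (g : R -> C) t :
  ccont f (g t) -> pcont g t -> pcont (fun s => f (g s)) t.
Proof.
move=> /ccontP h /ccvgP k; apply/ccvgP => e /h[d d0 {}h].
by have := k d d0; apply: filterS => s; exact: h.
Qed.

Lemma ccont_comp (f : C -> C) (g : C -> C) t :
  ccont f (g t) -> ccont g t -> ccont (fun s => f (g s)) t.
Proof.
move=> /ccontP h /ccvgP k; apply/ccvgP => e /h[d d0 {}h].
by have := k d d0; apply: filterS => s; exact: h.
Qed.

Definition cdiff (f : C -> C) z d := forall e, 0 < e ->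
  exists2 r, 0 < r & forall w, nm (w - z) < r ->
    nm (f w - f z - d * (w - z)) <= e * nm (w - z).

(** Caratheodory's form of the derivative: the slope [phi] is defined everywhere and continuous at
    z. It turns the product, chain and quotient rules into algebraic identities followed by
    continuity. *)
Lemma cdiffP f z d : cdiff f z d <->
  exists phi : C -> C, [/\ forall w, f w - f z = phi w * (w - z), phi z = d
    & ccont phi z].
Proof.
split => [h|[phi [h1 h2 /ccontP h3]] e /h3[r r0 {}h3]]; last first.
  exists r => // w wz; rewrite h1 -mulrBl nmM -h2 ler_wpM2r ?nm_ge0// ltW//.
  exact: h3.
exists (fun w => if w == z then d else (f w - f z) / (w - z)); split.
- move=> w; case: eqP => [->|/eqP wz]; first by rewrite !subrr mulr0.
  by rewrite divfK// subr_eq0.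
- by rewrite eqxx.
- apply/ccontP => e e0; have e2 : 0 < e / 2 by rewrite divr_gt0.
  have [r r0 k] := h _ e2; exists r => // w wz.
  rewrite eqxx; case: eqP => [_|/eqP wz']; first by rewrite subrr nm0.
  have wz0 : w - z != 0 by rewrite subr_eq0.
  have -> : (f w - f z) / (w - z) - d = (f w - f z - d * (w - z)) / (w - z).
    by field.
  rewrite nmM nmV ltr_pdivrMr ?nm_gt0//; apply: le_lt_trans (k _ wz) _.
  by rewrite ltr_pM2r ?nm_gt0// ltr_pdivrMr// ltr_pMr// ltr1n.
Qed.

Lemma cdiff_cont f z d : cdiff f z d -> ccont f z.
Proof.
move=> /cdiffP[phi [h1 h2 h3]].
have -> : f = (fun w => f z + phi w * (w - z)).
  by apply/funext => w; rewrite -h1 addrC subrK.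
rewrite /ccont subrr mulr0 addr0 -[X in ccvg _ _ X]addr0.
apply: ccvgD; first exact: ccvg_cst.
rewrite -(mulr0 (phi z)) -(subrr z).
by apply: ccvgM => //; apply: ccvgB; [exact: ccont_id|exact: ccvg_cst].
Qed.

Lemma cdiff_cst c z : cdiff (fun=> c) z 0.
Proof.
by apply/cdiffP; exists (fun=> 0); split => // [w|];
  [rewrite subrr mul0r|exact: ccont_cst].
Qed.

Lemma cdiff_id z : cdiff id z 1.
Proof.
by apply/cdiffP; exists (fun=> 1); split => // [w|];
  [rewrite mul1r|exact: ccont_cst].
Qed.

Lemma cdiffD f g z a b :
  cdiff f z a -> cdiff g z b -> cdiff (fun w => f w + g w) z (a + b).
Proof.
move=> /cdiffP[p [p1 p2 p3]] /cdiffP[q [q1 q2 q3]]; apply/cdiffP.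
exists (fun w => p w + q w); split => [w||]; last 2 first.
- by rewrite p2 q2.
- by have := ccontD p3 q3.
by rewrite mulrDl -p1 -q1; ring.
Qed.

Lemma cdiffM f g z a b : cdiff f z a -> cdiff g z b ->
  cdiff (fun w => f w * g w) z (a * g z + f z * b).
Proof.
move=> fa gb; have fc := cdiff_cont fa; have gc := cdiff_cont gb.
move: fa gb => /cdiffP[p [p1 p2 p3]] /cdiffP[q [q1 q2 q3]]; apply/cdiffP.
exists (fun w => p w * g w + f z * q w); split => [w||]; last 2 first.
- by rewrite p2 q2.
- exact: (ccontD (ccontM p3 gc) (ccontM (ccont_cst (f z) z) q3)).
have -> : (p w * g w + f z * q w) * (w - z) =
  (p w * (w - z)) * g w + f z * (q w * (w - z)) by ring.
by rewrite -p1 -q1; ring.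
Qed.

Lemma cdiffZ f z a c : cdiff f z a -> cdiff (fun w => c * f w) z (c * a).
Proof.
by move=> fa; have := cdiffM (cdiff_cst c z) fa; rewrite mul0r add0r.
Qed.

Lemma cdiffN f z a : cdiff f z a -> cdiff (fun w => - f w) z (- a).
Proof.
move=> fa; have := cdiffZ (-1) fa; rewrite mulN1r.
by congr cdiff; apply/funext => w; rewrite mulN1r.
Qed.

Lemma cdiffB f g z a b :
  cdiff f z a -> cdiff g z b -> cdiff (fun w => f w - g w) z (a - b).
Proof. by move=> fa gb; apply: cdiffD => //; exact: cdiffN. Qed.

Lemma cdiff_comp f g z a b : cdiff g z a -> cdiff f (g z) b ->
  cdiff (fun w => f (g w)) z (b * a).
Proof.
move=> ga; have gc := cdiff_cont ga.
move: ga => /cdiffP[p [p1 p2 p3]] /cdiffP[q [q1 q2 q3]]; apply/cdiffP.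
exists (fun w => q (g w) * p w); split => [w||]; last 2 first.
- by rewrite p2 q2.
- exact: (ccontM (ccont_comp q3 gc) p3).
by rewrite -mulrA -p1 -q1.
Qed.

Lemma cdiffV f z a : f z != 0 -> cdiff f z a ->
  cdiff (fun w => (f w)^-1) z (- a / f z ^+ 2).
Proof.
move=> fz0 fa; have fc := cdiff_cont fa.
have vc : ccvg (cnbhs z) (fun w => (f w)^-1) (f z)^-1 by exact: ccvgV.
have [phi [p1 p2 p3]] := (cdiffP f z a).1 fa; apply/cdiffP.
(* The inverse of 0 is 0 by convention, so at a zero of [f] the slope must be the difference
   quotient itself; the value for [w == z] there is a default. No zero of [f] lies near z, so
   continuity concerns the last branch only. *)
pose psi w := if f w == 0 then
  (if w == z then - a / f z ^+ 2 else ((f w)^-1 - (f z)^-1) / (w - z))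
  else - phi w / (f w * f z).
exists psi; rewrite /psi; split => [w||].
- have [fw|fw] := eqVneq (f w) 0.
    have wz : w != z by apply: contraNneq fz0 => <-; rewrite fw.
    by rewrite (negbTE wz) divfK// subr_eq0.
  have -> : - phi w / (f w * f z) * (w - z) = - (phi w * (w - z)) / (f w * f z).
    by ring.
  by rewrite -p1; field; apply/andP.
- by rewrite (negbTE fz0) p2 expr2.
- rewrite /ccont (negbTE fz0).
  have /ccvgP k : ccvg (cnbhs z) (fun w => - phi w * ((f w)^-1 * (f z)^-1))
      (- phi z / (f z * f z)).
    rewrite invfM; apply: ccvgM; first exact: ccvgN.
    by apply: ccvgM => //; exact: ccvg_cst.
  apply/ccvgP => e e0; have nf0 : 0 < nm (f z) by rewrite nm_gt0.
  have [d d0 hd] := (ccontP f z).1 fc _ nf0.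
  have nz : \forall w \near cnbhs z, f w != 0.
    apply/cnbhsP; exists d => // w /hd; apply: contraTneq => ->.
    by rewrite sub0r nmN ltxx.
  near=> w.
  have fw : f w != 0 by near: w.
  rewrite (negbTE fw) invfM; near: w; exact: k.
Unshelve. all: by end_near.
Qed.

Lemma cdiffX n z : cdiff (fun w => w ^+ n) z (n%:R * z ^+ n.-1).
Proof.
elim: n => [|n IH].
  rewrite mul0r; have -> : (fun w : C => w ^+ 0) = fun=> 1.
    by apply/funext => w; rewrite expr0.
  exact: cdiff_cst.
have -> : (fun w : C => w ^+ n.+1) = fun w => w * w ^+ n.
  by apply/funext => w; rewrite exprS.
have := cdiffM (cdiff_id z) IH.
congr cdiff; rewrite mul1r; case: n {IH} => [|n] /=; first by rewrite mul0r mulr0 addr0 expr0 mulr1.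
by rewrite mulrCA -exprS -[in RHS]natr1 mulrDl mul1r addrC.
Qed.

Lemma cdiff_sum (I : Type) (s : seq I) (F : I -> C -> C) (D : I -> C) z :
  (forall i, cdiff (F i) z (D i)) ->
  cdiff (fun w => \sum_(i <- s) F i w) z (\sum_(i <- s) D i).
Proof.
move=> h; elim: s => [|i s IH].
  rewrite big_nil; have -> : (fun w => \sum_(i <- [::]) F i w) = fun=> 0.
    by apply/funext => w; rewrite big_nil.
  exact: cdiff_cst.
rewrite big_cons.
have -> : (fun w => \sum_(j <- i :: s) F j w) = fun w => F i w + \sum_(j <- s) F j w.
  by apply/funext => w; rewrite big_cons.
exact: cdiffD.
Qed.

Lemma cdiff_eq_near f g z d : (\forall w \near cnbhs z, f w = g w) ->
  cdiff f z d -> cdiff g z d.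
Proof.
move=> /cnbhsP[s s0 h] fd e /fd[r r0 k].
exists (Num.min r s); first by rewrite lt_min r0.
move=> w; rewrite lt_min => /andP[wr ws].
by rewrite -!h ?subrr ?nm0//; exact: k.
Qed.


Lemma cdiff_cvg (f : C^o -> C^o) (z d : C^o) : cdiff f z d <->
  (fun h : C^o => h^-1 *: (f (h + z) - f z)) @ dnbhs (0 : C^o) --> d.
Proof.
split.
- move=> fd; apply/cvgrPdist_le => e; rewrite ltcE /= => /andP[/eqP ei e0].
  have [r r0 hr] := fd _ e0.
  suff : cnbhs 0 [set h : C | h != 0 -> `|d - h^-1 *: (f (h + z) - f z)| <= e].
    by [].
  apply/cnbhsP; exists r => // h; rewrite subr0 => hr' h0.
  rewrite nmE lecE /= -ei eqxx /=.
  have := hr (h + z); rewrite addrK => /(_ hr') k.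
  have -> : d - h^-1 *: (f (h + z) - f z) =
     - (h^-1 * (f (h + z) - f z - d * h)).
    by rewrite /GRing.scale /=; field.
  by rewrite nmN nmM nmV mulrC ler_pdivrMr ?nm_gt0.
- move=> /cvgrPdist_le h e e0; have eC : 0 < e%:C by rewrite ltcR.
  have : cnbhs 0 [set h : C | h != 0 -> `|d - h^-1 *: (f (h + z) - f z)| <= e%:C].
    exact: (h _ eC).
  move=> /cnbhsP[r r0 k]; exists r => // w wz.
  have [->|wz0] := eqVneq w z; first by rewrite !subrr mulr0 subrr nm0 mulr0.
  have wz1 : (w : C) - (z : C) != 0 by rewrite (subr_eq0 (w : C)).
  have := k (w - z); rewrite subr0 => /(_ wz wz1).
  rewrite (@subrK C) nmE lecR => {}k.
  have -> : f w - f z - d * (w - z) =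
     - ((d - (w - z)^-1 *: (f w - f z)) * (w - z)).
    by rewrite /GRing.scale /=; field.
  by rewrite nmN nmM ler_wpM2r ?nm_ge0.
Qed.

Lemma derivable_cdiff (f : C^o -> C^o) z :
  derivable f z 1 -> cdiff f z (f^`()%classic z).
Proof.
rewrite /derivable => h; apply/cdiff_cvg; rewrite /derive1.
by move: h; under eq_fun do rewrite [_ *: 1]mulr1.
Qed.

Lemma cdiff_derivable (f : C^o -> C^o) z d :
  cdiff f z d -> derivable f z 1 /\ f^`()%classic z = d.
Proof.
move=> /cdiff_cvg h; split.
  rewrite /derivable; under eq_fun do rewrite [_ *: 1]mulr1.
  by apply/cvg_ex; exists d.
by rewrite /derive1; apply: cvg_lim => //.
Qed.

Lemma entireP (f : C -> C) : entire f <-> forall z, exists d, cdiff f z d.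
Proof.
split=> [h z|h z]; first by exists ((f : C^o -> C^o)^`()%classic z); exact: derivable_cdiff.
by have [d /cdiff_derivable[]] := h z.
Qed.

End ComplexBasics.

(** * Path integrals *)

Section PathIntegral.
Variable R : realType.
Local Notation C := (R[i]).
Local Notation nm := (@Normc.normc R).
Local Notation Re := (@complex.Re R).
Local Notation Im := (@complex.Im R).
Local Notation leb := (@lebesgue_measure R).

Implicit Types (a b m M : R).

Definition rint (g : R -> R) (a b : R) : R := \int[leb]_(x in `[a, b]) g x.

Lemma cont_integrable (g : R -> R) a b :
  (forall t, a <= t <= b -> {for t, continuous g}) ->
  leb.-integrable `[a, b] (EFin \o g).
Proof.
move=> h; apply: continuous_compact_integrable; first exact: segment_compact.
apply: continuous_in_subspaceT => t; rewrite inE /= in_itv /=; exact: h.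
Qed.

Lemma rintD (g h : R -> R) a b : (forall t, a <= t <= b -> {for t, continuous g}) ->
  (forall t, a <= t <= b -> {for t, continuous h}) ->
  rint (fun t => g t + h t) a b = rint g a b + rint h a b.
Proof.
by move=> cg ch; rewrite /rint RintegralD//; exact: cont_integrable.
Qed.

Lemma rintZ (g : R -> R) a b k : (forall t, a <= t <= b -> {for t, continuous g}) ->
  rint (fun t => k * g t) a b = k * rint g a b.
Proof.
by move=> cg; rewrite /rint RintegralZl//; exact: cont_integrable.
Qed.

Lemma rint_cst (k : R) a b : a <= b -> rint (fun=> k) a b = k * (b - a).
Proof.
move=> ab; rewrite /rint Rintegral_cst//=; congr (_ * _).
rewrite lebesgue_measure_itv /= lte_fin; move: ab; rewrite le_eqVlt.
by move=> /predU1P[->|->]; rewrite ?ltxx ?subrr.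
Qed.

Lemma rint_split (g : R -> R) a m b : a <= m -> m <= b ->
  (forall t, a <= t <= b -> {for t, continuous g}) ->
  rint g a b = rint g a m + rint g m b.
Proof.
move=> am mb cg; have := @Rintegral_itvB R g (BLeft a) (BRight b) m.
have ci : leb.-integrable `[a, b] (EFin \o g) by exact: cont_integrable.
move=> /(_ ci); rewrite !bnd_simp => /(_ am mb) /eqP.
rewrite subr_eq => /eqP; rewrite -/(rint g a b) addrC -/(rint g a m) => ->.
congr (_ + _); rewrite /rint Rintegral_itv_obnd_cbnd//.
apply: integrableS ci => //; apply: subset_itvr; rewrite bnd_simp//.
Qed.

Lemma le_rint (g h : R -> R) a b : (forall t, a <= t <= b -> {for t, continuous g}) ->
  (forall t, a <= t <= b -> {for t, continuous h}) ->
  (forall t, a <= t <= b -> g t <= h t) -> rint g a b <= rint h a b.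
Proof.
move=> cg ch gh; apply: le_Rintegral => //; do ?exact: cont_integrable.
Qed.

Lemma eq_rint (g h : R -> R) a b : (forall t, a <= t <= b -> g t = h t) ->
  rint g a b = rint h a b.
Proof.
by move=> gh; apply: eq_Rintegral => x; rewrite inE /= in_itv /=; exact: gh.
Qed.

Lemma rint_bound (g : R -> R) a b M : a <= b ->
  (forall t, a <= t <= b -> {for t, continuous g}) ->
  (forall t, a <= t <= b -> `|g t| <= M) -> `|rint g a b| <= M * (b - a).
Proof.
move=> ab cg gM; rewrite ler_norml; apply/andP; split.
- rewrite -mulNr -rint_cst//; apply: le_rint => // [t _|t tab]; first exact: cvg_cst.
  by have := gM t tab; rewrite ler_norml => /andP[].
- rewrite -rint_cst//; apply: le_rint => // [t _|t tab]; first exact: cvg_cst.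
  by have := gM t tab; rewrite ler_norml => /andP[].
Qed.

Definition cint (f : R -> C) (a b : R) : C :=
  rint (fun t => Re (f t)) a b +i* rint (fun t => Im (f t)) a b.

Definition pcont_on (f : R -> C) (a b : R) := forall t, a <= t <= b -> pcont f t.

Implicit Types f g : R -> C.

Lemma pcont_Re f a b : pcont_on f a b ->
  forall t, a <= t <= b -> {for t, continuous (fun t => Re (f t))}.
Proof. by move=> h t /h[]. Qed.

Lemma pcont_Im f a b : pcont_on f a b ->
  forall t, a <= t <= b -> {for t, continuous (fun t => Im (f t))}.
Proof. by move=> h t /h[]. Qed.

Lemma eq_cint f g a b : (forall t, a <= t <= b -> f t = g t) ->
  cint f a b = cint g a b.
Proof.
move=> fg; rewrite /cint; congr Complex; apply: eq_rint => t /fg -> //.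
Qed.

Lemma pcont_onB f g a b : pcont_on f a b -> pcont_on g a b ->
  pcont_on (fun t => f t - g t) a b.
Proof. by move=> cf cg t ab; apply: ccvgB; [exact: cf|exact: cg]. Qed.

Lemma pcont_onM f g a b : pcont_on f a b -> pcont_on g a b ->
  pcont_on (fun t => f t * g t) a b.
Proof. by move=> cf cg t ab; apply: ccvgM; [exact: cf|exact: cg]. Qed.

Lemma pcont_on_cst c a b : pcont_on (fun=> c) a b.
Proof. by move=> t _; exact: ccvg_cst. Qed.

Lemma cintD f g a b : pcont_on f a b -> pcont_on g a b ->
  cint (fun t => f t + g t) a b = cint f a b + cint g a b.
Proof.
move=> cf cg; rewrite /cint.
under [X in X +i* _]eq_rint do rewrite ReD.
under [X in _ +i* X = _]eq_rint do rewrite ImD.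
by rewrite !rintD//; (exact: pcont_Re || exact: pcont_Im).
Qed.

Lemma cintZ f a b k : pcont_on f a b ->
  cint (fun t => k * f t) a b = k * cint f a b.
Proof.
move=> cf; have cR := pcont_Re cf; have cI := pcont_Im cf.
have zR (h : R -> R) x : (forall t, a <= t <= b -> {for t, continuous h}) ->
    forall t, a <= t <= b -> {for t, continuous (fun t => x * h t)}.
  by move=> ch t tab; apply: cvgM; [exact: cvg_cst|exact: ch].
apply: complex_eq; rewrite /cint ?ReM ?ImM /=.
- under eq_rint do rewrite ReM -mulNr.
  rewrite rintD ?rintZ//; last 2 first.
  + exact: zR.
  + exact: zR.
  by rewrite mulNr.
- under eq_rint do rewrite ImM.
  rewrite rintD ?rintZ//; exact: zR.
Qed.

Lemma cintB f g a b : pcont_on f a b -> pcont_on g a b ->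
  cint (fun t => f t - g t) a b = cint f a b - cint g a b.
Proof.
move=> cf cg; rewrite -mulN1r -cintZ// -cintD//; last first.
  by apply: pcont_onM => //; exact: pcont_on_cst.
by apply: eq_cint => t _; rewrite mulN1r.
Qed.

Lemma cint_cst c a b : a <= b -> cint (fun=> c) a b = c * (b - a)%:C.
Proof.
move=> ab; apply: complex_eq; rewrite /cint /= rint_cst// ?ReM ?ImM /=; ring.
Qed.

Lemma cint_split f a m b : a <= m -> m <= b -> pcont_on f a b ->
  cint f a b = cint f a m + cint f m b.
Proof.
move=> am mb cf; rewrite /cint (rint_split am mb (pcont_Re cf)).
by rewrite (rint_split am mb (pcont_Im cf)).
Qed.

(** The factor 2 comes from estimating the two coordinates separately; later it only enters
    constants. *)
Lemma nm_cint f a b M : a <= b -> pcont_on f a b ->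
  (forall t, a <= t <= b -> nm (f t) <= M) -> nm (cint f a b) <= 2 * M * (b - a).
Proof.
move=> ab cf fM; apply: le_trans (nm_le _) _.
have -> : 2 * M * (b - a) = M * (b - a) + M * (b - a) by ring.
apply: lerD; apply: rint_bound => //.
- exact: pcont_Re.
- by move=> t tab; rewrite (le_trans (Re_le_nm _))// fM.
- exact: pcont_Im.
- by move=> t tab; rewrite (le_trans (Im_le_nm _))// fM.
Qed.

End PathIntegral.

(** * Goursat's theorem on rectangles *)

Section Goursat.
Variable R : realType.
Local Notation C := (R[i]).
Local Notation nm := (@Normc.normc R).
Local Notation Re := (@complex.Re R).
Local Notation Im := (@complex.Im R).

Lemma pcont_hor (f : C -> C) (s t : R) : ccont f (s +i* t) ->
  pcont (fun x => f (x +i* t)) s.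
Proof.
move=> cf; apply: (@pcont_comp _ f (fun x => x +i* t)) => //.
by split => /=; [exact: cvg_id|exact: cvg_cst].
Qed.

Lemma pcont_ver (f : C -> C) (s t : R) : ccont f (s +i* t) ->
  pcont (fun x => f (s +i* x)) t.
Proof.
move=> cf; apply: (@pcont_comp _ f (fun x => s +i* x)) => //.
by split => /=; [exact: cvg_cst|exact: cvg_id].
Qed.

(** The integral over the boundary, counterclockwise: bottom minus top, then ['i] times right minus
    left. With opposite sides paired, an affine integrand becomes constant on each pair. *)
Definition rect_int (f : C -> C) (a b c d : R) : C :=
  cint (fun s => f (s +i* c) - f (s +i* d)) a b
  + 'i * cint (fun t => f (b +i* t) - f (a +i* t)) c d.

Definition cont_rect (f : C -> C) a b c d := forall s t, a <= s <= b -> c <= t <= d ->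
  ccont f (s +i* t).

Lemma rect_pcont f a b c d : a <= b -> c <= d -> cont_rect f a b c d ->
  [/\ forall t, c <= t <= d -> pcont_on (fun s => f (s +i* t)) a b &
      forall s, a <= s <= b -> pcont_on (fun t => f (s +i* t)) c d].
Proof.
move=> ab cd cf; split=> [t tcd s sab|s sab t tcd].
- by apply: pcont_hor; exact: cf.
- by apply: pcont_ver; exact: cf.
Qed.

Lemma rect_int_split_hor f a m b c d : a <= m -> m <= b -> c <= d ->
  cont_rect f a b c d ->
  rect_int f a b c d = rect_int f a m c d + rect_int f m b c d.
Proof.
move=> am mb cd cf; have ab := le_trans am mb.
have [ch cv] := rect_pcont ab cd cf.
have [hc hd] : c <= c <= d /\ c <= d <= d by rewrite !lexx cd.
have [ha hb hm] : [/\ a <= a <= b, a <= b <= b & a <= m <= b].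
  by rewrite !lexx ab am mb.
rewrite /rect_int (cint_split am mb); last by apply: pcont_onB; exact: ch.
have -> : cint (fun t => f (b +i* t) - f (a +i* t)) c d =
  cint (fun t => f (m +i* t) - f (a +i* t)) c d
  + cint (fun t => f (b +i* t) - f (m +i* t)) c d.
  rewrite -cintD; [|by apply: pcont_onB; exact: cv..].
  by apply: eq_cint => t _; ring.
ring.
Qed.

Lemma rect_int_split_ver f a b c m d : a <= b -> c <= m -> m <= d ->
  cont_rect f a b c d ->
  rect_int f a b c d = rect_int f a b c m + rect_int f a b m d.
Proof.
move=> ab cm md cf; have cd := le_trans cm md.
have [ch cv] := rect_pcont ab cd cf.
have [ha hb] : a <= a <= b /\ a <= b <= b by rewrite !lexx ab.
have [hc hd hm] : [/\ c <= c <= d, c <= d <= d & c <= m <= d].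
  by rewrite !lexx cd cm md.
rewrite /rect_int [cint _ c d](cint_split cm md); last by apply: pcont_onB; exact: cv.
have -> : cint (fun s => f (s +i* c) - f (s +i* d)) a b =
  cint (fun s => f (s +i* c) - f (s +i* m)) a b
  + cint (fun s => f (s +i* m) - f (s +i* d)) a b.
  rewrite -cintD; [|by apply: pcont_onB; exact: ch..].
  by apply: eq_cint => t _; ring.
ring.
Qed.

(** An affine function has boundary integral 0, because its constants on the two pairs of sides
    cancel. Hence only the distance of [f] to an affine function counts. *)
Lemma rect_int_affine f a b c d (p q : C) M : a <= b -> c <= d ->
  cont_rect f a b c d ->
  (forall s t, a <= s <= b -> c <= t <= d ->
    nm (f (s +i* t) - (p + q * (s +i* t))) <= M) ->
  nm (rect_int f a b c d) <= 4 * M * ((b - a) + (d - c)).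
Proof.
move=> ab cd cf fM; have [ch cv] := rect_pcont ab cd cf.
have [ha hb] : a <= a <= b /\ a <= b <= b by rewrite !lexx ab.
have [hc hd] : c <= c <= d /\ c <= d <= d by rewrite !lexx cd.
have -> : rect_int f a b c d =
  cint (fun s => f (s +i* c) - f (s +i* d) - q * ('i * (c - d)%:C)) a b
  + 'i * cint (fun t => f (b +i* t) - f (a +i* t) - q * (b - a)%:C) c d.
  rewrite /rect_int !cintB ?cint_cst//;
    do ?[exact: cv | exact: ch | exact: pcont_on_cst | apply: pcont_onB].
  rewrite !(rmorphB (real_complex R)) /=; ring.
apply: le_trans (nmD _ _) _; rewrite nmM nm_i mul1r mulrDr.
apply: lerD.
- have -> : 4 * M * (b - a) = 2 * (M + M) * (b - a) by ring.
  apply: nm_cint => //.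
    apply: pcont_onB; last exact: pcont_on_cst.
    by apply: pcont_onB; exact: ch.
  move=> s sab.
  have -> : f (s +i* c) - f (s +i* d) - q * ('i * (c - d)%:C) =
    (f (s +i* c) - (p + q * (s +i* c))) - (f (s +i* d) - (p + q * (s +i* d))).
    have -> : s +i* d = s +i* c - 'i * (c - d)%:C :> C.
      by apply: complex_eq => /=; ring.
    ring.
  by apply: le_trans (nmD _ _) _; rewrite nmN lerD// fM.
- have -> : 4 * M * (d - c) = 2 * (M + M) * (d - c) by ring.
  apply: nm_cint => //.
    apply: pcont_onB; last exact: pcont_on_cst.
    by apply: pcont_onB; exact: cv.
  move=> t tcd.
  have -> : f (b +i* t) - f (a +i* t) - q * (b - a)%:C =
    (f (b +i* t) - (p + q * (b +i* t))) - (f (a +i* t) - (p + q * (a +i* t))).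
    have -> : b +i* t = a +i* t + (b - a)%:C :> C.
      by apply: complex_eq => /=; ring.
    ring.
  by apply: le_trans (nmD _ _) _; rewrite nmN lerD// fM.
Qed.

End Goursat.

Section GoursatTheorem.
Variable R : realType.
Local Notation C := (R[i]).
Local Notation nm := (@Normc.normc R).

Lemma nm_pair (s t s' t' : R) : nm (s +i* t - s' +i* t') <= `|s - s'| + `|t - t'|.
Proof. exact: nm_le. Qed.

(* Goursat's bisection, without continuity of the derivative. *)
Lemma goursat (f : C -> C) (a b c d : R) : a <= b -> c <= d ->
  (forall s t, a <= s <= b -> c <= t <= d -> exists D, cdiff f (s +i* t) D) ->
  rect_int f a b c d = 0.
Proof.
move=> ab cd df.
have cf : cont_rect f a b c d by move=> s t hs ht; have [D /cdiff_cont] := df _ _ hs ht.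
pose w := b - a; pose h := d - c.
have w0 : 0 <= w by rewrite subr_ge0.
have h0 : 0 <= h by rewrite subr_ge0.
pose e n : R := 2 ^- n.
have e0 n : 0 < e n by rewrite invr_gt0 exprn_gt0.
have eS n : e n = e n.+1 + e n.+1 by rewrite /e exprS invfM; field; rewrite expf_neq0.
pose k := nm (rect_int f a b c d).
(* The state after n bisections is the lower left corner; the sides are the original ones times
   2^-n. At each step a quarter of the rectangle keeps at least a quarter of the boundary
   integral. *)
pose Q n (p : R * R) := [/\ a <= p.1, p.1 + w * e n <= b, c <= p.2,
  p.2 + h * e n <= d &
  k * e n ^+ 2 <= nm (rect_int f p.1 (p.1 + w * e n) p.2 (p.2 + h * e n))].
have step n p : Q n p -> exists p', [/\ Q n.+1 p', p.1 <= p'.1, p'.1 + w * e n.+1 <= p.1 + w * e n,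
   p.2 <= p'.2 & p'.2 + h * e n.+1 <= p.2 + h * e n].
  move=> [q1 q2 q3 q4 q5].
  have we : 0 <= w * e n.+1 by rewrite mulr_ge0// ltW.
  have he : 0 <= h * e n.+1 by rewrite mulr_ge0// ltW.
  have wn : w * e n = w * e n.+1 + w * e n.+1 by rewrite eS; ring.
  have hn : h * e n = h * e n.+1 + h * e n.+1 by rewrite eS; ring.
  have k4 : k * e n ^+ 2 = 4 * (k * e n.+1 ^+ 2) by rewrite (eS n); ring.
  have cf' : cont_rect f p.1 (p.1 + w * e n) p.2 (p.2 + h * e n).
    move=> s t /andP[s1 s2] /andP[t1 t2]; apply: cf; apply/andP.
      by clear -q1 q2 s1 s2 wn we; split; lra.
    by clear -q3 q4 t1 t2 hn he; split; lra.
  apply: contrapT => no.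
  have bad x y : x = p.1 \/ x = p.1 + w * e n.+1 -> y = p.2 \/ y = p.2 + h * e n.+1 ->
      nm (rect_int f x (x + w * e n.+1) y (y + h * e n.+1)) < k * e n.+1 ^+ 2.
    move=> hx hy; rewrite ltNge; apply/negP => hk; apply: no.
    exists (x, y); split => /=; last 4 first.
    - by case: hx => ->; lra.
    - by case: hx => ->; lra.
    - by case: hy => ->; lra.
    - by case: hy => ->; lra.
    by clear -q1 q2 q3 q4 hx hy hk we he wn hn; split => //=; case: hx => hx; case: hy => hy; lra.
  have E1 : p.1 + w * e n = p.1 + w * e n.+1 + w * e n.+1 by rewrite wn addrA.
  have E2 : p.2 + h * e n = p.2 + h * e n.+1 + h * e n.+1 by rewrite hn addrA.
  rewrite E1 E2 in cf' q5.
  clear df cf q1 q2 q3 q4 no.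
  move: q5; rewrite (rect_int_split_hor (m := p.1 + w * e n.+1)) //; [|lra..].
  rewrite (rect_int_split_ver (m := p.2 + h * e n.+1)) //; [|try lra..]; last first.
    by move=> s t /andP[s1 s2] /andP[t1 t2]; apply: cf'; apply/andP; split; lra.
  rewrite (rect_int_split_ver (a := p.1 + _) (m := p.2 + h * e n.+1)) //; [|try lra..]; last first.
    by move=> s t /andP[s1 s2] /andP[t1 t2]; apply: cf'; apply/andP; split; lra.
  apply/negP; rewrite -ltNge k4.
  apply: le_lt_trans (nmD _ _) _.
  apply: le_lt_trans (lerD (nmD _ _) (nmD _ _)) _.
  have b1 := bad _ _ (or_introl erefl) (or_introl erefl).
  have b2 := bad _ _ (or_introl erefl) (or_intror erefl).
  have b3 := bad _ _ (or_intror erefl) (or_introl erefl).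
  have b4 := bad _ _ (or_intror erefl) (or_intror erefl).
  by clear -b1 b2 b3 b4; lra.
pose nxt n p := xget p [set p' | [/\ Q n.+1 p', p.1 <= p'.1, p'.1 + w * e n.+1 <= p.1 + w * e n,
   p.2 <= p'.2 & p'.2 + h * e n.+1 <= p.2 + h * e n]].
pose u := fix u n := if n is m.+1 then nxt m (u m) else (a, c).
have Qu n : Q n (u n).
  elim: n => [|n IH].
    have e00 : e 0%N = 1 by rewrite /e expr0 invr1.
    have aw : a + w * e 0%N = b by rewrite e00 /w mulr1 addrC subrK.
    have ch : c + h * e 0%N = d by rewrite e00 /h mulr1 addrC subrK.
    by split; rewrite /= ?aw ?ch// e00 expr1n mulr1.
  have [p hp] := step _ _ IH; rewrite /= /nxt.
  by case: xgetP => [y _ []|/(_ p)].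
have nu n : [/\ (u n).1 <= (u n.+1).1, (u n.+1).1 + w * e n.+1 <= (u n).1 + w * e n,
   (u n).2 <= (u n.+1).2 & (u n.+1).2 + h * e n.+1 <= (u n).2 + h * e n].
  have [p hp] := step _ _ (Qu n); rewrite /= /nxt.
  by case: xgetP => [y _ []|/(_ p)].
have mono (x y : nat -> R) : (forall n, x n <= x n.+1) -> (forall n, y n.+1 <= y n) ->
    (forall n, x n <= y n) -> exists s, forall n, x n <= s <= y n.
  move=> xi yd xy.
  have xm : {homo x : n m / (n <= m)%N >-> n <= m} by apply: homo_leq => //; exact: le_trans.
  have ym : {homo y : n m / (n <= m)%N >-> m <= n}.
    by apply: homo_leq => //= ? ? ?; move=> h1 h2; exact: le_trans h2 h1.
  have xyn n m : x n <= y m.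
    by rewrite (le_trans (xm _ _ (leq_maxl n m)))// (le_trans (xy _))// ym// leq_maxr.
  exists (sup (range x)) => n; apply/andP; split.
    apply: ub_le_sup; last by exists n.
    by exists (y 0%N) => _ [m _ <-].
  by apply: ge_sup; [exists (x 0%N), 0%N|move=> _ [m _ <-]].
have [s hs] := mono (fun n => (u n).1) (fun n => (u n).1 + w * e n)
  (fun n => let: And4 x _ _ _ := nu n in x) (fun n => let: And4 _ x _ _ := nu n in x)
  (fun n => ler_wpDr (mulr_ge0 w0 (ltW (e0 n))) (lexx _)).
have [t ht] := mono (fun n => (u n).2) (fun n => (u n).2 + h * e n)
  (fun n => let: And4 _ _ x _ := nu n in x) (fun n => let: And4 _ _ _ x := nu n in x)
  (fun n => ler_wpDr (mulr_ge0 h0 (ltW (e0 n))) (lexx _)).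
have [D hD] : exists D, cdiff f (s +i* t) D.
  apply: df.
  - by have := hs 0%N; rewrite /e expr0 invr1 mulr1 /= /w [a + _]addrC subrK.
  - by have := ht 0%N; rewrite /e expr0 invr1 mulr1 /= /h [c + _]addrC subrK.
apply/eqP; rewrite -nm_eq0 -/k eq_le nm_ge0 andbT.
pose L := w + h + 1.
have L0 : 0 < L by rewrite /L; lra.
apply/ler_addgt0Pl => eps eps0; rewrite addr0.
(* The distance to the tangent function and the perimeter are both of order 2^-n, so the boundary
   integral is at most 4 eta L^2 4^-n, to be compared with k 4^-n. The 1 in [L] keeps it positive
   for a degenerate rectangle. *)
pose eta := eps / (4 * L ^+ 2).
have eta0 : 0 < eta by rewrite divr_gt0// mulr_gt0// exprn_gt0.
have [r r0 hr] := hD _ eta0.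
have [n hn] : exists n, e n * L < r.
  have [n _ hn] := @near_infty_natSinv_lt R (PosNum (divr_gt0 r0 L0)).
  exists n; have := hn n (leqnn n); rewrite /= => {}hn.
  rewrite -ltr_pdivlMr//; apply: le_lt_trans hn.
  rewrite /e lef_pV2 ?posrE ?exprn_gt0//.
  by rewrite -natrX ler_nat; exact: ltn_expl.
have [q1 q2 q3 q4 q5] := Qu n.
have /andP[s1 s2] := hs n; have /andP[t1 t2] := ht n.
have we : 0 <= w * e n by rewrite mulr_ge0// ltW.
have he : 0 <= h * e n by rewrite mulr_ge0// ltW.
have := @rect_int_affine R f (u n).1 ((u n).1 + w * e n) (u n).2 ((u n).2 + h * e n)
  (f (s +i* t) - D * (s +i* t)) D (eta * (e n * L)).
have xyx (x y : R) : x + y - x = y by ring.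
rewrite !xyx => H.
have {H} : nm (rect_int f (u n).1 ((u n).1 + w * e n) (u n).2 ((u n).2 + h * e n)) <=
    4 * (eta * (e n * L)) * (w * e n + h * e n).
  apply: H; [lra|lra| |].
    move=> x y /andP[x1 x2] /andP[y1 y2]; apply: cf; apply/andP.
      by clear -q1 q2 x1 x2; split; lra.
    by clear -q3 q4 y1 y2; split; lra.
  move=> x y /andP[x1 x2] /andP[y1 y2].
  have near : nm (x +i* y - s +i* t) <= e n * L.
    apply: le_trans (nm_pair _ _ _ _) _.
    have : `|x - s| <= w * e n by clear -s1 s2 x1 x2; rewrite ler_norml; apply/andP; split; lra.
    have : `|y - t| <= h * e n by clear -t1 t2 y1 y2; rewrite ler_norml; apply/andP; split; lra.
    have := e0 n; rewrite /L; lra.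
  have := hr (x +i* y) (le_lt_trans near hn).
  have -> : f (x +i* y) - (f (s +i* t) - D * (s +i* t) + D * (x +i* y)) =
    f (x +i* y) - f (s +i* t) - D * (x +i* y - s +i* t) by ring.
  move=> /le_trans; apply; rewrite ler_wpM2l// ltW//.
move=> H; have {H q5} q := le_trans q5 H.
have en2 : 0 < e n ^+ 2 by rewrite exprn_gt0.
rewrite -(ler_pM2r en2); apply: le_trans q _.
have -> : 4 * (eta * (e n * L)) * (w * e n + h * e n) =
  (4 * eta * L * (w + h)) * e n ^+ 2 by ring.
rewrite ler_pM2r//.
have -> : eps = 4 * eta * L * L by rewrite /eta; field; lra.
apply: ler_wpM2l; last by rewrite /L; lra.
by apply: mulr_ge0; [apply: mulr_ge0; lra|exact: ltW].
Qed.

End GoursatTheorem.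

(** * The complex exponential *)

Section ComplexExponential.
Variable R : realType.
Local Notation C := (R[i]).
Local Notation nm := (@Normc.normc R).
Local Notation Re := (@complex.Re R).
Local Notation Im := (@complex.Im R).

Lemma expi0 : expi 0 = 1 :> C.
Proof. by rewrite /expi cos0 sin0. Qed.

Lemma expiD (s t : R) : expi (s + t) = expi s * expi t :> C.
Proof. by apply: complex_eq; rewrite ?ReM ?ImM /= ?cosD ?sinD//; ring. Qed.

Lemma nm_expi (t : R) : nm (expi t) = 1.
Proof. by rewrite /= cos2Dsin2 sqrtr1. Qed.

Lemma expi2pi : expi (2 * pi) = 1 :> C.
Proof. by rewrite /expi mulrC mulr_natr cos2pi sin2pi. Qed.

Lemma expiX (t : R) n : expi t ^+ n = expi (n%:R * t).
Proof.
elim: n => [|n IH]; first by rewrite expr0 mul0r expi0.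
by rewrite exprS IH -expiD -natr1; congr expi; ring.
Qed.

Definition cexp (z : C) : C := (expR (Re z))%:C * expi (Im z).

Lemma cexp0 : cexp 0 = 1.
Proof. by rewrite /cexp /= expR0 expi0 mulr1. Qed.

Lemma cexpD z w : cexp (z + w) = cexp z * cexp w.
Proof.
by rewrite /cexp ReD ImD expRD expiD (rmorphM (real_complex R)) /=; ring.
Qed.

Lemma nm_cexp z : nm (cexp z) = expR (Re z).
Proof. by rewrite nmM nm_expi mulr1 nm_real ger0_norm// expR_ge0. Qed.

Lemma cexp_neq0 z : cexp z != 0.
Proof. by rewrite -nm_gt0 nm_cexp expR_gt0. Qed.

Lemma is_derive_eps (g : R -> R) (x d : R) : is_derive x 1 g d ->
  forall e, 0 < e -> exists2 r, 0 < r & forall y, `|y - x| < r ->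
    `|g y - g x - d * (y - x)| <= e * `|y - x|.
Proof.
move=> [dg <-] e e0.
have /cvgrPdist_le /(_ _ e0) : (fun h => h^-1 *: (g (h *: 1 + x) - g x)) @ 0^' --> 'D_1 g x.
  exact: dg.
rewrite /at_right /dnbhs /within /= => -[r /= r0 hr].
exists r => // y yx; have [->|yx0] := eqVneq y x.
  by rewrite !subrr mulr0 subr0 normr0 mulr0.
have yx1 : y - x != 0 by rewrite subr_eq0.
have := hr (y - x); rewrite /= sub0r normrN => /(_ yx yx1).
have -> : (y - x) *: 1 + x = y by rewrite /GRing.scale /= mulr1 subrK.
rewrite /GRing.scale /= distrC => h.
have -> : g y - g x - 'D_1 g x * (y - x) =
  ((y - x)^-1 * (g y - g x) - 'D_1 g x) * (y - x) by field.
by rewrite normrM ler_wpM2r.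
Qed.

(** The derivative at 0 comes from the first order expansions of [expR], [cos] and [sin]; the
    functional equation carries it to every point in [cdiff_cexp]. *)
Lemma cexp_diff0 : cdiff cexp 0 1.
Proof.
(* The errors in the two coordinates will be 3 e1 |w| and 5 e1 |w|, whence the 8. *)
move=> e e0; have [e1 [e10 e11 e18]] : exists e1, [/\ 0 < e1, e1 <= 1 & e1 <= e / 8].
  exists (Num.min 1 (e / 8)); split; rewrite ?ge_min ?lexx ?orbT//.
  by rewrite lt_min ltr01 divr_gt0.
have [r1 r10 h1] := is_derive_eps (is_derive_expR (0 : R)) e10.
have [r2 r20 h2] := is_derive_eps (is_derive_cos (0 : R)) e10.
have [r3 r30 h3] := is_derive_eps (is_derive_sin (0 : R)) e10.
exists (Num.min (Num.min r1 r2) (Num.min r3 e1)).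
  by rewrite !lt_min r10 r20 r30 e10.
move=> w; rewrite cexp0 subr0 mul1r !lt_min => /andP[/andP[w1 w2] /andP[w3 w4]].
set x := Re w; set y := Im w.
have xw : `|x| <= nm w := Re_le_nm w.
have yw : `|y| <= nm w := Im_le_nm w.
have {h1} := h1 x; rewrite expR0 subr0 mul1r => /(_ (le_lt_trans xw w1)) h1.
have {h2} := h2 y; rewrite cos0 sin0 subr0 oppr0 mul0r subr0 => /(_ (le_lt_trans yw w2)) h2.
have {h3} := h3 y; rewrite cos0 sin0 !subr0 mul1r => /(_ (le_lt_trans yw w3)) h3.
have x1 : `|x| <= e1 by rewrite (le_trans xw)// ltW.
have y1 : `|y| <= e1 by rewrite (le_trans yw)// ltW.
have x0 := normr_ge0 x; have y0 := normr_ge0 y.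
have k1 : `|expR x - 1| <= 2 * `|x|.
  have -> : expR x - 1 = (expR x - 1 - x) + x by ring.
  apply: le_trans (ler_normD _ _) _.
  have : e1 * `|x| <= `|x| by rewrite ler_piMl.
  lra.
have k2 : `|sin y| <= 2 * `|y|.
  have -> : sin y = (sin y - y) + y by ring.
  apply: le_trans (ler_normD _ _) _.
  have : e1 * `|y| <= `|y| by rewrite ler_piMl.
  lra.
have k3 : `|cos y| <= 1 by rewrite ler_norml cos_geN1 cos_le1.
have hr : `|Re (cexp w - 1 - w)| <= 3 * e1 * nm w.
  have -> : Re (cexp w - 1 - w) = (expR x - 1 - x) * cos y + (1 + x) * (cos y - 1).
    by rewrite /cexp !ReD !ReN ReM /= -/x -/y; ring.
  apply: le_trans (ler_normD _ _) _; rewrite !normrM.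
  have : `|expR x - 1 - x| * `|cos y| <= e1 * `|x| by rewrite -[leRHS]mulr1 ler_pM.
  have : `|1 + x| * `|cos y - 1| <= 2 * (e1 * `|y|).
    by apply: ler_pM => //; apply: le_trans (ler_normD _ _) _; rewrite normr1; lra.
  have : e1 * `|x| <= e1 * nm w by rewrite ler_pM2l.
  have : e1 * `|y| <= e1 * nm w by rewrite ler_pM2l.
  lra.
have hi : `|Im (cexp w - 1 - w)| <= 5 * e1 * nm w.
  have -> : Im (cexp w - 1 - w) = (expR x - 1) * sin y + (sin y - y).
    by rewrite /cexp !ImD !ImN ImM /= -/x -/y; ring.
  apply: le_trans (ler_normD _ _) _; rewrite !normrM.
  have : `|expR x - 1| * `|sin y| <= 2 * `|x| * (2 * e1).
    by apply: ler_pM => //; lra.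
  have : e1 * `|x| <= e1 * nm w by rewrite ler_pM2l.
  have : e1 * `|y| <= e1 * nm w by rewrite ler_pM2l.
  lra.
apply: le_trans (nm_le _) _.
have : 8 * e1 * nm w <= e * nm w.
  by rewrite ler_wpM2r ?nm_ge0//; lra.
lra.
Qed.

Lemma cdiff_cexp z : cdiff cexp z (cexp z).
Proof.
have dm : cdiff (fun w => w - z) z 1.
  by have := cdiffB (cdiff_id z) (cdiff_cst z z); rewrite subr0.
have d0 : cdiff cexp ((fun w => w - z) z) 1 by rewrite subrr; exact: cexp_diff0.
have := cdiffZ (cexp z) (cdiff_comp dm d0); rewrite !mulr1.
by congr cdiff; apply/funext => w; rewrite -cexpD addrC subrK.
Qed.

Lemma cexp_polar (s t : R) : cexp (s +i* t) = (expR s)%:C * expi t.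
Proof. by []. Qed.

Definition circ (r t : R) : C := r%:C * expi t.

Lemma nm_circ r t : 0 <= r -> nm (circ r t) = r.
Proof. by move=> r0; rewrite nmM nm_expi mulr1 nm_real ger0_norm. Qed.

Lemma circ_cvg r t : ccvg (nbhs (r, t)) (fun p => circ p.1 p.2) (circ r t).
Proof.
apply: ccvgM; first by apply: ccvg_real; exact: cvg_fst.
split => /=.
- by apply: (@cvg_comp _ _ _ snd cos _ (nbhs t)); [exact: cvg_snd|exact: continuous_cos].
- by apply: (@cvg_comp _ _ _ snd sin _ (nbhs t)); [exact: cvg_snd|exact: continuous_sin].
Qed.

Lemma pcont_circ r t : pcont (circ r) t.
Proof.
apply: ccvgM; first exact: ccvg_cst.
by split => /=; [exact: continuous_cos|exact: continuous_sin].
Qed.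

End ComplexExponential.

(** * Means over circles and Cauchy's formula *)

Arguments Normc.normc : simpl never.

Section CircleMeans.
Variable R : realType.
Local Notation C := (R[i]).
Local Notation nm := (@Normc.normc R).
Local Notation Re := (@complex.Re R).
Local Notation Im := (@complex.Im R).
Implicit Types (f g h q : C -> C) (r s t e M : R) (z w : C).

Definition twopi : R := 2 * pi.

Lemma twopi_gt0 : 0 < twopi.
Proof. by rewrite /twopi mulr_gt0// pi_gt0. Qed.
Let twopi_ge0 : 0 <= twopi := ltW twopi_gt0.

Definition cont_circ f r := forall t, 0 <= t <= twopi -> ccont f (circ r t).

Lemma cont_circ_on f r : 0 <= r -> (forall z, nm z = r -> ccont f z) -> cont_circ f r.
Proof. by move=> r0 h t _; apply: h; rewrite nm_circ. Qed.

Lemma cont_circP f r : cont_circ f r -> pcont_on (fun t => f (circ r t)) 0 twopi.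
Proof. by move=> cf t ht; apply: pcont_comp; [exact: cf|exact: pcont_circ]. Qed.

(** This is the contour integral of f(z) / z divided by 2 pi i; accordingly Cauchy's kernel appears
    below as z / (z - w). *)
Definition cmean f r : C := (twopi^-1)%:C * cint (fun t => f (circ r t)) 0 twopi.

Lemma eq_cmean f g r : 0 <= r -> (forall z, nm z = r -> f z = g z) -> cmean f r = cmean g r.
Proof.
by move=> r0 fg; congr (_ * _); apply: eq_cint => t _; apply: fg; rewrite nm_circ.
Qed.

Lemma cmeanD f g r : cont_circ f r -> cont_circ g r ->
  cmean (fun z => f z + g z) r = cmean f r + cmean g r.
Proof.
by move=> cf cg; rewrite /cmean -mulrDr -cintD//; exact: cont_circP.
Qed.

Lemma cmeanB f g r : cont_circ f r -> cont_circ g r ->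
  cmean (fun z => f z - g z) r = cmean f r - cmean g r.
Proof.
by move=> cf cg; rewrite /cmean -mulrBr -cintB//; exact: cont_circP.
Qed.

Lemma cmeanZ f r c : cont_circ f r -> cmean (fun z => c * f z) r = c * cmean f r.
Proof.
by move=> cf; rewrite /cmean cintZ ?mulrA 1?[c * _]mulrC//; exact: cont_circP.
Qed.

Lemma cmean_cst c r : cmean (fun=> c) r = c.
Proof.
rewrite /cmean cint_cst// subr0 mulrCA -(rmorphM (real_complex R)) /= mulVf ?mulr1//.
exact: lt0r_neq0 twopi_gt0.
Qed.

Lemma nm_cmean f r M : cont_circ f r -> 0 <= r ->
  (forall z, nm z = r -> nm (f z) <= M) -> nm (cmean f r) <= 2 * M.
Proof.
move=> cf r0 fM; have := nm_cint twopi_ge0 (cont_circP cf) (M := M).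
rewrite subr0 => H; rewrite nmM nm_real ger0_norm ?invr_ge0//.
rewrite mulrC ler_pdivrMr ?twopi_gt0//; apply: H => t _.
by apply: fM; rewrite nm_circ.
Qed.

(** Under z = exp(s + i t) the annulus becomes a rectangle whose horizontal sides carry the same
    values by periodicity, so Goursat's theorem equates the two vertical sides, which are the
    circles. *)
Lemma cmean_annulus q r0 r1 : 0 < r0 -> r0 <= r1 ->
  (forall z, r0 <= nm z -> nm z <= r1 -> exists D, cdiff q z D) ->
  cmean q r0 = cmean q r1.
Proof.
move=> r00 r01 dq; have r10 := lt_le_trans r00 r01.
have ll : ln r0 <= ln r1 by rewrite ler_ln ?posrE.
have H : rect_int (fun z => q (cexp z)) (ln r0) (ln r1) 0 twopi = 0.
  apply: goursat => // s t /andP[s1 s2] _.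
  have [||D hD] := dq (cexp (s +i* t)).
  - by rewrite nm_cexp -[leLHS]lnK ?posrE// ler_expR.
  - by rewrite nm_cexp -[leRHS]lnK ?posrE// ler_expR.
  - by exists (D * cexp (s +i* t)); apply: cdiff_comp => //; exact: cdiff_cexp.
have E r : 0 < r -> cmean q r =
    (twopi^-1)%:C * cint (fun t => q (cexp (ln r +i* t))) 0 twopi.
  by move=> r2; congr (_ * _); apply: eq_cint => t _; rewrite cexp_polar lnK ?posrE.
have P r : r0 <= r -> r <= r1 -> pcont_on (fun t => q (cexp (ln r +i* t))) 0 twopi.
  move=> ra rb t _; have rr := lt_le_trans r00 ra.
  apply: (@pcont_comp _ q (fun t => cexp (ln r +i* t))); last exact: pcont_circ.
  by have [||D /cdiff_cont//] := dq (cexp (ln r +i* t)); rewrite nm_cexp /= lnK ?posrE.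
move: H; rewrite /rect_int (@eq_cint _ _ (fun=> 0)); last first.
  by move=> t _; rewrite /= !cexp_polar expi0 /twopi expi2pi subrr.
rewrite cint_cst// mul0r add0r => /eqP; rewrite mulf_eq0.
rewrite -[_ == 0 :> C]nm_eq0 nm_i oner_eq0 /=.
rewrite cintB; [|exact: P..].
move=> H; have {}H : cint (fun t => q (cexp (ln r1 +i* t))) 0 twopi =
    cint (fun t => q (cexp (ln r0 +i* t))) 0 twopi.
  by apply/eqP; rewrite -(@subr_eq0 C).
exact: etrans (E r0 r00) (etrans (congr1 (fun x => (twopi^-1)%:C * x) (esym H))
  (esym (E r1 r10))).
Qed.

(* By compactness of the parameter interval. *)
Lemma cmean_cont q r e : cont_circ q r -> 0 < e ->
  exists2 d, 0 < d & forall r', `|r' - r| < d -> cont_circ q r' ->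
    nm (cmean q r' - cmean q r) <= e.
Proof.
move=> cq e0.
have e4 : 0 < e / 4 by rewrite divr_gt0.
have : near_covering `[0, twopi].
  by apply/compact_near_coveringP; exact: segment_compact.
move=> /(_ R (nbhs r) (fun r' t => nm (q (circ r' t) - q (circ r t)) < e / 2)).
case.
  move=> t; rewrite /= in_itv /= => ht.
  have [d d0 hd] := (ccontP _ _).1 (cq t ht) _ e4.
  have /ccvgP/(_ _ d0) h1 := @circ_cvg R r t.
  have /ccvgP/(_ _ d0) h2 := @pcont_circ R r t.
  have [[A B] /= [hA hB] AB] := h1.
  exists (B `&` [set s | nm (circ r s - circ r t) < d], A) => /=.
    by split => //; apply: filterI.
  move=> [s r'] /= [[Bs hs] Ar'].
  have k1 := hd (circ r' s) (AB (r', s) (conj Ar' Bs)).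
  have {}hs := hs.
  have k2 := hd _ hs; rewrite nmB in k2.
  apply: le_lt_trans (nm_triB _ _ (q (circ r t))) _.
  by apply: lt_le_trans (ltrD k1 k2) _; lra.
move=> d /= d0 hd; exists d => // r' rd cq'.
have {}hd := hd r'; rewrite /= distrC in hd; have {}hd := hd rd.
rewrite /cmean -mulrBr -cintB; [|exact: cont_circP..].
rewrite nmM nm_real ger0_norm ?invr_ge0// mulrC ler_pdivrMr ?twopi_gt0//.
have -> : e * twopi = 2 * (e / 2) * (twopi - 0) by field.
apply: nm_cint => //; first by apply: pcont_onB; exact: cont_circP.
by move=> t ht; apply/ltW; apply: hd; rewrite /= in_itv.
Qed.

(** Two points are exempt from differentiability: 0, where polar coordinates degenerate, and p,
    where the difference quotient of Cauchy's formula is only known to be continuous. The mean is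
    constant on the radii between them and on those beyond, and it is continuous in the radius,
    which joins the pieces. *)
Lemma mean_value q (rr : R) p r :
  (forall z, nm z < rr -> ccont q z) ->
  (forall z, nm z < rr -> z != 0 -> z != p -> exists D, cdiff q z D) ->
  0 <= r -> r < rr -> cmean q r = q 0.
Proof.
move=> cq dq r0 rr1.
have cc s : 0 <= s -> s < rr -> cont_circ q s.
  by move=> s0 sr; apply: cont_circ_on => // z zs; apply: cq; rewrite zs.
have m0 : cmean q 0 = q 0.
  rewrite -[RHS](@cmean_cst _ 0); apply: eq_cmean => // z /eqP.
  by rewrite nm_eq0 => /eqP ->.
have lim a b : 0 <= a -> a < b -> b < rr -> (forall s, a < s -> s <= b -> cmean q s = cmean q b) ->
    cmean q b = cmean q a.
  move=> a0 ab brr h; apply/eqP; rewrite -subr_eq0 -nm_eq0 eq_le nm_ge0 andbT.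
  apply/ler_addgt0Pl => e e0; rewrite addr0.
  have [d d0 hd] := cmean_cont (cc a a0 (lt_trans ab brr)) e0.
  pose s := Num.min b (a + d / 2).
  have sb : s <= b by rewrite ge_min lexx.
  have sa : a < s by rewrite lt_min ab ltrDl divr_gt0.
  have sd : s <= a + d / 2 by rewrite ge_min lexx orbT.
  rewrite -(h s sa sb); apply: hd; last by apply: cc; [exact: le_trans a0 (ltW sa)|exact: le_lt_trans sb brr].
  by rewrite ger0_norm; lra.
have limu a b : 0 <= a -> a < b -> b < rr -> (forall s, a < s -> s < b -> cmean q s = q 0) ->
    cmean q b = q 0.
  move=> a0 ab brr h; apply/eqP; rewrite -subr_eq0 -nm_eq0 eq_le nm_ge0 andbT.
  apply/ler_addgt0Pl => e e0; rewrite addr0.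
  have b0 : 0 <= b by rewrite (le_trans a0)// ltW.
  have [d d0 hd] := cmean_cont (cc b b0 brr) e0.
  pose s := Num.max ((a + b) / 2) (b - d / 2).
  have sb : s < b by rewrite gt_max; apply/andP; split; lra.
  have sa : (a + b) / 2 <= s by rewrite le_max lexx.
  have sd : b - d / 2 <= s by rewrite le_max lexx orbT.
  rewrite nmB -(h s); [|lra..].
  by apply: hd; [rewrite ler0_norm; lra|apply: cc; lra].
have ann a b : 0 < a -> a <= b -> b < rr -> (nm p < a \/ b < nm p) -> cmean q a = cmean q b.
  move=> a0 ab brr hp; apply: cmean_annulus => // z za zb; apply: dq.
  - exact: le_lt_trans zb brr.
  - by rewrite -nm_gt0 (lt_le_trans a0).
  - by apply: contraPneq hp => zp; rewrite -zp => -[]; lra.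
have small s : 0 <= s -> s < rr -> s < nm p \/ nm p = 0 -> cmean q s = q 0.
  move=> s0 sr hs; move: s0; rewrite le_eqVlt => /predU1P[<-//|s0].
  rewrite -m0; apply: lim => // t t0 ts; apply: ann => //.
  by case: hs => [|->]; [right|left].
have [p0|p0] := eqVneq (nm p) 0; first by apply: small => //; right.
have pp : 0 < nm p by rewrite lt_neqAle eq_sym p0 nm_ge0.
have [rp|rp|rp] := ltgtP r (nm p); first by apply: small => //; left.
- have hp : cmean q (nm p) = q 0.
    apply: (limu 0) => //; first exact: lt_trans rp rr1.
    move=> s s0 sp; apply: small; [exact: ltW|exact: lt_trans sp (lt_trans rp rr1)|by left].
  rewrite -hp; apply: lim => //; first exact: ltW.
  by move=> s ps sr; apply: ann => //; [exact: lt_trans pp ps|left].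
- rewrite rp in rr1 *; apply: (limu 0) => // s s0 sp.
  by apply: small; [exact: ltW|exact: lt_trans sp rr1|left].
Qed.

Lemma circ_subl_neq0 r z w : nm z = r -> nm w < r -> z - w != 0.
Proof. by move=> zr; apply: contraTneq => /eqP; rewrite subr_eq0 => /eqP <-; rewrite zr ltxx. Qed.

Lemma ccont_inv f z : f z != 0 -> ccont f z -> ccont (fun w => (f w)^-1) z.
Proof. by move=> f0 cf; exact: (ccvgV f0 cf). Qed.

Lemma ccontB f g z : ccont f z -> ccont g z -> ccont (fun w => f w - g w) z.
Proof. by move=> cf cg; exact: (ccvgB cf cg). Qed.

(** The mean does not depend on the radius, and the kernel tends to 1 as the radius grows. *)
Lemma cmean_kernel w r : nm w < r -> cmean (fun z => z / (z - w)) r = 1.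
Proof.
move=> wr; have w0 := nm_ge0 w; have r0 := le_lt_trans w0 wr.
have ck s : r <= s -> cont_circ (fun z => z / (z - w)) s.
  move=> rs; apply: cont_circ_on; first exact: le_trans (ltW r0) rs.
  move=> z zs; apply: (ccontM (ccont_id z)); apply: ccont_inv.
    by apply: circ_subl_neq0 zs _; exact: lt_le_trans wr rs.
  exact: (ccontB (ccont_id z) (ccont_cst w z)).
apply/eqP; rewrite -subr_eq0 -nm_eq0 eq_le nm_ge0 andbT.
apply/ler_addgt0Pl => e e0; rewrite addr0.
pose s := r + 2 * nm w / e.
have we : 0 <= 2 * nm w / e by rewrite divr_ge0 ?mulr_ge0// ltW.
have rs : r <= s by rewrite lerDl.
have -> : cmean (fun z => z / (z - w)) r = cmean (fun z => z / (z - w)) s.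
  apply: cmean_annulus => // z rz _; eexists.
  apply: (cdiffM (cdiff_id z)); apply: (@cdiffV _ (fun z => z - w)).
    by apply: circ_subl_neq0 erefl _; exact: lt_le_trans wr rz.
  exact: (cdiffB (cdiff_id z) (cdiff_cst w z)).
rewrite -[X in _ - X](@cmean_cst _ s) -cmeanB; last 2 first.
- exact: ck.
- by apply: cont_circ_on => [|z _]; [exact: le_trans (ltW r0) rs|exact: ccont_cst].
have s0 : 0 < s by exact: lt_le_trans r0 rs.
have -> : e = 2 * (e / 2) by field.
apply: nm_cmean; last 1 first.
- move=> z zs; have zw : z - w != 0 by apply: circ_subl_neq0 zs _; exact: lt_le_trans wr rs.
  have -> : z / (z - w) - 1 = w / (z - w) by field.
  rewrite nmM nmV ler_pdivrMr ?nm_gt0//.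
  have : s - nm w <= nm (z - w) by rewrite -zs; exact: nm_subl.
  move=> /(ler_wpM2l (ltW (divr_gt0 e0 (ltr0n R 2)))); apply: le_trans.
  have -> : e / 2 * (s - nm w) = e / 2 * (r - nm w) + nm w by rewrite /s; field; lra.
  by rewrite lerDr mulr_ge0; lra.
- apply: cont_circ_on => [|z zs]; first exact: ltW.
  apply: ccontB; last exact: ccont_cst.
  apply: (ccontM (ccont_id z)); apply: ccont_inv.
    by apply: circ_subl_neq0 zs _; exact: lt_le_trans wr rs.
  exact: (ccontB (ccont_id z) (ccont_cst w z)).
- exact: ltW.
Qed.

Lemma ccont_kernel w r z : nm z = r -> nm w < r -> ccont (fun z => (z - w)^-1) z.
Proof.
move=> zr wr; apply: ccont_inv; first exact: circ_subl_neq0 zr wr.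
exact: (ccontB (ccont_id z) (ccont_cst w z)).
Qed.

(** The mean value property is applied to q(z) = phi(z) z with [phi] the difference quotient at w: q
    vanishes at 0, and on the circle it is h(z) - h(w) times z / (z - w). *)
Lemma cauchy_formula h (rr : R) r w :
  (forall z, nm z < rr -> exists D, cdiff h z D) -> nm w < r -> r < rr ->
  cmean (fun z => h z * (z / (z - w))) r = h w.
Proof.
move=> dh wr rrr; have r0 := le_lt_trans (nm_ge0 w) wr.
have [Dw /cdiffP[phi [p1 p2 p3]]] := dh w (lt_trans wr rrr).
pose q z := phi z * z.
have phiE z : z != w -> phi z = (h z - h w) / (z - w).
  by move=> zw; rewrite p1 mulfK// subr_eq0.
have dq z : nm z < rr -> z != w -> exists D, cdiff q z D.
  move=> zr zw; have [Dz hDz] := dh z zr; eexists.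
  apply: cdiffM; last exact: cdiff_id.
  apply: (@cdiff_eq_near _ (fun z => (h z - h w) / (z - w))).
    apply/cnbhsP; exists (nm (z - w)); first by rewrite nm_gt0 subr_eq0.
    move=> v vz; apply/esym/phiE; apply: contraTneq vz => ->.
    by rewrite nmB ltxx.
  apply: (cdiffM (cdiffB hDz (cdiff_cst (h w) z))).
  apply: (@cdiffV _ (fun z => z - w)); first by rewrite subr_eq0.
  exact: (cdiffB (cdiff_id z) (cdiff_cst w z)).
have := @mean_value q rr w r _ _ (ltW r0) rrr.
rewrite /q mulr0 => H.
have {}H : cmean q r = 0.
  apply: H => z zr.
    have [->|zw] := eqVneq z w; first exact: (ccontM p3 (ccont_id w)).
    by have [D /cdiff_cont] := dq z zr zw.
  by move=> _; exact: dq.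
have ch z : nm z = r -> ccont h z.
  by move=> zr; have [|D /cdiff_cont//] := dh z; rewrite zr.
have ck z : nm z = r -> ccont (fun z => z / (z - w)) z.
  by move=> zr; exact: (ccontM (ccont_id z) (ccont_kernel zr wr)).
have c1 : cont_circ (fun z => h z * (z / (z - w))) r.
  by apply: cont_circ_on => [|z zr]; [exact: ltW|exact: (ccontM (ch z zr) (ck z zr))].
have c2 : cont_circ (fun z => z / (z - w)) r.
  by apply: cont_circ_on => [|z zr]; [exact: ltW|exact: ck].
apply/eqP; rewrite -subr_eq0 -[h w]mulr1 -(cmean_kernel wr) -cmeanZ// -cmeanB//; last first.
  by apply: cont_circ_on => [|z zr]; [exact: ltW|exact: (ccontM (ccont_cst (h w) z) (ck z zr))].
apply/eqP; rewrite -[RHS]H; apply: eq_cmean; first exact: ltW.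
move=> z zr; have zw := circ_subl_neq0 zr wr.
rewrite /q phiE; last by rewrite -subr_eq0.
by field.
Qed.

(** A remainder quadratic in v - w, uniformly on the circle, permits differentiation under the
    mean. *)
Lemma cdiff_cmean (F : C -> C -> C) (F' : C -> C) r w d M :
  0 <= r -> 0 < d ->
  (forall v, nm (v - w) < d -> cont_circ (F^~ v) r) -> cont_circ F' r ->
  (forall v z, nm (v - w) < d -> nm z = r ->
     nm (F z v - F z w - F' z * (v - w)) <= M * nm (v - w) ^+ 2) ->
  cdiff (fun v => cmean (F^~ v) r) w (cmean F' r).
Proof.
move=> r0 d0 cF cF' hM e e0.
pose m := 2 * `|M| + 1.
have m0 : 0 < m by rewrite /m; have := normr_ge0 M; lra.
exists (Num.min d (e / m)); first by rewrite lt_min d0 divr_gt0.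
move=> v; rewrite lt_min => /andP[vd ve].
have cw : cont_circ (F^~ w) r by apply: cF; rewrite subrr nm0.
have cv := cF v vd.
have ccB f g : cont_circ f r -> cont_circ g r -> cont_circ (fun z => f z - g z) r.
  by move=> cf cg t ht; exact: (ccontB (cf t ht) (cg t ht)).
have cZ : cont_circ (fun z => (v - w) * F' z) r.
  by move=> t ht; exact: (ccontM (ccont_cst (v - w) (circ r t)) (cF' t ht)).
rewrite -cmeanB// [X in _ - X]mulrC -cmeanZ// -cmeanB//; last exact: ccB.
have vw0 := nm_ge0 (v - w).
apply: (@le_trans _ _ (2 * (`|M| * nm (v - w) ^+ 2))).
  apply: nm_cmean => //; first by apply: (ccB (fun z => F z v - F z w)) => //; exact: ccB.
  move=> z zr; rewrite [(v - w) * _]mulrC; apply: le_trans (hM v z vd zr) _.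
  by rewrite ler_wpM2r ?sqr_ge0// ler_norm.
move: ve; rewrite ltr_pdivlMr// => ve.
rewrite expr2 !mulrA ler_wpM2r//.
by apply: le_trans (ltW ve); rewrite mulrC ler_wpM2l// /m; lra.
Qed.

End CircleMeans.

(** * Holomorphic functions on discs *)

Section CauchyTheory.
Variable R : realType.
Local Notation C := (R[i]).
Local Notation nm := (@Normc.normc R).
Local Notation Re := (@complex.Re R).
Local Notation Im := (@complex.Im R).
Implicit Types (f g h q : C -> C) (r s t e M rr : R) (z w v : C).

(** Compactness of a square around the disc, as a near covering whose parameter is the bound M
    tending to infinity. Near a point of the square outside the disc the condition holds
    vacuously. *)
Lemma ccont_disc_bounded f r : (forall z, nm z <= r -> ccont f z) ->
  exists2 M, 0 <= M & forall z, nm z <= r -> nm (f z) <= M.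
Proof.
move=> cf.
have cK : near_covering (`[- r, r] `*` `[- r, r]).
  by apply/compact_near_coveringP; apply: compact_setX; exact: segment_compact.
have H : \forall M \near +oo, forall p, (`[- r, r] `*` `[- r, r]) p ->
    nm (p.1 +i* p.2) <= r -> nm (f (p.1 +i* p.2)) <= M.
  apply: (cK R +oo (fun M p => nm (p.1 +i* p.2) <= r -> nm (f (p.1 +i* p.2)) <= M)) => p _.
  set z := p.1 +i* p.2.
  have cp : ccvg (nbhs p) (fun p => p.1 +i* p.2) z.
    by split => /=; [exact: cvg_fst|exact: cvg_snd].
  have [zr|zr] := leP (nm z) r.
    have [d d0 hd] := (ccontP _ _).1 (cf z zr) 1 ltr01.
    have /ccvgP/(_ _ d0) h1 := cp.
    exists ([set p' : R * R | nm (p'.1 +i* p'.2 - z) < d],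
      [set M | nm (f z) + 1 <= M]) => /=.
      split => //; apply: nbhs_pinfty_ge; exact: num_real.
    move=> [p' M] /= [pd hM] _; apply: le_trans hM.
    by have := hd _ pd; have := nm_subl (f (p'.1 +i* p'.2)) (f z); lra.
  have d0 : 0 < nm z - r by rewrite subr_gt0.
  have /ccvgP/(_ _ d0) h1 := cp.
  exists ([set p' : R * R | nm (p'.1 +i* p'.2 - z) < nm z - r], setT) => /=.
    by split => //; exact: filterT.
  move=> [p' M] /= [pd _] pr; exfalso.
  by have := nm_subl z (p'.1 +i* p'.2); rewrite nmB; lra.
have [M hM] := @filter_ex _ _ proper_pinfty_nbhs _ H.
exists `|M| => // z zr; apply: le_trans (ler_norm M).
have := hM (Re z, Im z) _; rewrite /=.
have -> : Re z +i* Im z = z by case: z {zr}.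
apply => //; split => /=; rewrite in_itv /=.
- by have := le_trans (Re_le_nm z) zr; rewrite ler_norml.
- by have := le_trans (Im_le_nm z) zr; rewrite ler_norml.
Qed.

(* Completeness in an effective form: the error bound itself gives the limit. *)
Lemma real_limit (u b : nat -> R) :
  (forall K N, (K <= N)%N -> `|u N - u K| <= b K) ->
  exists l, forall K, `|l - u K| <= b K.
Proof.
move=> h.
have ub : forall K N, u K - b K <= u N + b N.
  move=> K N; have [KN|/ltnW NK] := leqP K N.
    have := h K N KN; have := h N N (leqnn _); rewrite subrr normr0 ler_norml; lra.
  have := h N K NK; have := h K K (leqnn _); rewrite subrr normr0 ler_norml; lra.
exists (sup (range (fun K => u K - b K))) => K.
have lo : u K - b K <= sup (range (fun K => u K - b K)).
  apply: ub_le_sup; last by exists K.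
  by exists (u 0%N + b 0%N) => _ [m _ <-].
have hi : sup (range (fun K => u K - b K)) <= u K + b K.
  by apply: ge_sup; [exists (u 0%N - b 0%N), 0%N|move=> _ [m _ <-]].
by rewrite ler_norml; lra.
Qed.

Lemma complex_limit (u : nat -> C) (b : nat -> R) :
  (forall K N, (K <= N)%N -> nm (u N - u K) <= b K) ->
  exists l, forall K, nm (l - u K) <= 2 * b K.
Proof.
move=> h.
have hx K N : (K <= N)%N -> `|Re (u N) - Re (u K)| <= b K.
  by move=> KN; rewrite -ReN -ReD (le_trans (Re_le_nm _))// h.
have hy K N : (K <= N)%N -> `|Im (u N) - Im (u K)| <= b K.
  by move=> KN; rewrite -ImN -ImD (le_trans (Im_le_nm _))// h.
have [x {}hx] := real_limit hx; have [y {}hy] := real_limit hy.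
exists (x +i* y) => K; apply: le_trans (nm_le _) _.
by rewrite ReD ReN ImD ImN mulr2n mulrDl !mul1r /=; apply: lerD.
Qed.

(** Cauchy transforms: each is the derivative of the preceding one. The density that reproduces f is
    f(z) z, because the mean already contains the division by z. *)
Definition ctrans (phi : C -> C) r w := cmean (fun z => phi z / (z - w)) r.
Definition ctrans2 (phi : C -> C) r w := cmean (fun z => phi z / (z - w) ^+ 2) r.
Definition ctrans3 (phi : C -> C) r w := cmean (fun z => 2 * phi z / (z - w) ^+ 3) r.

Lemma ccont_kernelX m w r z : nm z = r -> nm w < r ->
  ccont (fun z => ((z - w) ^+ m)^-1) z.
Proof.
move=> zr wr; apply: ccont_inv; first by rewrite expf_neq0// (circ_subl_neq0 zr wr).
exact: (ccvgX m (ccontB (ccont_id z) (ccont_cst w z))).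
Qed.

Section Transform.
Variables (phi : C -> C) (r : R) (w : C).
Hypotheses (cphi : forall z, nm z = r -> ccont phi z) (wr : nm w < r).

Let r0 : 0 < r := le_lt_trans (nm_ge0 w) wr.
Let d := (r - nm w) / 2.
Let d0 : 0 < d. Proof. by rewrite divr_gt0// subr_gt0. Qed.

Let dist v z : nm (v - w) < d -> nm z = r -> d <= nm (z - v).
Proof.
move=> vd zr; have := nm_subl z v; have := nm_subl v w; move: vd; rewrite /d zr; lra.
Qed.

Let vr v : nm (v - w) < d -> nm v < r.
Proof. by move=> vd; have := nm_subl v w; move: vd wr; rewrite /d; lra. Qed.

Let wd : nm (w - w) < d. Proof. by rewrite subrr nm0. Qed.

Let inv_le v z : nm (v - w) < d -> nm z = r -> nm (z - v)^-1 <= d^-1.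
Proof.
move=> vd zr; have h := dist vd zr; rewrite nmV lef_pV2 ?posrE//.
exact: lt_le_trans d0 h.
Qed.

Lemma cont_circ_kernel m : cont_circ (fun z => phi z / (z - w) ^+ m) r.
Proof.
apply: cont_circ_on => [|z zr]; first exact: ltW.
exact: (ccontM (cphi zr) (ccont_kernelX m zr wr)).
Qed.

Variable M : R.
Hypotheses (M0 : 0 <= M) (phiM : forall z, nm z = r -> nm (phi z) <= M).

Lemma cdiff_ctrans_bound : cdiff (ctrans phi r) w (ctrans2 phi r w).
Proof.
apply: (@cdiff_cmean _ (fun z v => phi z / (z - v)) _ r w d (M * d^-1 ^+ 3)) => //.
- exact: ltW.
- move=> v vd; apply: cont_circ_on => [|z zr]; first exact: ltW.
  exact: (ccontM (cphi zr) (ccont_kernel zr (vr vd))).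
- exact: cont_circ_kernel.
- move=> v z vd zr.
  have zv := circ_subl_neq0 zr (vr vd); have zw := circ_subl_neq0 zr wr.
  have -> : phi z / (z - v) - phi z / (z - w) - phi z / (z - w) ^+ 2 * (v - w) =
     phi z * ((z - v)^-1 * (z - w)^-1 ^+ 2) * (v - w) ^+ 2.
    by field; apply/andP.
  rewrite nmM nmX ler_wpM2r ?sqr_ge0// nmM ler_pM ?nm_ge0 ?phiM//.
  rewrite nmM nmX [d^-1 ^+ 3]exprS; apply: ler_pM; rewrite ?nm_ge0 ?sqr_ge0 ?inv_le//.
  by rewrite lerXn2r ?nnegrE ?nm_ge0 ?invr_ge0 ?inv_le// ltW.
Qed.

Lemma cdiff_ctrans2_bound : cdiff (ctrans2 phi r) w (ctrans3 phi r w).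
Proof.
apply: (@cdiff_cmean _ (fun z v => phi z / (z - v) ^+ 2) _ r w d (M * (3 * d^-1 ^+ 4))) => //.
- exact: ltW.
- move=> v vd; apply: cont_circ_on => [|z zr]; first exact: ltW.
  exact: (ccontM (cphi zr) (ccont_kernelX 2 zr (vr vd))).
- apply: cont_circ_on => [|z zr]; first exact: ltW.
  exact: (ccontM (ccontM (ccont_cst 2 z) (cphi zr)) (ccont_kernelX 3 zr wr)).
- move=> v z vd zr.
  have zv := circ_subl_neq0 zr (vr vd); have zw := circ_subl_neq0 zr wr.
  have -> : phi z / (z - v) ^+ 2 - phi z / (z - w) ^+ 2 - 2 * phi z / (z - w) ^+ 3 * (v - w) =
     phi z * (((z - v)^-1 + 2 * (z - w)^-1) * ((z - v)^-1 * (z - w)^-1 ^+ 2)) * (v - w) ^+ 2.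
    by field; apply/andP.
  rewrite nmM nmX ler_wpM2r ?sqr_ge0// nmM ler_pM ?nm_ge0 ?phiM//.
  have -> : 3 * d^-1 ^+ 4 = (d^-1 + 2 * d^-1) * (d^-1 * d^-1 ^+ 2) by ring.
  rewrite nmM; apply: ler_pM; rewrite ?nm_ge0//.
    apply: le_trans (nmD _ _) _; rewrite nmM nm_nat lerD ?inv_le// ler_pM2l// inv_le//.
  rewrite nmM nmX; apply: ler_pM; rewrite ?nm_ge0 ?sqr_ge0 ?inv_le//.
  by rewrite lerXn2r ?nnegrE ?nm_ge0 ?invr_ge0 ?inv_le// ltW.
Qed.

End Transform.

Definition hol f rr := forall z, nm z < rr -> exists D, cdiff f z D.

Definition cder f : C -> C := ((f : C^o -> C^o)^`())%classic.

Lemma cdiff_cder f z D : cdiff f z D -> cder f z = D.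
Proof. by move=> /(cdiff_derivable (f := f)) []. Qed.

Lemma hol_cdiff f rr z : hol f rr -> nm z < rr -> cdiff f z (cder f z).
Proof. by move=> hf /hf[D hD]; rewrite (cdiff_cder hD). Qed.

Lemma hol_cont f rr z : hol f rr -> nm z < rr -> ccont f z.
Proof. by move=> hf zr; exact: cdiff_cont (hol_cdiff hf zr). Qed.

Lemma hol_bounded f rr r : hol f rr -> r < rr ->
  exists2 M, 0 <= M & forall z, nm z <= r -> nm (f z) <= M.
Proof.
move=> hf rrr; apply: ccont_disc_bounded => z zr.
exact: hol_cont hf (le_lt_trans zr rrr).
Qed.

Lemma cont_bounded_circle f rr r : (forall z, nm z < rr -> ccont f z) -> r < rr ->
  exists2 M, 0 <= M & forall z, nm z = r -> nm (f z) <= M.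
Proof.
move=> cf rrr; have [M M0 hM] := @ccont_disc_bounded f r (fun z zr => cf z (le_lt_trans zr rrr)).
by exists M => // z zr; apply: hM; rewrite zr.
Qed.

Lemma cdiff_ctrans phi rr r w : (forall z, nm z < rr -> ccont phi z) ->
  nm w < r -> r < rr ->
  cdiff (ctrans phi r) w (ctrans2 phi r w) /\ cdiff (ctrans2 phi r) w (ctrans3 phi r w).
Proof.
move=> cphi wr rrr; have [M M0 hM] := cont_bounded_circle cphi rrr.
have cp z : nm z = r -> ccont phi z by move=> zr; apply: cphi; rewrite zr.
by split; [exact: cdiff_ctrans_bound hM|exact: cdiff_ctrans2_bound hM].
Qed.

Lemma hol_ctrans f rr r w : hol f rr -> nm w < r -> r < rr ->
  f w = ctrans (fun z => f z * z) r w.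
Proof.
move=> hf wr rrr; rewrite -(cauchy_formula hf wr rrr).
apply: eq_cmean; first exact: le_trans (nm_ge0 w) (ltW wr).
by move=> z _; rewrite mulrA.
Qed.

Lemma near_disc w r : nm w < r -> \forall v \near cnbhs w, nm v < r.
Proof.
move=> wr; apply/cnbhsP; exists (r - nm w); first by rewrite subr_gt0.
by move=> v; have := nm_subl v w; lra.
Qed.

Lemma mid_lt w rr : nm w < rr -> exists2 r, nm w < r & r < rr.
Proof. by move=> h; exists ((nm w + rr) / 2); lra. Qed.

Lemma hol_cont_mulid f rr : hol f rr -> forall z, nm z < rr -> ccont (fun z => f z * z) z.
Proof. by move=> hf z zr; exact: (ccontM (hol_cont hf zr) (ccont_id z)). Qed.

Lemma cder_ctrans f rr r w : hol f rr -> nm w < r -> r < rr ->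
  cder f w = ctrans2 (fun z => f z * z) r w.
Proof.
move=> hf wr rrr; apply: cdiff_cder.
have [h1 _] := cdiff_ctrans (hol_cont_mulid hf) wr rrr.
apply: cdiff_eq_near h1; apply: filterS (near_disc wr) => v vr.
by rewrite -(hol_ctrans hf vr rrr).
Qed.

Lemma hol_cder f rr : hol f rr -> hol (cder f) rr.
Proof.
move=> hf w wr; have [r wr' rrr] := mid_lt wr.
have [_ h2] := cdiff_ctrans (hol_cont_mulid hf) wr' rrr.
eexists; apply: cdiff_eq_near h2; apply: filterS (near_disc wr') => v vr.
by rewrite -(cder_ctrans hf vr rrr).
Qed.

Lemma nm_ctrans phi r w M m : 0 <= M -> nm w < r ->
  (forall z, nm z = r -> ccont phi z) ->
  (forall z, nm z = r -> nm (phi z) <= M) ->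
  nm (cmean (fun z => phi z / (z - w) ^+ m) r) <= 2 * (M / (r - nm w) ^+ m).
Proof.
move=> M0 wr cphi hM; have r0 : 0 < r := le_lt_trans (nm_ge0 w) wr.
apply: nm_cmean; last 1 first.
- move=> z zr; rewrite nmM nmV nmX; apply: ler_pM; rewrite ?nm_ge0 ?hM//.
    by rewrite invr_ge0 exprn_ge0// nm_ge0.
  have zw : r - nm w <= nm (z - w) by rewrite -zr; exact: nm_subl.
  have rw : 0 < r - nm w by rewrite subr_gt0.
  rewrite lef_pV2 ?posrE ?exprn_gt0//; last exact: lt_le_trans rw zw.
  by rewrite lerXn2r ?nnegrE ?nm_ge0// ltW.
- exact: (cont_circ_kernel cphi wr).
- exact: ltW.
Qed.

(** Near 0 the difference quotient is the Cauchy transform of [f] itself on a small circle, hence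
    differentiable at 0 as well. *)
Lemma hol_divX f rr : 0 < rr -> hol f rr ->
  exists2 g, hol g rr & forall z, nm z < rr -> f z = f 0 + z * g z.
Proof.
move=> rr0 hf; pose r := rr / 2.
have r0 : 0 < r by rewrite divr_gt0.
have rrr : r < rr by rewrite /r; lra.
pose g w := if w == 0 then ctrans f r 0 else (f w - f 0) / w.
have gT w : nm w < r -> g w = ctrans f r w.
  move=> wr; rewrite /g; case: eqVneq => [->//|w0].
  have n0r : nm 0 < r by rewrite nm0.
  rewrite (hol_ctrans hf wr rrr) (hol_ctrans hf n0r rrr).
  have cc v : nm v < r -> cont_circ (fun z => f z * z / (z - v)) r.
    move=> vr; have := @cont_circ_kernel (fun z => f z * z) r v _ vr 1.
    by apply => z zr; apply: (hol_cont_mulid hf); rewrite zr.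
  rewrite /ctrans -cmeanB; [|exact: cc..].
  rewrite mulrC -cmeanZ; last first.
    by move=> t ht; apply: (ccontB (cc w wr t ht) (cc 0 n0r t ht)).
  apply: eq_cmean; first exact: ltW.
  move=> z zr; have zw := circ_subl_neq0 zr wr.
  have z0 : z != 0 by rewrite -nm_gt0 zr.
  by field; rewrite z0 zw w0.
exists g.
  move=> w wr; have [wr'|wr'] := ltP (nm w) r.
    have [h1 _] := cdiff_ctrans (fun z zr => hol_cont hf zr) wr' rrr.
    eexists; apply: cdiff_eq_near h1; apply: filterS (near_disc wr') => v vr.
    by rewrite gT.
  have w0 : w != 0 by rewrite -nm_gt0 (lt_le_trans r0).
  have [D hD] := hf w wr; eexists.
  apply: (@cdiff_eq_near _ (fun w => (f w - f 0) / w)).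
    apply/cnbhsP; exists (nm w); first by rewrite nm_gt0.
    move=> v vw; rewrite /g; case: eqP vw => // ->.
    by rewrite sub0r nmN ltxx.
  apply: (cdiffM (cdiffB hD (cdiff_cst (f 0) w))).
  exact: (cdiffV w0 (cdiff_id w)).
move=> z _; rewrite /g; case: eqVneq => [->|z0]; first by rewrite mul0r addr0.
by field.
Qed.

(** Cauchy's formula passes to a locally uniform limit, which is then a Cauchy transform; its
    derivative, a mean as well, is the limit of the derivatives. Continuity of the limit is
    established first, since the means require it. *)
Lemma hol_limit (F : nat -> C -> C) f rr : (forall N, hol (F N) rr) ->
  (forall r, r < rr -> forall e, 0 < e -> exists N0, forall N, (N0 <= N)%N ->
     forall z, nm z <= r -> nm (F N z - f z) <= e) ->
  hol f rr /\ forall w, nm w < rr -> forall e, 0 < e -> exists N0, forall N, (N0 <= N)%N ->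
     nm (cder (F N) w - cder f w) <= e.
Proof.
move=> hF Ff.
have cf z : nm z < rr -> ccont f z.
  move=> zr; have [r zr' rrr] := mid_lt zr.
  apply/ccontP => e e0; have e3 : 0 < e / 4 by rewrite divr_gt0.
  have [N hN] := Ff r rrr _ e3.
  have [d d0 hd] := (ccontP _ _).1 (hol_cont (hF N) zr) _ e3.
  exists (Num.min d (r - nm z)); first by rewrite lt_min d0 subr_gt0.
  move=> w; rewrite lt_min => /andP[wd wr].
  have wr' : nm w <= r by have := nm_subl w z; lra.
  have h1 := hN N (leqnn _) w wr'; have h2 := hN N (leqnn _) z (ltW zr').
  have h3 := hd w wd; rewrite nmB in h1.
  have -> : f w - f z = (f w - F N w) + (F N w - F N z) + (F N z - f z) by ring.
  apply: le_lt_trans (nmD _ _) _; apply: le_lt_trans (lerD (nmD _ _) (lexx _)) _; lra.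
have cfm z : nm z < rr -> ccont (fun z => f z * z) z.
  by move=> zr; exact: (ccontM (cf z zr) (ccont_id z)).
have conv m w r : nm w < r -> r < rr -> forall e, 0 < e -> exists N0, forall N, (N0 <= N)%N ->
    nm (cmean (fun z => F N z * z / (z - w) ^+ m) r - cmean (fun z => f z * z / (z - w) ^+ m) r) <= e.
  move=> wr rrr e e0; have r0 : 0 < r := le_lt_trans (nm_ge0 w) wr.
  have rw : 0 < r - nm w by rewrite subr_gt0.
  have rwm : 0 < (r - nm w) ^+ m by rewrite exprn_gt0.
  pose e1 := e * (r - nm w) ^+ m / (2 * r).
  have e10 : 0 < e1 by rewrite divr_gt0 ?mulr_gt0.
  have [N0 hN] := Ff r rrr _ e10; exists N0 => N NN.
  have c1 z : nm z = r -> ccont (fun z => F N z * z) z.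
    by move=> zr; apply: (hol_cont_mulid (hF N)); rewrite zr.
  have c2 z : nm z = r -> ccont (fun z => f z * z) z.
    by move=> zr; apply: cfm; rewrite zr.
  rewrite -cmeanB; [|exact: (cont_circ_kernel c1 wr)|exact: (cont_circ_kernel c2 wr)].
  have -> : cmean (fun z => F N z * z / (z - w) ^+ m - f z * z / (z - w) ^+ m) r =
     cmean (fun z => (F N z * z - f z * z) / (z - w) ^+ m) r.
    by apply: eq_cmean => [|z _]; [exact: ltW|rewrite mulrBl].
  have -> : e = 2 * (e1 * r / (r - nm w) ^+ m).
    by rewrite /e1; field; rewrite !lt0r_neq0.
  apply: nm_ctrans => //; first by rewrite mulr_ge0// ltW.
  - by move=> z zr; exact: (ccontB (c1 z zr) (c2 z zr)).
  - move=> z zr; rewrite -mulrBl nmM zr ler_wpM2r//; first exact: ltW.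
    by apply: hN; rewrite ?zr.
have fT w r : nm w < r -> r < rr -> f w = ctrans (fun z => f z * z) r w.
  move=> wr rrr; apply/eqP; rewrite -subr_eq0 -nm_eq0 eq_le nm_ge0 andbT.
  apply/ler_addgt0Pl => e e0; rewrite addr0.
  have e2 : 0 < e / 2 by rewrite divr_gt0.
  have [N1 h1] := conv 1%N w r wr rrr _ e2.
  have [N2 h2] := Ff r rrr _ e2.
  have := h1 _ (leq_maxl N1 N2); have := h2 _ (leq_maxr N1 N2) w (ltW wr).
  set N := maxn N1 N2.
  rewrite {1}(hol_ctrans (hF N) wr rrr) /ctrans nmB => k1 k2.
  apply: le_trans (nm_triB _ _ (ctrans (fun z => F N z * z) r w)) _.
  rewrite [e]splitr; exact: lerD.
have hf : hol f rr.
  move=> w wr; have [r wr' rrr] := mid_lt wr.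
  have [h1 _] := cdiff_ctrans cfm wr' rrr.
  eexists; apply: cdiff_eq_near h1; apply: filterS (near_disc wr') => v vr.
  by rewrite -(fT v r vr rrr).
split => // w wr e e0; have [r wr' rrr] := mid_lt wr.
have [N0 h] := conv 2%N w r wr' rrr e e0.
by exists N0 => N NN; rewrite (cder_ctrans (hF N) wr' rrr) (cder_ctrans hf wr' rrr) h.
Qed.

End CauchyTheory.

(** * Taylor expansions, primitives and logarithms *)

Section Primitives.
Variable R : realType.
Local Notation C := (R[i]).
Local Notation nm := (@Normc.normc R).
Local Notation Re := (@complex.Re R).
Local Notation Im := (@complex.Im R).
Implicit Types (f g h q : C -> C) (r s t e M rr : R) (z w v : C).

Lemma eps_is_derive (g : R -> R) (x d : R) :
  (forall e, 0 < e -> exists2 r, 0 < r & forall y, `|y - x| < r ->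
    `|g y - g x - d * (y - x)| <= e * `|y - x|) -> is_derive x 1 g d.
Proof.
move=> h.
have hc : (fun k => k^-1 *: (g (k *: 1 + x) - g x)) @ 0^' --> d.
  apply/cvgrPdist_le => e /h[r r0 hr].
  rewrite /dnbhs /within /=; exists r => // k /=; rewrite sub0r normrN => kr k0.
  have := hr (x + k); rewrite [x + k - x]addrC addKr => /(_ kr) H.
  have -> : k *: 1 + x = x + k by rewrite /GRing.scale /= mulr1 addrC.
  have -> : d - k^-1 *: (g (x + k) - g x) = - ((g (x + k) - g x - d * k) / k).
    by rewrite /GRing.scale /=; field.
  by rewrite normrN normrM normfV ler_pdivrMr ?normr_gt0.
apply: DeriveDef; first by apply/cvg_ex; exists d.
exact: cvg_lim.
Qed.

(** The real mean value theorem is applied to each coordinate along the segment, which costs the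
    factor 2. *)
Lemma mean_value_ineq f (a b : C) M :
  (forall t, 0 <= t <= 1 -> exists2 D, cdiff f (a + t%:C * (b - a)) D & nm D <= M) ->
  nm (f b - f a) <= 2 * M * nm (b - a).
Proof.
move=> hf.
pose p t := f (a + t%:C * (b - a)).
pose D t := xget 0 [set d | cdiff f (a + t%:C * (b - a)) d /\ nm d <= M].
have hD t : 0 <= t <= 1 -> cdiff f (a + t%:C * (b - a)) (D t) /\ nm (D t) <= M.
  by move=> /hf[d d1 d2]; rewrite /D; case: xgetP => [y _ //|H]; case: (H d (conj d1 d2)).
have ba0 := nm_ge0 (b - a).
have m0 : 0 < nm (b - a) + 1 by lra.
have der t : 0 <= t <= 1 -> forall e, 0 < e -> exists2 r, 0 < r & forall s, `|s - t| < r ->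
    nm (p s - p t - D t * (b - a) * (s - t)%:C) <= e * `|s - t|.
  move=> /hD[dt _] e e0.
  have [r r0 hr] := dt _ (divr_gt0 e0 m0).
  exists (r / (nm (b - a) + 1)); first exact: divr_gt0.
  move=> s; rewrite ltr_pdivlMr// => st.
  have E : a + s%:C * (b - a) - (a + t%:C * (b - a)) = (s - t)%:C * (b - a).
    by rewrite (rmorphB (real_complex R)) /=; ring.
  have := hr (a + s%:C * (b - a)); rewrite E nmM nm_real.
  have st0 := normr_ge0 (s - t).
  have small : `|s - t| * nm (b - a) < r.
    by apply: le_lt_trans st; rewrite ler_wpM2l// lerDl.
  move=> /(_ small); rewrite -/(p s) -/(p t) => H.
  have -> : D t * (b - a) * (s - t)%:C = D t * ((s - t)%:C * (b - a)) by ring.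
  apply: le_trans H _.
  have -> : e / (nm (b - a) + 1) * (`|s - t| * nm (b - a)) =
    e * `|s - t| * (nm (b - a) / (nm (b - a) + 1)) by ring.
  rewrite ler_piMr//; first by rewrite mulr_ge0// ltW.
  by rewrite ler_pdivrMr// mul1r lerDl.
have p0 : p 0 = f a by rewrite /p mul0r addr0.
have p1 : p 1 = f b by rewrite /p mul1r addrC subrK.
have M0 : 0 <= M.
  have [|_] := hD 0; first by rewrite lexx ler01.
  exact: le_trans (nm_ge0 _).
have key (k : C -> R) : (forall z w, k (z - w) = k z - k w) -> (forall z, `|k z| <= nm z) ->
    (forall z x, k (z * x%:C) = k z * x) -> `|k (f b) - k (f a)| <= M * nm (b - a).
  move=> kB kn kZ.
  have dk t : 0 <= t <= 1 -> is_derive t 1 (fun t => k (p t)) (k (D t * (b - a))).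
    move=> ht; apply: eps_is_derive => e e0; have [r r0 hr] := der t ht e e0.
    by exists r => // s st; rewrite -kZ -!kB (le_trans (kn _))// hr.
  have [t||c] := @MVT_segment R (fun t => k (p t)) (fun t => k (D t * (b - a))) 0 1 ler01.
    by rewrite in_itv /= => /andP[t0 t1]; apply: dk; rewrite !ltW.
    apply: derivable_within_continuous => t; rewrite in_itv /= => ht.
    by have [] := dk t ht.
  rewrite in_itv /= => hc; rewrite p0 p1 => ->; rewrite subr0 mulr1.
  by apply: le_trans (kn _) _; rewrite nmM ler_wpM2r//; have [] := hD c hc.
apply: le_trans (nm_le _) _.
have h1 : `|Re (f b) - Re (f a)| <= M * nm (b - a).
  apply: key => [z w|z|z x]; [by rewrite ReD ReN|exact: Re_le_nm|].
  by rewrite ReM /= mulr0 subr0.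
have h2 : `|Im (f b) - Im (f a)| <= M * nm (b - a).
  apply: key => [z w|z|z x]; [by rewrite ImD ImN|exact: Im_le_nm|].
  by rewrite ImM /= mulr0 add0r.
by rewrite ReD ReN ImD ImN; lra.
Qed.

Lemma hol_const f rr z : hol f rr -> (forall w, nm w < rr -> cder f w = 0) ->
  nm z < rr -> f z = f 0.
Proof.
move=> hf d0 zr; apply/eqP; rewrite -subr_eq0 -nm_eq0 eq_le nm_ge0 andbT.
have -> : 0 = 2 * 0 * nm (z - 0) :> R by rewrite mulr0 mul0r.
apply: mean_value_ineq => t /andP[t0 t1].
have tz : nm (0 + t%:C * (z - 0)) < rr.
  rewrite add0r subr0 nmM nm_real ger0_norm//; apply: le_lt_trans zr.
  by rewrite ler_piMl ?nm_ge0.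
exists 0; last by rewrite nm0.
by have := hol_cdiff hf tz; rewrite (d0 _ tz).
Qed.

Lemma holD f g rr : hol f rr -> hol g rr -> hol (fun z => f z + g z) rr.
Proof.
move=> hf hg z zr; have [a ha] := hf z zr; have [b hb] := hg z zr.
by exists (a + b); exact: cdiffD.
Qed.

Lemma holM f g rr : hol f rr -> hol g rr -> hol (fun z => f z * g z) rr.
Proof.
move=> hf hg z zr; have [a ha] := hf z zr; have [b hb] := hg z zr.
by eexists; exact: (cdiffM ha hb).
Qed.

Lemma hol_cst c rr : hol (fun=> c) rr.
Proof. by move=> z zr; exists 0; exact: cdiff_cst. Qed.

Lemma holV f rr : hol f rr -> (forall z, nm z < rr -> f z != 0) -> hol (fun z => (f z)^-1) rr.
Proof.
by move=> hf n0 z zr; have [a ha] := hf z zr; eexists; exact: (cdiffV (n0 z zr) ha).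
Qed.

Lemma hol_prod (I : Type) (s : seq I) (F : I -> C -> C) rr :
  (forall i, hol (F i) rr) -> hol (fun z => \prod_(i <- s) F i z) rr.
Proof.
move=> h; elim: s => [|i s IH].
  have -> : (fun z => \prod_(i <- [::]) F i z) = fun=> 1 by apply/funext => z; rewrite big_nil.
  exact: hol_cst.
have -> : (fun z => \prod_(j <- i :: s) F j z) = fun z => F i z * \prod_(j <- s) F j z.
  by apply/funext => z; rewrite big_cons.
exact: holM.
Qed.

Lemma hol_sum (I : Type) (s : seq I) (F : I -> C -> C) rr :
  (forall i, hol (F i) rr) -> hol (fun z => \sum_(i <- s) F i z) rr.
Proof.
move=> h z zr; pose D i := xget 0 [set d | cdiff (F i) z d].
exists (\sum_(i <- s) D i); apply: cdiff_sum => i.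
by have [d hd] := h i z zr; rewrite /D; case: xgetP => [y _ //|/(_ d)].
Qed.

Lemma hol_cexp f rr : hol f rr -> hol (fun z => cexp (f z)) rr.
Proof.
move=> hf z zr; have [d hd] := hf z zr.
by eexists; exact: (cdiff_comp hd (cdiff_cexp (f z))).
Qed.

Lemma hol_scale f rr (w : C) : nm w = 1 -> hol f rr -> hol (fun z => f (w * z)) rr.
Proof.
move=> w1 hf z zr; have [|d hd] := hf (w * z); first by rewrite nmM w1 mul1r.
by eexists; exact: (cdiff_comp (cdiffZ w (cdiff_id z)) hd).
Qed.

Lemma geometric_small (q M e : R) : 0 <= q -> q < 1 -> 0 < e ->
  exists N0, forall N, (N0 <= N)%N -> M * q ^+ N <= e.
Proof.
move=> q0 q1 e0.
have q1' : `|q| < 1 by rewrite ger0_norm.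
have /cvgrPdist_le /(_ e e0) [N0 _ h] := cvg_geometric M q1'.
exists N0 => N NN; have := h N NN; rewrite /= sub0r normrN.
by apply: le_trans; exact: ler_norm.
Qed.

Lemma geometric_tail (q : R) K N : 0 <= q -> q < 1 -> (K <= N)%N ->
  \sum_(K <= k < N) q ^+ k <= q ^+ K / (1 - q).
Proof.
move=> q0 q1 KN; have q1' : 0 < 1 - q by rewrite subr_gt0.
rewrite -(subnKC KN) geometric_partial_tail geometric_seriesE; last by rewrite lt_eqF.
rewrite ler_pM2r ?invr_gt0// ler_piMr ?exprn_ge0//.
by rewrite lerBlDr lerDl exprn_ge0.
Qed.

Section Taylor.
Variables (h : C -> C) (rr r M : R).
Hypotheses (hh : hol h rr) (r0 : 0 < r) (rrr : r < rr) (M0 : 0 <= M)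
  (hM : forall z, nm z = r -> nm (h z) <= M).

Definition tcoef k := cmean (fun z => h z / z ^+ k) r.

Let ch z : nm z = r -> ccont h z.
Proof. by move=> zr; apply: (hol_cont hh); rewrite zr. Qed.

Let w0r : nm (0 : C) < r. Proof. by rewrite nm0. Qed.

Let cc k : cont_circ (fun z => h z / z ^+ k) r.
Proof.
have -> : (fun z => h z / z ^+ k) = (fun z => h z / (z - 0) ^+ k).
  by apply/funext => z; rewrite subr0.
exact: (cont_circ_kernel ch w0r k).
Qed.

Lemma nm_tcoef k : nm (tcoef k) <= 2 * (M / r ^+ k).
Proof.
have := nm_ctrans k M0 w0r ch hM; rewrite nm0 subr0.
have -> // : (fun z => h z / (z - 0) ^+ k) = (fun z => h z / z ^+ k).
by apply/funext => z; rewrite subr0.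
Qed.

Let rem K w := cmean (fun z => h z / z ^+ K * (z / (z - w))) r.

Let ccr K w : nm w < r -> cont_circ (fun z => h z / z ^+ K * (z / (z - w))) r.
Proof.
move=> wr t ht; have zr := nm_circ t (ltW r0).
exact: (ccontM (cc K ht) (ccontM (ccont_id _) (ccont_kernel zr wr))).
Qed.

Lemma taylor_rem w K : nm w < r -> h w = \sum_(k < K) tcoef k * w ^+ k + w ^+ K * rem K w.
Proof.
move=> wr; elim: K => [|K IH].
  rewrite big_ord0 add0r expr0 mul1r -(cauchy_formula hh wr rrr).
  by apply: eq_cmean => [|z _]; [exact: ltW|rewrite expr0 divr1].
rewrite IH big_ord_recr /= -addrA; congr (_ + _).
suff -> : rem K w = tcoef K + w * rem K.+1 w by rewrite exprS; ring.
rewrite /rem /tcoef -cmeanZ; last exact: ccr.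
rewrite -cmeanD; [|exact: cc|]; last first.
  by move=> t ht; exact: (ccontM (ccont_cst w _) (ccr K.+1 wr ht)).
apply: eq_cmean => [|z zr]; first exact: ltW.
have zw := circ_subl_neq0 zr wr.
have z0 : z != 0 by rewrite -nm_gt0 zr.
have zK : z ^+ K != 0 by rewrite expf_neq0.
by rewrite exprS; field; rewrite zK z0 zw.
Qed.

Lemma nm_taylor_rem w K : nm w < r ->
  nm (h w - \sum_(k < K) tcoef k * w ^+ k) <= 2 * M * r / (r - nm w) * (nm w / r) ^+ K.
Proof.
move=> wr; rewrite (taylor_rem K wr) addrC addKr nmM nmX.
have -> : 2 * M * r / (r - nm w) * (nm w / r) ^+ K =
  nm w ^+ K * (2 * (M / r ^+ K * r / (r - nm w) ^+ 1)).
  rewrite expr1 expr_div_n; ring.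
rewrite ler_wpM2l ?exprn_ge0 ?nm_ge0//.
have E : rem K w = cmean (fun z => h z / z ^+ K * z / (z - w) ^+ 1) r.
  by apply: eq_cmean => [|z _]; [exact: ltW|rewrite expr1 mulrA].
rewrite E; apply: nm_ctrans => //.
- by rewrite mulr_ge0 ?divr_ge0 ?exprn_ge0// ltW.
- move=> z zr; have := ccontM (ccontM (ch zr) (@ccont_kernelX R K 0 r z zr w0r)) (ccont_id z).
  by under eq_fun do rewrite subr0.
- move=> z zr; rewrite nmM zr ler_wpM2r ?(ltW r0)//.
  by rewrite nmM nmV nmX zr ler_wpM2r ?invr_ge0 ?exprn_ge0 ?(ltW r0)// hM.
Qed.

(** The Taylor polynomials are integrated term by term. Geometric majorants make the result converge
    locally uniformly, and [hol_limit] identifies its derivative with the sum of the Taylor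
    series. *)
Lemma taylor_primitive : exists2 L, L 0 = 0 & forall z, nm z < r -> cdiff L z (h z).
Proof.
pose F K w : C := \sum_(k < K) tcoef k / k.+1%:R * w ^+ k.+1.
pose b w K := 2 * M * nm w / (1 - nm w / r) * (nm w / r) ^+ K.
have dF K w : cdiff (F K) w (\sum_(k < K) tcoef k * w ^+ k).
  rewrite /F.
  rewrite -(big_mkord xpredT (fun k => tcoef k * w ^+ k)).
  have -> : (fun w : C => \sum_(k < K) tcoef k / k.+1%:R * w ^+ k.+1) =
    (fun w => \sum_(0 <= k < K) tcoef k / k.+1%:R * w ^+ k.+1).
    by apply/funext => v; rewrite big_mkord.
  apply: cdiff_sum => k.
  have := cdiffZ (tcoef k / k.+1%:R) (cdiffX k.+1 w); congr cdiff.
  by rewrite /= mulrA divfK// pnatr_eq0.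
have FS w K N : nm w < r -> (K <= N)%N -> nm (F N w - F K w) <= b w K.
  move=> wr KN.
  have q0 : 0 <= nm w / r by rewrite divr_ge0 ?nm_ge0 ?(ltW r0).
  have q1 : nm w / r < 1 by rewrite ltr_pdivrMr// mul1r.
  rewrite /F -!(big_mkord xpredT (fun k => tcoef k / k.+1%:R * w ^+ k.+1)).
  rewrite (big_cat_nat (leq0n K) KN) /= addrAC subrr add0r.
  apply: le_trans (nm_sum _ _ _) _.
  apply: (@le_trans _ _ (\sum_(K <= k < N) 2 * M * nm w * (nm w / r) ^+ k)).
    apply: ler_sum => k _; rewrite (nmM (tcoef k / _)) (nmM (tcoef k)) nmV nm_nat nmX exprS.
    have -> : 2 * M * nm w * (nm w / r) ^+ k = 2 * (M / r ^+ k) * 1 * (nm w * nm w ^+ k).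
      by rewrite expr_div_n; ring.
    rewrite ler_wpM2r ?mulr_ge0 ?exprn_ge0 ?nm_ge0//.
    apply: ler_pM; rewrite ?nm_ge0 ?invr_ge0 ?ler0n ?nm_tcoef//.
    by rewrite invf_le1 ?ler1n ?ltr0n.
  have -> : b w K = 2 * M * nm w * ((nm w / r) ^+ K / (1 - nm w / r)) by rewrite /b; ring.
  by rewrite -mulr_sumr ler_wpM2l ?mulr_ge0 ?nm_ge0//; exact: geometric_tail.
have lim w : exists l, nm w < r -> forall K, nm (l - F K w) <= 2 * b w K.
  have [wr|] := boolP (nm w < r); last by exists 0.
  by have [l hl] := complex_limit (fun K N => FS w K N wr); exists l.
pose L w := xget 0 [set l | nm w < r -> forall K, nm (l - F K w) <= 2 * b w K].
have hL w : nm w < r -> forall K, nm (L w - F K w) <= 2 * b w K.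
  by have [l hl] := lim w; rewrite /L; case: xgetP => [y _ //|/(_ l)].
have bs w s K : nm w <= s -> s < r -> b w K <= 2 * M * s / (1 - s / r) * (s / r) ^+ K.
  move=> ws sr; have s0 := le_trans (nm_ge0 w) ws; have w0 := nm_ge0 w.
  have q1 : s / r < 1 by rewrite ltr_pdivrMr// mul1r.
  have qq : nm w / r <= s / r by rewrite ler_wpM2r// invr_ge0 ltW.
  have q0 : 0 <= nm w / r by rewrite divr_ge0// ltW.
  have qs0 : 0 <= s / r by rewrite divr_ge0// ltW.
  apply: ler_pM; rewrite ?exprn_ge0//.
  - by rewrite divr_ge0 ?mulr_ge0// subr_ge0 ltW// (le_lt_trans qq).
  - apply: ler_pM; rewrite ?mulr_ge0 ?invr_ge0//.
      by rewrite subr_ge0 ltW// (le_lt_trans qq).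
      by rewrite ler_wpM2l// mulr_ge0.
    rewrite lef_pV2 ?posrE ?subr_gt0//; last exact: le_lt_trans qq q1.
    by rewrite lerB.
  - by rewrite lerXn2r ?nnegrE.
have [hol_L dL] : hol L r /\ forall w, nm w < r -> forall e, 0 < e ->
    exists N0, forall N, (N0 <= N)%N -> nm (cder (F N) w - cder L w) <= e.
  apply: hol_limit => [N w _|s sr e e0]; first by eexists; exact: dF.
  have [s0|s0] := leP 0 s; last first.
    by exists 0%N => N _ z zs; have := nm_ge0 z; lra.
  have q1 : s / r < 1 by rewrite ltr_pdivrMr// mul1r.
  have qs0 : 0 <= s / r by rewrite divr_ge0// ltW.
  have [N0 hN] := geometric_small (2 * (2 * M * s / (1 - s / r))) qs0 q1 e0.
  exists N0 => N NN z zs; rewrite nmB; apply: le_trans (hL z (le_lt_trans zs sr) N) _.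
  by apply: le_trans (hN N NN); rewrite -[leRHS]mulrA ler_pM2l// bs.
exists L.
  apply/eqP; rewrite -nm_eq0 eq_le nm_ge0 andbT.
  have := hL 0 w0r 0%N; rewrite /F big_ord0 subr0 /b nm0.
  by rewrite mulr0 !mul0r mulr0.
move=> z zr; rewrite (_ : h z = cder L z); first exact: hol_cdiff hol_L zr.
apply/eqP; rewrite -subr_eq0 -nm_eq0 eq_le nm_ge0 andbT.
apply/ler_addgt0Pl => e e0; rewrite addr0.
have e2 : 0 < e / 2 by rewrite divr_gt0.
have [N1 h1] := dL z zr _ e2.
have q0 : 0 <= nm z / r by rewrite divr_ge0 ?nm_ge0 ?(ltW r0).
have q1 : nm z / r < 1 by rewrite ltr_pdivrMr// mul1r.
have [N2 h2] := geometric_small (2 * M * r / (r - nm z)) q0 q1 e2.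
have := h1 _ (leq_maxl N1 N2); have := h2 _ (leq_maxr N1 N2).
set N := maxn N1 N2 => k2.
rewrite (cdiff_cder (dF N z)) => k1.
have := le_trans (nm_taylor_rem N zr) k2.
by move=> k3; apply: le_trans (nm_triB _ _ (\sum_(k < N) tcoef k * z ^+ k)) _; lra.
Qed.

End Taylor.

Lemma hol_primitive h rr r : hol h rr -> 0 < r -> r < rr ->
  exists2 L, L 0 = 0 & forall z, nm z < r -> cdiff L z (h z).
Proof.
move=> hh r0 rrr; have [M M0 hM] := hol_bounded hh rrr.
apply: (@taylor_primitive h rr r M) => // z zr; apply: hM; rewrite zr//.
Qed.

(** [L] is a primitive of the logarithmic derivative, and g exp(-L) has derivative 0. *)
Lemma hol_log g rr r : hol g rr -> (forall z, nm z < rr -> g z != 0) -> 0 < r -> r < rr ->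
  exists L, [/\ L 0 = 0, hol L r & forall z, nm z < r -> g z = g 0 * cexp (L z)].
Proof.
move=> hg g0 r0 rrr.
have hh : hol (fun z => cder g z * (g z)^-1) rr by apply: holM; [exact: hol_cder|exact: holV].
have [L L0 dL] := hol_primitive hh r0 rrr; exists L; split => //.
  by move=> z zr; eexists; exact: dL.
move=> z zr.
pose G z := g z * cexp (- L z).
have dG w : nm w < r -> cdiff G w 0.
  move=> wr; have wrr := lt_trans wr rrr.
  have := cdiffM (hol_cdiff hg wrr) (cdiff_comp (cdiffN (dL w wr)) (cdiff_cexp (- L w))).
  congr cdiff; have := g0 w wrr; have := cexp_neq0 (- L w).
  by move=> e0 n0; field.
have hG : hol G r by move=> w wr; exists 0; exact: dG.
have := hol_const hG (fun w wr => cdiff_cder (dG w wr)) zr.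
rewrite /G L0 oppr0 cexp0 mulr1 => <-.
by rewrite -mulrA -cexpD addNr cexp0 mulr1.
Qed.

End Primitives.

(** * Averages over roots of unity *)

Section RootsOfUnity.
Variable R : realType.
Local Notation C := (R[i]).
Local Notation nm := (@Normc.normc R).
Local Notation Re := (@complex.Re R).
Implicit Types (f g : C -> C) (r s t e M rr : R) (z w u : C) (n : nat).

Lemma prim_of n w : (0 < n)%N -> w ^+ n = 1 ->
  (forall i, (0 < i)%N -> (i < n)%N -> w ^+ i != 1) -> n.-primitive_root w.
Proof.
move=> n0 wn h; have [m pm mn] := prim_order_exists n0 wn.
have m0 := prim_order_gt0 pm.
have : (m <= n)%N by exact: dvdn_leq.
rewrite leq_eqVlt => /predU1P[<-//|mn'].
by have := h m m0 mn'; rewrite (prim_expr_order pm) eqxx.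
Qed.

Definition omega n : C := expi (2 * pi / n%:R).

Lemma nm_omega n : nm (omega n) = 1.
Proof. exact: nm_expi. Qed.

Lemma cos_lt1 (t : R) : 0 < t < 2 * pi -> cos t < 1.
Proof.
move=> /andP[t0 t1]; have st : 0 < sin (t / 2).
  by apply: sin_gt0_pi; apply/andP; split; lra.
have -> : t = (t / 2) *+ 2 by rewrite mulr2n; field.
rewrite cos_mulr2n; have := cos2Dsin2 (t / 2).
have : 0 < sin (t / 2) ^+ 2 by rewrite exprn_gt0.
by rewrite mulr2n; lra.
Qed.

Lemma omega_prim n : (0 < n)%N -> n.-primitive_root (omega n).
Proof.
move=> n0; have n0' : (0 : R) < n%:R by rewrite ltr0n.
apply: prim_of => // [|i i0 iN].
  rewrite expiX (_ : _ * _ = 2 * pi) ?expi2pi//.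
  by field; rewrite lt0r_neq0.
rewrite expiX; apply/eqP => /(congr1 Re) /=; apply/eqP; rewrite lt_eqF//.
have pi0 := pi_gt0 R; have i0' : (0 : R) < i%:R by rewrite ltr0n.
have iN' : (i%:R : R) < n%:R by rewrite ltr_nat.
apply: cos_lt1; apply/andP; split; first by rewrite !mulr_gt0 ?invr_gt0.
rewrite mulrA ltr_pdivrMr// mulrC ltr_pM2l//; lra.
Qed.

Lemma prim_inv n w : n.-primitive_root w -> n.-primitive_root w^-1.
Proof.
move=> pw; have n0 := prim_order_gt0 pw; apply: prim_of => // [|i i0 iN].
  by rewrite exprVn (prim_expr_order pw) invr1.
rewrite exprVn invr_eq1 -(prim_order_dvd pw); apply/negP => /dvdn_leq.
by rewrite i0 leqNgt iN => /(_ isT).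
Qed.

Lemma prim_sum n w i : n.-primitive_root w -> ~~ (n %| i)%N ->
  \sum_(j < n) (w ^+ j) ^+ i = 0.
Proof.
move=> pw ni; have wi : w ^+ i != 1 by rewrite -(prim_order_dvd pw).
have := subrX1 (w ^+ i) n.
rewrite -exprM mulnC exprM (prim_expr_order pw) expr1n subrr => /esym/eqP.
rewrite mulf_eq0 subr_eq0 (negbTE wi) /= => /eqP H; rewrite -[RHS]H.
by apply: eq_bigr => j _; rewrite -!exprM mulnC.
Qed.

Lemma prim_prod n w u : n.-primitive_root w ->
  \prod_(j < n) (1 - w ^+ j * u) = 1 - u ^+ n.
Proof.
move=> pw; have n0 := prim_order_gt0 pw.
have [->|u0] := eqVneq u 0.
  rewrite expr0n gtn_eqF// subr0 big1// => j _; by rewrite mulr0 subr0.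
have := congr1 (fun p => p.[u^-1]%R) (factor_Xn_sub_1 pw).
rewrite big_mkord horner_prod -polyC1 hornerD hornerN hornerXn hornerC => /(congr1 (fun x => u ^+ n * x)).
rewrite mulrBr mulr1 exprVn mulfV ?expf_neq0// => <-.
have -> : u ^+ n = \prod_(j < n) u by rewrite prodr_const card_ord.
rewrite -big_split /=; apply: eq_bigr => j _.
by rewrite hornerXsubC mulrBr mulfV// mulrC.
Qed.

(** Each summand is the geometric sum of (w^j u)^i, i < n, divided by 1 - u^n, and summation over j
    kills every i except 0. *)
Lemma prim_sum_kernel n w u : n.-primitive_root w -> u ^+ n != 1 ->
  \sum_(j < n) (1 - w ^+ j * u)^-1 = n%:R / (1 - u ^+ n).
Proof.
move=> pw un; have n0 := prim_order_gt0 pw.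
have un' : 1 - u ^+ n != 0 by rewrite subr_eq0 eq_sym.
have E (j : 'I_n) : (1 - w ^+ j * u)^-1 = (\sum_(i < n) (w ^+ j * u) ^+ i) / (1 - u ^+ n).
  have := subrX1 (w ^+ j * u) n.
  rewrite exprMn -exprM mulnC exprM (prim_expr_order pw) expr1n mul1r => H.
  have {}H : 1 - u ^+ n = (1 - w ^+ j * u) * \sum_(i < n) (w ^+ j * u) ^+ i.
    by rewrite -opprB H -mulNr opprB.
  have nz := un'; rewrite H mulf_eq0 negb_or in nz; have /andP[n1 n2] := nz.
  by rewrite H; field; rewrite n1 n2.
under eq_bigr do rewrite E.
rewrite -mulr_suml; congr (_ / _).
under eq_bigr do under eq_bigr do rewrite exprMn.
rewrite exchange_big /= (bigD1 (Ordinal n0)) //= [X in _ + X]big1 ?addr0.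
  by rewrite (eq_bigr (fun=> 1)) ?sumr_const ?card_ord// => j _; rewrite ?expr0 mulr1.
move=> i i0; rewrite -mulr_suml prim_sum ?mul0r//; apply/negP => /dvdn_leq.
have i0' : (0 < i)%N by rewrite lt0n; apply: contraNneq i0 => h; apply/eqP/val_inj.
by rewrite i0' leqNgt ltn_ord => /(_ isT).
Qed.

Lemma nm_prim n w : n.-primitive_root w -> nm w = 1.
Proof.
move=> pw; have n0 := prim_order_gt0 pw.
have := congr1 nm (prim_expr_order pw); rewrite nmX nm1 => /eqP.
by rewrite pexpr_eq1 ?nm_ge0// => /eqP.
Qed.

(* Averaging the Cauchy kernel over the rotations by n-th roots of unity leaves
   only the powers divisible by n, so the deviation is of order |z|^n. *)
Lemma symmetric_mean n w f rr r z M : n.-primitive_root w ->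
  hol f rr -> (forall v, nm v < rr -> f (w * v) = f v) ->
  nm z < r -> r < rr -> 0 <= M -> (forall v, nm v = r -> nm (f v) <= M) ->
  nm (f z - f 0) <= 2 * M * (nm z / r) ^+ n / (1 - (nm z / r) ^+ n).
Proof.
move=> pw hf sf zr rrr M0 hM; have w1 := nm_prim pw.
have r0 : 0 < r := le_lt_trans (nm_ge0 z) zr.
have n0 := prim_order_gt0 pw.
have n0' : (n%:R : C) != 0 by rewrite pnatr_eq0 -lt0n.
have wj (j : nat) : nm (w ^+ j) = 1 by rewrite nmX w1 expr1n.
have sfj j v : nm v < rr -> f (w ^+ j * v) = f v.
  move=> vr; elim: j => [|j IH]; first by rewrite expr0 mul1r.
  by rewrite exprS -mulrA sf// nmM wj mul1r.
have zj (j : nat) : nm (w ^+ j * z) < r by rewrite nmM wj mul1r.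
have cf v : nm v = r -> ccont f v by move=> vr; apply: (hol_cont hf); rewrite vr.
have ck v y : nm v < r -> nm y = r -> ccont (fun y => f y * (y / (y - v))) y.
  move=> vr yr.
  exact: (ccontM (cf y yr) (ccontM (ccont_id y) (ccont_kernel yr vr))).
have cck v : nm v < r -> cont_circ (fun y => f y * (y / (y - v))) r.
  by move=> vr; apply: cont_circ_on => [|y yr]; [exact: ltW|exact: ck].
pose G y := f y * ((y ^+ n - z ^+ n)^-1 * z ^+ n).
have q0 : 0 <= nm z / r by rewrite divr_ge0 ?nm_ge0 ?(ltW r0).
have q1 : nm z / r < 1 by rewrite ltr_pdivrMr// mul1r.
have zrn : nm z ^+ n < r ^+ n by rewrite ltrXn2r ?gtn_eqF// ?nm_ge0// ltW.
have den y : nm y = r -> y ^+ n - z ^+ n != 0.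
  move=> yr; rewrite subr_eq0; apply/eqP => /(congr1 nm); rewrite !nmX yr => h.
  by move: zrn; rewrite h ltxx.
have sumc : forall (m : nat) (F : nat -> C -> C), (forall j, cont_circ (F j) r) ->
    cont_circ (fun y => \sum_(0 <= j < m) F j y) r /\
    cmean (fun y => \sum_(0 <= j < m) F j y) r = \sum_(0 <= j < m) cmean (F j) r.
  move=> m F cF; elim: m => [|m [IH1 IH2]].
    have -> : (fun y => \sum_(0 <= j < 0) F j y) = fun=> 0 by apply/funext => y; rewrite big_nil.
    by rewrite big_nil cmean_cst; split => // t _; exact: ccont_cst.
  have -> : (fun y => \sum_(0 <= j < m.+1) F j y) = fun y => \sum_(0 <= j < m) F j y + F m y.
    by apply/funext => y; rewrite big_nat_recr.
  rewrite big_nat_recr //= -IH2 -cmeanD//; split => // t ht.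
  exact: (ccontD (IH1 t ht) (cF m t ht)).
have [cS eS] := sumc n (fun j y => f y * (y / (y - w ^+ j * z))) (fun j => cck _ (zj j)).
(* By [prim_sum_kernel] with u = z / y the averaged kernel is y^n / (y^n - z^n); subtracting the
   kernel 1 of f(0) leaves z^n / (y^n - z^n). *)
have key : f z - f 0 = cmean G r.
  have c0 : nm (0 : C) < r by rewrite nm0.
  have E1 : n%:R * f z = cmean (fun y => \sum_(0 <= j < n) f y * (y / (y - w ^+ j * z))) r.
    rewrite eS (eq_bigr (fun=> f z)) ?big_mkord ?sumr_const ?card_ord ?mulr_natl//.
    move=> j _; rewrite (cauchy_formula hf (zj j) rrr) sfj//.
    exact: lt_trans zr rrr.
  have -> : f z = n%:R^-1 * cmean (fun y => \sum_(0 <= j < n) f y * (y / (y - w ^+ j * z))) r.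
    by rewrite -E1 mulKf.
  rewrite -(cauchy_formula hf c0 rrr) -cmeanZ// -cmeanB; last 2 first.
  - by move=> t ht; exact: (ccontM (ccont_cst n%:R^-1 _) (cS t ht)).
  - exact: cck.
  apply: eq_cmean => [|y yr]; first exact: ltW.
  have y0 : y != 0 by rewrite -nm_gt0 yr.
  have dy := den y yr.
  rewrite big_mkord -mulr_sumr subr0 divff// mulr1.
  have -> : \sum_(j < n) (y / (y - w ^+ j * z)) = \sum_(j < n) (1 - w ^+ j * (z / y))^-1.
    apply: eq_bigr => j _.
    have dj : y - w ^+ j * z != 0 := circ_subl_neq0 yr (zj j).
    by field; rewrite y0 dj.
  rewrite prim_sum_kernel//; last first.
    rewrite expr_div_n; apply/eqP => h; move: dy; rewrite subr_eq0 => /eqP; apply.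
    by rewrite -[LHS]mul1r -h divfK// expf_neq0.
  rewrite /G expr_div_n; field.
  by rewrite n0' dy expf_neq0.
rewrite key.
have -> : 2 * M * (nm z / r) ^+ n / (1 - (nm z / r) ^+ n) =
   2 * (M * ((r ^+ n - nm z ^+ n)^-1 * nm z ^+ n)).
  have h1 : r ^+ n != 0 by rewrite expf_neq0// lt0r_neq0.
  have h2 : r ^+ n - nm z ^+ n != 0 by rewrite lt0r_neq0// subr_gt0.
  by rewrite expr_div_n; field; rewrite h1 h2.
apply: nm_cmean; last 1 first.
- move=> y yr; rewrite nmM; apply: ler_pM; rewrite ?nm_ge0 ?hM//.
  rewrite nmM nmX ler_wpM2r ?exprn_ge0 ?nm_ge0// nmV lef_pV2 ?posrE ?nm_gt0 ?den ?subr_gt0//.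
  by have := nm_subl (y ^+ n) (z ^+ n); rewrite !nmX yr.
- apply: cont_circ_on => [|y yr]; first exact: ltW.
  apply: (ccontM (cf y yr)); apply: (ccontM _ (ccont_cst (z ^+ n) y)).
  apply: ccont_inv; first exact: den.
  exact: (ccontB (ccvgX n (ccont_id y)) (ccont_cst (z ^+ n) y)).
- exact: ltW.
Qed.

Definition ent f := forall z, exists D, cdiff f z D.

Lemma ent_hol f : ent f <-> forall rr, hol f rr.
Proof.
split=> [h rr z _|h z]; first exact: h.
by apply: (h (nm z + 1)); rewrite ltrDl.
Qed.

Lemma Re_sum (I : Type) (s : seq I) (F : I -> C) :
  Re (\sum_(i <- s) F i) = \sum_(i <- s) Re (F i).
Proof.
elim: s => [|i s IH]; first by rewrite !big_nil.
by rewrite !big_cons ReD IH.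
Qed.

Lemma ln_prod (I : Type) (s : seq I) (F : I -> R) : (forall i, 0 < F i) ->
  ln (\prod_(i <- s) F i) = \sum_(i <- s) ln (F i).
Proof.
move=> F0; elim: s => [|i s IH]; first by rewrite !big_nil ln1.
by rewrite !big_cons lnM ?posrE ?IH// prodr_gt0.
Qed.

Lemma ln_1Bx_ge (x : R) : 0 <= x -> x <= 2^-1 -> - (2 * x) <= ln (1 - x).
Proof.
move=> x0 x1; have h : 0 < 1 - x by lra.
rewrite -[leRHS]opprK -lnV ?posrE// lerN2.
have -> : (1 - x)^-1 = 1 + x / (1 - x) by field; lra.
apply: le_trans (le_ln1Dx _) _.
  by apply: (@lt_le_trans _ _ 0); rewrite ?ltrN10// divr_ge0// ltW.
by rewrite ler_pdivrMr//; nra.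
Qed.

(* A zero-free g that is bounded by exp A on a disc cannot be small on average
   over the n rotations: take a B-th root of its symmetrization. *)
Lemma zero_free_lower n w g T A B z : n.-primitive_root w -> ent g -> 0 < T ->
  (forall v, nm v < T -> g v != 0) ->
  (forall v, nm v < T -> nm (g v) <= expR A) ->
  1 <= B -> n%:R * (A - ln (nm (g 0))) <= B ->
  (2 * nm z / T) ^+ n <= 32^-1 ->
  nm (g 0) ^+ n * expR (- (32 * B * (2 * nm z / T) ^+ n)) <=
    \prod_(j < n) nm (g (w ^+ j * z)).
Proof.
move=> pw /ent_hol hg T0 g0 gA B1 hB hq; have w1 := nm_prim pw.
have n0 := prim_order_gt0 pw.
have wj (j : nat) : nm (w ^+ j) = 1 by rewrite nmX w1 expr1n.
set q := (2 * nm z / T) ^+ n in hq *.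
have q0 : 0 <= q by rewrite exprn_ge0// divr_ge0 ?mulr_ge0 ?nm_ge0// ltW.
pose r := T / 2.
have r0 : 0 < r by rewrite divr_gt0.
have zr : nm z < r.
  rewrite ltNge; apply/negP => h.
  have : 1 <= q by rewrite exprn_ege1// ler_pdivlMr// mul1r; move: h; rewrite /r; lra.
  lra.
have [rT1 rT2] : r < 3 / 4 * T /\ 3 / 4 * T < T by rewrite /r; lra.
have [L [L0 hL gL]] := hol_log (hg T) g0 (lt_trans r0 rT1) rT2.
have B0 : 0 < B by lra.
pose S v := \sum_(j < n) L (w ^+ j * v).
pose psi v := cexp ((B^-1)%:C * S v).
have hS : hol S (3 / 4 * T) by apply: hol_sum => j; apply: hol_scale.
have hpsi : hol psi (3 / 4 * T) by apply: hol_cexp; apply: holM => //; exact: hol_cst.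
have g00 : 0 < nm (g 0) by rewrite nm_gt0 g0// nm0.
have lng v : nm v < 3 / 4 * T -> ln (nm (g v)) = ln (nm (g 0)) + Re (L v).
  move=> vT; rewrite gL// nmM nm_cexp lnM ?posrE ?expR_gt0// expRK//.
have nS v : nm v < 3 / 4 * T -> Re (S v) = \sum_(j < n) ln (nm (g (w ^+ j * v))) - n%:R * ln (nm (g 0)).
  move=> vT; rewrite Re_sum.
  have -> : \sum_(j < n) ln (nm (g (w ^+ j * v))) =
     \sum_(j < n) (ln (nm (g 0)) + Re (L (w ^+ j * v))).
    by apply: eq_bigr => j _; rewrite lng// nmM wj mul1r.
  by rewrite big_split /= sumr_const card_ord mulr_natl addrC addrK.
have npsi v : nm (psi v) = expR (B^-1 * Re (S v)).
  by rewrite nm_cexp ReM /= mul0r subr0.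
have psi0 : psi 0 = 1.
  by rewrite /psi /S big1 ?mulr0 ?cexp0// => j _; rewrite mulr0.
(* [B] is chosen so that this root is bounded by e whatever the size of [A]; in the end [A] enters
   only through the factor [B] in front of (2 |z| / T)^n. *)
have psiM v : nm v = r -> nm (psi v) <= expR 1.
  move=> vr; rewrite npsi ler_expR mulrC ler_pdivrMr// mul1r nS ?vr//.
  apply: le_trans hB; rewrite mulrBr lerB//.
  have -> : n%:R * A = \sum_(j < n) A by rewrite sumr_const card_ord mulr_natl.
  apply: ler_sum => j _.
  have jT : nm (w ^+ j * v) < T by rewrite nmM wj mul1r vr; lra.
  by rewrite -[leRHS]expRK ler_ln ?posrE ?expR_gt0 ?nm_gt0 ?g0// gA.
have spsi v : nm v < 3 / 4 * T -> psi (w * v) = psi v.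
  move=> vT; congr (cexp (_ * _)); rewrite /S.
  case: n n0 pw {S psi hS hpsi nS npsi psi0 psiM hB hq q q0 zr} => // m _ pw.
  rewrite big_ord_recr big_ord_recl /= addrC expr0 mul1r; congr (_ + _).
    by rewrite mulrA -exprSr (prim_expr_order pw) mul1r.
  by apply: eq_bigr => j _; rewrite mulrA -exprSr.
have e4 : expR 1 <= 4 :> R.
  have h2 : expR (2^-1) <= 2 :> R.
    rewrite -[2^-1]opprK expRN invf_ple ?posrE ?expR_gt0//.
    by apply: le_trans (expR_ge1Dx _); lra.
  have -> : (1 : R) = 2^-1 + 2^-1 by field.
  rewrite expRD; apply: (@le_trans _ _ (2 * 2)); last by lra.
  by rewrite ler_pM ?expR_ge0.
have := symmetric_mean pw hpsi spsi zr rT1 (expR_ge0 1) psiM.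
have -> : nm z / r = 2 * nm z / T by rewrite /r; field; rewrite lt0r_neq0.
rewrite psi0 -/q => H.
(* With e <= 4 and q <= 1/32 the bound 2 e q / (1 - q) is at most 16 q <= 1/2, and ln(1 - x) >= -2 x
   on that range produces the 32 of the statement. *)
have {}H : nm (psi z - 1) <= 16 * q.
  apply: le_trans H _; rewrite ler_pdivrMr; last by lra.
  have : expR 1 * q <= 4 * q by rewrite ler_wpM2r.
  nra.
have ps : 1 - 16 * q <= nm (psi z).
  have := nm_subl 1 (psi z); rewrite nm1 nmB; lra.
have zT : nm z < 3 / 4 * T by lra.
have lnpsi : - (32 * q) <= ln (nm (psi z)).
  have -> : 32 * q = 2 * (16 * q) by ring.
  apply: le_trans (@ln_1Bx_ge (16 * q) _ _) _; [lra|lra|].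
  by rewrite ler_ln ?posrE//; [lra|rewrite npsi expR_gt0].
have H2 : - (32 * q) * B <= Re (S z).
  by rewrite -ler_pdivlMr// [Re _ / _]mulrC; move: lnpsi; rewrite npsi expRK.
rewrite nS// in H2.
have P0 : 0 < \prod_(j < n) nm (g (w ^+ j * z)).
  by apply: prodr_gt0 => j _; rewrite nm_gt0 g0// nmM wj mul1r; lra.
rewrite -[leRHS]lnK ?posrE// -[nm (g 0) ^+ n]lnK ?posrE ?exprn_gt0//.
rewrite -expRD ler_expR lnXn//.
have -> : ln (\prod_(j < n) nm (g (w ^+ j * z))) = \sum_(j < n) ln (nm (g (w ^+ j * z))).
  by rewrite ln_prod// => j; rewrite nm_gt0 g0// nmM wj mul1r; lra.
rewrite -mulr_natl; lra.
Qed.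

End RootsOfUnity.

(** * Zeros of entire functions *)

Section Zeros.
Variable R : realType.
Local Notation C := (R[i]).
Local Notation nm := (@Normc.normc R).
Implicit Types (f g : C -> C) (r s t e M rr : R) (z w u a : C) (n m j : nat).

Lemma ent_cder f : ent f -> ent (cder f).
Proof. by move=> /ent_hol hf; apply/ent_hol => rr; exact: hol_cder. Qed.

Lemma entM f g : ent f -> ent g -> ent (fun z => f z * g z).
Proof. by move=> /ent_hol hf /ent_hol hg; apply/ent_hol => rr; exact: holM. Qed.

Lemma entD f g : ent f -> ent g -> ent (fun z => f z + g z).
Proof. by move=> /ent_hol hf /ent_hol hg; apply/ent_hol => rr; exact: holD. Qed.

Lemma ent_cst (c : C) : ent (fun=> c).
Proof. by move=> z; exists 0; exact: cdiff_cst. Qed.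

Lemma ent_cdiff f z : ent f -> cdiff f z (cder f z).
Proof. by move=> hf; have [D hD] := hf z; rewrite (cdiff_cder hD). Qed.

Lemma ent_cont f z : ent f -> ccont f z.
Proof. by move=> hf; exact: cdiff_cont (ent_cdiff z hf). Qed.

Lemma cdiff_subX a m w : cdiff (fun w => (w - a) ^+ m) w (m%:R * (w - a) ^+ m.-1).
Proof.
have := cdiff_comp (cdiffB (cdiff_id w) (cdiff_cst a w)) (cdiffX m (w - a)).
by rewrite subr0 mulr1.
Qed.

Lemma ent_subX a m : ent (fun w => (w - a) ^+ m).
Proof. by move=> w; eexists; exact: cdiff_subX. Qed.

Lemma ent_comp f g : ent f -> ent g -> ent (fun z => f (g z)).
Proof.
move=> hf hg z; eexists; exact: (cdiff_comp (ent_cdiff z hg) (ent_cdiff (g z) hf)).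
Qed.

Lemma eq_limit f g a : ccont f a -> ccont g a -> (forall z, z != a -> f z = g z) -> f a = g a.
Proof.
move=> /ccontP cf /ccontP cg h.
apply/eqP; rewrite -subr_eq0 -nm_eq0 eq_le nm_ge0 andbT.
apply/ler_addgt0Pl => e e0; rewrite addr0.
have e2 : 0 < e / 2 by rewrite divr_gt0.
have [d1 d10 h1] := cf _ e2; have [d2 d20 h2] := cg _ e2.
pose t := Num.min d1 d2 / 2.
have m0 : 0 < Num.min d1 d2 by rewrite lt_min d10.
have t0 : 0 < t by rewrite divr_gt0.
have td : t < Num.min d1 d2 by rewrite ltr_pdivrMr// ltr_pMr// ltr1n.
have E : a + t%:C - a = t%:C by rewrite addrC addKr.
have za : a + t%:C != a by rewrite -subr_eq0 E -nm_gt0 nm_real normr_gt0 gt_eqF.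
have := h1 (a + t%:C); have := h2 (a + t%:C); rewrite E nm_real gtr0_norm//.
have [t1 t2] : t < d1 /\ t < d2.
  by split; apply: lt_le_trans td _; rewrite ge_min lexx ?orbT.
move=> /(_ t2) k2 /(_ t1) k1; rewrite h// nmB in k1.
by apply: le_trans (nm_triB _ _ (g (a + t%:C))) _; lra.
Qed.

Lemma ent_div f a : ent f -> exists2 g, ent g & forall z, f z = f a + (z - a) * g z.
Proof.
move=> hf.
pose F z := f (z + a).
have hF : ent F by apply: ent_comp => //; apply: entD; [move=> z; exists 1; exact: cdiff_id|exact: ent_cst].
pose G z := if z == 0 then cder F 0 else (F z - F 0) / z.
have hG rr : 0 < rr -> exists2 k, hol k rr & forall z, nm z < rr -> k z = G z.
  move=> rr0; have [k hk kE] := hol_divX rr0 (proj1 (ent_hol F) hF rr).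
  exists k => // z zr; rewrite /G; case: eqVneq => [->|z0]; last first.
    by rewrite kE// addrC addKr; field.
  have n0 : nm (0 : C) < rr by rewrite nm0.
  have := cdiffD (cdiff_cst (F 0) 0) (cdiffM (cdiff_id 0) (hol_cdiff hk n0)).
  rewrite add0r mul1r mul0r addr0 => h.
  apply/esym/cdiff_cder; apply: cdiff_eq_near h.
  by apply: filterS (near_disc n0) => v vr; rewrite -(kE v vr).
have eG : ent G.
  move=> z; have rr0 : 0 < nm z + 1 by have := nm_ge0 z; lra.
  have [k hk kE] := hG _ rr0; have zr : nm z < nm z + 1 by rewrite ltrDl.
  have [d hd] := hk z zr; exists d; apply: cdiff_eq_near hd.
  exact: filterS (near_disc zr).
exists (fun z => G (z - a)).
  by apply: ent_comp => //; apply: entD; [move=> z; exists 1; exact: cdiff_id|exact: ent_cst].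
move=> z; rewrite /G; case: eqVneq => [/eqP|z0].
  by rewrite subr_eq0 => /eqP ->; rewrite subrr mul0r addr0.
by rewrite /F subrK add0r; field.
Qed.

Lemma cderivS n f : cderiv n.+1 f = cder (cderiv n f).
Proof. by []. Qed.

(** It connects orders defined by iterated derivatives with factorizations: the falling factorial is
    nonzero for j <= m, so the m-th derivative vanishes at [a] exactly when g does. *)
Lemma cderiv_subX f g a m : ent g -> (forall w, f w = (w - a) ^+ m * g w) ->
  forall j, (j <= m)%N -> exists g', [/\ ent g',
    forall w, cderiv j f w = (w - a) ^+ (m - j) * g' w & g' a = (m ^_ j)%:R * g a].
Proof.
move=> hg fE; elim=> [|j IH] jm.
  by exists g; split => // [w|]; rewrite ?subn0 ?ffactn0 ?mul1r//; exact: fE.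
have [g' [eg' dE g'a]] := IH (ltnW jm).
exists (fun w => (m - j)%:R * g' w + (w - a) * cder g' w); split.
- apply: entD; first by apply: entM => //; exact: ent_cst.
  apply: entM; last exact: ent_cder.
  by have := ent_subX a 1; under eq_fun do rewrite expr1.
- move=> w; rewrite cderivS; apply: cdiff_cder.
  have := cdiffM (cdiff_subX a (m - j) w) (ent_cdiff w eg').
  have -> : (fun w => (w - a) ^+ (m - j) * g' w) = cderiv j f.
    by apply/funext => v; rewrite dE.
  congr cdiff; rewrite subnS; case: (m - j)%N (subn_gt0 j m) jm => [|k] /= h jm.
    by rewrite jm in h.
  by rewrite exprS; ring.
- by rewrite subrr mul0r addr0 g'a ffactnSr natrM; ring.
Qed.

Lemma subX_vanishes f g a m : ent g -> (forall w, f w = (w - a) ^+ m * g w) ->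
  vanishes_to_order f a m.
Proof.
move=> hg fE j jm; have [g' [_ -> _]] := cderiv_subX hg fE (ltnW jm).
by rewrite subrr expr0n subn_eq0 leqNgt jm /= mul0r.
Qed.

Lemma exact_orderE f a m : ent f -> exact_order f a m ->
  exists g, [/\ ent g, forall w, f w = (w - a) ^+ m * g w & g a != 0].
Proof.
move=> hf [van ex].
have P k : (k <= m)%N -> exists2 g, ent g & forall w, f w = (w - a) ^+ k * g w.
  elim: k => [|k IH] km; first by exists f => // w; rewrite expr0 mul1r.
  have [g hg fE] := IH (ltnW km).
  have ga0 : g a = 0.
    have := van k km; have [g' [_ -> g'a]] := cderiv_subX hg fE (leqnn k).
    rewrite subnn expr0 mul1r g'a ffactnn => /eqP; rewrite mulf_eq0 pnatr_eq0.
    by rewrite -[_ == _]negbK -lt0n fact_gt0 /= => /eqP.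
  have [g1 hg1 gE] := ent_div a hg.
  by exists g1 => // w; rewrite fE gE ga0 add0r exprS; ring.
have [g hg fE] := P m (leqnn m); exists g; split => //.
apply/eqP => ga0; apply: ex; have [g' [_ -> g'a]] := cderiv_subX hg fE (leqnn m).
by rewrite subnn expr0 mul1r g'a ga0 mulr0.
Qed.

Definition has_order f a m :=
  exists g, [/\ ent g, forall w, f w = (w - a) ^+ m * g w & g a != 0].

(** The zeros of the list, a multiset, are removed one at a time. The remaining order is recorded at
    every point, which later shows that the quotient has no zero in a disc whose zeros are all
    listed. *)
Lemma divide_zeros f (ord : C -> nat) (s : seq C) : ent f ->
  (forall z, has_order f z (ord z)) -> (forall z, (count_mem z s <= ord z)%N) ->
  exists g, [/\ ent g, forall w, f w = \prod_(a <- s) (w - a) * g w &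
    forall z, has_order g z (ord z - count_mem z s)].
Proof.
move=> hf ho; elim: s => [|a s IH] hs.
  exists f; split => // [w|z]; first by rewrite big_nil mul1r.
  by rewrite subn0.
have hs' z : (count_mem z s <= ord z)%N.
  by apply: leq_trans (hs z); rewrite /= leq_addl.
have [g [hg fE go]] := IH hs'.
have ka : (0 < ord a - count_mem a s)%N.
  by rewrite subn_gt0; have := hs a; rewrite /= eqxx.
have [ga [hga gaE ga0]] := go a.
have gz : g a = 0 by rewrite gaE subrr expr0n gtn_eqF// mul0r.
have [g1 hg1 gE] := ent_div a hg.
have gE' z : g z = (z - a) * g1 z by rewrite gE gz add0r.
exists g1; split => // [w|z].
  by rewrite fE gE' big_cons; ring.
have [->|za] := eqVneq z a.
  exists ga; split => // w; rewrite /= eqxx.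
  (* Cancelling v - a gives the factorization off [a] only; [eq_limit] extends it to [a] by
     continuity. *)
  have E v : v != a -> g1 v = (v - a) ^+ (ord a - (true + count_mem a s)) * ga v.
    move=> va; have va0 : v - a != 0 by rewrite subr_eq0.
    apply: (mulfI va0); rewrite -gE' gaE mulrA -exprS; congr (_ ^+ _ * _).
    by rewrite add1n -subSn ?subSS//; have := hs a; rewrite /= eqxx.
  have [->|wa] := eqVneq w a; last exact: E.
  apply: (@eq_limit g1 (fun v => (v - a) ^+ (ord a - (true + count_mem a s)) * ga v)) => //.
    exact: ent_cont.
  by apply: ent_cont; apply: entM => //; exact: ent_subX.
have [gz' [hgz gzE gz0]] := go z.
rewrite /= [a == z]eq_sym (negbTE za) add0n.
have za0 : a - z != 0 by rewrite subr_eq0 eq_sym.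
have gza : gz' a = 0.
  move: (gzE a); rewrite gz => /esym/eqP; rewrite mulf_eq0 expf_eq0 (negbTE za0) andbF /=.
  by move=> /eqP.
have [k hk kE] := ent_div a hgz.
have kE' v : gz' v = (v - a) * k v by rewrite kE gza add0r.
exists k; split => // [w|]; last first.
  by apply: contraNneq gz0 => k0; rewrite kE' k0 mulr0.
have E v : v != a -> g1 v = (v - z) ^+ (ord z - count_mem z s) * k v.
  move=> va; have va0 : v - a != 0 by rewrite subr_eq0.
  by apply: (mulfI va0); rewrite -gE' gzE kE'; ring.
have [->|wa] := eqVneq w a; last exact: E.
apply: (@eq_limit g1 (fun v => (v - z) ^+ (ord z - count_mem z s) * k v)) => //.
  exact: ent_cont.
by apply: ent_cont; apply: entM => //; exact: ent_subX.
Qed.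

(** It passes from the cardinality of a fibre, the multiplicity in the definitions, to a count in a
    finite list; the two agree once the fibre lies below N. *)
Lemma count_fiber (lam : nat -> C) N z m : ([set k | lam k = z] #= `I_m)%card ->
  (count_mem z [seq lam k | k <- iota 0 N] <= m)%N /\
  ((forall k, lam k = z -> (k < N)%N) -> count_mem z [seq lam k | k <- iota 0 N] = m).
Proof.
move=> /card_eqPle [c1 c2].
pose A := [seq k <- iota 0 N | lam k == z].
have cA : count_mem z [seq lam k | k <- iota 0 N] = size A.
  by rewrite count_map size_filter; apply: eq_count => k.
have uA : uniq A by rewrite filter_uniq ?iota_uniq.
pose S : {fset nat} := [fset x in A]%fset.
have cS : #|` S| = size A by rewrite card_fseq undup_id.
have SI : ([set` S] #= `I_(size A))%card by apply/card_eq_fsetP.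
rewrite cA; split.
  rewrite -card_le_II -(card_le_eql SI); apply: card_le_trans c1.
  by apply: subset_card_le => k /=; rewrite !inE mem_filter => /andP[/eqP].
move=> h; apply: anti_leq; rewrite -!card_le_II -(card_le_eql SI) -(card_le_eqr SI).
have -> : [set` S] = [set k | lam k = z].
  apply/seteqP; split => k /=; rewrite !inE mem_filter mem_iota /= add0n.
    by move=> /andP[/eqP].
  by move=> kz; rewrite kz eqxx h.
by apply/andP.
Qed.

End Zeros.

(** * Pointwise bounds from square integrability *)

Section PointwiseBound.
Variable R : realType.
Local Notation C := (R[i]).
Local Notation nm := (@Normc.normc R).
Local Notation Re := (@complex.Re R).
Local Notation Im := (@complex.Im R).
Implicit Types (f g : C -> C) (r s t e M rr x y a b : R) (z w u : C) (n m j : nat).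

Lemma pcont_nm (p : R -> C) t : pcont p t -> {for t, continuous (fun t => nm (p t))}.
Proof. by move=> h; apply: ccvg_nm. Qed.

Lemma nm_cint_int (p : R -> C) a b : a <= b -> pcont_on p a b ->
  nm (cint p a b) <= 2 * rint (fun t => nm (p t)) a b.
Proof.
move=> ab cp; apply: le_trans (nm_le _) _.
have cn t : a <= t <= b -> {for t, continuous (fun t => nm (p t))}.
  by move=> tab; apply: pcont_nm; exact: cp.
have B (g : R -> R) : (forall t, a <= t <= b -> {for t, continuous g}) ->
    (forall t, `|g t| <= nm (p t)) -> `|rint g a b| <= rint (fun t => nm (p t)) a b.
  move=> cg gp; rewrite ler_norml; apply/andP; split.
    rewrite -mulN1r -rintZ//; apply: le_rint => // [t tab|t _].
      by apply: cvgM; [exact: cvg_cst|exact: cn].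
    by have := gp t; rewrite ler_norml mulN1r => /andP[].
  by apply: le_rint => // t _; have := gp t; rewrite ler_norml => /andP[].
rewrite mulr2n mulrDl !mul1r; apply: lerD; apply: B.
- exact: pcont_Re.
- by move=> t; exact: Re_le_nm.
- exact: pcont_Im.
- by move=> t; exact: Im_le_nm.
Qed.

Lemma rint_ge (g : R -> R) a b M : a <= b ->
  (forall t, a <= t <= b -> {for t, continuous g}) ->
  (forall t, a <= t <= b -> M <= g t) -> M * (b - a) <= rint g a b.
Proof.
move=> ab cg gm; rewrite -rint_cst//; apply: le_rint => // t _; exact: cvg_cst.
Qed.

Lemma rint_widen (g : R -> R) a b a' b' : a' <= a -> a <= b -> b <= b' ->
  (forall t, {for t, continuous g}) -> (forall t, 0 <= g t) ->
  rint g a b <= rint g a' b'.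
Proof.
move=> h1 h2 h3 cg g0.
rewrite (@rint_split _ g a' a b')// ?(le_trans h2)//.
rewrite (@rint_split _ g a b b')//.
have P c d : c <= d -> 0 <= rint g c d.
  by move=> cd; have := @rint_ge g c d 0 cd (fun t _ => cg t) (fun t _ => g0 t); rewrite mul0r.
have := P _ _ h1; have := P _ _ h3; lra.
Qed.

(* Cauchy's formula on a rectangle around z; the value of the integral of
   1 / (zeta - z) is not needed, only that its imaginary part is at least 1. *)
Lemma rectangle_bound f x0 y0 X1 X2 Y1 Y2 : ent f ->
  x0 - 2 <= X1 <= x0 - 1 -> x0 + 1 <= X2 <= x0 + 2 ->
  y0 - 2 <= Y1 <= y0 - 1 -> y0 + 1 <= Y2 <= y0 + 2 ->
  nm (f (x0 +i* y0)) <= 2 * (rint (fun s => nm (f (s +i* Y1))) (x0 - 2) (x0 + 2)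
    + rint (fun s => nm (f (s +i* Y2))) (x0 - 2) (x0 + 2)
    + rint (fun s => nm (f (X1 +i* s))) (y0 - 2) (y0 + 2)
    + rint (fun s => nm (f (X2 +i* s))) (y0 - 2) (y0 + 2)).
Proof.
move=> hf /andP[a1 a2] /andP[b1 b2] /andP[c1 c2] /andP[d1 d2].
set z := x0 +i* y0.
have [q hq qE] := ent_div z hf.
have X12 : X1 <= X2 by lra.
have Y12 : Y1 <= Y2 by lra.
pose k w : C := (w - z)^-1.
have ne w : `|Re w - x0| >= 1 \/ `|Im w - y0| >= 1 -> 1 <= nm (w - z).
  have h1 := Re_le_nm (w - z); have h2 := Im_le_nm (w - z).
  move: h1 h2; rewrite ReD ReN ImD ImN /= => h1 h2 [h|h]; lra.
have ne0 w : 1 <= nm (w - z) -> w - z != 0 by move=> h; rewrite -nm_gt0; lra.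
have ck w : 1 <= nm (w - z) -> ccont k w.
  by move=> h; apply: ccont_inv; [exact: ne0|exact: (ccontB (ccont_id w) (ccont_cst z w))].
have k1 w : 1 <= nm (w - z) -> nm (k w) <= 1.
  by move=> h; rewrite nmV invf_le1//; lra.
have bY1 s : 1 <= nm (s +i* Y1 - z).
  by apply: ne; right => /=; rewrite ler0_norm; lra.
have bY2 s : 1 <= nm (s +i* Y2 - z).
  by apply: ne; right => /=; rewrite ger0_norm; lra.
have bX1 s : 1 <= nm (X1 +i* s - z).
  by apply: ne; left => /=; rewrite ler0_norm; lra.
have bX2 s : 1 <= nm (X2 +i* s - z).
  by apply: ne; left => /=; rewrite ger0_norm; lra.
pose h w := f w * k w.
have ch w : 1 <= nm (w - z) -> ccont h w.
  by move=> wz; exact: (ccontM (ent_cont w hf) (ck w wz)).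
have PC (v : C -> C) : (forall w, 1 <= nm (w - z) -> ccont v w) ->
    [/\ forall a b, pcont_on (fun s => v (s +i* Y1)) a b,
      forall a b, pcont_on (fun s => v (s +i* Y2)) a b,
      forall a b, pcont_on (fun s => v (X1 +i* s)) a b &
      forall a b, pcont_on (fun s => v (X2 +i* s)) a b].
  move=> cv; split => a b t _.
  - by apply: pcont_hor; apply: cv; exact: bY1.
  - by apply: pcont_hor; apply: cv; exact: bY2.
  - by apply: pcont_ver; apply: cv; exact: bX1.
  - by apply: pcont_ver; apply: cv; exact: bX2.
have [h1 h2 h3 h4] := PC h ch.
have [k1' k2' k3' k4'] := PC k ck.
have qh w : 1 <= nm (w - z) -> q w = h w - f z * k w.
  by move=> wz; rewrite /h /k qE; have := ne0 w wz => w0; field.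
have G : rect_int q X1 X2 Y1 Y2 = 0 by apply: goursat => // s t _ _; exact: hq.
have [q1 q2 q3 q4] := PC q (fun w _ => ent_cont w hq).
have E : rect_int h X1 X2 Y1 Y2 = f z * rect_int k X1 X2 Y1 Y2.
  rewrite -[LHS]subr0 -[X in _ - X]G /rect_int.
  have -> : cint (fun s => h (s +i* Y1) - h (s +i* Y2)) X1 X2 =
      cint (fun s => q (s +i* Y1) - q (s +i* Y2)) X1 X2
      + f z * cint (fun s => k (s +i* Y1) - k (s +i* Y2)) X1 X2.
    rewrite -cintZ; last by apply: pcont_onB.
    rewrite -cintD.
    - by apply: eq_cint => s _; rewrite !qh//; ring.
    - by apply: pcont_onB.
    - by apply: pcont_onM; [exact: pcont_on_cst|apply: pcont_onB].
  have -> : cint (fun s => h (X2 +i* s) - h (X1 +i* s)) Y1 Y2 =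
      cint (fun s => q (X2 +i* s) - q (X1 +i* s)) Y1 Y2
      + f z * cint (fun s => k (X2 +i* s) - k (X1 +i* s)) Y1 Y2.
    rewrite -cintZ; last by apply: pcont_onB.
    rewrite -cintD.
    - by apply: eq_cint => s _; rewrite !qh//; ring.
    - by apply: pcont_onB.
    - by apply: pcont_onM; [exact: pcont_on_cst|apply: pcont_onB].
  ring.
have K1 : 1 <= nm (rect_int k X1 X2 Y1 Y2).
  apply: le_trans (Im_le_nm _); apply: le_trans (ler_norm _).
  rewrite /rect_int ImD ImM /= mul0r add0r mul1r.
  have Imk x y : Im (k (x +i* y)) = (y0 - y) / ((x - x0) ^+ 2 + (y0 - y) ^+ 2).
    rewrite /k Im_inv nm_sqr ReD ReN ImD ImN /=.
    by rewrite -[(y - y0) ^+ 2]sqrrN opprB.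
  have Rek x y : Re (k (x +i* y)) = (x - x0) / ((x - x0) ^+ 2 + (y - y0) ^+ 2).
    by rewrite /k Re_inv nm_sqr ReD ReN ImD ImN /=.
  have est (p q' c : R) : 1 <= c -> c <= 2 -> p ^+ 2 <= 4 -> c ^+ 2 = q' -> 8^-1 <= c / (p ^+ 2 + q').
    move=> c1' c2' h8 <-; have p0 := sqr_ge0 p; rewrite ler_pdivlMr; nra.
  have sq4 (p : R) : -2 <= p -> p <= 2 -> p ^+ 2 <= 4 by move=> ? ?; nra.
  (* On each side the relevant coordinate of the kernel has modulus at least 1/8, since z is at
     distance between 1 and 2 in one coordinate and at most 2 in the other. Two opposite sides give
     1/4 over a length at least 2, and the two pairs together give 1. *)
  have A1 : 4^-1 * (X2 - X1) <= rint (fun t => Im (k (t +i* Y1) - k (t +i* Y2))) X1 X2.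
    apply: rint_ge => // [t tX|t /andP[t1 t2]].
      exact: (pcont_Im (pcont_onB (k1' X1 X2) (k2' X1 X2))).
    rewrite ImD ImN !Imk.
    have t4 : (t - x0) ^+ 2 <= 4 by apply: sq4; lra.
    have H1 : 8^-1 <= (y0 - Y1) / ((t - x0) ^+ 2 + (y0 - Y1) ^+ 2) by apply: est => //; lra.
    have H2 : 8^-1 <= (Y2 - y0) / ((t - x0) ^+ 2 + (y0 - Y2) ^+ 2).
      by apply: est => //; [lra|lra|rewrite -sqrrN opprB].
    have -> : - ((y0 - Y2) / ((t - x0) ^+ 2 + (y0 - Y2) ^+ 2)) =
      (Y2 - y0) / ((t - x0) ^+ 2 + (y0 - Y2) ^+ 2) by rewrite -mulNr opprB.
    lra.
  have A2 : 4^-1 * (Y2 - Y1) <= rint (fun t => Re (k (X2 +i* t) - k (X1 +i* t))) Y1 Y2.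
    apply: rint_ge => // [t tX|t /andP[t1 t2]].
      exact: (pcont_Re (pcont_onB (k4' Y1 Y2) (k3' Y1 Y2))).
    rewrite ReD ReN !Rek ![(_ - x0) ^+ 2 + _]addrC.
    have t4 : (t - y0) ^+ 2 <= 4 by apply: sq4; lra.
    have H1 : 8^-1 <= (X2 - x0) / ((t - y0) ^+ 2 + (X2 - x0) ^+ 2) by apply: est => //; lra.
    have H2 : 8^-1 <= (x0 - X1) / ((t - y0) ^+ 2 + (X1 - x0) ^+ 2).
      by apply: est => //; [lra|lra|rewrite -sqrrN opprB].
    have -> : - ((X1 - x0) / ((t - y0) ^+ 2 + (X1 - x0) ^+ 2)) =
      (x0 - X1) / ((t - y0) ^+ 2 + (X1 - x0) ^+ 2) by rewrite -mulNr opprB.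
    lra.
  lra.
have nh w : 1 <= nm (w - z) -> nm (h w) <= nm (f w).
  by move=> wz; rewrite nmM ler_piMr ?nm_ge0// k1.
have cnf (p : R -> C) : (forall t, pcont p t) -> forall t, {for t, continuous (fun t => nm (f (p t)))}.
  by move=> cp t; apply: pcont_nm; apply: pcont_comp; [exact: ent_cont|exact: cp].
have ph y : forall t, pcont (fun s => s +i* y : C) t.
  by move=> t; split => /=; [exact: cvg_id|exact: cvg_cst].
have pv x : forall t, pcont (fun s => x +i* s : C) t.
  by move=> t; split => /=; [exact: cvg_cst|exact: cvg_id].
have side (p : R -> C) a b a' b' : a' <= a -> a <= b -> b <= b' -> (forall t, pcont p t) ->
    (forall t, 1 <= nm (p t - z)) ->
    nm (cint (fun s => h (p s)) a b) <= 2 * rint (fun s => nm (f (p s))) a' b'.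
  move=> aa ab bb cp hp.
  have ch' : pcont_on (fun s => h (p s)) a b.
    by move=> t _; apply: pcont_comp; [exact: ch|exact: cp].
  apply: le_trans (nm_cint_int ab ch') _; rewrite ler_pM2l//.
  apply: (@le_trans _ _ (rint (fun s => nm (f (p s))) a b)).
    apply: le_rint => [t tab|t tab|t _]; [exact: pcont_nm (ch' t tab)|exact: cnf|exact: nh].
  by apply: rint_widen => //; [exact: cnf|move=> t; exact: nm_ge0].
have := nmM (f z) (rect_int k X1 X2 Y1 Y2); rewrite -E /rect_int => EE.
have : nm (f z) <= nm (f z) * nm (rect_int k X1 X2 Y1 Y2) by rewrite ler_peMr ?nm_ge0.
rewrite -EE => H; apply: le_trans H _.
rewrite !cintB//; apply: le_trans (nmD _ _) _.
rewrite nmM nm_i mul1r.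
have n1 := nmD (cint (fun s => h (s +i* Y1)) X1 X2) (- cint (fun s => h (s +i* Y2)) X1 X2).
have n2 := nmD (cint (fun s => h (X2 +i* s)) Y1 Y2) (- cint (fun s => h (X1 +i* s)) Y1 Y2).
rewrite !nmN in n1 n2.
have s1 := @side (fun s => s +i* Y1) X1 X2 (x0 - 2) (x0 + 2) a1 X12 b2 (ph Y1) bY1.
have s2 := @side (fun s => s +i* Y2) X1 X2 (x0 - 2) (x0 + 2) a1 X12 b2 (ph Y2) bY2.
have s3 := @side (fun s => X1 +i* s) Y1 Y2 (y0 - 2) (y0 + 2) c1 Y12 d2 (pv X1) bX1.
have s4 := @side (fun s => X2 +i* s) Y1 Y2 (y0 - 2) (y0 + 2) c1 Y12 d2 (pv X2) bX2.
clear -n1 n2 s1 s2 s3 s4; lra.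
Qed.

End PointwiseBound.

(** * From the weighted integral to a pointwise bound *)

Section PointwiseBoundL2.
Variable R : realType.
Local Notation C := (R[i]).
Local Notation nm := (@Normc.normc R).
Local Notation leb := (@lebesgue_measure R).

(** Measurability refers to the product sigma-algebra. Rounding the first coordinate down to
    multiples of 1 / (N + 1) makes the preimages countable unions of measurable rectangles, and
    continuity gives pointwise convergence. *)
Lemma measurable_cont2 (g : R * R -> R) : (forall p, {for p, continuous g}) ->
  measurable_fun [set: R * R] g.
Proof.
move=> cg.
pose st (N : nat) (x : R) : R := (Num.floor (x * N.+1%:R))%:~R / N.+1%:R.
have cg' (a b : R) : g (z.1, z.2) @[z --> (a, b)] --> g (a, b).
  have -> : (fun z : R * R => g (z.1, z.2)) = g by apply/funext => -[].
  exact: cg.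
have N0 (N : nat) : (0 : R) < N.+1%:R by rewrite ltr0n.
have st_le N x : `|st N x - x| <= N.+1%:R^-1.
  have /andP[h1 h2] := floor_itv (x * N.+1%:R).
  rewrite intrD in h2; rewrite ler_norml; apply/andP; split.
    rewrite -(ler_pM2r (N0 N)) mulrBl /st divfK ?lt0r_neq0// mulNr mulVf ?lt0r_neq0//; lra.
  rewrite -(ler_pM2r (N0 N)) mulrBl /st divfK ?lt0r_neq0// mulVf ?lt0r_neq0//; lra.
have st_cvg x : st N x @[N --> \oo] --> x.
  apply/cvgrPdist_le => e e0.
  have [N1 _ hN] := @near_infty_natSinv_lt R (PosNum e0).
  exists N1 => // N NN; rewrite distrC; apply: le_trans (st_le N x) _.
  by apply/ltW; exact: (hN N NN).
apply: (@measurable_fun_cvg _ _ _ _ (fun N p => g (st N p.1, p.2))).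
  move=> N _ B mB; rewrite setTI.
  have -> : (fun p : R * R => g (st N p.1, p.2)) @^-1` B =
    \bigcup_(k in [set: int]) ([set x : R | Num.floor (x * N.+1%:R) = k] `*`
      ((fun y => g (k%:~R / N.+1%:R, y)) @^-1` B)).
    apply/seteqP; split => [[x y] /= Bxy|[x y] [k _] [/= <-]//].
    by exists (Num.floor (x * N.+1%:R)).
  apply: countable_bigcupT_measurable => // k.
  apply: measurableX.
    have -> : [set x : R | Num.floor (x * N.+1%:R) = k] = `[k%:~R / N.+1%:R, (k + 1)%:~R / N.+1%:R[%classic.
      apply/funext => x /=; apply/propext; rewrite in_itv /= ler_pdivrMr// ltr_pdivlMr//; split.
        by move=> <-; exact: floor_itv.
      exact: floor_def.
    exact: measurable_itv.
  have cm : measurable_fun setT (fun y => g (k%:~R / N.+1%:R, y)).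
    apply: continuous_measurable_fun => y.
    have := @continuous2_cvg R R R R (nbhs y) _ (fun=> k%:~R / N.+1%:R) id
      (fun a b => g (a, b)) (k%:~R / N.+1%:R) y (cg' _ _).
    by apply; [exact: cvg_cst|exact: cvg_id].
  by have := cm measurableT B mB; rewrite setTI.
move=> [x y] _ /=.
have := @continuous2_cvg nat R R R \oo _ (fun N => st N x) (fun=> y)
  (fun a b => g (a, b)) x y (cg' _ _).
by apply; [exact: st_cvg|exact: cvg_cst].
Qed.

(** Markov's inequality on an interval of length 1, over which the constant N + 1 already integrates
    to more than N. *)
Lemma small_value (H : R -> \bar R) a (N : R) : measurable_fun setT H ->
  (forall x, (0 <= H x)%E) -> (\int[leb]_x H x <= N%:E)%E ->
  exists2 x, a <= x <= a + 1 & (H x <= (N + 1)%:E)%E.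
Proof.
move=> mH H0 HN; apply: contrapT => no.
have big x : `[a, a + 1]%classic x -> ((N + 1)%:E <= H x)%E.
  rewrite /= in_itv /= => hx; rewrite leNgt; apply/negP => h; apply: no.
  by exists x => //; exact: ltW.
have N0 : 0 <= N by rewrite -lee_fin; apply: le_trans HN; exact: integral_ge0.
have : (\int[leb]_(x in `[a, (a + 1)%R]) cst (N + 1)%R%:E x <= \int[leb]_(x in `[a, (a + 1)%R]) H x)%E.
  apply: ge0_le_integral => //.
  - by move=> x _; rewrite lee_fin addr_ge0.
  - exact: measurable_funS mH.
rewrite integral_cst//= lebesgue_measure_itv /= lte_fin ltrDl ltr01 -EFinB (_ : a + 1 - a = 1) ?mule1; last by ring.
move=> h; have : (\int[leb]_(x in `[a, (a + 1)%R]) H x <= \int[leb]_x H x)%E.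
  by apply: ge0_subset_integral.
move=> /(le_trans h) /le_trans /(_ HN); rewrite lee_fin; lra.
Qed.

Definition fock_weight (rho : R) (f : C -> C) (p : R * R) : R :=
  (nm (f (p.1 +i* p.2)) * expR (- (nm (p.1 +i* p.2) `^ rho))) ^+ 2.

Lemma fock_weight_ge0 rho f p : 0 <= fock_weight rho f p.
Proof. exact: sqr_ge0. Qed.

Lemma cont_pair_nm (f : C -> C) : (forall z, ccont f z) ->
  forall p : R * R, {for p, continuous (fun p : R * R => nm (f (p.1 +i* p.2)))}.
Proof.
move=> cf p; apply: ccvg_nm.
have cp : ccvg (nbhs p) (fun p : R * R => p.1 +i* p.2 : C) (p.1 +i* p.2).
  by split => /=; [exact: cvg_fst|exact: cvg_snd].
apply/ccvgP => e e0; have [d d0 hd] := (ccontP _ _).1 (cf (p.1 +i* p.2)) e e0.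
by have /ccvgP/(_ d d0) := cp; apply: filterS => q; exact: hd.
Qed.

Lemma measurable_fock_weight rho f : ent f -> measurable_fun setT (fock_weight rho f).
Proof.
move=> hf; apply: measurable_funX; apply: measurable_funM.
  by apply: measurable_cont2; apply: cont_pair_nm => z; exact: ent_cont.
apply: measurableT_comp; first exact: measurable_expR.
apply: measurable_funN.
have := measurableT_comp (measurable_powR rho) (measurable_cont2 (cont_pair_nm (@ccont_id R))).
exact.
Qed.

Lemma rint_integral (g : R -> R) a b : (forall t, {for t, continuous g}) ->
  (rint g a b)%:E = (\int[leb]_(x in `[a, b]) (g x)%:E)%E.
Proof.
move=> cg; rewrite /rint /Rintegral fineK//.
by apply: integrable_fin_num => //; apply: cont_integrable.
Qed.

(** By Tonelli's theorem each of four unit strips around z contains a line on which the weighted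
    integral of |f|^2 is at most N + 1; these lines bound the rectangle of [rectangle_bound],
    applied to f^2. The segments used lie within distance 4 of z, hence the shift in the weight. *)
Lemma fock_pointwise rho f : 0 <= rho -> ent f -> (fock_norm_sq rho f < +oo)%E ->
  exists2 A, 0 <= A & forall z, nm (f z) ^+ 2 <= A * expR (2 * (nm z + 4) `^ rho).
Proof.
move=> rho0 hf fin.
pose W := fock_weight rho f.
have mW : measurable_fun setT (EFin \o W) by apply/measurable_EFinP; exact: measurable_fock_weight.
have W0 p : (0 <= (EFin \o W) p)%E by rewrite lee_fin; exact: fock_weight_ge0.
pose N := fine (fock_norm_sq rho f).
have NE : (N%:E = \int[leb \x leb]_p (EFin \o W) p)%E.
  rewrite /N fineK// ge0_fin_numE//; apply: integral_ge0 => p _; exact: W0.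
pose H1 := fubini_F leb (EFin \o W); pose H2 := fubini_G leb (EFin \o W).
have mH1 : measurable_fun setT H1 by apply: measurable_fun_fubini_tonelli_F.
have mH2 : measurable_fun setT H2 by apply: measurable_fun_fubini_tonelli_G.
have H10 x : (0 <= H1 x)%E by apply: integral_ge0.
have H20 x : (0 <= H2 x)%E by apply: integral_ge0.
have I1 : (\int[leb]_x H1 x <= N%:E)%E 
  by rewrite NE le_eqVlt; apply/orP; left; apply/eqP/esym; have := @fubini_tonelli1 _ _ _ _ R leb leb (EFin \o W) mW W0; exact.
have I2 : (\int[leb]_x H2 x <= N%:E)%E 
  by rewrite NE le_eqVlt; apply/orP; left; apply/eqP/esym; have := @fubini_tonelli2 _ _ _ _ R leb leb (EFin \o W) mW W0; exact.
have N0 : 0 <= N by rewrite -lee_fin; apply: le_trans I1; exact: integral_ge0.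
exists (8 * (N + 1)); first by rewrite mulr_ge0// addr_ge0.
move=> z; set E := expR _.
have E0 : 0 < E := expR_gt0 _.
pose x0 := complex.Re z; pose y0 := complex.Im z.
have zE : z = x0 +i* y0 by rewrite /x0 /y0; case: (z).
have box x y : `|x - x0| <= 2 -> `|y - y0| <= 2 -> nm (f (x +i* y)) ^+ 2 <= E * W (x, y).
  move=> hx hy; have hz : nm (x +i* y) <= nm z + 4.
    have := nm_subl (x +i* y) z; have := nm_le (x +i* y - z).
    rewrite {2 3}zE /=; lra.
  rewrite /W /fock_weight /= exprMn mulrCA ler_peMr ?sqr_ge0//.
  rewrite /E expRN exprVn -expRM_natl -expRN -expRD -[leLHS]expR0 ler_expR.
  have : nm (x +i* y) `^ rho <= (nm z + 4) `^ rho.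
    by apply: ge0_ler_powR; rewrite ?nnegrE ?nm_ge0 ?addr_ge0 ?nm_ge0.
  lra.
have cF (p : R -> C) : (forall t, pcont p t) -> forall t,
    {for t, continuous (fun t => nm (f (p t) * f (p t)))}.
  move=> cp t; apply: pcont_nm; apply: (ccvgM (f := fun t => f (p t)) (g := fun t => f (p t)));
    by apply: (pcont_comp (ent_cont _ hf) (cp t)).
have ph y : forall t, pcont (fun s => s +i* y : C) t.
  by move=> t; split => /=; [exact: cvg_id|exact: cvg_cst].
have pv x : forall t, pcont (fun s => x +i* s : C) t.
  by move=> t; split => /=; [exact: cvg_cst|exact: cvg_id].
have S1 X : `|X - x0| <= 2 ->
    ((rint (fun s => nm (f (X +i* s) * f (X +i* s))) (y0 - 2) (y0 + 2))%:E <= E%:E * H1 X)%E.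
  move=> hX; rewrite rint_integral; last exact: (cF (fun s => X +i* s)).
  have mWs : measurable_fun setT (fun y : R => (EFin \o W) (X, y)).
    by apply: (measurableT_comp mW); exact: measurable_pair1.
  have -> : (E%:E * H1 X = \int[leb]_y (E%:E * (EFin \o W) (X, y)))%E.
    apply/esym; have := @ge0_integralZl _ _ R leb setT measurableT _ mWs E%:E.
    by apply => //; rewrite lee_fin ltW.
  apply: (@le_trans _ _ (\int[leb]_(y in `[(y0 - 2)%R, (y0 + 2)%R]) (E%:E * (EFin \o W) (X, y)))%E).
    apply: ge0_le_integral => //=.
    - by move=> y _; rewrite lee_fin nm_ge0.
    - apply/measurable_EFinP; apply: (measurable_funS measurableT) => //.
      by apply: continuous_measurable_fun; exact: (cF (fun s => X +i* s)).
    - apply: (measurable_funS measurableT) => //; apply: measurable_funeM.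
      exact: mWs.
    - move=> y; rewrite in_itv /= => /andP[ya yb]; rewrite -EFinM lee_fin nmM -expr2.
      by apply: box => //; rewrite ler_norml; lra.
  apply: ge0_subset_integral => //.
  - by apply: measurable_funeM; exact: mWs.
  - by move=> y _; rewrite mule_ge0// lee_fin ltW.
have S2 Y : `|Y - y0| <= 2 ->
    ((rint (fun s => nm (f (s +i* Y) * f (s +i* Y))) (x0 - 2) (x0 + 2))%:E <= E%:E * H2 Y)%E.
  move=> hY; rewrite rint_integral; last exact: (cF (fun s => s +i* Y)).
  have mWs : measurable_fun setT (fun y : R => (EFin \o W) (y, Y)).
    by apply: (measurableT_comp mW); exact: measurable_pair2.
  have -> : (E%:E * H2 Y = \int[leb]_y (E%:E * (EFin \o W) (y, Y)))%E.
    apply/esym; have := @ge0_integralZl _ _ R leb setT measurableT _ mWs E%:E.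
    by apply => //; rewrite lee_fin ltW.
  apply: (@le_trans _ _ (\int[leb]_(x in `[(x0 - 2)%R, (x0 + 2)%R]) (E%:E * (EFin \o W) (x, Y)))%E).
    apply: ge0_le_integral => //=.
    - by move=> y _; rewrite lee_fin nm_ge0.
    - apply/measurable_EFinP; apply: (measurable_funS measurableT) => //.
      by apply: continuous_measurable_fun; exact: (cF (fun s => s +i* Y)).
    - apply: (measurable_funS measurableT) => //; apply: measurable_funeM.
      exact: mWs.
    - move=> x; rewrite in_itv /= => /andP[ya yb]; rewrite -EFinM lee_fin nmM -expr2.
      by apply: box => //; rewrite ler_norml; lra.
  apply: ge0_subset_integral => //.
  - by apply: measurable_funeM; exact: mWs.
  - by move=> x _; rewrite mule_ge0// lee_fin ltW.
have fin_le (H : \bar R) (c : R) : (c%:E <= E%:E * H)%E -> (0 <= H)%E -> (H <= (N + 1)%:E)%E ->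
    c <= E * (N + 1).
  move=> h h0 h1; rewrite -lee_fin; apply: le_trans h _.
  by rewrite EFinM lee_wpmul2l// lee_fin ltW.
have [X1 /andP[a1 a2] hX1] := small_value (x0 - 2) mH1 H10 I1.
have [X2 /andP[b1 b2] hX2] := small_value (x0 + 1) mH1 H10 I1.
have [Y1 /andP[c1 c2] hY1] := small_value (y0 - 2) mH2 H20 I2.
have [Y2 /andP[d1 d2] hY2] := small_value (y0 + 1) mH2 H20 I2.
have a2' : X1 <= x0 - 1 by clear -a2; lra.
have b2' : X2 <= x0 + 2 by clear -b2; lra.
have c2' : Y1 <= y0 - 1 by clear -c2; lra.
have d2' : Y2 <= y0 + 2 by clear -d2; lra.
have nX1 : `|X1 - x0| <= 2 by clear -a1 a2; rewrite ler_norml; lra.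
have nX2 : `|X2 - x0| <= 2 by clear -b1 b2; rewrite ler_norml; lra.
have nY1 : `|Y1 - y0| <= 2 by clear -c1 c2; rewrite ler_norml; lra.
have nY2 : `|Y2 - y0| <= 2 by clear -d1 d2; rewrite ler_norml; lra.
have k1 := fin_le _ _ (S1 X1 nX1) (H10 X1) hX1.
have k2 := fin_le _ _ (S1 X2 nX2) (H10 X2) hX2.
have k3 := fin_le _ _ (S2 Y1 nY1) (H20 Y1) hY1.
have k4 := fin_le _ _ (S2 Y2 nY2) (H20 Y2) hY2.
have := @rectangle_bound R (fun z => f z * f z) x0 y0 X1 X2 Y1 Y2 (entM hf hf).
rewrite -zE nmM -expr2 => H.
have H' : nm (f z) ^+ 2 <= 2 * (4 * (E * (N + 1))).
  apply: le_trans (H _ _ _ _) _; [by apply/andP..|].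
  rewrite ler_pM2l//; move: k1 k2 k3 k4; clear; lra.
by apply: le_trans H' _; lra.
Qed.

End PointwiseBoundL2.

(** * Growth of functions vanishing on a symmetric set *)

Section ZeroSetBound.
Variable R : realType.
Local Notation C := (R[i]).
Local Notation nm := (@Normc.normc R).
Implicit Types (f g : C -> C) (r s t e M T x y : R) (z w u : C) (n m j : nat).

Lemma powR_large s M : 0 < s -> exists2 T0, 1 <= T0 & forall T, T0 <= T -> M <= T `^ s.
Proof.
move=> s0; pose M1 := Num.max 1 M.
have M11 : 1 <= M1 by rewrite le_max lexx.
have MM : M <= M1 by rewrite le_max lexx orbT.
exists (M1 `^ (s^-1)).
  by rewrite -[leLHS](powRr0 M1) ler_powR// invr_ge0 ltW.
move=> T hT; apply: le_trans MM _.
rewrite -[leLHS]powRr1 ?(le_trans ler01)// -(mulVf (lt0r_neq0 s0)) powRrM.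
apply: ge0_ler_powR; rewrite ?nnegrE ?powR_ge0 ?(ltW s0)//.
exact: le_trans (powR_ge0 _ _) hT.
Qed.

Lemma powR_lt_expn (rho : R) n c e : rho < n%:R -> 0 < e ->
  exists2 T0, 1 <= T0 & forall T, T0 <= T -> c * T `^ rho <= e * T ^+ n.
Proof.
move=> rn e0; have s0 : 0 < n%:R - rho by rewrite subr_gt0.
have [T0 T01 h] := powR_large (c / e) s0; exists T0 => // T TT.
have T1 : 0 < T by rewrite (lt_le_trans ltr01)// (le_trans T01).
have := h T TT; rewrite ler_pdivrMr// mulrC => k.
have -> : T ^+ n = T `^ (n%:R - rho) * T `^ rho.
  by rewrite -powRD ?subrK ?powR_mulrn ?(ltW T1)//; apply/implyP => _; rewrite gt_eqF.
by rewrite mulrA ler_wpM2r ?powR_ge0.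
Qed.

(** For fixed r the finitely many zeros of modulus below T are divided out. The quotient [G] has no
    zero in the disc of radius T and obeys, up to a constant factor, the bound of [f] at radius 2 T;
    so the logarithm of its rotational product at radius r is at least a constant minus O(T^rho (r /
    T)^n). For large T only the product over the zeros matters. *)
Lemma zero_set_bound (rho : R) n w (lam : nat -> C) (l : nat -> R) :
  0 <= rho -> rho < n%:R -> n.-primitive_root w ->
  (forall k, 0 < l k) -> (forall k, nm (lam k) = l k) ->
  (forall k, lam k ^+ n = (l k ^+ n)%:C) ->
  (forall T, exists N, forall k, (k < N)%N = (l k < T)) ->
  zero_set rho lam ->
  exists C0, forall r K, 0 <= r ->
    \sum_(0 <= k < K) ln (1 + (r / l k) ^+ n) <= n%:R * (r + 4) `^ rho + C0.
Proof.
move=> rho0 rn pw l0 lamE lamn hN [f [/entireP hf fin] zf].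
have n0 := prim_order_gt0 pw; have w1 := nm_prim pw.
have wj (j : nat) : nm (w ^+ j) = 1 by rewrite nmX w1 expr1n.
have [A A0 hA] := fock_pointwise rho0 hf fin.
have {hA} fA z : nm (f z) <= expR (A + (nm z + 4) `^ rho).
  rewrite -ler_sqr ?nnegrE ?nm_ge0 ?expR_ge0//; apply: le_trans (hA z) _.
  have -> : expR (A + (nm z + 4) `^ rho) ^+ 2 = expR (2 * A) * expR (2 * (nm z + 4) `^ rho).
    by rewrite -expRM_natl -expRD; congr expR; ring.
  rewrite ler_wpM2r ?expR_ge0//; apply: le_trans (expR_ge1Dx _); lra.
pose ord z := xget 0%N [set m | ([set k | lam k = z] #= `I_m)%card /\ exact_order f z m].
have hord z : ([set k | lam k = z] #= `I_(ord z))%card /\ exact_order f z (ord z).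
  have [m m1 m2] := zf z; rewrite /ord; case: xgetP => [y _ //|H].
  by case: (H m (conj m1 m2)).
have ho z : has_order f z (ord z) by apply: exact_orderE => //; have [] := hord z.
have lam0 k : lam k != 0 by rewrite -nm_gt0 lamE.
have f0 : f 0 != 0.
  have ord0 : ord 0 = 0%N.
    have [_ <- //] := @count_fiber R lam 0 0 (ord 0) (proj1 (hord 0)).
    by move=> k kz; have := lam0 k; rewrite kz eqxx.
  by have [_ [_]] := hord 0; rewrite ord0 => /eqP.
have nf0 : 0 < nm (f 0) by rewrite nm_gt0.
exists (n%:R * A + 1 - n%:R * ln (nm (f 0))) => r K r0.
pose c1 := 1 + n%:R * (ln 4 + A + `|ln (nm (f 0))|).
have c10 : 1 <= c1.
  by rewrite /c1 lerDl mulr_ge0// !addr_ge0// ln_ge0//; lra.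
have n0' : (0 : R) < n%:R by rewrite ltr0n.
have h2 : (0 : R) < 2^-1 by lra.
have [T1 T11 hT1] := powR_lt_expn (32 * n%:R * 3 `^ rho * (2 * r) ^+ n) rn h2.
have [T2 T21 hT2] := powR_lt_expn (32 * c1 * (2 * r) ^+ n) n0' h2.
(* [T1] and [T2] make 32 B (2 r / T)^n at most 1, 64 r provides the smallness required by
   [zero_free_lower], 4 gives 2 T + 4 <= 3 T, and the sum puts the first K points into the disc. *)
pose T := T1 + T2 + 64 * r + 4 + \sum_(0 <= k < K) l k.
have sl : 0 <= \sum_(0 <= k < K) l k by apply: sumr_ge0 => k _; exact: ltW.
have [TT1 TT2] : T1 <= T /\ T2 <= T by rewrite /T; split; lra.
have [T4 T64] : 4 <= T /\ 64 * r <= T by rewrite /T; split; lra.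
have lT k : (k < K)%N -> l k < T.
  move=> kK; have : l k <= \sum_(0 <= k < K) l k.
    rewrite big_mkord (bigD1 (Ordinal kK)) //= lerDl sumr_ge0// => i _.
    exact: ltW.
  by rewrite /T; lra.
have T0 : 0 < T by lra.
have {}hT1 := hT1 T TT1; have {}hT2 := hT2 T TT2; rewrite powRr0 mulr1 in hT2.
have [N hNT] := hN T.
pose s := [seq lam k | k <- iota 0 N].
have [g [hg fg go]] := divide_zeros hf ho (fun z => proj1 (count_fiber N (proj1 (hord z)))).
rewrite -/s in fg go.
pose G v := \prod_(a <- s) (- a) * g v.
have hG : ent G by apply: entM => //; exact: ent_cst.
have s0 a : a \in s -> a != 0 by move=> /mapP[k _ ->].
have fG v : f v = \prod_(a <- s) (1 - v / a) * G v.
  rewrite fg /G mulrA -big_split /=; congr (_ * _).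
  apply: eq_big_seq => a /s0 a0; field; exact: a0.
have sT a : a \in s -> nm a < T.
  by move=> /mapP[k]; rewrite mem_iota /= add0n => kN ->; rewrite lamE -hNT.
have gn0 v : nm v < T -> G v != 0.
  move=> vT; rewrite mulf_neq0//.
    rewrite -nm_gt0 nm_prod; rewrite big_seq; apply: prodr_gt0 => a /s0 a0.
    by rewrite nmN nm_gt0.
  have [_ cE] := count_fiber N (proj1 (hord v)).
  have := go v; rewrite cE; last by move=> k kv; rewrite hNT -lamE kv.
  by rewrite subnn => -[g' [_ -> g'0]]; rewrite expr0 mul1r.
have T2' : 0 < 2 * T by lra.
pose M := expR (A + (2 * T + 4) `^ rho).
(* On the circle of radius 2 T every removed factor 1 - v / a has modulus at least 1, as |a| < T, so
   [G] is no larger than [f] there. *)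
have GM v : nm v = 2 * T -> nm (G v) <= M.
  move=> vT; have := fA v; rewrite fG nmM vT -/M; apply: le_trans.
  rewrite ler_peMl ?nm_ge0// nm_prod big_seq.
  elim/big_ind : _ => // [x y x1 y1|a sa]; first by rewrite mulr_ege1.
  have := nm_subl (v / a) 1; rewrite nmB nm1 nmM nmV vT; apply: le_trans.
  have a0 : 0 < nm a by rewrite nm_gt0 s0.
  have : 2 <= 2 * T / nm a by rewrite ler_pdivlMr// ler_pM2l// ltW// sT.
  lra.
pose B0 := ln 4 + (A + (2 * T + 4) `^ rho).
(* Cauchy's formula on that circle takes the place of the maximum principle, at the price of the
   factor 4. *)
have GB v : nm v < T -> nm (G v) <= expR B0.
  move=> vT; have hGG : hol G (3 * T) := proj1 (ent_hol G) hG (3 * T).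
  have v2 : nm v < 2 * T by lra.
  have T23 : 2 * T < 3 * T by lra.
  rewrite (hol_ctrans hGG v2 T23).
  have cc u : nm u = 2 * T -> ccont (fun z => G z * z) u.
    by move=> _; exact: (ccontM (ent_cont u hG) (ccont_id u)).
  have GM' u : nm u = 2 * T -> nm (G u * u) <= M * (2 * T).
    by move=> uT; rewrite nmM uT ler_wpM2r ?(ltW T2')// GM.
  have MT0 : 0 <= M * (2 * T) by rewrite mulr_ge0 ?expR_ge0// ltW.
  have := nm_ctrans 1 MT0 v2 cc GM'.
  have -> : (fun z => G z * z / (z - v) ^+ 1) = (fun z => G z * z / (z - v)).
    by apply/funext => u; rewrite expr1.
  move=> /le_trans; apply; rewrite expr1 /B0 expRD lnK ?posrE//.
  have d0 : 0 < 2 * T - nm v by lra.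
  rewrite mulrA ler_pdivrMr// -/M.
  have : 0 < M := expR_gt0 _.
  by move=> M0; have := nm_ge0 v; nra.
pose B := 1 + n%:R * (B0 + `|ln (nm (f 0))|).
have G0 : G 0 = f 0.
  by rewrite fG big1_seq ?mul1r// => a _; rewrite mul0r subr0.
have pT : 0 <= (2 * T + 4) `^ rho by exact: powR_ge0.
have ln4 : 0 <= ln (4 : R) by rewrite ln_ge0//; lra.
have BB : n%:R * (B0 - ln (nm (G 0))) <= B.
  rewrite G0 /B; apply: (@le_trans _ _ (n%:R * (B0 + `|ln (nm (f 0))|))); last by rewrite lerDr.
  by rewrite ler_wpM2l// lerD2l -normrN ler_norm.
have B1 : 1 <= B by rewrite /B lerDl mulr_ge0// /B0 !addr_ge0.
(* Here z^n = -r^n, so the n rotated factors of one zero multiply to 1 + (r / l k)^n, the largest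
   modulus possible. *)
pose z := r%:C * expi (pi / n%:R).
have zr : nm z = r by rewrite /z nmM nm_expi mulr1 nm_real ger0_norm.
have zn : z ^+ n = - (r ^+ n)%:C.
  rewrite /z exprMn expiX (_ : n%:R * (pi / n%:R) = pi); last by field; rewrite lt0r_neq0.
  by rewrite /expi cospi sinpi (rmorphXn (real_complex R)) /=; apply: complex_eq; rewrite ?ReM ?ImM ?ReN ?ImN /=; ring.
have q32 : (2 * nm z / T) ^+ n <= 32^-1.
  have x32 : 2 * nm z / T <= 32^-1 by rewrite zr ler_pdivrMr//; lra.
  have x0 : 0 <= 2 * nm z / T by rewrite zr divr_ge0 ?mulr_ge0// ltW.
  apply: le_trans x32; rewrite -[leRHS]expr1; apply: ler_wiXn2l => //.
  by rewrite zr ler_pdivrMr//; lra.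
have := zero_free_lower pw hG T0 gn0 GB B1 BB q32.
rewrite G0 zr => low.
have small : 32 * B * (2 * r / T) ^+ n <= 1.
  have Tn : 0 < T ^+ n by rewrite exprn_gt0.
  rewrite expr_div_n mulrA ler_pdivrMr// mul1r.
  have rT : (2 * T + 4) `^ rho <= 3 `^ rho * T `^ rho.
    rewrite -powRM//; last exact: ltW.
    by apply: ge0_ler_powR => //; rewrite ?nnegrE; lra.
  have rn0 : 0 <= (2 * r) ^+ n by rewrite exprn_ge0// mulr_ge0.
  have -> : B = c1 + n%:R * (2 * T + 4) `^ rho by rewrite /B /B0 /c1; ring.
  have H : 32 * n%:R * (2 * r) ^+ n * (2 * T + 4) `^ rho <= 32 * n%:R * (2 * r) ^+ n * (3 `^ rho * T `^ rho).
    by rewrite ler_wpM2l// !mulr_ge0.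
  have -> : 32 * (c1 + n%:R * (2 * T + 4) `^ rho) * (2 * r) ^+ n =
    32 * c1 * (2 * r) ^+ n + 32 * n%:R * (2 * r) ^+ n * (2 * T + 4) `^ rho by ring.
  have E : 32 * n%:R * (2 * r) ^+ n * (3 `^ rho * T `^ rho) =
     32 * n%:R * 3 `^ rho * (2 * r) ^+ n * T `^ rho by ring.
  rewrite E in H; lra.
have pP : 0 < \prod_(j < n) nm (G (w ^+ j * z)).
  by apply: prodr_gt0 => j _; rewrite nm_gt0 gn0// nmM wj mul1r zr; lra.
have lnlow : n%:R * ln (nm (f 0)) - 1 <= ln (\prod_(j < n) nm (G (w ^+ j * z))).
  have : ln (nm (f 0) ^+ n * expR (- (32 * B * (2 * r / T) ^+ n))) <=
      ln (\prod_(j < n) nm (G (w ^+ j * z))).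
    by rewrite ler_ln ?posrE// mulr_gt0 ?expR_gt0 ?exprn_gt0.
  rewrite lnM ?posrE ?expR_gt0 ?exprn_gt0// expRK lnXn// -mulr_natl; lra.
have up : \prod_(j < n) nm (f (w ^+ j * z)) <= expR (A + (r + 4) `^ rho) ^+ n.
  have -> : expR (A + (r + 4) `^ rho) ^+ n = \prod_(j < n) expR (A + (r + 4) `^ rho).
    by rewrite prodr_const card_ord.
  apply: ler_prod => j _; rewrite nm_ge0 /=; apply: le_trans (fA _) _.
  by rewrite nmM wj mul1r zr.
have split_f : \prod_(j < n) nm (f (w ^+ j * z)) =
    \prod_(k <- iota 0 N) (1 + (r / l k) ^+ n) * \prod_(j < n) nm (G (w ^+ j * z)).
  rewrite (eq_bigr (fun j : 'I_n => nm (\prod_(a <- s) (1 - w ^+ j * z / a)) *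
    nm (G (w ^+ j * z)))); last by move=> j _; rewrite -nmM -fG.
  rewrite big_split /=; congr (_ * _).
  rewrite -nm_prod exchange_big /= big_map nm_prod; apply: eq_bigr => k _.
  have -> : \prod_(j < n) (1 - w ^+ j * z / lam k) = 1 + ((r / l k) ^+ n)%:C.
    under eq_bigr do rewrite -mulrA.
    rewrite prim_prod// expr_div_n zn lamn mulNr opprK expr_div_n.
    by rewrite (fmorph_div (real_complex R)).
  rewrite -(rmorph1 (real_complex R)) -(rmorphD (real_complex R)) /= nm_real ger0_norm//.
  by rewrite addr_ge0// exprn_ge0// divr_ge0// ltW.
have t0 k : 0 < 1 + (r / l k) ^+ n.
  by rewrite ltr_wpDr// exprn_ge0// divr_ge0// ltW.
have KN : (K <= N)%N.
  rewrite leqNgt; apply/negP => NK; have := hNT N; rewrite ltnn => /esym/negP; apply.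
  exact: lT.
have lnup : \sum_(k <- iota 0 N) ln (1 + (r / l k) ^+ n) +
    ln (\prod_(j < n) nm (G (w ^+ j * z))) <= n%:R * (A + (r + 4) `^ rho).
  have -> : \sum_(k <- iota 0 N) ln (1 + (r / l k) ^+ n) =
      ln (\prod_(k <- iota 0 N) (1 + (r / l k) ^+ n)) by rewrite ln_prod.
  have pN : 0 < \prod_(k <- iota 0 N) (1 + (r / l k) ^+ n) by rewrite prodr_gt0.
  rewrite -lnM ?posrE// -split_f.
  apply: (@le_trans _ _ (ln (expR (A + (r + 4) `^ rho) ^+ n))).
    rewrite ler_ln ?posrE ?exprn_gt0 ?expR_gt0//.
    by rewrite split_f mulr_gt0// prodr_gt0.
  by rewrite lnXn ?expR_gt0// expRK mulr_natl.
have mono : \sum_(0 <= k < K) ln (1 + (r / l k) ^+ n) <= \sum_(k <- iota 0 N) ln (1 + (r / l k) ^+ n).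
  have -> : iota 0 N = index_iota 0 N by rewrite /index_iota subn0.
  rewrite (big_cat_nat (leq0n K) KN) /= lerDl sumr_ge0// => k _.
  by rewrite ln_ge0// lerDl exprn_ge0// divr_ge0// ltW.
lra.
Qed.

End ZeroSetBound.

(** * Logarithmic sums *)

Section LogSums.
Variable R : realType.
Implicit Types (x y u e s t a : R) (k m n N : nat).

Lemma powR_V (k : R) a : 0 < k -> k^-1 `^ a = (k `^ a)^-1.
Proof.
move=> k0; rewrite /powR invr_eq0 gt_eqF// lnV ?posrE// mulrN expRN//.
Qed.

Lemma powR_div x (k : R) a : 0 <= x -> 0 < k -> (x / k) `^ a = x `^ a / k `^ a.
Proof. by move=> x0 k0; rewrite powRM ?powR_V// invr_ge0 ltW. Qed.

Lemma ln_lt_id x : 0 < x -> ln x <= x.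
Proof.
move=> x0; have := @le_ln1Dx R (x - 1).
have -> : 1 + (x - 1) = x by ring.
lra.
Qed.

(** The power 1/2 is chosen because the sum of k^(-1/2) up to x is O(x^(1/2)), see [sum_sqrt]. *)
Lemma powR_gt1_ln u a : 1 <= u -> 0 <= a -> ln (1 + u `^ a) <= (1 + 2 * a) * u `^ 2^-1.
Proof.
move=> u1 a0; have u0 : 0 < u by lra.
have ua1 : 1 <= u `^ a by rewrite -[leLHS](powRr0 u) ler_powR//; lra.
have h1 : 1 <= u `^ 2^-1 by rewrite -[leLHS](powRr0 u) ler_powR//; lra.
apply: (@le_trans _ _ (ln (2 * u `^ a))).
  by rewrite ler_ln ?posrE; lra.
rewrite lnM ?posrE ?powR_gt0// ln_powR.
have -> : ln u = 2 * ln (u `^ 2^-1) by rewrite ln_powR; field.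
have := ln_lt_id (powR_gt0 2^-1 u0).
have : ln 2 <= 1 :> R by have := @le_ln1Dx R 1; rewrite -[1 + 1]/2; lra.
nra.
Qed.

(** A discrete form of the integral of t^-a, so that the tail telescopes. With y = 1 / (k + 2) it
    reduces to (1 - y)^(1 - a) >= 1 + (a - 1) y, which follows from ln(1 - y) <= -y. *)
Lemma pseries_step a k : 1 < a ->
  (a - 1) * k.+2%:R `^ (- a) <= k.+1%:R `^ (1 - a) - k.+2%:R `^ (1 - a).
Proof.
move=> a1; have k2 : (0 : R) < k.+2%:R by rewrite ltr0n.
have k1 : (0 : R) < k.+1%:R by rewrite ltr0n.
pose y : R := k.+2%:R^-1.
have y0 : 0 < y by rewrite invr_gt0.
have E : k.+1%:R = k.+2%:R * (1 - y) :> R.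
  by rewrite mulrBr mulr1 mulfV ?lt0r_neq0// -[k.+2%:R]natr1 addrK.
have y1 : 0 < 1 - y by rewrite -(pmulr_rgt0 _ k2) -E.
rewrite E powRM ?(ltW k2) ?(ltW y1)//.
have -> : k.+2%:R `^ (- a) = k.+2%:R `^ (1 - a) * y.
  rewrite [in LHS](_ : - a = (1 - a) + (- 1)); last by ring.
  rewrite powRD; last by apply/implyP => _; rewrite lt0r_neq0.
  by rewrite powRN powRr1 ?ler0n.
have B : 1 + (a - 1) * y <= (1 - y) `^ (1 - a).
  rewrite /powR gt_eqF//; apply: le_trans (expR_ge1Dx _); rewrite lerD2l.
  have := @le_ln1Dx R (- y); rewrite ltrN2 => h.
  have {}h : ln (1 - y) <= - y by apply: h; lra.
  nra.
have := ler_wpM2l (powR_ge0 k.+2%:R (1 - a)) B; lra.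
Qed.

Lemma pseries_tail a m N : 1 < a -> (m <= N)%N ->
  (a - 1) * \sum_(m <= k < N) k.+2%:R `^ (- a) <= m.+1%:R `^ (1 - a).
Proof.
move=> a1 mN; rewrite mulr_sumr.
apply: (@le_trans _ _ (\sum_(m <= k < N) (- k.+2%:R `^ (1 - a) - - k.+1%:R `^ (1 - a)))).
  by apply: ler_sum => k _; have := pseries_step k a1; lra.
rewrite (telescope_sumr (fun k => - k.+1%:R `^ (1 - a)))//.
have := powR_ge0 (N.+1%:R : R) (1 - a); lra.
Qed.

Lemma sqrt_step k : k.+1%:R `^ (- 2^-1) <= 2 * (k.+1%:R `^ 2^-1 - k%:R `^ 2^-1) :> R.
Proof.
have k1 : (0 : R) < k.+1%:R by rewrite ltr0n.
rewrite powRN !powR12_sqrt ?ler0n//.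
set p := Num.sqrt k.+1%:R; set q := Num.sqrt k%:R.
have p0 : 0 < p by rewrite sqrtr_gt0.
have q0 : 0 <= q by exact: sqrtr_ge0.
have pp : p ^+ 2 = q ^+ 2 + 1 by rewrite !sqr_sqrtr ?ler0n// natr1.
rewrite -[leLHS]mul1r ler_pdivrMr//; nra.
Qed.

Lemma sum_sqrt N : \sum_(0 <= k < N) k.+1%:R `^ (- 2^-1) <= 2 * N%:R `^ 2^-1 :> R.
Proof.
apply: (@le_trans _ _ (\sum_(0 <= k < N) (2 * k.+1%:R `^ 2^-1 - 2 * k%:R `^ 2^-1))).
  by apply: ler_sum => k _; rewrite -mulrBr; exact: sqrt_step.
rewrite (telescope_sumr (fun k => 2 * k%:R `^ 2^-1))//.
have := powR_ge0 (0%:R : R) 2^-1; lra.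
Qed.

Definition logsum a x N : R := \sum_(0 <= k < N) ln (1 + (x / k.+1%:R) `^ a).

Lemma logsum_term_ge0 a x k : 0 <= ln (1 + (x / k.+1%:R) `^ a).
Proof. by rewrite ln_ge0// lerDl powR_ge0. Qed.

Lemma logsum_ge0 a x N : 0 <= logsum a x N.
Proof. by apply: sumr_ge0 => k _; exact: logsum_term_ge0. Qed.

Lemma logsum_le a x y N : 0 <= a -> 0 <= x -> x <= y -> logsum a x N <= logsum a y N.
Proof.
move=> a0 x0 xy; apply: ler_sum => k _.
have p (z : R) : 0 < 1 + z `^ a by have := powR_ge0 z a; lra.
rewrite ler_ln ?posrE// lerD2l; apply: ge0_ler_powR; rewrite ?nnegrE//.
- by rewrite divr_ge0.
- by rewrite divr_ge0// (le_trans x0).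
- by rewrite ler_wpM2r// invr_ge0.
Qed.

Lemma logsum_leN a x N M : (N <= M)%N -> logsum a x N <= logsum a x M.
Proof.
move=> NM; rewrite /logsum (big_cat_nat (leq0n N) NM) /= lerDl.
by apply: sumr_ge0 => k _; exact: logsum_term_ge0.
Qed.

(** Up to k of order x the terms are O((x / k)^(1/2)), beyond it at most (x / k)^a; both parts sum
    to O(x). *)
Lemma logsum_linear a : 1 < a -> exists2 B, 0 < B & forall x N, 0 < x -> logsum a x N <= B * x.
Proof.
move=> a1; have a0 : 0 < a by lra.
have a10 : 0 < a - 1 by lra.
exists (2 * (1 + 2 * a) + a / (a - 1)); first by rewrite addr_gt0 ?divr_gt0//; lra.
move=> x N x0.
have ta k : ln (1 + (x / k.+1%:R) `^ a) <= x `^ a * k.+1%:R `^ (- a).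
  rewrite powRN -powR_div ?(ltW x0) ?ltr0n//.
  apply: le_ln1Dx; apply: lt_le_trans (powR_ge0 _ _); lra.
pose m := Num.truncn x.
have /andP[mx xm] : m%:R <= x < m.+1%:R by apply: truncn_itv; exact: ltW.
have head M : (M <= m)%N -> logsum a x M <= (1 + 2 * a) * (2 * x).
  move=> Mm; apply: (@le_trans _ _ (\sum_(0 <= k < M) (1 + 2 * a) * (x `^ 2^-1 * k.+1%:R `^ (- 2^-1)))).
    rewrite /logsum !big_nat; apply: ler_sum => k /andP[_ kM].
    have k0 : (0 : R) < k.+1%:R by rewrite ltr0n.
    have kx : k.+1%:R <= x by apply: le_trans mx; rewrite ler_nat (leq_trans kM).
    rewrite powRN -powR_div ?(ltW x0)//; apply: powR_gt1_ln; last exact: ltW.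
    by rewrite ler_pdivlMr// mul1r.
  rewrite -mulr_sumr -mulr_sumr ler_wpM2l//; first by lra.
  have := ler_wpM2l (powR_ge0 x 2^-1) (sum_sqrt M); move=> /le_trans; apply.
  have -> : x `^ 2^-1 * (2 * M%:R `^ 2^-1) = 2 * (x `^ 2^-1 * M%:R `^ 2^-1) by ring.
  rewrite ler_pM2l//.
  have Mx : M%:R <= x by apply: le_trans mx; rewrite ler_nat.
  have : M%:R `^ 2^-1 <= x `^ 2^-1 by apply: ge0_ler_powR; rewrite ?nnegrE ?ler0n ?(ltW x0)//; lra.
  move=> /(ler_wpM2l (powR_ge0 x 2^-1)) /le_trans; apply.
  by rewrite !powR12_sqrt ?(ltW x0)// -expr2 sqr_sqrtr ?(ltW x0).
have [Nm|mN] := leqP N m.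
  apply: le_trans (head N Nm) _.
  have : 0 < a / (a - 1) * x by rewrite mulr_gt0// divr_gt0.
  lra.
rewrite /logsum (big_cat_nat (leq0n m) (ltnW mN)) /=.
have h1 := head m (leqnn m).
suff h2 : \sum_(m <= k < N) ln (1 + (x / k.+1%:R) `^ a) <= a / (a - 1) * x.
  by move: h1; rewrite /logsum; lra.
have m0 : (0 : R) < m.+1%:R by rewrite ltr0n.
(* The term k = m, with denominator m + 1, is split off because [pseries_tail] starts at m + 2. *)
rewrite big_ltn//.
have t1 : ln (1 + (x / m.+1%:R) `^ a) <= x.
  apply: le_trans (le_ln1Dx _) _; first by apply: lt_le_trans (powR_ge0 _ _); lra.
  have xm1 : x / m.+1%:R <= 1 by rewrite ler_pdivrMr// mul1r ltW.
  apply: (@le_trans _ _ (x / m.+1%:R)).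
    rewrite -[leRHS]powRr1 ?divr_ge0 ?(ltW x0) ?ler0n//.
    by apply: ger_powR; rewrite ?divr_gt0//; lra.
  by rewrite ler_pdivrMr// ler_peMr ?(ltW x0)// ler1n.
have t2 : \sum_(m.+1 <= k < N) ln (1 + (x / k.+1%:R) `^ a) <= x / (a - 1).
  rewrite big_add1.
  apply: (@le_trans _ _ (x `^ a * \sum_(m <= k < N.-1) k.+2%:R `^ (- a))).
    by rewrite mulr_sumr; apply: ler_sum => k _; exact: ta.
  have mN1 : (m <= N.-1)%N by rewrite -ltnS prednK// (leq_ltn_trans _ mN).
  have := pseries_tail a1 mN1; rewrite mulrC -ler_pdivlMr// => T.
  apply: le_trans (ler_wpM2l (powR_ge0 x a) T) _.
  rewrite mulrA ler_wpM2r ?invr_ge0 ?(ltW a10)//.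
  apply: (@le_trans _ _ (x `^ a * x `^ (1 - a))).
    rewrite ler_wpM2l ?powR_ge0// -opprB !powRN lef_pV2 ?posrE ?powR_gt0//.
    by apply: ge0_ler_powR; rewrite ?nnegrE ?ler0n ?(ltW x0) ?(ltW a10)// ltW.
  rewrite -powRD; last by apply/implyP => _; rewrite gt_eqF.
  by rewrite (_ : a + (1 - a) = 1) ?powRr1 ?(ltW x0)//; ring.
have -> : a / (a - 1) * x = x + x / (a - 1) by field; rewrite lt0r_neq0.
exact: lerD.
Qed.

(** This is the integral of ln(1 + t^-a) over t > 0, that is pi / sin(pi / a). As a supremum it
    bounds all the sums by definition, and [logsum_lower] shows that it is approached for all large
    x. *)
Definition logconst a : R := sup [set y | exists x N, 0 < x /\ y = logsum a x N / x].

Section LogConst.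
Variable a : R.
Hypothesis a1 : 1 < a.

Let has_sup_logconst : has_sup [set y | exists x N, 0 < x /\ y = logsum a x N / x].
Proof.
split; first by exists (logsum a 1 1 / 1), 1, 1%N; split.
have [B B0 hB] := logsum_linear a1; exists B => _ [x [N [x0 ->]]].
by rewrite ler_pdivrMr// hB.
Qed.

Lemma logsum_upper x N : 0 < x -> logsum a x N <= logconst a * x.
Proof.
move=> x0; rewrite -ler_pdivrMr//; apply: ub_le_sup; first by case: has_sup_logconst.
by exists x, N.
Qed.

Lemma logconst_gt0 : 0 < logconst a.
Proof.
have := @logsum_upper 1 1 ltr01; rewrite mulr1; apply: lt_le_trans.
rewrite /logsum big_nat1 divr1 powR1 ln_gt0//; have := a1; lra.
Qed.

(** Each term of the short sum is compared with m terms of the long one, all of which satisfy m x /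
    (k + 1) >= x / (N + 1). This superadditivity makes the supremum a limit. *)
Lemma logsum_super x N m : (0 < m)%N -> 0 < x ->
  m%:R * logsum a x N <= logsum a (m%:R * x) (m * N).
Proof.
move=> m0 x0; rewrite /logsum.
elim: N => [|N IH]; first by rewrite muln0 !big_nil mulr0.
rewrite big_nat_recr //= mulrDr.
have mN : (m * N <= m * N.+1)%N by rewrite leq_pmul2l.
rewrite (big_cat_nat (leq0n (m * N)) mN) /=; apply: lerD => //.
have -> : m%:R * ln (1 + (x / N.+1%:R) `^ a) = \sum_(m * N <= k < m * N.+1) ln (1 + (x / N.+1%:R) `^ a).
  by rewrite sumr_const_nat mulnS addnK mulr_natl.
rewrite !big_nat; apply: ler_sum => k /andP[_ kN].
have p (z : R) : 0 < 1 + z `^ a by have := powR_ge0 z a; lra.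
have N0 : (0 : R) < N.+1%:R by rewrite ltr0n.
have k0 : (0 : R) < k.+1%:R by rewrite ltr0n.
have mR : (0 : R) < m%:R by rewrite ltr0n.
rewrite ler_ln ?posrE// lerD2l; apply: ge0_ler_powR; rewrite ?nnegrE.
- by have := a1; lra.
- by rewrite divr_ge0 ?(ltW x0) ?(ltW N0).
- by rewrite divr_ge0 ?mulr_ge0 ?(ltW x0) ?(ltW k0) ?(ltW mR).
rewrite ler_pdivrMr// mulrAC ler_pdivlMr// [leRHS]mulrAC mulrC ler_wpM2r ?(ltW x0)//.
by rewrite -natrM ler_nat.
Qed.

Lemma logsum_lower e : 0 < e -> exists2 x1, 0 < x1 &
  forall x, x1 <= x -> exists N, (logconst a - e) * x <= logsum a x N.
Proof.
move=> e0; have e2 : 0 < e / 2 by rewrite divr_gt0.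
have [_ [x0 [N0 [x00 ->]]] h] := sup_adherent e2 has_sup_logconst.
rewrite -/(logconst a) ltr_pdivlMr// in h.
have c0 := logconst_gt0.
pose L := logsum a x0 N0.
have L0 : 0 <= L := logsum_ge0 _ _ _.
(* The second term pays for rounding x down to a multiple of [x0]. *)
exists (x0 + 2 * L / e); first by rewrite ltr_wpDr// divr_ge0 ?mulr_ge0// ltW.
move=> x xx.
have ex : 0 <= 2 * L / e by rewrite divr_ge0 ?mulr_ge0// ltW.
have xx0 : x0 <= x by lra.
have xp : 0 < x by lra.
pose m := Num.truncn (x / x0).
have /andP[m1 m2] : m%:R <= x / x0 < m.+1%:R by apply: truncn_itv; rewrite divr_ge0// ltW.
have m0 : (0 < m)%N.
  rewrite lt0n; apply/eqP => m0; move: m2; rewrite m0 ltr_pdivrMr//; lra.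
exists (m * N0)%N.
apply: (@le_trans _ _ (logsum a (m%:R * x0) (m * N0))); last first.
  apply: logsum_le; [have := a1; lra|by rewrite mulr_ge0// ltW|by rewrite -ler_pdivlMr].
apply: le_trans (logsum_super N0 m0 x00).
rewrite -/L; rewrite -/L in h.
have mx : x < (m%:R + 1) * x0 by rewrite natr1 -ltr_pdivrMr.
have : 2 * L <= e * x.
  have := ler_wpM2l (ltW e0) xx; rewrite mulrDr mulrCA mulfV ?lt0r_neq0// mulr1.
  have : 0 < e * x0 by rewrite mulr_gt0.
  lra.
have mR : (0 : R) <= m%:R by rewrite ler0n.
have [cn|cp] := leP (logconst a - e / 2) 0.
  move=> _; apply: (@le_trans _ _ 0); last by rewrite mulr_ge0.
  by rewrite mulr_le0_ge0 ?(ltW xp)//; lra.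
have h' : (logconst a - e / 2) * x0 * m%:R <= L * m%:R by rewrite ler_wpM2r// ltW.
have : (logconst a - e / 2) * x <= (logconst a - e / 2) * ((m%:R + 1) * x0).
  by rewrite ler_wpM2l// ltW.
have : (logconst a - e / 2) * ((m%:R + 1) * x0) = (logconst a - e / 2) * x0 * m%:R + (logconst a - e / 2) * x0 by ring.
lra.
Qed.

End LogConst.

Lemma ln_powR_small a (K e : R) : 0 <= a -> 0 <= K -> 0 < e ->
  exists2 x1, 1 <= x1 & forall x, x1 <= x -> K * ln (1 + x `^ a) <= e * x.
Proof.
move=> a0 K0 e0; have h2 : (0 : R) < 2^-1 by lra.
have [T0 T01 hT] := powR_large (K * (1 + 2 * a) / e) h2.
exists T0 => // x xT; have x1 : 1 <= x := le_trans T01 xT.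
have x0 : 0 < x by lra.
apply: le_trans (ler_wpM2l K0 (powR_gt1_ln x1 a0)) _.
have := hT x xT; rewrite ler_pdivrMr// => h.
have -> : e * x = e * (x `^ 2^-1 * x `^ 2^-1).
  by rewrite !powR12_sqrt ?(ltW x0)// -expr2 sqr_sqrtr ?(ltW x0).
have := ler_wpM2r (powR_ge0 x 2^-1) h; lra.
Qed.

End LogSums.

(** * Sequences with a density *)

Section Density.
Variable R : realType.
Local Notation C := R[i].
Local Notation nm := (@Normc.normc R).
Variables (rho D : R) (l : nat -> R).
Hypothesis rho0 : 0 < rho.
Hypothesis D0 : 0 < D.
Hypothesis l0 : forall k, 0 < l k.
Hypothesis lnd : nondecreasing_seq l.
Hypothesis dens : has_density rho l D.

Lemma initial_segment (r : R) : finite_set [set k | l k < r] ->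
  exists N, forall k, (k < N)%N = (l k < r).
Proof.
move=> fin; have ex : exists N, ~~ (l N < r).
  apply: contrapT => H; apply: infinite_nat; apply: sub_finite_set fin => k _ /=.
  by apply: contrapT => /negP h; apply: H; exists k.
exists (ex_minn ex); case: ex_minnP => N hN minN k; apply/idP/idP => [kN|].
  by apply: contraT => /minN; rewrite leqNgt kN.
apply: contraTT; rewrite -leqNgt => Nk; apply: contra hN; apply: le_lt_trans.
exact: lnd.
Qed.

Lemma density_count (e : R) : 0 < e -> exists2 r0, 1 <= r0 & forall r, r0 <= r ->
  exists N, [/\ forall k, (k < N)%N = (l k < r),
    (D - e) * r `^ rho <= N%:R & N%:R <= (D + e) * r `^ rho].
Proof.
move=> e0; have /fine_cvgP[h1 h2] := dens.
have h3 := cvgr_dist_lt _ _ h2 _ e0.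
have [M [_ hM]] := filterI h1 (h3 _).
exists (Num.max 1 (M + 1)); first by rewrite le_max lexx.
move=> r; rewrite ge_max => /andP[r1 rM].
have Mr : M < r by lra.
have [{}h1 {}h3] := hM r Mr.
have p0 : 0 < r `^ rho by rewrite powR_gt0//; lra.
have fin : finite_set [set k | l k < r].
  apply: contrapT => nf; move: h1; rewrite /counting_function /counting.
  case: asboolP => // _; rewrite gt0_mulye ?lte_fin ?invr_gt0//.
have [N hN] := initial_segment fin; exists N.
have cN : counting_function l r = N%:R%:E.
  rewrite /counting_function /counting; case: asboolP => // _; congr (_%:R%:E).
  apply: card_fset_set; rewrite (_ : [set k | l k < r] = `I_N)//.
  by apply/seteqP; split => k /=; rewrite hN.
move: h3; rewrite /= cN -EFinM /= ltr_distlC.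
rewrite -(ltr_pM2r p0) -mulrA mulVf ?gt_eqF// mulr1 => /andP[a1].
rewrite -(ltr_pM2r p0) -[in X in X -> _]mulrA mulVf ?gt_eqF// mulr1 => a2.
by split => //; apply: ltW.
Qed.

Lemma counting_finite (r : R) : exists N, forall k, (k < N)%N = (l k < r).
Proof.
have [r0 _ h] := density_count ltr01.
apply: initial_segment; have [|N [hN _ _]] := h (Num.max r0 r); first by rewrite le_max lexx.
apply: (@sub_finite_set _ _ `I_N); last exact: finite_II.
by move=> k /= kr; rewrite hN lt_max kr orbT.
Qed.

Lemma powR_gt1 (x s : R) : 1 < x -> 0 < s -> 1 < x `^ s.
Proof.
move=> x1 s0; have h : 1 `^ s = 1 :> R by rewrite powR1.
rewrite -[ltLHS]h; apply: gt0_ltr_powR; rewrite ?nnegrE//; lra.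
Qed.

Lemma density_power e : 0 < e -> exists K0, forall k, (K0 <= k)%N ->
  k.+1%:R <= (D + e) * l k `^ rho /\ (D - e) * l k `^ rho <= k%:R.
Proof.
move=> e0; have e2 : 0 < e / 2 by lra.
have [r1 r11 h1] := density_count e2; have [r2 r21 h2] := density_count e0.
have [N hN] := counting_finite (Num.max r1 r2).
exists N => k Nk; have := hN k; rewrite ltnNge Nk /= => /esym/negbT; rewrite -leNgt ge_max => /andP[kr1 kr2].
split; last first.
  have [M [hM lo _]] := h2 _ kr2; apply: le_trans lo _; rewrite ler_nat leqNgt.
  by apply/negP; rewrite hM ltxx.
(* Counting is strict, so the radius l k does not count the index k itself. The slightly larger
   radius q l k does, and q^rho turns D + e / 2 into D + e. *)
pose q := ((D + e) / (D + e / 2)) `^ rho^-1.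
have hD := D0; have De : 0 < D + e / 2 by lra.
have q1 : 1 < q.
  by apply: powR_gt1; rewrite ?invr_gt0// ltr_pdivlMr//; lra.
have qr : q `^ rho = (D + e) / (D + e / 2).
  rewrite -powRrM mulVf ?gt_eqF// powRr1// divr_ge0//; lra.
have qk : l k < q * l k by rewrite ltr_pMl.
have [M [hM _ up]] := h1 (q * l k) (le_trans kr1 (ltW qk)).
apply: (@le_trans _ _ M%:R); first by rewrite ler_nat hM.
apply: le_trans up _; rewrite powRM ?(ltW (l0 k))//; last by lra.
by rewrite qr mulrA mulrCA mulfV ?gt_eqF// mulr1.
Qed.

Variable n : nat.
Hypothesis n0 : (0 < n)%N.

Lemma powR_ratio (r x : R) : 0 <= r -> 0 < x -> (r / x) ^+ n = (r `^ rho / x `^ rho) `^ (n%:R / rho).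
Proof.
move=> r0 x0; rewrite -powR_div// -powRrM mulrCA mulfV ?gt_eqF// mulr1 powR_mulrn//.
by rewrite divr_ge0// ltW.
Qed.

(** In terms of l k ^ rho, which is about k / D, the sum is a logarithmic sum at x = (D - e) r^rho;
    the first [K0] indices, where this comparison may fail, cost only O(ln x). *)
Lemma product_lower c e : 0 < e -> e < D -> 0 < c - e -> c = logconst (n%:R / rho) -> 1 < n%:R / rho ->
  exists2 r1, 1 <= r1 & forall r, r1 <= r -> exists K,
    (c - 2 * e) * (D - e) * r `^ rho <= \sum_(0 <= k < K) ln (1 + (r / l k) ^+ n).
Proof.
set a := n%:R / rho => e0 eD ce cE a1.
have De : 0 < D - e by lra.
have a0 : 0 <= a by lra.
have [K0 hK0] := density_power e0.
have [x1 x10 hx1] := logsum_lower a1 e0.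
have [x2 x20 hx2] := ln_powR_small a0 (ler0n R K0) e0.
have [r1 r11 hr1] := powR_large (Num.max x1 x2 / (D - e)) rho0.
exists r1 => // r rr; have r0 : 0 < r by lra.
pose x := (D - e) * r `^ rho.
have : Num.max x1 x2 <= x by rewrite /x mulrC -ler_pdivrMr// hr1.
rewrite ge_max => /andP[xx1 xx2].
have [K1 hK] := hx1 x xx1; rewrite -cE in hK.
pose K := maxn K0 K1.
have {}hK : (c - e) * x <= logsum a x K by apply: le_trans hK _; rewrite logsum_leN// leq_maxr.
exists K; have K0K : (K0 <= K)%N by rewrite leq_maxl.
have t0 k : 0 <= ln (1 + (r / l k) ^+ n).
  by rewrite ln_ge0// lerDl exprn_ge0// divr_ge0// ltW.
have x0 : 0 < x by lra.
have h1 : \sum_(K0 <= k < K) ln (1 + (x / k.+1%:R) `^ a) <= \sum_(K0 <= k < K) ln (1 + (r / l k) ^+ n).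
  rewrite !big_nat; apply: ler_sum => k /andP[kK _]; rewrite (powR_ratio (ltW r0) (l0 k)).
  have k1 : (0 : R) < k.+1%:R by rewrite ltr0n.
  have lk : 0 < l k `^ rho by rewrite powR_gt0.
  have p (y : R) : 0 < 1 + y `^ a by have := powR_ge0 y a; lra.
  rewrite ler_ln ?posrE// lerD2l; apply: ge0_ler_powR; rewrite ?nnegrE//.
  - by rewrite divr_ge0// ltW.
  - by rewrite divr_ge0 ?powR_ge0.
  rewrite ler_pdivrMr// mulrAC ler_pdivlMr// /x mulrAC [leRHS]mulrC ler_wpM2r ?powR_ge0//.
  by have [_ /le_trans->] := hK0 k kK; rewrite // ler_nat.
have h2 : \sum_(0 <= k < K0) ln (1 + (x / k.+1%:R) `^ a) <= e * x.
  apply: le_trans (hx2 x xx2); rewrite mulr_natl -[in leRHS](subn0 K0) -sumr_const_nat.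
  apply: ler_sum => k _; have p (y : R) : 0 < 1 + y `^ a by have := powR_ge0 y a; lra.
  rewrite ler_ln ?posrE// lerD2l; apply: ge0_ler_powR; rewrite ?nnegrE//.
  - by rewrite divr_ge0// ltW.
  - exact: ltW.
  by rewrite ler_pdivrMr ?ltr0n// ler_peMr ?(ltW x0)// ler1n.
move: hK; rewrite /logsum (big_cat_nat (leq0n K0) K0K) /= (big_cat_nat (leq0n K0) K0K) /= => hK.
have : 0 <= \sum_(0 <= k < K0) ln (1 + (r / l k) ^+ n) by apply: sumr_ge0 => k _.
have -> : (c - 2 * e) * (D - e) * r `^ rho = (c - e) * x - e * x by rewrite /x; ring.
lra.
Qed.

Lemma dense_not_zero_set (w : C) (lam : nat -> C) : rho < n%:R -> n.-primitive_root w ->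
  (forall k, nm (lam k) = l k) -> (forall k, lam k ^+ n = (l k ^+ n)%:C) ->
  n%:R < logconst (n%:R / rho) * D -> ~ zero_set rho lam.
Proof.
move=> rn pw lamE lamn big zs; have hD := D0.
have a1 : 1 < n%:R / rho by rewrite ltr_pdivlMr// mul1r.
set c := logconst _ in big.
have c0 : 0 < c := logconst_gt0 a1.
have [C0 up] := zero_set_bound (ltW rho0) rn pw l0 lamE lamn counting_finite zs.
have nR : (0 : R) < n%:R by rewrite ltr0n.
(* Comparing the two bounds for large r leads to (c - 2 e) (D - e) <= n (1 + e) + e, which is
   incompatible with e M <= c D - n. *)
pose M := 2 * (c + 2 * D + 3 * n%:R + 1).
have M0 : 0 < M by rewrite /M; lra.
pose e := Num.min ((c * D - n%:R) / M) (Num.min (D / 2) (c / 4)).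
have e0 : 0 < e by rewrite !lt_min !divr_gt0//; lra.
have : e <= e by [].
rewrite {2}/e !le_min => /andP[]; rewrite ler_pdivlMr// => eM /andP[eD ec].
have [||r1 r11 lo] := @product_lower c e e0 _ _ erefl a1; [lra|lra|].
pose q := 1 + e.
pose s := q `^ rho^-1.
have s1 : 1 < s.
  by apply: powR_gt1; rewrite ?invr_gt0// /q; lra.
have sr : s `^ rho = q by rewrite -powRrM mulVf ?gt_eqF// powRr1// /q; lra.
have [r2 r21 hr2] := powR_large (C0 / e) rho0.
pose r := Num.max r1 (Num.max r2 (4 / (s - 1))).
have : r <= r by [].
rewrite {1}/r !ge_max => /andP[rr1 /andP[rr2 rr3]].
have [K {}lo] := lo r rr1; have {}up := up r K.
have r0 : 0 <= r by lra.
have {}up := le_trans lo (up r0).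
have h : (r + 4) `^ rho <= q * r `^ rho.
  rewrite -sr -powRM//; last by lra.
  apply: ge0_ler_powR; rewrite ?nnegrE; [exact: ltW|lra|by rewrite mulr_ge0//; lra|].
  by move: rr3; rewrite ler_pdivrMr ?subr_gt0//; lra.
have h2 : C0 <= e * r `^ rho by have := hr2 r rr2; rewrite ler_pdivrMr// mulrC.
have X1 : 1 <= r `^ rho by rewrite -[leLHS](powRr0 r) ler_powR; [|lra|exact: ltW].
have {}h : n%:R * (r + 4) `^ rho <= n%:R * (q * r `^ rho) by rewrite ler_wpM2l// ltW.
have {}up : ((c - 2 * e) * (D - e)) * r `^ rho <= (n%:R * q + e) * r `^ rho by lra.
rewrite ler_pM2r in up; last by lra.
move: up eM; rewrite /q /M; nra.
Qed.

End Density.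

(** * A product decaying on the negative ray *)

Section Antiray.
Variable R : realType.
Implicit Types (x y u e s t a v X Y : R) (k m n N : nat).

(* |w^2| times the product of |(k + 1)^2 - w^2|^2, k < N, for w = X + iY: up to
   the last factors it is periodic in X, as the sine is. *)
Definition shifted Y N X : R :=
  (X ^+ 2 + Y ^+ 2) * \prod_(0 <= k < N)
    (((k.+1%:R - X) ^+ 2 + Y ^+ 2) * ((k.+1%:R + X) ^+ 2 + Y ^+ 2)).

Lemma shifted_ge0 Y N X : 0 <= shifted Y N X.
Proof.
have sq (u v : R) : 0 <= u ^+ 2 + v ^+ 2 by rewrite addr_ge0 ?sqr_ge0.
by rewrite mulr_ge0//; apply: prodr_ge0 => k _; rewrite mulr_ge0.
Qed.

Lemma shifted_step Y N X :
  shifted Y N (X + 1) * ((N%:R - X) ^+ 2 + Y ^+ 2) =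
  shifted Y N X * ((N.+1%:R + X) ^+ 2 + Y ^+ 2).
Proof.
rewrite /shifted; elim: N => [|N IH]; first by rewrite !big_nil; ring.
rewrite !big_nat_recr//=; move: IH.
set p := \prod_(_ <= _ < _) _; set q := \prod_(_ <= _ < _) _.
rewrite -[N.+2%:R]natr1 -[N.+1%:R]natr1; set M := N%:R => IH.
transitivity ((((X + 1) ^+ 2 + Y ^+ 2) * p * ((M - X) ^+ 2 + Y ^+ 2)) *
  (((M + 1 + (X + 1)) ^+ 2 + Y ^+ 2) * ((M + 1 - X) ^+ 2 + Y ^+ 2))); first by ring.
by rewrite IH; ring.
Qed.

(** By [shifted_step] a unit shift multiplies the product by a quotient of two extreme factors,
    which is at most 1 + e <= exp(e) once N is large compared with X + m. *)
Lemma shifted_growth Y N X m e : 0 < e -> e <= 1 -> 0 <= X ->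
  X + m%:R + 3 * (1 + 2 * (X + m%:R)) / e <= N%:R ->
  shifted Y N (X + m%:R) <= expR (e * m%:R) * shifted Y N X.
Proof.
move=> e0 e1 X0; elim: m => [|m IH]; first by rewrite mulr0 expR0 mul1r addr0.
rewrite -natr1 => hN.
have mR : (0 : R) <= m%:R by rewrite ler0n.
have {}IH : shifted Y N (X + m%:R) <= expR (e * m%:R) * shifted Y N X.
  apply: IH; apply: le_trans hN; rewrite lerD//; first by rewrite addrA lerDl.
  by rewrite ler_pM2r ?invr_gt0// ler_pM2l//; lra.
set Z := X + m%:R in IH *; have Z0 : 0 <= Z by rewrite addr_ge0.
have {}hN : Z + 3 * (1 + 2 * Z) / e <= N%:R.
  apply: le_trans hN; rewrite lerD//; first by rewrite /Z; lra.
  by rewrite ler_pM2r ?invr_gt0// ler_pM2l// /Z; lra.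
rewrite addrA -/Z; set M := N%:R in hN.
have {}hN : 3 * (1 + 2 * Z) <= e * (M - Z).
  by rewrite [leRHS]mulrC -ler_pdivrMr//; lra.
have MZ : 0 < M - Z by rewrite -(pmulr_rgt0 _ e0); lra.
have h2 : (M + 1 + Z) ^+ 2 + Y ^+ 2 <= (1 + e) * ((M - Z) ^+ 2 + Y ^+ 2).
  have hh : M + 1 + Z <= (1 + e / 3) * (M - Z) by lra.
  have h3 : (M + 1 + Z) ^+ 2 <= ((1 + e / 3) * (M - Z)) ^+ 2.
    by rewrite ler_sqr ?nnegrE// ?mulr_ge0//; lra.
  have h4 : (1 + e / 3) ^+ 2 <= 1 + e by nra.
  have := ler_wpM2r (sqr_ge0 (M - Z)) h4; rewrite exprMn in h3.
  have : 0 <= e * Y ^+ 2 by rewrite mulr_ge0 ?sqr_ge0// ltW.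
  lra.
have pM : 0 < (M - Z) ^+ 2 + Y ^+ 2 by rewrite ltr_pwDl ?sqr_ge0// exprn_gt0.
rewrite -(ler_pM2r pM) shifted_step -natr1 -/M.
apply: le_trans (ler_wpM2l (shifted_ge0 _ _ _) h2) _.
rewrite mulrA ler_pM2r//.
apply: le_trans (ler_wpM2r _ IH) _; first by lra.
rewrite mulrAC ler_wpM2r ?shifted_ge0// [in leRHS]mulrDr mulr1 expRD ler_wpM2l ?expR_ge0//.
exact: expR_ge1Dx.
Qed.

(** The square of |1 - w^2 / (k + 1)^2| for |w| = x and Re w^2 = x^2 (1 - v); thus v = 0 means that
    w is real. *)
Definition quad x v k : R := (1 - (x / k.+1%:R) ^+ 2) ^+ 2 + 2 * (x / k.+1%:R) ^+ 2 * v.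

(** The full product is |sin(pi w) / (pi w)|^2 and grows only with Im w = Y. The real part is
    shifted into [0, 1] by [shifted_growth]; there |w| <= 1 + Y, and replacing every factor by its
    largest value at that modulus is enough. *)
Lemma quad_prod_le x v e : 0 < e -> e <= 1 -> 1 <= x -> 0 <= v -> v <= 2 ->
  exists N0, forall N, (N0 <= N)%N ->
  \prod_(0 <= k < N) quad x v k <=
  4 * expR (e * x + 2 * logconst 2 * (1 + x * Num.sqrt (v / 2))).
Proof.
move=> e0 e1 x1 v0 v2; have x0 : 0 < x by lra.
pose Y := x * Num.sqrt (v / 2); pose X := x * Num.sqrt (1 - v / 2).
have Y2 : Y ^+ 2 = x ^+ 2 * (v / 2) by rewrite exprMn sqr_sqrtr//; lra.
have X2 : X ^+ 2 = x ^+ 2 * (1 - v / 2) by rewrite exprMn sqr_sqrtr//; lra.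
have Y0 : 0 <= Y by rewrite mulr_ge0 ?sqrtr_ge0// ltW.
have X0 : 0 <= X by rewrite mulr_ge0 ?sqrtr_ge0// ltW.
pose m := Num.truncn X.
have /andP[mX Xm] : m%:R <= X < m.+1%:R by apply: truncn_itv.
pose X' := X - m%:R.
have X'0 : 0 <= X' by rewrite subr_ge0.
have X'1 : X' <= 1 by rewrite /X'; move: Xm; rewrite -natr1; lra.
have XE : X = X' + m%:R by rewrite /X'; ring.
pose s := Num.sqrt (X' ^+ 2 + Y ^+ 2).
have s2 : s ^+ 2 = X' ^+ 2 + Y ^+ 2 by rewrite sqr_sqrtr// addr_ge0 ?sqr_ge0.
have s0 : 0 <= s by exact: sqrtr_ge0.
have s1 : s <= 1 + Y.
  rewrite -ler_sqr ?nnegrE//; last by lra.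
  by rewrite s2; nra.
pose B := X + 3 * (1 + 2 * X) / e.
have B0 : 0 <= B by rewrite addr_ge0// divr_ge0 ?(ltW e0)//; lra.
exists (Num.truncn B).+1 => N NB.
have {}NB : X' + m%:R + 3 * (1 + 2 * (X' + m%:R)) / e <= N%:R.
  rewrite -XE -/B; apply: (@le_trans _ _ (Num.truncn B).+1%:R); last by rewrite ler_nat.
  by apply: ltW; have /andP[] := truncn_itv B0.
have G := shifted_growth Y e0 e1 X'0 NB; rewrite -XE in G.
pose P : R := \prod_(0 <= k < N) k.+1%:R ^+ 4.
have P0 : 0 < P by apply: prodr_gt0 => k _; rewrite exprn_gt0// ltr0n.
have k0 k : k.+1%:R != 0 :> R by rewrite pnatr_eq0.
have E1 : \prod_(0 <= k < N) quad x v k * P * x ^+ 2 = shifted Y N X.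
  rewrite /shifted Y2 X2 mulrC; congr (_ * _); first by ring.
  rewrite -big_split; apply: eq_bigr => k _ /=.
  have := k0 k; rewrite /quad; move: (k.+1%:R : R) => K Kn.
  transitivity ((K ^+ 2 - x ^+ 2) ^+ 2 + 2 * x ^+ 2 * K ^+ 2 * v); first by field.
  transitivity ((K ^+ 2 + X ^+ 2 + x ^+ 2 * (v / 2)) ^+ 2 - 4 * K ^+ 2 * X ^+ 2); last by ring.
  by rewrite X2; field.
have E2 : shifted Y N X' <= s ^+ 2 * (P * expR (2 * logconst 2 * s)).
  rewrite /shifted -s2 ler_wpM2l ?sqr_ge0//.
  apply: (@le_trans _ _ (P * (\prod_(0 <= k < N) (1 + (s / k.+1%:R) `^ 2)) ^+ 2)).
    rewrite -prodrXl -big_split; apply: ler_prod => k _ /=.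
    have sq (p q : R) : 0 <= p ^+ 2 + q ^+ 2 by rewrite addr_ge0 ?sqr_ge0.
    apply/andP; split; first by rewrite mulr_ge0.
    rewrite powR_mulrn ?divr_ge0//.
    have := k0 k; move: (k.+1%:R : R) => K Kn.
    rewrite [leRHS](_ : _ = (K ^+ 2 + s ^+ 2) ^+ 2); last by field.
    rewrite s2 -subr_ge0.
    rewrite [leRHS](_ : _ = (2 * K * X') ^+ 2); last by ring.
    exact: sqr_ge0.
  rewrite ler_pM2l//.
  have [->|sp] := eqVneq s 0.
    rewrite mulr0 expR0 big1 ?expr1n// => k _.
    by rewrite mul0r powR0 ?addr0// pnatr_eq0.
  have {}sp : 0 < s by rewrite lt_neqAle eq_sym sp.
  have p (z : R) : 0 < 1 + z `^ 2 by have := powR_ge0 z 2; lra.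
  have -> : \prod_(0 <= k < N) (1 + (s / k.+1%:R) `^ 2) = expR (logsum 2 s N).
    rewrite /logsum expR_sum; apply: eq_bigr => k _; by rewrite lnK// posrE.
  rewrite -expRM_natl ler_expR -mulrA ler_pM2l//.
  by apply: logsum_upper => //; lra.
have xs : s ^+ 2 <= 4 * x ^+ 2.
  have Yx : Y <= x.
    rewrite -ler_sqr ?nnegrE ?(ltW x0)// Y2; have := sqr_ge0 x; nra.
  have : s ^+ 2 <= (2 * x) ^+ 2 by rewrite ler_sqr ?nnegrE; lra.
  by rewrite exprMn; lra.
have Px : 0 < P * x ^+ 2 by rewrite mulr_gt0// exprn_gt0.
rewrite -(ler_pM2r Px) mulrA E1; apply: le_trans G _.
apply: le_trans (ler_wpM2l (expR_ge0 _) E2) _.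
apply: (@le_trans _ _ (expR (e * x) * (4 * x ^+ 2 * (P * expR (2 * logconst 2 * (1 + Y)))))); last first.
  by rewrite expRD le_eqVlt; apply/orP; left; apply/eqP; ring.
have c2 : 0 < logconst (2 : R) by apply: logconst_gt0; lra.
have xX : m%:R <= x.
  apply: le_trans mX _; rewrite -ler_sqr ?nnegrE ?(ltW x0)// X2; have := sqr_ge0 x; nra.
apply: ler_pM; rewrite ?expR_ge0//.
- by rewrite mulr_ge0 ?sqr_ge0// mulr_ge0 ?expR_ge0// ltW.
- by rewrite ler_expR ler_pM2l.
apply: ler_pM => //; first by rewrite sqr_ge0.
  by rewrite mulr_ge0 ?expR_ge0// ltW.
by rewrite ler_pM2l// ler_expR ler_pM2l// mulr_gt0.
Qed.

(* On the ray where u^a is replaced by -u^a the product with exponent a < 2 is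
   dominated factor by factor by the one with exponent 2, a sine; the factors with
   1/3 <= u <= 1/2 gain a fixed ratio. *)
Lemma quad_compare a : 1 < a -> a < 2 -> exists h, [/\ 0 < h, h <= 2^-1 &
  forall u v, 0 <= u -> 0 <= v -> v <= h ->
  let A := (1 - u `^ a) ^+ 2 + 2 * u `^ a * v in
  let B := (1 - u ^+ 2) ^+ 2 + 2 * u ^+ 2 * (4 * v) in
  A <= B /\ (3^-1 <= u -> u <= 2^-1 -> A <= (1 - h) * B)].
Proof.
move=> a1 a2.
have pw2 : (2^-1 : R) `^ (2 - a) < 1.
  have h1 : (1 : R) `^ (2 - a) = 1 by rewrite powR1.
  by rewrite -[ltRHS]h1; apply: gt0_ltr_powR; rewrite ?nnegrE; lra.
pose g := (1 - (2^-1 : R) `^ (2 - a)) / 9.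
have g0 : 0 < g by rewrite /g; lra.
have g1 : g <= 9^-1 by rewrite /g; have := powR_ge0 (2^-1 : R) (2 - a); lra.
exists (g / 4); split; [lra|lra|move=> u v u0 v0 vh A B].
have [uz|un] := eqVneq u 0.
  rewrite /A /B uz powR0; last by rewrite gt_eqF//; lra.
  by split => [|h]; rewrite ?expr0n /=; [lra|move: h; lra].
have up : 0 < u by rewrite lt_neqAle eq_sym un.
pose p := u `^ a; pose q := u `^ (2 - a).
have p0 : 0 < p by rewrite powR_gt0.
have q0 : 0 < q by rewrite powR_gt0.
have pq : u ^+ 2 = p * q.
  rewrite /p /q -powRD; last by apply/implyP => _; rewrite gt_eqF.
  by rewrite addrC subrK -powR_mulrn ?ltW.
have [u2|u2] := leP u 2^-1.
  have qg : q <= 1 - 9 * g.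
    rewrite /g (_ : 1 - _ = 2^-1 `^ (2 - a)); last by field.
    by apply: ge0_ler_powR; rewrite ?nnegrE; lra.
  have p1 : p <= 2^-1.
    rewrite /p -[leRHS]powRr1; last by lra.
    apply: (@le_trans _ _ (2^-1 `^ a)); first by apply: ge0_ler_powR; rewrite ?nnegrE; lra.
    by apply: ger_powR; lra.
  rewrite /A /B -/p pq.
  have pv : 0 <= p * v by rewrite mulr_ge0// ltW.
  have pqv : 0 <= p * q * v by rewrite mulr_ge0// mulr_ge0// ltW.
  have key : p * (9 * g) <= (1 - p * q) ^+ 2 - (1 - p) ^+ 2.
    rewrite [leRHS](_ : _ = p * ((1 - q) * (2 - p - p * q))); last by ring.
    by rewrite ler_pM2l//; have : p * q <= 2^-1 * 1 by [apply: ler_pM; lra]; nra.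
  have pvg : p * v <= p * (g / 4) by rewrite ler_pM2l.
  split; first by lra.
  move=> u3 _.
  have pq9 : 9^-1 <= p * q.
    by rewrite -pq; nra.
  have p9 : 9^-1 <= p by apply: le_trans pq9 _; rewrite ger_pMr//; lra.
  have b1 : (1 - p * q) ^+ 2 <= 1.
    have : p * q <= 1 by rewrite -[1]mulr1; apply: ler_pM; lra.
    nra.
  have : g / 4 * ((1 - p * q) ^+ 2 + 2 * (p * q) * (4 * v)) <= g / 4 * 2.
    rewrite ler_pM2l; last by lra.
    have : p * q * v <= 2^-1 * (36^-1).
      apply: ler_pM => //; first by rewrite mulr_ge0// ltW.
        by rewrite -[2^-1]mulr1; apply: ler_pM; lra.
      lra.
    lra.
  nra.
split; last by [].
have h1 : (1 - p) ^+ 2 <= (1 - u ^+ 2) ^+ 2.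
  rewrite -sqrrN -[leRHS]sqrrN.
  have [u1|u1] := leP 1 u.
    have p1 : 1 <= p by rewrite /p -[leLHS](powRr0 u) ler_powR//; lra.
    have p2 : p <= u ^+ 2 by rewrite /p -powR_mulrn// ler_powR//; lra.
    by rewrite ler_sqr ?nnegrE; lra.
  have p1 : p <= 1 by rewrite /p -[leRHS](powRr0 u) ger_powR//; lra.
  have p2 : u ^+ 2 <= p by rewrite /p -powR_mulrn// ger_powR//; lra.
  have : 0 <= u ^+ 2 by exact: sqr_ge0.
  nra.
(* The reason for [4 * v] in [B]: for u > 1/2 the power u^a may exceed u^2, but by no more than a
   factor 4. *)
have h2 : p <= 4 * u ^+ 2.
  have [u1|u1] := leP 1 u.
    have p2 : p <= u ^+ 2 by rewrite /p -powR_mulrn// ler_powR//; lra.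
    have := sqr_ge0 u; lra.
  have p1 : p <= 1 by rewrite /p -[leRHS](powRr0 u) ger_powR//; lra.
  nra.
have : p * v <= 4 * u ^+ 2 * v by rewrite ler_wpM2r.
by rewrite /A /B -/p; lra.
Qed.

(** About x of the indices satisfy 1/3 <= x / (k + 1) <= 1/2 and each contributes a factor 1 - h,
    together at most exp(-h (x - 1)). For small v the dominating sine product is at most exp(h x /
    2) up to a constant, and [x1] absorbs the constants. *)
Lemma antiray_decay a : 1 < a -> a < 2 -> exists ka d x1 : R, [/\ 0 < ka, 0 < d, 1 <= x1 &
  forall x v, x1 <= x -> 0 <= v -> v <= d -> exists N0, forall N, (N0 <= N)%N ->
  \prod_(0 <= k < N) ((1 - (x / k.+1%:R) `^ a) ^+ 2 + 2 * (x / k.+1%:R) `^ a * v)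
  <= expR (- (ka * x))].
Proof.
move=> a1 a2; have [h [h0 h1 cmp]] := quad_compare a1 a2.
have c2 : 0 < logconst (2 : R) by apply: logconst_gt0; lra.
set c := logconst 2 in c2.
pose b := Num.min 1 (h / (8 * c)).
have b0 : 0 < b by rewrite lt_min ltr01 divr_gt0//; lra.
pose d := Num.min h (b ^+ 2 / 2).
have d0 : 0 < d by rewrite lt_min h0 divr_gt0// exprn_gt0.
pose x1 := 1 + 8 / h * (h + 2 * c + 4).
exists (h / 8), d, x1; split => //; first by lra.
  by rewrite lerDl mulr_ge0 ?divr_ge0//; lra.
move=> x v xx1 v0; rewrite le_min => /andP[vh vb].
have x1h : h + 2 * c + 4 <= h / 8 * x.
  rewrite -[leLHS](mulKf (x := 8 / h)); last by rewrite mulf_neq0 ?invr_eq0 ?pnatr_eq0// gt_eqF.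
  by rewrite invf_div ler_pM2l ?divr_gt0//; move: xx1; rewrite /x1; lra.
have x1' : 1 <= x.
  apply: le_trans xx1; rewrite lerDl mulr_ge0 ?divr_ge0//; lra.
have x0 : 0 < x by lra.
have h41 : h / 4 <= 1 by lra.
have h40 : 0 < h / 4 by lra.
have v4 : 0 <= 4 * v by lra.
have v42 : 4 * v <= 2 by have : b ^+ 2 <= 1 by [rewrite expr_le1 ?(ltW b0)// ge_min lexx]; lra.
have [N0 hN0] := quad_prod_le h40 h41 x1' v4 v42.
pose p1 := Num.truncn (2 * x); pose p2 := Num.truncn (3 * x).
have /andP[p1a p1b] : p1%:R <= 2 * x < p1.+1%:R by apply: truncn_itv; lra.
have /andP[p2a p2b] : p2%:R <= 3 * x < p2.+1%:R by apply: truncn_itv; lra.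
have p12 : (p1 <= p2)%N by rewrite -ltnS -(ltr_nat R); lra.
exists (maxn N0 p2) => N; rewrite geq_max => /andP[N0N p2N].
have {}hN0 := hN0 N N0N.
have u0 k : 0 <= x / k.+1%:R by rewrite divr_ge0// ltW.
pose g k : R := if (p1 <= k < p2)%N then 1 - h else 1.
have A0 k : 0 <= (1 - (x / k.+1%:R) `^ a) ^+ 2 + 2 * (x / k.+1%:R) `^ a * v.
  by rewrite addr_ge0 ?sqr_ge0// mulr_ge0// mulr_ge0// powR_ge0.
apply: (@le_trans _ _ (\prod_(0 <= k < N) (g k * quad x (4 * v) k))).
  apply: ler_prod => k _; rewrite A0 /=.
  have [c1 c3] := cmp _ v (u0 k) v0 vh.
  rewrite /g /quad; case: ifP => [/andP[k1 k2]|_]; last by rewrite mul1r.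
  have kp : (0 : R) < k.+1%:R by rewrite ltr0n.
  apply: c3.
    have : k.+1%:R <= p2%:R :> R by rewrite ler_nat.
    by rewrite ler_pdivlMr//; lra.
  have : p1.+1%:R <= k.+1%:R :> R by rewrite ler_nat.
  by rewrite ler_pdivrMr//; lra.
have gE : \prod_(0 <= k < N) g k = (1 - h) ^+ (p2 - p1).
  rewrite (big_cat_nat (leq0n p2) p2N) /= (big_cat_nat (leq0n p1) p12) /=.
  rewrite [X in X * _ * _]big_nat_cond big1; last first.
    by move=> k /andP[/andP[_ kp] _]; rewrite /g leqNgt kp.
  rewrite [X in _ * X]big_nat_cond [X in _ * X]big1; last first.
    by move=> k /andP[/andP[kp _] _]; rewrite /g [(k < p2)%N]ltnNge kp andbF.
  rewrite mul1r mulr1 -prodr_const_nat big_nat_cond [RHS]big_nat_cond.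
  by apply: eq_bigr => k; rewrite andbT /g => ->.
rewrite big_split /= gE.
have gl : (1 - h) ^+ (p2 - p1) <= expR (- h * (x - 1)).
  apply: (@le_trans _ _ (expR (- h) ^+ (p2 - p1))).
    by apply: lerXn2r; rewrite ?nnegrE ?expR_ge0//; [lra|exact: expR_ge1Dx].
  rewrite -expRM_natl ler_expR mulrC !mulNr lerN2 ler_pM2l//.
  by rewrite natrB//; move: p2b p1a; rewrite -natr1; lra.
have q0 : 0 <= \prod_(0 <= k < N) quad x (4 * v) k.
  by apply: prodr_ge0 => k _; rewrite /quad addr_ge0 ?sqr_ge0// (@mulr_ge0 _ (2 * _))// mulr_ge0// sqr_ge0.
apply: le_trans (ler_pM _ q0 gl hN0) _; first by rewrite exprn_ge0//; lra.
have sb : Num.sqrt (4 * v / 2) <= b.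
  rewrite -(ler_sqr (x := Num.sqrt _)) ?nnegrE ?sqrtr_ge0 ?(ltW b0)// sqr_sqrtr; lra.
have e4 : 4 <= expR 4 :> R by apply: le_trans (expR_ge1Dx _); lra.
apply: le_trans (ler_wpM2l (expR_ge0 _) (ler_wpM2r (expR_ge0 _) e4)) _.
rewrite -!expRD ler_expR.
have cb : c * (x * Num.sqrt (4 * v / 2)) <= h / 8 * x.
  have : Num.sqrt (4 * v / 2) <= h / (8 * c) by apply: le_trans sb _; rewrite ge_min lexx orbT.
  move=> /(ler_wpM2l (ltW (mulr_gt0 c2 x0))).
  rewrite [X in _ <= X](_ : _ = h / 8 * x); first by rewrite mulrA.
  by field; rewrite gt_eqF.
rewrite -/c; move: (Num.sqrt _) cb => t cb; clear -cb x1h h0 x0; nra.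
Qed.

End Antiray.

(** * Infinite products *)

Section InfiniteProduct.
Variable R : realType.
Local Notation C := R[i].
Local Notation nm := (@Normc.normc R).
Implicit Types (z w : C) (k m n K N : nat).

Lemma nm_prod_sub1 (x : nat -> C) m N : (m <= N)%N ->
  nm (\prod_(m <= k < N) x k - 1) <= expR (\sum_(m <= k < N) nm (x k - 1)) - 1.
Proof.
elim: N => [|N IH]; first by rewrite leqn0 => /eqP->; rewrite !big_geq// expR0 !subrr nm0.
rewrite leq_eqVlt => /predU1P[->|]; first by rewrite !big_geq// expR0 !subrr nm0.
rewrite ltnS => mN; rewrite !big_nat_recr//= expRD.
have {}IH := IH mN; move: IH.
set P := \prod_(_ <= _ < _) _; set s := \sum_(_ <= _ < _) _ => IH.
have -> : P * x N - 1 = (P - 1) * (1 + (x N - 1)) + (x N - 1) by ring.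
apply: le_trans (nmD _ _) _; rewrite nmM.
have t0 := nm_ge0 (x N - 1).
have h1 : nm (1 + (x N - 1)) <= 1 + nm (x N - 1).
  by apply: le_trans (nmD _ _) _; rewrite nm1.
have h2 := expR_ge1Dx (nm (x N - 1)).
have p0 : 0 <= expR s - 1 by apply: le_trans IH; exact: nm_ge0.
have : nm (P - 1) * nm (1 + (x N - 1)) <= (expR s - 1) * expR (nm (x N - 1)).
  by apply: ler_pM; rewrite ?nm_ge0//; lra.
lra.
Qed.

Lemma expR_sub1_le (x : R) : 0 <= x -> x <= 2^-1 -> expR x - 1 <= 2 * x.
Proof.
move=> x0 x1; have := expR_ge1Dx (- x); rewrite expRN => h.
have p := expR_gt0 x.
have : (1 - x) * expR x <= 1.
  by rewrite -[leRHS](mulVf (lt0r_neq0 p)) ler_pM2r.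
nra.
Qed.

Variables (a : R) (F : nat -> C -> C).
Hypothesis a1 : 1 < a.
Hypothesis entF : forall k, ent (F k).
Hypothesis Fsmall : forall r, exists B K, forall k z, (K <= k)%N -> nm z <= r ->
  nm (F k z - 1) <= B * k.+2%:R `^ (- a).

Let P N z := \prod_(0 <= k < N) F k z.

Let entP N : ent (P N).
Proof.
by apply/ent_hol => rr; apply: hol_prod => k; move: rr; apply/ent_hol.
Qed.

Let tail_small (A e : R) : 0 < e -> exists M, forall K, (M <= K)%N -> A * K.+1%:R `^ (1 - a) <= e.
Proof.
move=> e0; have a10 : 0 < a - 1 by have := a1; lra.
have [T T1 hT] := powR_large (A / e) a10.
exists (Num.truncn T) => K TK.
have TK' : T <= K.+1%:R.
  have /andP[_ h] : (Num.truncn T)%:R <= T < (Num.truncn T).+1%:R by apply: truncn_itv; lra.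
  by apply: le_trans (ltW h) _; rewrite ler_nat.
have := hT _ TK'; rewrite -(opprB a 1) powRN ler_pdivrMr// => h.
by rewrite ler_pdivrMr ?powR_gt0// mulrC.
Qed.

(** The hypothesis on [F] matches [pseries_tail], so partial products converge on discs with an
    explicit error of order (K + 1)^(1 - a), the uniformity that [hol_limit] requires. *)
Let P_cauchy r : exists M A, [/\ 0 <= A & forall K N z, (M <= K)%N -> (K <= N)%N -> nm z <= r ->
  nm (P N z - P K z) <= A * K.+1%:R `^ (1 - a)].
Proof.
have [B0 [K0 hB]] := Fsmall r; pose B := Num.max 0 B0.
have B0' : 0 <= B by rewrite le_max lexx.
have {}hB k z : (K0 <= k)%N -> nm z <= r -> nm (F k z - 1) <= B * k.+2%:R `^ (- a).
  move=> kk zr; apply: le_trans (hB k z kk zr) _; rewrite ler_wpM2r ?powR_ge0//.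
  by rewrite le_max lexx orbT.
have a10 : 0 < a - 1 by have := a1; lra.
have h2 : (0 : R) < 2^-1 by lra.
have [M1 hM] := tail_small (B / (a - 1)) h2.
pose M := maxn K0 M1.
have [D D0 hD] := @ccont_disc_bounded _ (P M) r (fun z _ => ent_cont z (@entP M)).
have tl K N z : (M <= K)%N -> (K <= N)%N -> nm z <= r ->
    nm (\prod_(K <= k < N) F k z - 1) <= 2 * (B / (a - 1) * K.+1%:R `^ (1 - a)).
  rewrite geq_max => /andP[K0K M1K] KN zr.
  apply: le_trans (nm_prod_sub1 (F ^~ z) KN) _.
  have s1 : \sum_(K <= k < N) nm (F k z - 1) <= B / (a - 1) * K.+1%:R `^ (1 - a).
    apply: (@le_trans _ _ (B * \sum_(K <= k < N) k.+2%:R `^ (- a))).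
      rewrite mulr_sumr !big_nat; apply: ler_sum => k /andP[Kk _].
      by apply: hB => //; exact: leq_trans Kk.
    rewrite -mulrA ler_wpM2l// ler_pdivlMl//; exact: pseries_tail.
  apply: (@le_trans _ _ (expR (B / (a - 1) * K.+1%:R `^ (1 - a)) - 1)).
    by rewrite lerD2r ler_expR.
  apply: expR_sub1_le; last exact: hM.
  by rewrite mulr_ge0 ?powR_ge0// divr_ge0// ltW.
exists M, (D * 2 * (2 * (B / (a - 1)))); split.
  by rewrite !mulr_ge0// invr_ge0 ltW.
move=> K N z MK KN zr.
have split_prod (m1 m2 : nat) : (m1 <= m2)%N -> P m2 z = P m1 z * \prod_(m1 <= k < m2) F k z.
  by move=> h; rewrite /P (big_cat_nat (leq0n m1) h).
rewrite (split_prod K N KN) -[X in _ - X]mulr1 -mulrBr nmM -!mulrA (mulrA D) ler_pM ?nm_ge0//; last first.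
  by have := tl K N z MK KN zr; rewrite -!mulrA.
rewrite (split_prod M K MK) nmM ler_pM ?nm_ge0 ?hD//.
have := tl M K z (leqnn M) MK zr; have := hM M (leq_maxr _ _) => h h'.
have -> : \prod_(M <= k < K) F k z = 1 + (\prod_(M <= k < K) F k z - 1) by ring.
apply: le_trans (nmD _ _) _; rewrite nm1; lra.
Qed.

Lemma infinite_product : exists2 f, ent f &
  forall z e, 0 < e -> exists M, forall N, (M <= N)%N -> nm (\prod_(0 <= k < N) F k z - f z) <= e.
Proof.
have ex z : exists l, forall e, 0 < e -> exists M, forall N, (M <= N)%N -> nm (P N z - l) <= e.
  have [M [A [A0 hA]]] := P_cauchy (nm z).
  have [|l hl] := @complex_limit R (fun i => P (M + i) z) (fun i => A * (M + i).+1%:R `^ (1 - a)).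
    by move=> K N KN; apply: hA; rewrite ?leq_addr ?leq_add2l.
  exists l => e e0; have [M2 hM2] := tail_small (2 * A) e0.
  exists (M + M2)%N => N MN; have NE : N = (M + (N - M))%N by rewrite subnKC// (leq_trans (leq_addr M2 M)).
  rewrite -opprB nmN NE; apply: le_trans (hl _) _; rewrite mulrA; apply: hM2.
  by rewrite -NE (leq_trans (leq_addl M M2)).
pose f z := xget 0 [set l | forall e, 0 < e -> exists M, forall N, (M <= N)%N -> nm (P N z - l) <= e].
have hf z : forall e, 0 < e -> exists M, forall N, (M <= N)%N -> nm (P N z - f z) <= e.
  by rewrite /f; case: xgetP => [l _ //|H]; have [l /H] := ex z.
exists f => //; apply/ent_hol => rr.
have [] // := @hol_limit R P f rr => [N|r rrr e e0]; first by have /ent_hol := @entP N; apply.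
have [M [A [A0 hA]]] := P_cauchy r.
have [M2 hM2] := tail_small A e0.
exists (maxn M M2) => K; rewrite geq_max => /andP[MK M2K] z zr.
apply/ler_addgt0Pl => d d0; have [M3 hM3] := hf z d d0.
have h1 := hM3 (maxn K M3) (leq_maxr _ _).
have h2 := hA K (maxn K M3) z MK (leq_maxl _ _) zr.
have -> : P K z - f z = (P (maxn K M3) z - f z) - (P (maxn K M3) z - P K z) by ring.
apply: le_trans (nmD _ _) _; rewrite nmN; have := hM2 K M2K; lra.
Qed.

End InfiniteProduct.

(** * Weierstrass factors *)

Section Weierstrass.
Variable R : realType.
Local Notation C := R[i].
Local Notation nm := (@Normc.normc R).
Local Notation Re := (@complex.Re R).
Implicit Types (z w u om : C) (r s t h e d : R) (k m n : nat).

Definition wpoly p u : C := \sum_(i < p) u ^+ i.+1 / i.+1%:R.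

Definition wfactor p u : C := (1 - u) * cexp (wpoly p u).

Lemma cdiff_wpoly p u : cdiff (wpoly p) u (\sum_(i < p) u ^+ i).
Proof.
apply: cdiff_sum => i; have := cdiffZ (i.+1%:R^-1) (cdiffX i.+1 u).
rewrite /= mulrA mulVf ?pnatr_eq0// mul1r => h.
rewrite (_ : (fun w => _) = (fun w => i.+1%:R^-1 * w ^+ i.+1))//.
by apply/funext => w; rewrite mulrC.
Qed.

(** The geometric sum telescopes against 1 - u and leaves -u^p times the exponential. This order of
    vanishing gives both [wfactor_sub1] and the Lipschitz bounds near 0. *)
Lemma cdiff_wfactor p u : cdiff (wfactor p) u (- u ^+ p * cexp (wpoly p u)).
Proof.
have h1 := cdiffB (cdiff_cst 1 u) (cdiff_id u).
have h2 := cdiff_comp (cdiff_wpoly p u) (cdiff_cexp (wpoly p u)).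
have := cdiffM h1 h2; congr cdiff.
have E : u ^+ p = (u - 1) * (\sum_(i < p) u ^+ i) + 1 by rewrite -subrX1; ring.
by rewrite E; ring.
Qed.

Lemma wpoly_le p u : nm u <= 1 -> nm (wpoly p u) <= p%:R.
Proof.
move=> u1; apply: le_trans (nm_sum _ _ _) _.
have -> : p%:R = \sum_(i < p) 1 :> R by rewrite sumr_const card_ord.
apply: ler_sum => i _; rewrite nmM nmV nm_nat nmX ler_pdivrMr ?ltr0n// mul1r.
by apply: (@le_trans _ _ 1); rewrite ?ler1n// exprn_ile1// nm_ge0.
Qed.

Lemma nm_ray om s : nm om = 1 -> nm (s%:C * om) = `|s|.
Proof. by move=> o1; rewrite nmM nm_real o1 mulr1. Qed.

Lemma wfactor_lip p om (s t : R) : nm om = 1 -> 0 <= s -> s <= t -> t <= 1 ->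
  nm (wfactor p (t%:C * om) - wfactor p (s%:C * om)) <= 2 * (t ^+ p * expR p%:R) * (t - s).
Proof.
move=> o1 s0 st t1.
have -> : t - s = nm (t%:C * om - s%:C * om).
  by rewrite -mulrBl -(rmorphB (real_complex R)) nm_ray// ger0_norm// subr_ge0.
apply: mean_value_ineq => x /andP[x0 x1]; exists (- (s%:C * om + x%:C * (t%:C * om - s%:C * om)) ^+ p *
  cexp (wpoly p (s%:C * om + x%:C * (t%:C * om - s%:C * om)))); first exact: cdiff_wfactor.
have -> : s%:C * om + x%:C * (t%:C * om - s%:C * om) = (s + x * (t - s))%:C * om.
  by rewrite !(rmorphD, rmorphM, rmorphN, rmorphB) /=; ring.
have y0 : 0 <= s + x * (t - s) by nra.
have yt : s + x * (t - s) <= t by nra.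
rewrite nmM nmN nmX nm_ray// ger0_norm// nm_cexp.
apply: ler_pM; rewrite ?exprn_ge0 ?expR_ge0//.
  by apply: lerXn2r; rewrite ?nnegrE//; lra.
rewrite ler_expR; apply: le_trans (ler_norm _) (le_trans (Re_le_nm _) _).
by apply: wpoly_le; rewrite nm_ray// ger0_norm//; lra.
Qed.

Lemma wfactor0 p : wfactor p 0 = 1.
Proof.
rewrite /wfactor /wpoly big1 ?cexp0 ?subr0 ?mulr1// => i _.
by rewrite expr0n mul0r.
Qed.

Lemma wfactor_sub1 p u : nm u <= 1 -> nm (wfactor p u - 1) <= 2 * expR p%:R * nm u ^+ p.+1.
Proof.
move=> u1; have [->|u0] := eqVneq u 0.
  by rewrite wfactor0 subrr nm0 mulr_ge0 ?exprn_ge0 ?nm_ge0// mulr_ge0 ?expR_ge0.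
have n0 : 0 < nm u by rewrite nm_gt0.
pose om := u / (nm u)%:C.
have nC : (nm u)%:C != 0 by rewrite -nm_gt0 nm_real normr_gt0 gt_eqF.
have o1 : nm om = 1 by rewrite /om nmM nmV nm_real ger0_norm ?nm_ge0// mulfV// gt_eqF.
have uE : u = (nm u)%:C * om by rewrite /om mulrCA mulfV// mulr1.
have := @wfactor_lip p om 0 (nm u) o1 (lexx 0) (nm_ge0 u) u1.
rewrite -uE (_ : 0%:C * om = 0) ?mul0r// wfactor0 subr0 => h.
apply: le_trans h _; rewrite exprS le_eqVlt; apply/orP; left; apply/eqP; ring.
Qed.

Lemma ln_lip (m x y : R) : 0 < m -> m <= x -> m <= y -> `|ln x - ln y| <= `|x - y| / m.
Proof.
move=> m0; have key (a b : R) : m <= a -> m <= b -> ln a - ln b <= `|a - b| / m.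
  move=> ma mb; have a0 : 0 < a by lra.
  have b0 : 0 < b by lra.
  rewrite -ln_div ?posrE//.
  have [ab|ab] := leP a b.
    apply: (@le_trans _ _ 0); last by rewrite divr_ge0// ltW.
    by apply: ln_le0; rewrite ler_pdivrMr// mul1r.
  have -> : a / b = 1 + (a - b) / b by field; rewrite gt_eqF.
  apply: le_trans (le_ln1Dx _) _.
    by apply: lt_le_trans (_ : 0 <= _); [lra|rewrite divr_ge0; lra].
  rewrite ger0_norm; last by lra.
  by rewrite ler_wpM2l ?lef_pV2 ?posrE//; lra.
move=> mx my; rewrite ler_norml key// andbT lerNl opprB distrC; exact: key.
Qed.

Variables (p : nat) (d : R).
Hypothesis d0 : 0 < d.
Hypothesis d2 : d <= 2^-1.

(* Truncating the logarithm at d keeps it Lipschitz near the zero u = 1. *)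
Definition wlog u : R := ln (Num.max (nm (1 - u)) d) + Re (wpoly p u).

Let max_gt0 u : 0 < Num.max (nm (1 - u)) d.
Proof. by rewrite lt_max d0 orbT. Qed.

Lemma nm_wfactor_le u : nm (wfactor p u) <= expR (wlog u).
Proof.
by rewrite expRD lnK ?posrE// nmM nm_cexp ler_wpM2r ?expR_ge0// le_max lexx.
Qed.

Lemma wlogE u : nm u <= 2^-1 -> wlog u = ln (nm (wfactor p u)).
Proof.
move=> u2; have h : 2^-1 <= nm (1 - u) by have := nm_subl 1 u; rewrite nm1; lra.
rewrite /wlog nmM nm_cexp lnM ?posrE ?expR_gt0 ?expRK//; last by lra.
by rewrite max_l//; have := d2; lra.
Qed.

Lemma wlog0 : wlog 0 = 0.
Proof. by rewrite wlogE ?nm0 ?invr_ge0// wfactor0 nm1 ln1. Qed.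

Let small_lip om (s t : R) : nm om = 1 -> 0 <= s -> s <= t -> t <= 2^-1 ->
  `|wlog (t%:C * om) - wlog (s%:C * om)| <= 4 * expR p%:R ^+ 2 * (t ^+ p * (t - s)).
Proof.
move=> o1 s0 st t2.
have t0 : 0 <= t := le_trans s0 st.
have nt : nm (t%:C * om) <= 2^-1 by rewrite nm_ray// ger0_norm.
have ns : nm (s%:C * om) <= 2^-1 by rewrite nm_ray// ger0_norm//; lra.
rewrite !wlogE//.
have lo (x : R) : 0 <= x -> x <= 2^-1 -> (2 * expR p%:R)^-1 <= nm (wfactor p (x%:C * om)).
  move=> x0 x2; rewrite nmM nm_cexp invfM; apply: ler_pM; rewrite ?invr_ge0 ?expR_ge0//.
    by have := nm_subl 1 (x%:C * om); rewrite nm1 nm_ray// ger0_norm//; lra.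
  rewrite -expRN ler_expR.
  have := le_trans (Re_le_nm (wpoly p (x%:C * om))) (@wpoly_le p (x%:C * om) _).
  rewrite nm_ray// ger0_norm// ler_norml => h.
  by have /andP[] := h ltac:(lra).
have m0 : 0 < (2 * expR p%:R)^-1 :> R by rewrite invr_gt0 mulr_gt0 ?expR_gt0.
apply: le_trans (ln_lip m0 (lo t t0 t2) (lo s s0 (le_trans st t2))) _.
rewrite invrK.
have h1 : `|nm (wfactor p (t%:C * om)) - nm (wfactor p (s%:C * om))| <=
   nm (wfactor p (t%:C * om) - wfactor p (s%:C * om)).
  by rewrite ler_norml nm_subl andbT lerNl opprB nmB nm_subl.
have t1 : t <= 1 by lra.
have h2 := le_trans h1 (wfactor_lip p o1 s0 st t1).
apply: le_trans (ler_wpM2r _ h2) _; first by rewrite mulr_ge0 ?expR_ge0.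
rewrite le_eqVlt; apply/orP; left; apply/eqP; ring.
Qed.

Variable rho : R.
Hypothesis rho0 : 0 < rho.
Hypothesis prho : p%:R <= rho.
Hypothesis rhop : rho <= p.+1%:R.

Let pow_half (t : R) i : 2^-1 <= t -> (i <= p)%N -> t ^+ i <= 2 `^ rho * t `^ rho.
Proof.
move=> t2 ip; have t0 : 0 < t by lra.
rewrite -powRM//; last exact: ltW.
apply: (@le_trans _ _ ((2 * t) ^+ i)).
  by apply: lerXn2r; rewrite ?nnegrE; lra.
rewrite -powR_mulrn; last by lra.
apply: ler_powR; first by lra.
by apply: le_trans prho; rewrite ler_nat.
Qed.

Let one_half (t : R) : 2^-1 <= t -> 1 <= 2 `^ rho * t `^ rho.
Proof. by move=> t2; rewrite -(expr0 t); exact: pow_half. Qed.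

Let poly_lip om (s t : R) : nm om = 1 -> 0 <= s -> s <= t -> 2^-1 <= t ->
  `|Re (wpoly p (t%:C * om)) - Re (wpoly p (s%:C * om))| <= p%:R * (2 `^ rho * t `^ rho) * (1 - s / t).
Proof.
move=> o1 s0 st t2; have t0 : 0 < t by lra.
have x0 : 0 <= s / t by rewrite divr_ge0// ltW.
have x1 : s / t <= 1 by rewrite ler_pdivrMr// mul1r.
have sE : s = t * (s / t) by rewrite mulrCA mulfV ?mulr1// gt_eqF.
rewrite -ReN -ReD; apply: le_trans (Re_le_nm _) _.
rewrite /wpoly -sumrN -big_split /=; apply: le_trans (nm_sum _ _ _) _.
have -> : p%:R * (2 `^ rho * t `^ rho) * (1 - s / t) = \sum_(i < p) (2 `^ rho * t `^ rho * (1 - s / t)).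
  by rewrite sumr_const card_ord -mulrA mulr_natl.
apply: ler_sum => i _.
rewrite -mulrBl !exprMn -mulrBl nmM nmV nm_nat nmM nmX o1 expr1n mulr1.
rewrite -!(rmorphXn (real_complex R)) -(rmorphB (real_complex R)) nm_real.
have q (x : R) k : 0 <= x -> x <= 1 -> 0 <= 1 - x ^+ k <= k%:R * (1 - x).
  move=> y0 y1; rewrite subr_ge0 exprn_ile1//=.
  elim: k => [|k IH]; first by rewrite expr0 subrr mul0r.
  rewrite exprS -natr1; have := exprn_ge0 k y0; have := @exprn_ile1 _ k x y0 y1; nra.
have /andP[q0 q1] := q _ i.+1 x0 x1.
rewrite [in s ^+ _]sE exprMn -{1}[t ^+ i.+1]mulr1 -mulrBr ger0_norm; last by rewrite mulr_ge0// exprn_ge0// ltW.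
rewrite ler_pdivrMr ?ltr0n// -(mulrA (2 `^ rho * _)); apply: ler_pM => //; first by rewrite exprn_ge0// ltW.
  exact: (pow_half t2 (ltn_ord i)).
by rewrite [leRHS]mulrC.
Qed.

(** For t / 2 <= s <= t the truncated moduli are at least d t / 4, which turns the increment t - s
    into the relative increment 1 - s / t. *)
Let max_lip om (s t : R) : nm om = 1 -> 0 <= s -> s <= t -> 2^-1 <= t -> t <= 2 * s ->
  `|ln (Num.max (nm (1 - t%:C * om)) d) - ln (Num.max (nm (1 - s%:C * om)) d)| <= 4 / d * (1 - s / t).
Proof.
move=> o1 s0 st t2 ts; have t0 : 0 < t by lra.
have hd := d2; have hd0 := d0.
have lo x : t <= 2 * x -> x <= t -> d * t / 4 <= Num.max (nm (1 - x%:C * om)) d.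
  move=> tx xt; rewrite le_max; have [x2|x2] := leP x 2; apply/orP; [right|left].
    by nra.
  have := nm_subl (x%:C * om) 1; rewrite nmB nm1 nm_ray// ger0_norm; last by lra.
  nra.
have m0 : 0 < d * t / 4 by rewrite divr_gt0// mulr_gt0.
apply: le_trans (ln_lip m0 (lo t _ _) (lo s _ _)) _ => //; first by lra.
have h : `|Num.max (nm (1 - t%:C * om)) d - Num.max (nm (1 - s%:C * om)) d| <= t - s.
  have h1 : `|nm (1 - t%:C * om) - nm (1 - s%:C * om)| <= t - s.
    have E : nm ((1 - t%:C * om) - (1 - s%:C * om)) = t - s.
      rewrite (_ : _ - _ = - ((t - s)%:C * om)).
        by rewrite nmN nm_ray// ger0_norm// subr_ge0.
      by rewrite rmorphB /=; ring.
    have := nm_subl (1 - t%:C * om) (1 - s%:C * om).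
    have := nm_subl (1 - s%:C * om) (1 - t%:C * om).
    by rewrite nmB E ler_norml; lra.
  move: h1; set x := nm _; set y := nm _; rewrite !ler_norml => /andP[a1 a2].
  by case: (leP x d); case: (leP y d) => c1 c2; apply/andP; split; lra.
apply: le_trans (ler_wpM2r _ h) _; first by rewrite invr_ge0 ltW.
rewrite le_eqVlt; apply/orP; left; apply/eqP; field.
by rewrite !gt_eqF.
Qed.

Let small_pow (t : R) : 0 <= t -> t <= 2^-1 -> t ^+ p.+1 <= t `^ rho.
Proof.
move=> t0 t2; have [->|tn] := eqVneq t 0; first by rewrite expr0n powR_ge0.
have tp : 0 < t by rewrite lt_neqAle eq_sym tn.
by rewrite -powR_mulrn// ger_powR// tp; lra.
Qed.

Let C1 : R := 4 * expR p%:R ^+ 2.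
Let C2 : R := C1 + (3 `^ rho / rho) + (- ln d) * 2 `^ rho + p%:R * 2 `^ rho.

Let lnd0 : 0 <= - ln d.
Proof. by rewrite oppr_ge0 ln_le0//; have := d2; lra. Qed.

Let C1_ge0 : 0 <= C1.
Proof. by rewrite /C1 mulr_ge0// exprn_ge0// expR_ge0. Qed.

Let wlog_bound om (t : R) : nm om = 1 -> 0 <= t -> `|wlog (t%:C * om)| <= C2 * t `^ rho.
Proof.
move=> o1 t0; have tr := powR_ge0 t rho; have hr0 := rho0.
have q1 : 0 <= 3 `^ rho / rho * t `^ rho by rewrite mulr_ge0// divr_ge0 ?powR_ge0// ltW.
have q2 : 0 <= (- ln d) * (2 `^ rho * t `^ rho) by rewrite mulr_ge0 ?lnd0// mulr_ge0 ?powR_ge0.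
have q3 : 0 <= p%:R * (2 `^ rho * t `^ rho) by rewrite mulr_ge0// mulr_ge0 ?powR_ge0.
have E : C2 * t `^ rho = C1 * t `^ rho + 3 `^ rho / rho * t `^ rho +
  (- ln d) * (2 `^ rho * t `^ rho) + p%:R * (2 `^ rho * t `^ rho) by rewrite /C2; ring.
have [t2|t2] := leP t 2^-1.
  have := small_lip o1 (lexx 0) t0 t2.
  rewrite (_ : 0%:C * om = 0) ?mul0r// wlog0 !subr0 -exprSr => h.
  have := ler_wpM2l C1_ge0 (small_pow t0 t2); rewrite -/C1 in h; lra.
have {}t2 := ltW t2; have tp : 0 < t by lra.
have h1 := poly_lip o1 (lexx 0) t0 t2.
have W0 : Re (wpoly p (0%:C * om)) = 0.
  by rewrite (_ : 0%:C * om = 0) ?mul0r// /wpoly big1// => i _; rewrite expr0n mul0r.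
rewrite W0 subr0 mul0r subr0 mulr1 in h1.
have h2 : ln (Num.max (nm (1 - t%:C * om)) d) <= 3 `^ rho / rho * t `^ rho.
  have m1 : Num.max (nm (1 - t%:C * om)) d <= 3 * t.
    rewrite ge_max; apply/andP; split; last by have := d2; lra.
    by apply: le_trans (nmD _ _) _; rewrite nmN nm1 nm_ray// ger0_norm//; lra.
  have t3 : 0 < 3 * t by lra.
  apply: (@le_trans _ _ (ln (3 * t))); first by rewrite ler_ln ?posrE.
  rewrite -mulrAC -powRM// ler_pdivlMr// mulrC -ln_powR; apply: ln_lt_id.
  exact: powR_gt0.
have h3 : ln d <= ln (Num.max (nm (1 - t%:C * om)) d).
  by rewrite ler_ln ?posrE// le_max lexx orbT.
have h4 : - ln d <= - ln d * (2 `^ rho * t `^ rho) by rewrite ler_peMr ?lnd0// one_half.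
have c1 : 0 <= C1 * t `^ rho by rewrite mulr_ge0.
rewrite /wlog; move: h1; rewrite !ler_norml E => /andP[b1 b2].
apply/andP; split; lra.
Qed.

Let pow_diff (s t : R) : 0 <= s -> s <= t -> 0 < t ->
  rho / (1 + rho) * t `^ rho * (1 - s / t) <= t `^ rho - s `^ rho.
Proof.
move=> s0 st t0; have hr0 := rho0.
have x0 : 0 <= s / t by rewrite divr_ge0// ltW.
have x1 : s / t <= 1 by rewrite ler_pdivrMr// mul1r.
have sE : s = t * (s / t) by rewrite mulrCA mulfV ?mulr1// gt_eqF.
rewrite [in s `^ _]sE powRM ?(ltW t0)// -{2}[t `^ rho]mulr1 -mulrBr mulrAC mulrC ler_wpM2l ?powR_ge0//.
move: x0 x1; set x := s / t => x0 x1.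
have h0 : 0 <= rho * (1 - x) by rewrite mulr_ge0 ?subr_ge0// ltW.
have h1 : x `^ rho <= (1 + rho * (1 - x))^-1.
  have [->|xn] := eqVneq x 0.
    by rewrite powR0 ?gt_eqF// invr_ge0; lra.
  have xp : 0 < x by rewrite lt_neqAle eq_sym xn.
  apply: (@le_trans _ _ (expR (- (rho * (1 - x))))).
    rewrite /powR gt_eqF// ler_expR; have := @le_ln1Dx R (x - 1).
    rewrite (_ : 1 + (x - 1) = x); last by ring.
    by move=> h; have := h ltac:(lra); nra.
  rewrite expRN lef_pV2 ?posrE ?expR_gt0//; last by lra.
  exact: expR_ge1Dx.
suff : rho / (1 + rho) * (1 - x) <= 1 - (1 + rho * (1 - x))^-1 by lra.
have -> : 1 - (1 + rho * (1 - x))^-1 = rho * (1 - x) / (1 + rho * (1 - x)).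
  by field; rewrite gt_eqF//; lra.
rewrite mulrAC ler_wpM2l// lef_pV2 ?posrE//; [|lra..].
have : rho * (1 - x) <= rho * 1 by rewrite ler_pM2l//; lra.
lra.
Qed.

(** Along rays the truncated logarithm is Lipschitz in t^rho, uniformly in the direction; in this
    form summation by parts meets the increments of l k ^ -rho. It rests on p <= rho <= p + 1: the
    logarithm is O(t^(p + 1)) near 0 and its polynomial part O(t^p) at infinity. *)
Lemma wlog_lip : exists2 B, 0 <= B & forall om (s t : R), nm om = 1 -> 0 <= s -> s <= t ->
  `|wlog (t%:C * om) - wlog (s%:C * om)| <= B * (t `^ rho - s `^ rho) /\
  `|wlog (t%:C * om)| <= B * t `^ rho.
Proof.
have hr0 := rho0; have C20 : 0 <= C2.
  rewrite /C2 !addr_ge0// ?divr_ge0 ?powR_ge0 ?(ltW rho0)// mulr_ge0 ?lnd0 ?powR_ge0//.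
pose B0 := 4 * C2 + C1 + 4 / d * 2 `^ rho + p%:R * 2 `^ rho.
have t1 : 0 <= 4 / d * 2 `^ rho by rewrite mulr_ge0 ?divr_ge0 ?powR_ge0// ltW.
have t2 : 0 <= p%:R * 2 `^ rho by rewrite mulr_ge0 ?powR_ge0.
have t3 := C1_ge0.
have B00 : 0 <= B0 by rewrite /B0; lra.
have r1 : 1 <= (1 + rho) / rho by rewrite ler_pdivlMr//; lra.
exists (B0 * ((1 + rho) / rho)); first by rewrite mulr_ge0//; lra.
move=> om s t o1 s0 st; have tt : 0 <= t := le_trans s0 st; split; last first.
  apply: le_trans (wlog_bound o1 tt) _; rewrite ler_wpM2r ?powR_ge0//.
  have : B0 <= B0 * ((1 + rho) / rho) by rewrite ler_peMr.
  by rewrite /B0; lra.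
have [tz|tn] := eqVneq t 0.
  have -> : s = t by lra.
  by rewrite !subrr normr0 mulr0.
have tp : 0 < t by rewrite lt_neqAle eq_sym tn.
have x0 : 0 <= s / t by rewrite divr_ge0// ltW.
have x1 : s / t <= 1 by rewrite ler_pdivrMr// mul1r.
suff h : `|wlog (t%:C * om) - wlog (s%:C * om)| <= B0 * (t `^ rho * (1 - s / t)).
  apply: le_trans h _; rewrite -mulrA ler_wpM2l//.
  have c0 : 0 < rho / (1 + rho) by rewrite divr_gt0//; lra.
  by rewrite -[(1 + rho) / rho]invf_div ler_pdivlMl// mulrA; exact: pow_diff.
have T : 0 <= t `^ rho * (1 - s / t) by rewrite mulr_ge0 ?powR_ge0// subr_ge0.
set T' := t `^ rho * (1 - s / t) in T *.
have E : B0 * T' = 4 * (C2 * T') + C1 * T' + 4 / d * 2 `^ rho * T' + p%:R * 2 `^ rho * T' by rewrite /B0; ring.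
have P1 : 0 <= C2 * T' by rewrite mulr_ge0.
have P2 : 0 <= C1 * T' by rewrite mulr_ge0.
have P3 : 0 <= 4 / d * 2 `^ rho * T' by rewrite mulr_ge0.
have P4 : 0 <= p%:R * 2 `^ rho * T' by rewrite mulr_ge0.
rewrite E; have [t12|t12] := leP t 2^-1.
  apply: le_trans (small_lip o1 s0 st t12) _; rewrite -/C1.
  have -> : t ^+ p * (t - s) = t ^+ p.+1 * (1 - s / t).
    by rewrite exprSr -mulrA; congr (_ * _); field; rewrite gt_eqF.
  have : t ^+ p.+1 * (1 - s / t) <= T' by rewrite ler_wpM2r ?subr_ge0// small_pow.
  move=> /(ler_wpM2l C1_ge0); lra.
have {}t12 := ltW t12.
have [ts|ts] := leP t (2 * s).
  have h1 := max_lip o1 s0 st t12 ts; have h2 := poly_lip o1 s0 st t12.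
  have h3 : 4 / d * (1 - s / t) <= 4 / d * 2 `^ rho * T'.
    rewrite -(mulrA (4 / d)) ler_wpM2l ?divr_ge0 ?(ltW d0)// /T' mulrA ler_peMl ?subr_ge0//.
    exact: one_half.
  have -> : wlog (t%:C * om) - wlog (s%:C * om) =
    (ln (Num.max (nm (1 - t%:C * om)) d) - ln (Num.max (nm (1 - s%:C * om)) d)) +
    (Re (wpoly p (t%:C * om)) - Re (wpoly p (s%:C * om))) by rewrite /wlog; ring.
  apply: le_trans (ler_normD _ _) _.
  have h4 : p%:R * (2 `^ rho * t `^ rho) * (1 - s / t) = p%:R * 2 `^ rho * T' by rewrite /T'; ring.
  lra.
(* Here 1 - s / t >= 1/2, so it is enough to bound the two values separately. *)
have xh : s / t <= 2^-1 by rewrite ler_pdivrMr//; lra.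
apply: le_trans (ler_normB _ _) _.
have h1 := wlog_bound o1 tt; have h2 := wlog_bound o1 s0.
have h3 : s `^ rho <= t `^ rho by apply: ge0_ler_powR; rewrite ?nnegrE// ltW.
have h4 : 2^-1 * t `^ rho <= T'.
  by rewrite /T' mulrC ler_wpM2l ?powR_ge0//; lra.
have := ler_wpM2l C20 h3; have := ler_wpM2l C20 h4; lra.
Qed.

End Weierstrass.

(** * Growth of the canonical product *)

Section SymmetricSums.
Variable R : realType.
Local Notation C := R[i].
Local Notation nm := (@Normc.normc R).
Local Notation Re := (@complex.Re R).
Implicit Types (z u : C) (r s t h e : R) (k m : nat).

Lemma third_half p : (3^-1 : R) ^+ p.+1 <= 2^-1.
Proof.
apply: (@le_trans _ _ 3^-1); last by lra.
by rewrite exprS ger_pMr ?invr_gt0// exprn_ile1//; lra.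
Qed.

Variables (p : nat) (w : C).
Local Notation n := p.+1.
Hypothesis pw : n.-primitive_root w.
Let d : R := 3^-1 ^+ n.

Let d0 : 0 < d.
Proof. by rewrite exprn_gt0// invr_gt0. Qed.

Let w1 j : nm (w ^+ j) = 1.
Proof. by rewrite nmX (nm_prim pw) expr1n. Qed.

(** The exponents 1, ..., p are not divisible by n = p + 1; hence the exponential parts of the
    Weierstrass factors disappear from every symmetric sum. *)
Lemma sum_wpoly u : \sum_(j < n) wpoly p (w ^+ j * u) = 0.
Proof.
rewrite /wpoly exchange_big /= big1// => i _.
rewrite (eq_bigr (fun j : 'I_n => (w ^+ j) ^+ i.+1 * (u ^+ i.+1 / i.+1%:R))); last first.
  by move=> j _; rewrite exprMn mulrA.
by rewrite -mulr_suml prim_sum ?mul0r// gtnNdvd// ltnS.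
Qed.

(** If the truncation is inactive the product is |1 - u^n|. If it acts on one rotation, then |u| <=
    2, the other factors are at most 3, and d 3^p <= 1; this dictates the value of [d]. *)
Lemma prod_max_le u : \prod_(j < n) Num.max (nm (1 - w ^+ j * u)) d <= 1 + nm u ^+ n.
Proof.
have [|] := pselect (forall j : 'I_n, d <= nm (1 - w ^+ j * u)) => [h|/existsNP[j /negP]].
  rewrite (eq_bigr (fun j : 'I_n => nm (1 - w ^+ j * u))); last by move=> j _; rewrite max_l.
  rewrite -nm_prod (prim_prod u pw); apply: le_trans (nmD _ _) _.
  by rewrite nm1 nmN nmX.
rewrite -ltNge => jd; apply: (@le_trans _ _ 1); last by rewrite lerDl exprn_ge0// nm_ge0.
rewrite (bigD1 j)//= max_r; last exact: ltW.
have u2 : nm u <= 2.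
  have := nm_subl (w ^+ j * u) 1; rewrite nmB nm1 nmM w1 mul1r.
  by have := third_half p; rewrite -/d; lra.
apply: (@le_trans _ _ (d * \prod_(i < n | i != j) 3)); last first.
  rewrite prodr_const (_ : #|_| = p); last by rewrite cardC1 card_ord.
  by rewrite /d exprS -mulrA -exprMn mulVf// expr1n mulr1; lra.
rewrite ler_pM2l//; apply: ler_prod => i _; rewrite le_max nm_ge0/= ge_max.
apply/andP; split; last by have := third_half p; rewrite -/d; lra.
by apply: le_trans (nmD _ _) _; rewrite nm1 nmN nmM w1 mul1r; lra.
Qed.

Let sum_wlogE u : \sum_(j < n) wlog p d (w ^+ j * u) =
  ln (\prod_(j < n) Num.max (nm (1 - w ^+ j * u)) d).
Proof.
rewrite ln_prod; last by move=> j; rewrite lt_max d0 orbT.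
by rewrite big_split /= -Re_sum sum_wpoly addr0.
Qed.

Lemma sum_wlog_le u : \sum_(j < n) wlog p d (w ^+ j * u) <= ln (1 + nm u ^+ n).
Proof.
rewrite sum_wlogE ler_ln ?posrE; first exact: prod_max_le.
  by apply: prodr_gt0 => j _; rewrite lt_max d0 orbT.
by have := exprn_ge0 n (nm_ge0 u); lra.
Qed.

(** v = 0 is the ray u^n < 0, where |1 - u^n| is largest; in general |1 - u^n|^2 = (1 + |u|^n)^2 - 2
    |u|^n v. The range of |u| ensures |u|^n >= d and keeps all moduli above the truncation. *)
Lemma sum_wlog_gain u v : 3^-1 <= nm u -> nm u <= 2^-1 -> 0 <= v ->
  Re (u ^+ n) = nm u ^+ n * (v - 1) ->
  \sum_(j < n) wlog p d (w ^+ j * u) <= ln (1 + nm u ^+ n) - d / 4 * v.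
Proof.
move=> u3 u2 v0 uv; rewrite sum_wlogE.
have far j : 2^-1 <= nm (1 - w ^+ j * u).
  by have := nm_subl 1 (w ^+ j * u); rewrite nm1 nmM w1 mul1r; lra.
rewrite (eq_bigr (fun j : 'I_n => nm (1 - w ^+ j * u))); last first.
  by move=> j _; rewrite max_l//; apply: le_trans (third_half p) (far j).
rewrite -nm_prod (prim_prod u pw); set s := nm u ^+ n in uv *.
have s0 : d <= s by apply: lerXn2r; rewrite ?nnegrE ?nm_ge0 ?invr_ge0.
have s1 : s <= 1 by apply: exprn_ile1; [exact: nm_ge0|lra].
have hd := d0.
have E : nm (1 - u ^+ n) ^+ 2 = (1 + s) ^+ 2 - 2 * s * v.
  have := nm_sqr (u ^+ n); rewrite nmX -/s uv => e.
  by rewrite nm_sqr ReD ImD ReN ImN uv /= sub0r sqrrN; move: (complex.Im _) e => y e; lra.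
have p1 : 0 < 1 + s by lra.
have sq : nm (1 - u ^+ n) <= (1 + s) * expR (- (d / 4 * v)).
  rewrite -ler_sqr ?nnegrE ?nm_ge0 ?mulr_ge0 ?expR_ge0 ?(ltW p1)// E exprMn -expRM_natl.
  have := expR_ge1Dx (2%:R * - (d / 4 * v)).
  set x := expR _ => hx; have hx' := ler_wpM2l (sqr_ge0 (1 + s)) hx.
  apply: le_trans hx'.
  have : d * v <= s * v by rewrite ler_wpM2r.
  have : (1 + s) ^+ 2 <= 4 by nra.
  have : 0 <= d * v by rewrite mulr_ge0// ltW.
  nra.
have n0 : 0 < nm (1 - u ^+ n).
  have := nm_subl 1 (u ^+ n); rewrite nm1 nmX -/s.
  have : s <= 2^-1.
    rewrite /s exprS; apply: (@le_trans _ _ (nm u * 1)); last by rewrite mulr1.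
    by rewrite ler_wpM2l ?nm_ge0// exprn_ile1 ?nm_ge0//; lra.
  lra.
apply: (@le_trans _ _ (ln ((1 + s) * expR (- (d / 4 * v))))).
  by rewrite ler_ln ?posrE// mulr_gt0// expR_gt0.
by rewrite lnM ?posrE ?expR_gt0// expRK.
Qed.

End SymmetricSums.

(** * Summation by parts and the symmetric main term *)

Section Abel.
Variable R : realType.

Lemma abel_bound (A f : nat -> R) K N : (K <= N)%N ->
  `|\sum_(K <= k < N) (A k.+1 - A k) * f k| <=
  `|A N| * `|f N| + `|A K| * `|f K| + \sum_(K <= k < N) `|A k.+1| * `|f k - f k.+1|.
Proof.
move=> KN.
have -> : \sum_(K <= k < N) (A k.+1 - A k) * f k =
  A N * f N - A K * f K + \sum_(K <= k < N) A k.+1 * (f k - f k.+1).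
  rewrite -(telescope_sumr (fun k => A k * f k))// -big_split /=.
  by apply: eq_bigr => k _; ring.
apply: le_trans (ler_normD _ _) _; apply: lerD.
  by apply: le_trans (ler_normB _ _) _; rewrite !normrM.
apply: le_trans (ler_norm_sum _ _ _) _.
by apply: ler_sum => k _; rewrite normrM.
Qed.

End Abel.

Section MainTerm.
Variable R : realType.
Local Notation C := R[i].
Local Notation nm := (@Normc.normc R).
Local Notation Re := (@complex.Re R).
Variables (p : nat) (w : C) (rho : R) (l : nat -> R) (j : nat -> 'I_p.+1).
Local Notation n := p.+1.
Hypothesis pw : n.-primitive_root w.
Hypothesis rho0 : 0 < rho.
Hypothesis prho : p%:R <= rho.
Hypothesis rhon : rho < n%:R.
Hypothesis l0 : forall k, 0 < l k.
Hypothesis lnd : nondecreasing_seq l.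
Let d : R := 3^-1 ^+ n.
Let a : R := n%:R / rho.

Definition discrepancy (i : 'I_n) k : R :=
  \sum_(0 <= q < k) ((j q == i)%:R - n%:R^-1).

(** The right-hand side of [abel_bound] with the discrepancies as partial sums and l k ^ -rho in
    place of the terms and their variation. *)
Definition discrepancy_bound i K N : R :=
  `|discrepancy i N| * (l N `^ rho)^-1 + `|discrepancy i K| * (l K `^ rho)^-1 +
  \sum_(K <= k < N) `|discrepancy i k.+1| * ((l k `^ rho)^-1 - (l k.+1 `^ rho)^-1).

Let phi z (i : 'I_n) k := wlog p d (w ^+ i * (z / (l k)%:C)).

(** The indicator of the chosen direction is 1 / n plus an increment of the discrepancy, so the sum
    is its average over all directions plus sums ready for summation by parts. *)
Lemma sum_wlog_split z K N :
  \sum_(K <= k < N) wlog p d (w ^+ j k * (z / (l k)%:C)) =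
  \sum_(K <= k < N) n%:R^-1 * (\sum_(i < n) phi z i k) +
  \sum_(i < n) \sum_(K <= k < N) (discrepancy i k.+1 - discrepancy i k) * phi z i k.
Proof.
rewrite exchange_big /= -big_split /=; apply: eq_bigr => k _.
rewrite mulr_sumr -big_split /= (bigD1 (j k))//= big1 => [|i ij].
  rewrite addr0 /discrepancy big_nat_recr//= eqxx /phi mulr1n.
  by move: (wlog _ _ _) (n%:R^-1) (\sum_(0 <= _ < _) _) => x y s; ring.
rewrite /discrepancy big_nat_recr//= eq_sym (negbTE ij) mulr0n.
by move: (phi _ _ _) (n%:R^-1) (\sum_(0 <= _ < _) _) => x y s; ring.
Qed.

Let dB : exists2 B, 0 <= B & forall om (s t : R), nm om = 1 -> 0 <= s -> s <= t ->
  `|wlog p d (t%:C * om) - wlog p d (s%:C * om)| <= B * (t `^ rho - s `^ rho) /\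
  `|wlog p d (t%:C * om)| <= B * t `^ rho.
Proof.
by apply: wlog_lip => //; [rewrite exprn_gt0// invr_gt0|exact: third_half|exact: ltW].
Qed.

(** For a fixed direction the points z / l k move inward along one ray, so [wlog_lip] bounds each
    increment by that of l k ^ -rho times |z|^rho. *)
Lemma discrepancy_sum_le : exists2 B, 0 <= B & forall z K N, z != 0 -> (K <= N)%N ->
  \sum_(i < n) \sum_(K <= k < N) (discrepancy i k.+1 - discrepancy i k) * phi z i k <=
  B * nm z `^ rho * \sum_(i < n) discrepancy_bound i K N.
Proof.
have [B B0 hB] := dB; exists B => // z K N z0 KN.
have r0 : 0 < nm z by rewrite nm_gt0.
rewrite mulr_sumr; apply: ler_sum => i _.
apply: le_trans (ler_norm _) (le_trans (abel_bound _ _ KN) _).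
pose om := w ^+ i * (z / (nm z)%:C).
have nC (x : R) : 0 < x -> x%:C != 0 :> C by move=> x0; rewrite -nm_gt0 nm_real normr_gt0 gt_eqF.
have o1 : nm om = 1.
  by rewrite /om nmM nmX (nm_prim pw) expr1n mul1r nmM nmV nm_real ger0_norm ?nm_ge0// mulfV// gt_eqF.
have phE k : phi z i k = wlog p d ((nm z / l k)%:C * om).
  have -> : (nm z / l k)%:C = (nm z)%:C / (l k)%:C by rewrite rmorphM fmorphV.
  rewrite /phi /om; congr wlog; have := nC _ r0; have := nC _ (l0 k).
  move: (nm z)%:C (l k)%:C => x y y0 x0; field.
  by rewrite x0 y0.
have pE k : (nm z / l k) `^ rho = nm z `^ rho * (l k `^ rho)^-1.
  by rewrite powR_div// ltW.
have t0 k : 0 <= nm z / l k by rewrite divr_ge0// ltW.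
have b1 k : `|phi z i k| <= B * nm z `^ rho * (l k `^ rho)^-1.
  by rewrite phE -mulrA -pE; have [_] := hB om _ _ o1 (t0 k) (lexx _).
have b2 k : `|phi z i k - phi z i k.+1| <= B * nm z `^ rho * ((l k `^ rho)^-1 - (l k.+1 `^ rho)^-1).
  rewrite !phE -mulrA mulrBr -!pE; have [] // := hB om _ _ o1 (t0 k.+1) (_ : nm z / l k.+1 <= nm z / l k).
  by rewrite ler_wpM2l ?(ltW r0)// lef_pV2 ?posrE//; exact: lnd.
rewrite /discrepancy_bound !mulrDr mulr_sumr; apply: lerD; first apply: lerD.
- by rewrite mulrCA ler_wpM2l.
- by rewrite mulrCA ler_wpM2l.
by apply: ler_sum => k _; rewrite mulrCA ler_wpM2l.
Qed.

Variable D : R.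
Hypothesis D0 : 0 < D.
Hypothesis dens : has_density rho l D.

(** The points with 2 r <= l k <= 3 r will supply the gain. Their indices include those from (D + e)
    (2 r)^rho to (D - e) (3 r)^rho; the factor 2 in the hypothesis absorbs the rounding of the
    ends. *)
Lemma density_window e k0 K0 : 0 < e -> 0 < k0 ->
  2 * k0 <= (D - e) * 3 `^ rho - (D + e) * 2 `^ rho ->
  exists2 r1, 1 <= r1 & forall r, r1 <= r -> exists p1 p2, [/\ (K0 <= p1)%N, (p1 <= p2)%N,
    k0 * r `^ rho <= (p2 - p1)%:R &
    forall k, (p1 <= k)%N -> (k < p2)%N -> 3^-1 <= r / l k /\ r / l k <= 2^-1].
Proof.
move=> e0 k00 win; have hD := D0.
have [K1 hK1] := density_power rho0 D0 l0 lnd dens e0.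
pose M := maxn K0 K1.
have De : 0 < D + e by lra.
have p20 : 0 < 2 `^ rho :> R by rewrite powR_gt0.
have p30 : 0 < 3 `^ rho :> R by rewrite powR_gt0.
have De3 : 0 < D - e.
  by rewrite -(pmulr_lgt0 _ p30); have := mulr_gt0 De p20; lra.
have [r1 r11 hr1] := powR_large (Num.max k0^-1 (M%:R + 1) / Num.min 1 ((D + e) * 2 `^ rho)) rho0.
exists r1 => // r rr; have r0 : 0 < r by lra.
have {hr1} := hr1 r rr; set X := r `^ rho; have X0 : 0 < X by rewrite powR_gt0.
rewrite ler_pdivrMr; last by rewrite lt_min ltr01 mulr_gt0.
rewrite ge_max => /andP[X1 X2].
have {}X1 : k0^-1 <= X by apply: le_trans X1 _; rewrite ger_pMr// ge_min lexx.
have {}X2 : M%:R + 1 <= (D + e) * 2 `^ rho * X.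
  by apply: le_trans X2 _; rewrite mulrC ler_pM2r// ge_min lexx orbT.
pose y1 := (D + e) * 2 `^ rho * X; pose y2 := (D - e) * 3 `^ rho * X.
have /andP[q1 q1'] : (Num.truncn y1)%:R <= y1 < (Num.truncn y1).+1%:R.
  by apply: truncn_itv; rewrite !mulr_ge0// ltW.
have /andP[q2 q2'] : (Num.truncn y2)%:R <= y2 < (Num.truncn y2).+1%:R.
  by apply: truncn_itv; rewrite !mulr_ge0// ltW.
have k0X : 1 <= k0 * X by rewrite -ler_pdivrMl// mulr1.
have y12 : 2 * k0 * X <= y2 - y1 by have := ler_wpM2r (ltW X0) win; rewrite /y1 /y2; lra.
have p12 : (Num.truncn y1 <= Num.truncn y2)%N.
  rewrite -ltnS -(ltr_nat R); lra.
have Mp : (M <= Num.truncn y1)%N by rewrite -ltnS -(ltr_nat R) -/y1 in X2 *; lra.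
exists (Num.truncn y1), (Num.truncn y2); split => //.
- by apply: leq_trans Mp; rewrite leq_maxl.
- by rewrite natrB//; move: q2'; rewrite -natr1; lra.
move=> k k1 k2; have lk := l0 k.
have [|h1 h2] := hK1 k; first by apply: leq_trans k1; apply: leq_trans Mp; rewrite leq_maxr.
have pe (x y : R) : 0 <= x -> 0 <= y -> x `^ rho <= y `^ rho -> x <= y.
  move=> x0 y0; rewrite leNgt => h; rewrite leNgt; apply: contra h => h.
  exact: gt0_ltr_powR.
split.
  rewrite ler_pdivlMr// mulrC ler_pdivrMr//.
  apply: pe; rewrite ?mulr_ge0 ?(ltW lk) ?(ltW r0)//.
  rewrite mulrC powRM ?(ltW r0)// -/X -(ler_pM2l De3); apply: le_trans h2 _.
  rewrite mulrA; apply: le_trans q2; rewrite ler_nat; exact: ltnW.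
rewrite ler_pdivrMr// mulrC ler_pdivlMr//.
apply: pe; rewrite ?mulr_ge0 ?(ltW lk) ?(ltW r0)//.
rewrite mulrC powRM ?(ltW r0)// -/X -(ler_pM2l De); apply: le_trans h1.
by rewrite mulrA; apply: ltW; apply: lt_le_trans q1' _; rewrite ler_nat.
Qed.

(** Each symmetric sum is at most ln(1 + |z / l k|^n), and these add up to [logconst]; the indices
    of [density_window] improve this by an amount proportional to v. *)
Lemma main_term e k0 K0 : 0 < e -> 0 < k0 ->
  2 * k0 <= (D - e) * 3 `^ rho - (D + e) * 2 `^ rho ->
  (forall k, (K0 <= k)%N -> k.+1%:R <= (D + e) * l k `^ rho) ->
  exists2 r1, 1 <= r1 & forall z v, r1 <= nm z -> 0 <= v -> Re (z ^+ n) = nm z ^+ n * (v - 1) ->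
  exists N1, forall N, (N1 <= N)%N ->
  \sum_(K0 <= k < N) n%:R^-1 * (\sum_(i < n) phi z i k) <=
  n%:R^-1 * (logconst a * (D + e) - d / 4 * k0 * v) * nm z `^ rho.
Proof.
move=> e0 k00 win hK0; have hD := D0.
have [r1 r11 hr1] := density_window K0 e0 k00 win.
exists r1 => // z v zr v0 zv; have r0 : 0 < nm z by lra.
have [p1 [p2 [K0p1 p12 cnt hk]]] := hr1 _ zr.
exists p2 => N p2N.
have dd : 0 < d by rewrite exprn_gt0// invr_gt0.
have De : 0 < D + e by lra.
have a1 : 1 < a by rewrite /a ltr_pdivlMr// mul1r.
rewrite -mulr_sumr -mulrA ler_wpM2l ?invr_ge0//.
pose g k : R := if (p1 <= k < p2)%N then d / 4 * v else 0.
pose x := (D + e) * nm z `^ rho.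
have nmu k : nm (z / (l k)%:C) = nm z / l k by rewrite nmM nmV nm_real ger0_norm// ltW.
have b k : (K0 <= k)%N -> \sum_(i < n) phi z i k <= ln (1 + (x / k.+1%:R) `^ a) - g k.
  move=> Kk; apply: (@le_trans _ _ (ln (1 + nm (z / (l k)%:C) ^+ n) - g k)).
    rewrite /g; case: ifP => [/andP[k1 k2]|_]; last by rewrite subr0; exact: sum_wlog_le.
    have [h1 h2] := hk k k1 k2.
    apply: sum_wlog_gain => //; rewrite ?nmu//.
    rewrite exprMn exprVn -(rmorphXn (real_complex R)) /= -fmorphV mulrC.
    by rewrite ReM /= mul0r subr0 zv exprMn exprVn; ring.
  rewrite lerD2r nmu (powR_ratio rho0 n (ltW r0) (l0 k)) -/a.
  have q (y : R) : 0 < 1 + y `^ a by have := powR_ge0 y a; lra.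
  have kp : (0 : R) < k.+1%:R by rewrite ltr0n.
  have lk : 0 < l k `^ rho by rewrite powR_gt0.
  rewrite ler_ln ?posrE// lerD2l; apply: ge0_ler_powR; rewrite ?nnegrE.
  - lra.
  - by rewrite divr_ge0 ?powR_ge0.
  - by rewrite divr_ge0 ?mulr_ge0 ?powR_ge0// ltW.
  rewrite ler_pdivrMr// mulrAC ler_pdivlMr// /x mulrAC mulrC ler_wpM2r ?powR_ge0//.
  exact: hK0.
apply: (@le_trans _ _ (\sum_(K0 <= k < N) (ln (1 + (x / k.+1%:R) `^ a) - g k))).
  by rewrite !big_nat; apply: ler_sum => k /andP[Kk _]; exact: b.
rewrite big_split /= sumrN.
have K0N : (K0 <= N)%N by rewrite (leq_trans K0p1)// (leq_trans p12).
have h1 : \sum_(K0 <= k < N) ln (1 + (x / k.+1%:R) `^ a) <= logconst a * x.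
  have x0 : 0 < x by rewrite mulr_gt0// powR_gt0.
  apply: le_trans (logsum_upper a1 N x0); rewrite /logsum (big_cat_nat (leq0n K0) K0N) /= lerDr.
  by apply: sumr_ge0 => k _; exact: logsum_term_ge0.
have h2 : \sum_(K0 <= k < N) g k = (p2 - p1)%:R * (d / 4 * v).
  rewrite (big_cat_nat K0p1 (leq_trans p12 p2N)) /= (big_cat_nat p12 p2N) /=.
  rewrite big_nat_cond big1; last by move=> k /andP[/andP[_ kp] _]; rewrite /g leqNgt kp.
  rewrite [X in _ + (_ + X)]big_nat_cond [X in _ + (_ + X)]big1; last first.
    by move=> k /andP[/andP[kp _] _]; rewrite /g [(k < p2)%N]ltnNge kp andbF.
  rewrite add0r addr0 mulr_natl -sumr_const_nat big_nat_cond [RHS]big_nat_cond.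
  by apply: eq_bigr => k; rewrite andbT /g => ->.
have : k0 * nm z `^ rho * (d / 4 * v) <= (p2 - p1)%:R * (d / 4 * v).
  by rewrite ler_wpM2r// mulr_ge0// divr_ge0// ltW.
rewrite h2; move: h1; rewrite /x; lra.
Qed.

End MainTerm.

(** * Canonical products and their zeros *)

Section CanonicalProduct.
Variable R : realType.
Local Notation C := R[i].
Local Notation nm := (@Normc.normc R).
Implicit Types (z x : C) (k m N : nat).

Variables (a : R) (lam : nat -> C) (H : nat -> C -> C).
Hypothesis a1 : 1 < a.
Hypothesis lam0 : forall k, lam k != 0.
Hypothesis entH : forall k, ent (H k).
Hypothesis fin : forall z, exists N, forall k, lam k = z -> (k < N)%N.

Let F k x := (1 - x / lam k) * H k x.

Hypothesis Fsmall : forall r, exists B K, forall k z, (K <= k)%N -> nm z <= r ->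
  nm (F k z - 1) <= B * k.+2%:R `^ (- a).

Let entF k : ent (F k).
Proof.
apply: entM => // z; eexists; apply: cdiffB; first exact: cdiff_cst.
rewrite (_ : (fun x => x / lam k) = (fun x => (lam k)^-1 * x)); first exact: (cdiffZ _ (cdiff_id z)).
by apply/funext => x; rewrite mulrC.
Qed.

Lemma partial_product_zeros z N : exists2 G, ent G & forall x,
  \prod_(0 <= k < N) F k x = (x - z) ^+ count_mem z [seq lam k | k <- iota 0 N] * G x.
Proof.
elim: N => [|N [G hG GE]].
  by exists (fun=> 1); [exact: ent_cst|move=> x; rewrite big_nil mulr1].
have cE : count_mem z [seq lam k | k <- iota 0 N.+1] =
    (count_mem z [seq lam k | k <- iota 0 N] + (lam N == z))%N.
  by rewrite -addn1 iotaD map_cat count_cat /= add0n addn0.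
have [lz|lz] := eqVneq (lam N) z; last first.
  exists (fun x => G x * F N x); first exact: entM.
  by move=> x; rewrite cE (negbTE lz) addn0 big_nat_recr// GE mulrA.
exists (fun x => (- z^-1) * (G x * H N x)).
  by apply: entM; [exact: ent_cst|exact: entM].
move=> x; rewrite cE lz eqxx addn1 big_nat_recr// GE exprSr.
have z0 : z != 0 by rewrite -lz.
by rewrite /= /F lz; field.
Qed.

(** Only divisibility by (x - z)^m is claimed, since the factors [H] may bring further zeros. All
    indices with lam k = z lie below some N: the first N factors carry these zeros, and the others
    form an entire product of the same kind. *)
Lemma canonical_product : exists f, [/\ ent f,
  forall z e, 0 < e -> exists M, forall N, (M <= N)%N -> nm (\prod_(0 <= k < N) F k z - f z) <= e &
  forall z m, (`I_m #<= [set k | lam k = z])%card -> exists2 g, ent g & forall x, f x = (x - z) ^+ m * g x].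
Proof.
have [f hf fl] := infinite_product a1 entF Fsmall; exists f; split=> // z m mz.
have [N hN] := fin z.
have [|g hg gl] := @infinite_product R a (fun k => F (N + k)%N) a1 (fun k => entF (N + k)).
  move=> r; have [B [K hB]] := Fsmall r; exists (Num.max 0 B), K => k x Kk xr.
  apply: le_trans (hB (N + k)%N x _ xr) _; first by rewrite (leq_trans Kk)// leq_addl.
  apply: (@le_trans _ _ (Num.max 0 B * (N + k).+2%:R `^ (- a))).
    by rewrite ler_wpM2r ?powR_ge0// le_max lexx orbT.
  rewrite ler_wpM2l ?le_max ?lexx// !powRN lef_pV2 ?posrE ?powR_gt0//.
  by apply: ge0_ler_powR; rewrite ?nnegrE// ?ler_nat ?ltnS ?leq_addl//; have := a1; lra.
have [G hG GE] := partial_product_zeros z N.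
have fE x : f x = \prod_(0 <= k < N) F k x * g x.
  apply/eqP; rewrite -subr_eq0 -nm_eq0 eq_le nm_ge0 andbT; apply/ler_addgt0Pl => e e0.
  rewrite addr0; set P := \prod_(0 <= k < N) F k x.
  have P1 : 0 < 1 + nm P by have := nm_ge0 P; lra.
  have e1 : 0 < e / 2 by rewrite divr_gt0.
  have e2 : 0 < e / 2 / (1 + nm P) by rewrite divr_gt0.
  have [M1 h1] := fl x _ e1; have [M2 h2] := gl x _ e2.
  have {}h1 := h1 (N + (M1 + M2))%N (leq_trans (leq_addr M2 M1) (leq_addl _ _)).
  have {}h2 := h2 (M1 + M2)%N (leq_addl _ _).
  rewrite (big_cat_nat (leq0n N) (leq_addr _ N)) /= -/P in h1.
  rewrite -[X in \prod_(X <= _ < _) _]add0n big_addn addKn (eq_bigr (fun k => F (N + k)%N x)) in h1; last first.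
    by move=> k _; rewrite addnC.
  move: h1 h2; set Q := \prod_(0 <= k < _) _ => h1 h2.
  have -> : f x - P * g x = P * (Q - g x) - (P * Q - f x) by ring.
  apply: le_trans (nmD _ _) _; rewrite nmN nmM.
  have : nm P * nm (Q - g x) <= e / 2.
    apply: (@le_trans _ _ ((1 + nm P) * (e / 2 / (1 + nm P)))).
      by apply: ler_pM; rewrite ?nm_ge0//; lra.
    by rewrite mulrCA mulfV ?mulr1// gt_eqF.
  lra.
have fz : finite_set [set k | lam k = z].
  by apply: (@sub_finite_set _ _ `I_N) (finite_II N) => k /= /hN.
have /finite_setP[m' cm'] := fz.
have mm' : (m <= m')%N by rewrite -card_le_II -(card_le_eqr cm').
have [_ /(_ hN) cE] := @count_fiber R lam N z m' cm'.
exists (fun x => (x - z) ^+ (m' - m) * (G x * g x)).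
  by apply: entM; [exact: ent_subX|exact: entM].
by move=> x; rewrite fE GE cE -{1}(subnKC mm') exprD; ring.
Qed.

End CanonicalProduct.

(** * The factors of the constructed function *)

Section Growth.
Variable R : realType.
Local Notation C := R[i].
Local Notation nm := (@Normc.normc R).
Local Notation Re := (@complex.Re R).
Implicit Types (z x : C) (r v e : R) (k m N K : nat).

(** v = 1 + cos(n arg z), which measures the distance to the rays z^n < 0, where it vanishes. *)
Lemma direction n z : z != 0 -> exists v, [/\ 0 <= v, v <= 2 & Re (z ^+ n) = nm z ^+ n * (v - 1)].
Proof.
move=> z0; have r0 : 0 < nm z ^+ n by rewrite exprn_gt0// nm_gt0.
have := Re_le_nm (z ^+ n); rewrite nmX ler_norml => /andP[h1 h2].
exists (1 + Re (z ^+ n) / nm z ^+ n); split.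
- have : -1 <= Re (z ^+ n) / nm z ^+ n by rewrite ler_pdivlMr// mulN1r.
  lra.
- have : Re (z ^+ n) / nm z ^+ n <= 1 by rewrite ler_pdivrMr// mul1r.
  lra.
by rewrite addrC addKr mulrCA mulfV ?mulr1// gt_eqF.
Qed.

Variables (p : nat) (rho E : R).
Local Notation n := p.+1.
Let a : R := n%:R / rho.
Hypothesis rho0 : 0 < rho.
Hypothesis prho : p%:R <= rho.
Hypothesis rhon : rho < n%:R.
Hypothesis E0 : 0 < E.

Let a1 : 1 < a.
Proof. by rewrite /a ltr_pdivlMr// mul1r. Qed.

(* These zeros lie on the rays where z^n is negative, which carry no point of the
   randomized set and where the growth of its canonical product is maximal. *)
Definition antiray_factor k z : C := 1 + ((E / k.+1%:R) `^ a)%:C * z ^+ n.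

Let antiray_coef k r : 0 <= r -> (E / k.+1%:R) `^ a * r ^+ n = (E * r `^ rho / k.+1%:R) `^ a.
Proof.
move=> r0; have -> : E * r `^ rho / k.+1%:R = E / k.+1%:R * r `^ rho by rewrite mulrAC.
rewrite (@powRM _ (E / k.+1%:R) (r `^ rho)) ?powR_ge0// ?divr_ge0 ?(ltW E0)//; congr (_ * _).
by rewrite -powRrM /a mulrCA mulfV ?mulr1 ?powR_mulrn// gt_eqF.
Qed.

(** This is the factor in [antiray_decay] at x = E |z|^rho; [E] is the density of the additional
    zeros on each ray. *)
Lemma antiray_factor_sqr z v k : Re (z ^+ n) = nm z ^+ n * (v - 1) ->
  nm (antiray_factor k z) ^+ 2 =
  (1 - (E * nm z `^ rho / k.+1%:R) `^ a) ^+ 2 + 2 * (E * nm z `^ rho / k.+1%:R) `^ a * v.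
Proof.
move=> zv; rewrite -(antiray_coef k (nm_ge0 z)) /antiray_factor.
have := nm_sqr (z ^+ n); rewrite nmX zv nm_sqr ReD ImD ReM ImM zv /=.
move: (powR _ _) (nm z ^+ n) (complex.Im _) => s t y h.
rewrite !mul0r subr0 addr0 add0r exprMn.
have -> : y ^+ 2 = t ^+ 2 - (t * (v - 1)) ^+ 2 by rewrite h; ring.
ring.
Qed.

Lemma antiray_factor_le z k :
  nm (antiray_factor k z) <= 1 + (E * nm z `^ rho / k.+1%:R) `^ a.
Proof.
rewrite -(antiray_coef k (nm_ge0 z)); apply: le_trans (nmD _ _) _.
by rewrite nm1 nmM nmX nm_real ger0_norm// powR_ge0.
Qed.

Lemma antiray_product_le z N : z != 0 ->
  nm (\prod_(0 <= k < N) antiray_factor k z) <= expR (logconst a * (E * nm z `^ rho)).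
Proof.
move=> z0; have x0 : 0 < E * nm z `^ rho by rewrite mulr_gt0// powR_gt0// nm_gt0.
apply: (@le_trans _ _ (expR (logsum a (E * nm z `^ rho) N))); last first.
  by rewrite ler_expR logsum_upper.
rewrite nm_prod /logsum expR_sum; apply: ler_prod => k _; rewrite nm_ge0 /=.
rewrite lnK ?posrE; last by have := powR_ge0 (E * nm z `^ rho / k.+1%:R) a; lra.
exact: antiray_factor_le.
Qed.

Variables (l : nat -> R) (lam : nat -> C).
Hypothesis l0 : forall k, 0 < l k.
Hypothesis lnd : nondecreasing_seq l.
Hypothesis lamE : forall k, nm (lam k) = l k.
Variable K0 : nat.

(* The convergence factor is omitted for k < K0: for integral rho the finitely
   many exponentials would contribute to the growth of order rho. *)
Definition regular_factor k z : C :=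
  (if (k < K0)%N then 1 else cexp (wpoly p (z / lam k))) * antiray_factor k z.

Definition zero_factor k z : C := (1 - z / lam k) * regular_factor k z.

Lemma zero_factorE k z : zero_factor k z =
  (if (k < K0)%N then 1 - z / lam k else wfactor p (z / lam k)) * antiray_factor k z.
Proof. by rewrite /zero_factor /regular_factor; case: ifP => _; rewrite /wfactor; ring. Qed.

Let ent_ratio k : ent (fun z => z / lam k).
Proof.
move=> z; eexists; rewrite (_ : (fun x => x / lam k) = (fun x => (lam k)^-1 * x)).
  exact: (cdiffZ _ (cdiff_id z)).
by apply/funext => x; rewrite mulrC.
Qed.

Lemma ent_regular_factor k : ent (regular_factor k).
Proof.
apply: entM.
  case: (k < K0)%N; first exact: ent_cst.
  have ec : ent (@cexp R) by move=> z; eexists; exact: cdiff_cexp.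
  have ew : ent (@wpoly R p) by move=> z; eexists; exact: cdiff_wpoly.
  exact: (ent_comp ec (ent_comp ew (ent_ratio k))).
apply: entD; first exact: ent_cst.
by apply: entM; [exact: ent_cst|move=> z; eexists; exact: cdiffX].
Qed.

Variable D : R.
Hypothesis D0 : 0 < D.
Hypothesis dens : has_density rho l D.

Let shift_pow k : (k.+1%:R : R) `^ (- a) <= 2 `^ a * k.+2%:R `^ (- a).
Proof.
have k1 : (0 : R) < k.+1%:R by rewrite ltr0n.
have k2 : (0 : R) < k.+2%:R by rewrite ltr0n.
rewrite !powRN ler_pdivlMr ?powR_gt0// mulrC ler_pdivrMr ?powR_gt0// -powRM ?ler0n//.
have ap : 0 <= a := ltW (lt_trans ltr01 a1).
have k2' : 0 <= 2 * k.+1%:R :> R by rewrite mulr_ge0.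
apply: ge0_ler_powR; rewrite ?nnegrE ?ler0n//.
rewrite -[k.+2%:R]natr1; have : 1 <= k.+1%:R :> R by rewrite ler1n.
lra.
Qed.

(** Each point is paired with one factor of the additional product, so that a single product
    converges: both deviations from 1 are O(k^-a) on discs, the first because genus p gives |z / lam
    k|^n and l k ^ rho is of order k. *)
Lemma zero_factor_small r : exists B K, forall k z, (K <= k)%N -> nm z <= r ->
  nm (zero_factor k z - 1) <= B * k.+2%:R `^ (- a).
Proof.
have hD := D0; have ha := a1; have ap : 0 <= a := ltW (lt_trans ltr01 a1).
have [K1 hK1] := density_power rho0 D0 l0 lnd dens (@ltr01 R).
have [K2 hK2] := counting_finite lnd dens r.
have [r0|r0] := ltP r 0.
  exists 0, 0%N => k z _ zr; have := nm_ge0 z; lra.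
pose S := 2 * expR p%:R * ((D + 1) * r `^ rho) `^ a * 2 `^ a.
pose T := (E * r `^ rho) `^ a * 2 `^ a.
have S0 : 0 <= S by rewrite !mulr_ge0 ?expR_ge0 ?powR_ge0.
have T0 : 0 <= T by rewrite mulr_ge0 ?powR_ge0.
exists (S + T + S * T), (maxn K0 (maxn K1 K2)) => k z; rewrite !geq_max => /andP[k0 /andP[k1 k2]] zr.
rewrite zero_factorE ltnNge k0 /=.
have lk := l0 k; have kp : (0 : R) < k.+1%:R by rewrite ltr0n.
have rl : r <= l k by rewrite leNgt -hK2 -leqNgt.
have nu : nm (z / lam k) = nm z / l k by rewrite nmM nmV lamE.
have u1 : nm (z / lam k) <= 1 by rewrite nu ler_pdivrMr// mul1r (le_trans zr).
have h1 : nm (wfactor p (z / lam k) - 1) <= S * k.+2%:R `^ (- a).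
  apply: le_trans (wfactor_sub1 p u1) _; rewrite /S -[leRHS]mulrA -[leRHS]mulrA.
  rewrite ler_pM2l ?mulr_gt0 ?expR_gt0//.
  have := ler_wpM2l (powR_ge0 ((D + 1) * r `^ rho) a) (shift_pow k); apply: le_trans.
  rewrite nu (powR_ratio rho0 n (nm_ge0 z) lk) -/a powRN -(@powR_div R ((D + 1) * r `^ rho))//; last first.
    by rewrite mulr_ge0 ?powR_ge0//; lra.
  have lr : 0 < l k `^ rho by rewrite powR_gt0.
  apply: ge0_ler_powR; rewrite ?nnegrE; [by []|by rewrite divr_ge0 ?powR_ge0| |].
    by rewrite divr_ge0// mulr_ge0 ?powR_ge0//; lra.
  rewrite ler_pdivrMr// mulrAC ler_pdivlMr//.
  have q1 : nm z `^ rho <= r `^ rho by apply: ge0_ler_powR; rewrite ?nnegrE ?nm_ge0// ltW.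
  have [q2 _] := hK1 k k1.
  have := ler_pM (powR_ge0 (nm z) rho) (ltW kp) q1 q2.
  by rewrite mulrA [_ * (D + 1)]mulrC.
have h2 : nm (antiray_factor k z - 1) <= T * k.+2%:R `^ (- a).
  rewrite /antiray_factor addrC addKr nmM nm_real ger0_norm ?powR_ge0// nmX antiray_coef ?nm_ge0//.
  rewrite /T -[leRHS]mulrA; have := ler_wpM2l (powR_ge0 (E * r `^ rho) a) (shift_pow k); apply: le_trans.
  have q0 : 0 <= E * r `^ rho by rewrite mulr_ge0 ?powR_ge0// ltW.
  rewrite powRN -(powR_div a q0 kp).
  apply: ge0_ler_powR; rewrite ?nnegrE; [by []| | |].
  - by rewrite divr_ge0 ?mulr_ge0 ?powR_ge0// ltW.
  - by rewrite divr_ge0 ?mulr_ge0 ?powR_ge0// ltW.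
  rewrite ler_pM2r ?invr_gt0// ler_pM2l//.
  by apply: ge0_ler_powR; rewrite ?nnegrE ?nm_ge0// ltW.
have s1 : k.+2%:R `^ (- a) <= 1 :> R.
  rewrite powRN invf_le1 ?powR_gt0//.
  by rewrite -[leLHS](powRr0 k.+2%:R) ler_powR ?ler1n.
have s0 := powR_ge0 (k.+2%:R : R) (- a).
move: h1 h2 s0 s1; set A := wfactor _ _; set B := antiray_factor _ _; set s := powR _ _ => h1 h2 s0 s1.
have -> : A * B - 1 = (A - 1) + (B - 1) + (A - 1) * (B - 1) by ring.
apply: le_trans (nmD _ _) _; apply: le_trans (lerD (nmD _ _) (lexx _)) _; rewrite nmM.
have h3 : nm (A - 1) * nm (B - 1) <= S * T * s.
  apply: (@le_trans _ _ ((S * s) * (T * s))).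
    by apply: ler_pM => //; exact: nm_ge0.
  have : S * T * s * s <= S * T * s * 1.
    by apply: ler_wpM2l => //; exact: mulr_ge0 (mulr_ge0 S0 T0) s0.
  lra.
lra.
Qed.

Lemma head_product_small e : 0 < e -> exists2 r1, 1 <= r1 & forall z, r1 <= nm z ->
  \prod_(0 <= k < K0) nm (1 - z / lam k) <= expR (e * nm z `^ rho).
Proof.
move=> e0; pose b := l 0%N `^ rho; have b0 : 0 < b by rewrite powR_gt0.
have ri : 0 <= rho^-1 by rewrite invr_ge0 ltW.
have [x1 x11 hx] := ln_powR_small ri (ler0n R K0) (mulr_gt0 e0 b0).
have [r1 r11 hr1] := powR_large (x1 * b) rho0.
exists r1 => // z zr; have r0 : 0 < nm z by lra.
have := hr1 _ zr; rewrite -ler_pdivlMr// => /hx.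
have -> : e * b * (nm z `^ rho / b) = e * nm z `^ rho by field; rewrite gt_eqF.
have -> : (nm z `^ rho / b) `^ rho^-1 = nm z / l 0%N.
  rewrite -powR_div ?(ltW r0)// -powRrM mulfV ?gt_eqF// powRr1// divr_ge0 ?ltW//.
move=> h; apply: (@le_trans _ _ (expR (K0%:R * ln (1 + nm z / l 0%N)))); last by rewrite ler_expR.
have q : 0 < 1 + nm z / l 0%N by have := divr_gt0 r0 (l0 0); lra.
rewrite expRM_natl lnK ?posrE//.
have -> : (1 + nm z / l 0%N) ^+ K0 = \prod_(0 <= k < K0) (1 + nm z / l 0%N).
  by rewrite prodr_const_nat subn0.
apply: ler_prod => k _; rewrite nm_ge0 /=; apply: le_trans (nmD _ _) _.
rewrite nm1 nmN nmM nmV lamE lerD2l ler_wpM2l ?nm_ge0// lef_pV2 ?posrE//.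
exact: lnd.
Qed.

End Growth.

(** * Functions in the Fock space *)

Section FockNorm.
Variable R : realType.
Local Notation C := R[i].
Local Notation nm := (@Normc.normc R).
Local Notation leb := (@lebesgue_measure R).

Lemma integral_oneDsqr : (\int[leb]_x ((oneDsqr x)^-1)%:E = pi%:E)%E.
Proof.
rewrite (ge0_symfun_integralT (f := fun x => (oneDsqr x)^-1)); first last.
- by move=> x /=; rewrite /oneDsqr sqrrN.
- exact: continuous_oneDsqrV.
- by move=> x; rewrite invr_ge0; apply: le_trans (oneDsqr_ge1 x).
rewrite (_ : [set x : R | 0 <= x] = `[0%R, +oo[%classic); last first.
  by apply/seteqP; split => x; rewrite /= in_itv /= andbT.
by rewrite integral0y_oneDsqr -EFinM; congr EFin; field.
Qed.

Lemma powR_le_exp (s t : R) : 0 <= s -> 0 < t ->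
  exists2 B, 0 < B & forall X, 0 < X -> X `^ s <= B * expR (t * X).
Proof.
move=> s0 t0; pose y := t / (1 + s).
have y0 : 0 < y by rewrite divr_gt0//; lra.
exists (expR (- (s * ln y))); first exact: expR_gt0.
move=> X X0; rewrite -expRD /powR gt_eqF// ler_expR.
have := ln_lt_id (mulr_gt0 y0 X0); rewrite lnM ?posrE// => h.
have : s * (ln y + ln X) <= s * (y * X) by rewrite ler_wpM2l.
have yX : 0 < y * X by rewrite mulr_gt0.
have : t * X = (1 + s) * (y * X) by rewrite /y; field; rewrite gt_eqF//; lra.
lra.
Qed.

(** The surplus h in the exponent absorbs (1 + |z|^2)^2, so the integrand is at most A / ((1 + x^2)
    (1 + y^2)), whose double integral factors. *)
Lemma fock_norm_fin (rho h r1 : R) (f : C -> C) : 0 < rho -> 0 < h -> ent f ->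
  (forall z, r1 <= nm z -> nm (f z) <= expR ((1 - h) * nm z `^ rho)) ->
  (fock_norm_sq rho f < +oo)%E.
Proof.
move=> rho0 h0 hf fb.
pose G z := (nm (f z) * expR (- nm z `^ rho)) ^+ 2.
pose r2 := Num.max 1 r1.
have [M M0 hM] := @ccont_disc_bounded R f r2 (fun z _ => ent_cont z hf).
have s0 : 0 <= 4 / rho by rewrite divr_ge0// ltW.
have h2 : 0 < 2 * h by lra.
have [B B0 hB] := powR_le_exp s0 h2.
pose A := 4 * B + M ^+ 2 * (1 + r2 ^+ 2) ^+ 2.
have A0 : 0 <= A.
  by apply: addr_ge0; apply: mulr_ge0; rewrite ?sqr_ge0// ltW.
have dom z : G z * (1 + nm z ^+ 2) ^+ 2 <= A.
  have [zr|zr] := leP (nm z) r2.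
    apply: (@le_trans _ _ (M ^+ 2 * (1 + r2 ^+ 2) ^+ 2)); last by rewrite lerDr mulr_ge0// ltW.
    have n0 := nm_ge0 z; have q0 := nm_ge0 (f z).
    apply: ler_pM; rewrite ?sqr_ge0//.
      apply: lerXn2r; rewrite ?nnegrE// ?mulr_ge0 ?expR_ge0//.
      rewrite -[leRHS]mulr1; apply: ler_pM; rewrite ?expR_ge0 ?hM//.
      by rewrite -[leRHS]expR0 ler_expR oppr_le0 powR_ge0.
    apply: lerXn2r; rewrite ?nnegrE ?addr_ge0 ?sqr_ge0// lerD2l.
    by apply: lerXn2r; rewrite ?nnegrE// (le_trans n0).
  have z1 : 1 < nm z by apply: le_lt_trans zr; rewrite le_max lexx.
  have zr1 : r1 <= nm z by apply: le_trans (ltW zr); rewrite le_max lexx orbT.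
  have z0 : 0 < nm z by lra.
  apply: (@le_trans _ _ (4 * B)); last by rewrite lerDl mulr_ge0 ?sqr_ge0.
  pose X := nm z `^ rho; have X0 : 0 < X by rewrite powR_gt0.
  have g1 : G z <= expR (- (2 * h * X)).
    rewrite [leRHS](_ : _ = expR (- (h * X)) ^+ 2); last by rewrite -expRM_natl; congr expR; ring.
    apply: lerXn2r; rewrite ?nnegrE ?mulr_ge0 ?expR_ge0 ?nm_ge0//.
    apply: le_trans (ler_wpM2r (expR_ge0 _) (fb z zr1)) _.
    by rewrite -expRD -/X ler_expR; lra.
  have g2 : (1 + nm z ^+ 2) ^+ 2 <= 4 * X `^ (4 / rho).
    have -> : X `^ (4 / rho) = nm z ^+ 4.
      by rewrite -powRrM mulrCA mulfV ?gt_eqF// mulr1 powR_mulrn// ltW.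
    have : 1 <= nm z ^+ 2 by rewrite exprn_ege1// ltW.
    rewrite (exprM _ 2 2); set y := nm z ^+ 2; nra.
  apply: le_trans (ler_pM (sqr_ge0 _) (sqr_ge0 _) g1 g2) _.
  have := hB X X0 => hX.
  apply: (@le_trans _ _ (expR (- (2 * h * X)) * (4 * (B * expR (2 * h * X))))).
    by rewrite ler_wpM2l ?expR_ge0// ler_pM2l.
  rewrite expRN [leLHS](_ : _ = 4 * B * ((expR (2 * h * X))^-1 * expR (2 * h * X))); last by ring.
  by rewrite mulVf ?mulr1// gt_eqF// expR_gt0.
pose W (q : R * R) := (oneDsqr q.1)^-1 * (oneDsqr q.2)^-1.
have W0 q : 0 <= W q by rewrite mulr_ge0 ?invr_ge0// (le_trans _ (oneDsqr_ge1 _)).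
have mW1 : measurable_fun [set: R] (fun x : R => (oneDsqr x)^-1).
  exact: continuous_measurable_fun (@continuous_oneDsqrV R).
have mW : measurable_fun [set: R * R] (fun q => (A * W q)%:E).
  apply/measurable_EFinP; apply: measurable_funM; first exact: measurable_cst.
  by apply: measurable_funM; [exact: (measurableT_comp mW1 measurable_fst)|exact: (measurableT_comp mW1 measurable_snd)].
have le1 : (fock_norm_sq rho f <= \int[leb \x leb]_q (A * W q)%:E)%E.
  rewrite /fock_norm_sq; apply: ge0_le_integral => //.
  - by move=> q _; rewrite lee_fin sqr_ge0.
  - by apply/measurable_EFinP; exact: measurable_fock_weight.
  move=> [x y] _; rewrite lee_fin /=.
  have := dom (x +i* y); rewrite -/(G (x +i* y)) nm_sqr /= => h1.
  have ox : 0 < oneDsqr x by apply: lt_le_trans (oneDsqr_ge1 x).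
  have oy : 0 < oneDsqr y by apply: lt_le_trans (oneDsqr_ge1 y).
  rewrite /W /= -invfM ler_pdivlMr ?mulr_gt0//; apply: le_trans h1.
  rewrite ler_wpM2l ?sqr_ge0// /oneDsqr.
  have := sqr_ge0 x; have := sqr_ge0 y; nra.
apply: le_lt_trans le1 _.
rewrite (@fubini_tonelli1 _ _ _ _ R leb leb (fun q => (A * W q)%:E) mW); last first.
  by move=> q; rewrite lee_fin mulr_ge0.
rewrite /fubini_F /=.
have lin (c : R) : 0 <= c -> (\int[leb]_y (c * (oneDsqr y)^-1)%:E = (c * pi)%:E)%E.
  move=> c0; rewrite EFinM -integral_oneDsqr.
  have := @ge0_integralZl_EFin _ _ R leb setT measurableT (EFin \o (fun y => (oneDsqr y)^-1)) _ _ _ c0.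
  apply; last by apply/measurable_EFinP.
  by move=> y _; rewrite lee_fin invr_ge0 (le_trans _ (oneDsqr_ge1 y)).
have -> : (fun x => \int[leb]_y (A * W (x, y))%:E)%E = (fun x => (A * pi * (oneDsqr x)^-1)%:E).
  apply/funext => x.
  have -> : A * pi * (oneDsqr x)^-1 = A * (oneDsqr x)^-1 * pi by ring.
  rewrite -lin; last by rewrite mulr_ge0// invr_ge0 (le_trans _ (oneDsqr_ge1 x)).
  by congr (integral _ _ _); apply/funext => y; rewrite /W mulrA.
by rewrite lin ?ltry// mulr_ge0// pi_ge0.
Qed.

End FockNorm.

(** * Sets that are not uniqueness sets *)

Section NonUniqueness.
Variable R : realType.
Local Notation C := R[i].
Local Notation nm := (@Normc.normc R).
Local Notation Re := (@complex.Re R).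

(** Smallness for arbitrarily large N suffices, because it is applied to convergent partial
    products; a large [K0] is admissible because the first factors are estimated separately. *)
Definition balanced p (rho : R) (l : nat -> R) (j : nat -> 'I_p.+1) :=
  forall e K, 0 < e -> exists2 K0, (K <= K0)%N & forall M, exists N,
    [/\ (M <= N)%N & \sum_(i < p.+1) discrepancy_bound rho l j i K0 N <= e].

Lemma limit_le (u : nat -> C) (f : C) (T : R) :
  (forall e, 0 < e -> exists M, forall N, (M <= N)%N -> nm (u N - f) <= e) ->
  (forall M, exists2 N, (M <= N)%N & nm (u N) <= T) -> nm f <= T.
Proof.
move=> uf uT; apply/ler_addgt0Pr => e e0; have [M hM] := uf e e0.
have [N MN uN] := uT M; have := nm_subl f (u N); rewrite nmB.
have := hM N MN; lra.
Qed.

Variables (p : nat) (rho : R).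
Local Notation n := p.+1.
Hypothesis rho0 : 0 < rho.
Hypothesis prho : p%:R <= rho.
Hypothesis rhon : rho < n%:R.
Hypothesis n2rho : n%:R < 2 * rho.
Let a : R := n%:R / rho.
Let c : R := logconst a.
Let d : R := 3^-1 ^+ n.

Let a1 : 1 < a.
Proof. by rewrite /a ltr_pdivlMr// mul1r. Qed.

Let a2 : a < 2.
Proof. by rewrite /a ltr_pdivrMr. Qed.

Let c0 : 0 < c.
Proof. exact: logconst_gt0. Qed.

Let d0 : 0 < d.
Proof. by rewrite exprn_gt0// invr_gt0. Qed.

Lemma zero_factor_product_bound E e1 (A W : R) (lam : nat -> C) K0 N z : (K0 <= N)%N ->
  \prod_(0 <= k < K0) nm (1 - z / lam k) <= expR (e1 * nm z `^ rho) ->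
  nm (\prod_(0 <= k < N) antiray_factor p rho E k z) <= expR (A * nm z `^ rho) ->
  \sum_(K0 <= k < N) wlog p d (z / lam k) <= W * nm z `^ rho ->
  nm (\prod_(0 <= k < N) zero_factor p rho E lam K0 k z) <= expR ((e1 + W + A) * nm z `^ rho).
Proof.
move=> K0N h1 h2 h3.
rewrite (eq_bigr (fun k => (if (k < K0)%N then 1 - z / lam k else wfactor p (z / lam k)) * antiray_factor p rho E k z)); last first.
  by move=> k _; exact: zero_factorE.
rewrite big_split nmM /= !mulrDl !expRD; apply: ler_pM; rewrite ?nm_ge0//.
rewrite nm_prod (big_cat_nat (leq0n K0) K0N) /=; apply: ler_pM.
- by apply: prodr_ge0 => k _; exact: nm_ge0.
- by apply: prodr_ge0 => k _; exact: nm_ge0.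
- apply: le_trans h1; rewrite le_eqVlt; apply/orP; left; apply/eqP.
  by rewrite big_nat [RHS]big_nat; apply: eq_bigr => k /andP[_ ->].
apply: (@le_trans _ _ (expR (\sum_(K0 <= k < N) wlog p d (z / lam k)))); last by rewrite ler_expR.
rewrite expR_sum big_nat [leRHS]big_nat; apply: ler_prod => k /andP[kK _].
by rewrite nm_ge0 /= ltnNge kK /=; exact: nm_wfactor_le.
Qed.

(** The growth exponent is c D / n, slightly above 1, minus a gain proportional to v. Where v >= dv
    half of the gain pays for the additional zeros; where v <= dv their product decays and brings
    the exponent below 1. [eta] depends only on p and rho, as it must be fixed before the sequence
    is given. *)
Lemma balanced_not_unique : exists2 eta, 0 < eta &
  forall (w : C) (l : nat -> R) (j : nat -> 'I_n) (D : R) (lam : nat -> C),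
  n.-primitive_root w -> (forall k, 0 < l k) -> nondecreasing_seq l -> has_density rho l D ->
  n%:R / c < D -> D < n%:R / c * (1 + eta) -> balanced rho l j ->
  (forall k, lam k = (l k)%:C / w ^+ j k) -> ~ uniqueness_set rho lam.
Proof.
have [ka [dv [x1 [ka0 dv0 x11 decay]]]] := antiray_decay a1 a2.
have nR : (0 : R) < n%:R by rewrite ltr0n.
have hc := c0; have hd := d0; have hr := rho0.
pose P3 : R := 3 `^ rho; pose P2 : R := 2 `^ rho.
have P20 : 0 < P2 by rewrite powR_gt0.
have P23 : P2 < P3 by apply: gt0_ltr_powR; rewrite ?nnegrE//; lra.
have nc0 : 0 < n%:R / c by rewrite divr_gt0.
pose k0 := n%:R / c * (P3 - P2) / 4.
have k00 : 0 < k0 by rewrite divr_gt0// mulr_gt0// subr_gt0.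
(* The gain at v = dv. [E] makes the additional product cost at most half of it, and [eta0] is at
   most the other half and at most the decay ka E / 2, halved because [antiray_decay] bounds
   squares. *)
pose g := n%:R^-1 * (d / 4 * k0 * dv).
have g0 : 0 < g by rewrite mulr_gt0 ?invr_gt0// mulr_gt0// mulr_gt0// divr_gt0.
pose E := g / (2 * c).
have E0 : 0 < E by rewrite divr_gt0// mulr_gt0.
have cE : c * E = g / 2 by rewrite /E; field; rewrite gt_eqF.
pose eta0 := Num.min (ka * E / 2) (g / 2).
have eta00 : 0 < eta0 by rewrite lt_min !divr_gt0// mulr_gt0.
have eta1 : eta0 <= ka * E / 2 by rewrite ge_min lexx.
have eta2 : eta0 <= g / 2 by rewrite ge_min lexx orbT.
exists (eta0 / 4); first by rewrite divr_gt0.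
move=> w l j D lam pw l0 lnd dens ncD Dnc bal lamE.
have D0 : 0 < D by lra.
have w1 k : nm (w ^+ k) = 1 by rewrite nmX (nm_prim pw) expr1n.
have lamn k : nm (lam k) = l k by rewrite lamE nmM nmV w1 invr1 mulr1 nm_real ger0_norm// ltW.
have lam0 k : lam k != 0 by rewrite -nm_gt0 lamn.
have ratio k z : z / lam k = w ^+ j k * (z / (l k)%:C).
  by rewrite lamE invfM invrK mulrA mulrC.
(* The first term keeps the error of the density below eta0 / 8 in the exponent, the second leaves
   the window required by [main_term]. *)
pose e := Num.min (eta0 * n%:R / (8 * c)) (n%:R / c * (P3 - P2) / 2 / (P3 + P2)).
have e0 : 0 < e.
  rewrite lt_min !divr_gt0 ?mulr_gt0 ?invr_gt0//; lra.
have e1 : n%:R^-1 * (c * e) <= eta0 / 8.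
  have : e <= eta0 * n%:R / (8 * c) by rewrite ge_min lexx.
  move=> /(ler_wpM2l (ltW (mulr_gt0 (_ : 0 < n%:R^-1) hc))); rewrite invr_gt0 => /(_ nR); rewrite -mulrA => /le_trans; apply.
  by rewrite le_eqVlt; apply/orP; left; apply/eqP; field; rewrite !gt_eqF.
have e2 : e * (P3 + P2) <= n%:R / c * (P3 - P2) / 2.
  rewrite -ler_pdivlMr; last by lra.
  by rewrite ge_min lexx orbT.
have win : 2 * k0 <= (D - e) * P3 - (D + e) * P2.
  have : n%:R / c * (P3 - P2) <= D * (P3 - P2) by rewrite ler_wpM2r//; lra.
  rewrite /k0; lra.
have [K1 hK1] := density_power rho0 D0 l0 lnd dens e0.
have [B B0 hB] := discrepancy_sum_le j pw rho0 prho rhon l0 lnd.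
(* Budget in the exponent: eta0 / 4 for the excess of [D], and eta0 / 8 each for [e], for the
   discrepancy and for the first [K0] factors. Against the gain [eta0] this leaves less than 1 -
   eta0 / 8. *)
have e3 : 0 < eta0 / (8 * (1 + B)) by rewrite divr_gt0// mulr_gt0//; lra.
have [K0 K10 hK0] := bal _ K1 e3.
have hK1' k : (K0 <= k)%N -> k.+1%:R <= (D + e) * l k `^ rho.
  by move=> kK; have [] := hK1 k (leq_trans K10 kK).
have [r1 r11 hr1] := main_term pw rho0 rhon l0 lnd D0 dens e0 k00 win hK1'.
have eta8 : 0 < eta0 / 8 by rewrite divr_gt0.
have [r2 r21 hr2] := head_product_small rho0 l0 lnd lamn K0 eta8.
have [r3 r31 hr3] := powR_large (x1 / E) rho0.
have fin z : exists N, forall k, lam k = z -> (k < N)%N.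
  have [N hN] := counting_finite lnd dens (nm z + 1); exists N => k kz.
  by rewrite hN -lamn kz; lra.
have [f [hf fl fz]] := canonical_product a1 lam0 (ent_regular_factor p rho E lam K0) fin
  (zero_factor_small rho0 rhon E0 l0 lnd lamn K0 D0 dens).
pose r4 := Num.max r1 (Num.max r2 r3).
have gE : g = n%:R^-1 * (d / 4 * k0 * dv) by [].
have cD : n%:R^-1 * (c * D) <= 1 + eta0 / 4.
  rewrite ler_pdivrMl//; apply: le_trans (ler_wpM2l (ltW hc) (ltW Dnc)) _.
  by rewrite le_eqVlt; apply/orP; left; apply/eqP; field; rewrite gt_eqF.
clearbody e eta0 E g k0 P2 P3; clear P20 P23 win e2 nc0 ncD Dnc.
have key (m q s t : R) : m * (c * D) <= s -> m * (c * e) <= t -> m * (c * (D + e) - q) <= s + t - m * q by lra.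
have growth z : r4 <= nm z -> nm (f z) <= expR ((1 - eta0 / 8) * nm z `^ rho).
  rewrite /r4 !ge_max => /andP[z1 /andP[z2 z3]].
  have zp : 0 < nm z by lra.
  have z0 : z != 0 by rewrite -nm_gt0.
  have X0 : 0 < nm z `^ rho by rewrite powR_gt0.
  have [v [v0 v2 zv]] := direction n z0.
  have [N1 hN1] := hr1 z v z1 v0 zv.
  have {}hB := hB z K0 _ z0.
  have Ex : x1 <= E * nm z `^ rho by rewrite mulrC -ler_pdivrMr// hr3.
  have main N : (N1 <= N)%N -> (K0 <= N)%N ->
      \sum_(i < n) discrepancy_bound rho l j i K0 N <= eta0 / (8 * (1 + B)) ->
      \sum_(K0 <= k < N) wlog p d (z / lam k) <=
      (1 + eta0 / 4 + eta0 / 8 + eta0 / 8 - n%:R^-1 * (d / 4 * k0 * v)) * nm z `^ rho.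
    move=> N1N K0N db.
    rewrite (eq_bigr (fun k => wlog p d (w ^+ j k * (z / (l k)%:C)))); last by move=> k _; rewrite ratio.
    rewrite sum_wlog_split; apply: le_trans (lerD (hN1 N N1N) (hB N K0N)) _.
    have b1 : B * nm z `^ rho * \sum_(i < n) discrepancy_bound rho l j i K0 N <= eta0 / 8 * nm z `^ rho.
      apply: (@le_trans _ _ (B * nm z `^ rho * (eta0 / (8 * (1 + B))))).
        by rewrite ler_wpM2l// mulr_ge0// ltW.
      rewrite mulrAC ler_wpM2r ?(ltW X0)// mulrA ler_pdivrMr; last by lra.
      nra.
    have b2 : n%:R^-1 * (c * (D + e) - d / 4 * k0 * v) <=
        1 + eta0 / 4 + eta0 / 8 - n%:R^-1 * (d / 4 * k0 * v).
      exact: key cD e1.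
    apply: le_trans (lerD (ler_wpM2r (ltW X0) b2) b1) _; rewrite -mulrDl ler_pM2r//.
    by move: (_ * (d / 4 * k0 * v)) => q; lra.
  apply: (@limit_le (fun N => \prod_(0 <= k < N) zero_factor p rho E lam K0 k z)); first exact: fl.
  have concl A N : nm (\prod_(0 <= k < N) antiray_factor p rho E k z) <= expR (A * nm z `^ rho) ->
      A + eta0 <= n%:R^-1 * (d / 4 * k0 * v) ->
      (N1 <= N)%N -> (K0 <= N)%N ->
      \sum_(i < n) discrepancy_bound rho l j i K0 N <= eta0 / (8 * (1 + B)) ->
      nm (\prod_(0 <= k < N) zero_factor p rho E lam K0 k z) <= expR ((1 - eta0 / 8) * nm z `^ rho).
    move=> hA Aeta N1N K0N db.
    apply: le_trans (zero_factor_product_bound K0N (hr2 z z2) hA (main N N1N K0N db)) _.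
    rewrite ler_expR ler_wpM2r ?(ltW X0)//.
    by move: Aeta; move: (_ * (d / 4 * k0 * v)) => q; lra.
  have gv : 0 <= n%:R^-1 * (d / 4 * k0 * v).
    by rewrite pmulr_rge0 ?invr_gt0// pmulr_rge0// mulr_gt0// divr_gt0.
  have [vd|vd] := leP v dv.
    have [N2 hN2] := decay _ v Ex v0 vd.
    move=> M; have [N [MN db]] := hK0 (maxn M (maxn N1 (maxn N2 K0))).
    move: MN; rewrite !geq_max => /andP[MN /andP[N1N /andP[N2N K0N]]].
    exists N => //; apply: (concl (- (ka * E / 2))) => //; last by apply: le_trans gv; lra.
    rewrite -ler_sqr ?nnegrE ?nm_ge0 ?expR_ge0// nm_prod -prodrXl.
    rewrite (eq_bigr (fun k => (1 - (E * nm z `^ rho / k.+1%:R) `^ a) ^+ 2 + 2 * (E * nm z `^ rho / k.+1%:R) `^ a * v)); last first.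
      by move=> k _; exact: antiray_factor_sqr.
    apply: le_trans (hN2 N N2N) _; rewrite -expRM_natl ler_expR; lra.
  move=> M; have [N [MN db]] := hK0 (maxn M (maxn N1 K0)).
  move: MN; rewrite !geq_max => /andP[MN /andP[N1N K0N]].
  exists N => //; apply: (concl (c * E)) => //.
    by rewrite -mulrA; exact: antiray_product_le.
  rewrite cE; apply: (@le_trans _ _ g); first by lra.
  by rewrite gE ler_pM2l ?invr_gt0// ler_pM2l ?(ltW vd)// mulr_gt0// divr_gt0.
have f0 : f 0 = 1.
  apply/eqP; rewrite -subr_eq0 -nm_eq0 eq_le nm_ge0 andbT; apply/ler_addgt0Pl => e4 e40.
  rewrite addr0; have [M hM] := fl 0 e4 e40; have := hM M (leqnn M).
  rewrite nmB big1// => k _.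
  rewrite -/(zero_factor p rho E lam K0 k 0) zero_factorE mul0r subr0 wfactor0.
  by rewrite /antiray_factor expr0n /= mulr0 addr0 if_same mulr1.
move=> uniq; have := uniq f _ _ 0; rewrite f0 => H.
have : (1 : C) = 0; last by apply/eqP; exact: oner_neq0.
apply: H.
  split; first by apply/entireP.
  exact: (fock_norm_fin rho0 eta8 hf growth).
move=> z m mz; have [h hh hE] := fz z m mz; exact: subX_vanishes hh hE.
Qed.

End NonUniqueness.

(** * Random directions *)

Section Balance.
Variable R : realType.

Let b : R := 5 / 6.

Let b0 : 0 <= b. Proof. by rewrite divr_ge0. Qed.

Let b1 : b <= 1. Proof. by rewrite ler_pdivrMr// mul1r ler_nat. Qed.

Lemma five_sixth_step k : k.+3%:R `^ b - k.+2%:R `^ b <= k.+2%:R `^ (- 6^-1) :> R.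
Proof.
have x0 : (0 : R) < k.+2%:R by rewrite ltr0n.
have -> : k.+3%:R = k.+2%:R * (1 + k.+2%:R^-1) :> R.
  by rewrite mulrDr mulr1 mulfV ?gt_eqF// natr1.
rewrite powRM ?(ltW x0) ?addr_ge0 ?invr_ge0//.
have h : (1 + k.+2%:R^-1) `^ b <= 1 + k.+2%:R^-1 :> R.
  have q1 : 1 <= 1 + k.+2%:R^-1 :> R by rewrite lerDl invr_ge0.
  rewrite -[leRHS]powRr1; last exact: ltW (lt_le_trans ltr01 q1).
  exact: ler_powR.
have := ler_wpM2l (powR_ge0 k.+2%:R b) h; rewrite mulrDr mulr1.
have -> : k.+2%:R `^ b * k.+2%:R^-1 = k.+2%:R `^ (- 6^-1) :> R.
  rewrite -powR_inv1 ?ltW// -powRD; last by apply/implyP => _; rewrite gt_eqF.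
  by congr powR; rewrite /b; field.
lra.
Qed.

Variables (p : nat) (rho D : R) (l : nat -> R) (j : nat -> 'I_p.+1).
Hypothesis rho0 : 0 < rho.
Hypothesis D0 : 0 < D.
Hypothesis l0 : forall k, 0 < l k.
Hypothesis lnd : nondecreasing_seq l.
Hypothesis dens : has_density rho l D.

(** l k ^ -rho is at most of order 1 / k, so a discrepancy O(k^(5/6)) leaves errors O(K0^(-1/6)). *)
Lemma balanced_of_growth (B : R) : 0 <= B ->
  (forall i k, `|discrepancy R j i k| <= B * k.+1%:R `^ b) -> balanced rho l j.
Proof.
move=> B0 hB e K e0; have hD := D0.
have [K1 hK1] := density_power rho0 D0 l0 lnd dens ltr01.
pose A := D + 1; have A0 : 0 < A by rewrite /A; lra.
pose ak k := (l k `^ rho)^-1.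
have ak0 k : 0 <= ak k by rewrite invr_ge0 powR_ge0.
have akA k : (K1 <= k)%N -> ak k <= A / k.+1%:R.
  move=> /hK1[h _]; rewrite /ak ler_pdivlMr// mulrC ler_pdivrMr ?powR_gt0//.
have akd k : 0 <= ak k - ak k.+1.
  rewrite subr_ge0 lef_pV2 ?posrE ?powR_gt0//; apply: ge0_ler_powR.
  - exact: ltW.
  - by rewrite nnegrE ltW.
  - by rewrite nnegrE ltW.
  - exact: lnd.
have bp k : k.+1%:R `^ b * k.+1%:R^-1 = k.+1%:R `^ (- 6^-1) :> R.
  rewrite -powR_inv1// -powRD; last by apply/implyP => _; rewrite pnatr_eq0.
  by congr powR; rewrite /b; field.
pose t k : R := k.+1%:R `^ (- 6^-1).
have tdec k k' : (k <= k')%N -> t k' <= t k.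
  move=> kk; rewrite /t !powRN lef_pV2 ?posrE ?powR_gt0//.
  by apply: ge0_ler_powR; rewrite ?nnegrE ?ler_nat.
have single i k : (K1 <= k)%N -> `|discrepancy R j i k| * ak k <= B * A * t k.
  move=> Kk; apply: (@le_trans _ _ (B * k.+1%:R `^ b * (A / k.+1%:R))).
    by apply: ler_pM => //; exact: akA.
  by rewrite /t -bp le_eqVlt; apply/orP; left; apply/eqP; ring.
(* [ak] is bounded, but its increments have no individual bound; a further summation by parts moves
   the difference onto q^(5/6) and leaves the convergent sum of q^(-7/6). *)
have sum_bound k N : (K1 <= k)%N -> (k <= N)%N ->
    \sum_(k <= q < N) q.+2%:R `^ b * (ak q - ak q.+1) <= 8 * A * t k.
  move=> Kk kN.
  have E : \sum_(k <= q < N) q.+2%:R `^ b * (ak q - ak q.+1) =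
     k.+2%:R `^ b * ak k - N.+2%:R `^ b * ak N + \sum_(k <= q < N) (q.+3%:R `^ b - q.+2%:R `^ b) * ak q.+1.
    have -> : k.+2%:R `^ b * ak k - N.+2%:R `^ b * ak N = - (N.+2%:R `^ b * ak N - k.+2%:R `^ b * ak k) by ring.
    rewrite -(telescope_sumr (fun q => q.+2%:R `^ b * ak q) kN) -sumrN -big_split /=.
    by apply: eq_bigr => q _; ring.
  have h1 : k.+2%:R `^ b * ak k <= 2 * A * t k.
    have : k.+2%:R `^ b <= 2 * k.+1%:R `^ b :> R.
      apply: (@le_trans _ _ ((2 * k.+1%:R) `^ b)).
        apply: ge0_ler_powR => //; rewrite ?nnegrE ?mulr_ge0//.
        by rewrite -natrM ler_nat mul2n -addnn !addSn !addnS !ltnS leq_addr.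
      rewrite powRM// ler_wpM2r ?powR_ge0//.
      by rewrite -[leRHS]powRr1// ler_powR ?ler1n.
    move=> h; apply: (@le_trans _ _ ((2 * k.+1%:R `^ b) * (A / k.+1%:R))).
      by apply: ler_pM; rewrite ?powR_ge0//; exact: akA.
    by rewrite /t -bp le_eqVlt; apply/orP; left; apply/eqP; ring.
  have h2 : 0 <= N.+2%:R `^ b * ak N by rewrite mulr_ge0 ?powR_ge0.
  have h3 : \sum_(k <= q < N) (q.+3%:R `^ b - q.+2%:R `^ b) * ak q.+1 <= 6 * A * t k.
    apply: (@le_trans _ _ (A * \sum_(k <= q < N) q.+2%:R `^ (- (7 / 6)))).
      rewrite mulr_sumr !big_nat; apply: ler_sum => q /andP[kq _].
      have q2 : (0 : R) < q.+2%:R by rewrite ltr0n.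
      have -> : q.+2%:R `^ (- (7 / 6)) = q.+2%:R `^ (- 6^-1) / q.+2%:R :> R.
        rewrite -(powR_inv1 (ltW q2)) -powRD; last by apply/implyP => _; rewrite gt_eqF.
        by congr powR; field.
      rewrite mulrCA; apply: (@le_trans _ _ (q.+2%:R `^ (- 6^-1) * ak q.+1)).
        by rewrite ler_wpM2r// five_sixth_step.
      by rewrite ler_wpM2l ?powR_ge0// akA// (leq_trans Kk)// (leq_trans kq).
    have a7 : 1 < 7 / 6 :> R by lra.
    have := pseries_tail a7 kN; rewrite (_ : 1 - 7 / 6 = - 6^-1 :> R); last by field.
    rewrite -/(t k) => h; have := ler_wpM2l (ltW A0) h; lra.
  rewrite E; lra.
have h6 : 0 < 6^-1 :> R by rewrite invr_gt0.
(* 10 = 1 + 1 + 8, from the two boundary terms and [sum_bound]; the factor [p.+1] counts the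
   directions. *)
have [T T1 hT] := powR_large (p.+1%:R * (10 * B * A) / e) h6.
pose K0 := maxn (maxn K K1) (Num.truncn T).
exists K0; first by rewrite !leq_max leqnn.
move=> M; exists (maxn M K0); split; first by rewrite leq_maxl.
have KN : (K0 <= maxn M K0)%N by rewrite leq_maxr.
set N := maxn M K0 in KN *.
have K1K0 : (K1 <= K0)%N by rewrite !leq_max leqnn orbT.
have small : p.+1%:R * (10 * B * A * t K0) <= e.
  have TK : T <= K0.+1%:R.
    have /andP[_ h] : (Num.truncn T)%:R <= T < (Num.truncn T).+1%:R by apply: truncn_itv; lra.
    by apply: le_trans (ltW h) _; rewrite ler_nat ltnS leq_maxr.
  have := hT _ TK; rewrite /t powRN ler_pdivrMr// => h.
  by rewrite !mulrA ler_pdivrMr ?powR_gt0// -!mulrA [e * _]mulrC; move: h; rewrite -!mulrA.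
apply: le_trans small; have -> : p.+1%:R * (10 * B * A * t K0) = \sum_(i < p.+1) 10 * B * A * t K0.
  by rewrite sumr_const card_ord mulr_natl.
apply: ler_sum => i _; rewrite /discrepancy_bound -!/(ak _).
have s1 := single i N (leq_trans K1K0 KN); have s2 := single i K0 K1K0.
have s3 : \sum_(K0 <= k < N) `|discrepancy R j i k.+1| * (ak k - ak k.+1) <= B * (8 * A * t K0).
  apply: le_trans (ler_wpM2l B0 (sum_bound K0 N K1K0 KN)); rewrite mulr_sumr.
  by apply: ler_sum => k _; rewrite mulrA ler_wpM2r.
have BA : 0 <= B * A by rewrite mulr_ge0// ltW.
have := ler_wpM2l BA (tdec _ _ KN); lra.
Qed.

End Balance.

(** * Second moments and almost sure growth of deviations *)

Section SecondMoment.
Variables (disp : measure_display) (T : measurableType disp) (R : realType).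
Variables (P : probability T R) (A : nat -> set T) (al : R).
Hypothesis mA : forall k, measurable (A k).
Hypothesis al0 : 0 <= al.
Hypothesis al1 : al <= 1.
Hypothesis PA : forall k, P (A k) = al%:E.
Hypothesis PAA : forall k m, k != m -> P (A k `&` A m) = (al ^+ 2)%:E.

Let hits k w : R := \sum_(q < k) \1_(A q) w.

Definition deviation k w : R := \sum_(0 <= q < k) (\1_(A q) w - al).

Let deviationE k w : deviation k w = hits k w - k%:R * al.
Proof.
rewrite /deviation /hits big_mkord big_split /= sumrN sumr_const card_ord.
by rewrite mulr_natl.
Qed.

Let hits_ge0 k w : 0 <= hits k w.
Proof. by apply: sumr_ge0 => q _; rewrite indicE. Qed.

Let measurable_hits k : measurable_fun setT (hits k).
Proof.
apply: measurable_sum => q; exact: measurable_indic.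
Qed.

Lemma measurable_deviation k : measurable_fun setT (deviation k).
Proof.
rewrite (_ : deviation k = (fun w => hits k w - k%:R * al)); last first.
  by apply/funext => w; exact: deviationE.
by apply: measurable_funB => //; exact: measurable_cst.
Qed.

Let int_hits k : (\int[P]_w (hits k w)%:E = (k%:R * al)%:E)%E.
Proof.
rewrite (eq_integral (fun w => (\sum_(q < k) (\1_(A q) w)%:E)%E)); last first.
  by move=> w _; rewrite /hits sumEFin.
have m1 (q : 'I_k) : measurable_fun setT (fun w => (\1_(A q) w : R)%:E).
  by apply/measurable_EFinP; exact: measurable_indic.
rewrite (ge0_integral_sum _ measurableT m1); last by move=> q w _; rewrite lee_fin indicE.
rewrite (eq_bigr (fun _ : 'I_k => al%:E)); last first.
  by move=> q _; rewrite integral_indic// setIT; exact: PA.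
by rewrite sumEFin sumr_const card_ord mulr_natl.
Qed.

Let int_hits_sqr k : (\int[P]_w ((hits k w) ^+ 2)%:E = (k%:R * (al + (k%:R - 1) * al ^+ 2))%:E)%E.
Proof.
have sq w : ((hits k w) ^+ 2)%:E = (\sum_(q < k) \sum_(r < k) (\1_(A q `&` A r) w)%:E)%E.
  under eq_bigr do rewrite sumEFin; rewrite sumEFin; congr EFin.
  rewrite expr2 /hits mulr_suml; apply: eq_bigr => q _; rewrite mulr_sumr.
  by apply: eq_bigr => r _; rewrite indicI.
rewrite (eq_integral _ _ (fun w _ => sq w)).
have mI q r : measurable_fun setT (fun w => (\1_(A q `&` A r) w : R)%:E).
  by apply/measurable_EFinP; apply: measurable_indic; exact: measurableI.
have m2 (q : 'I_k) : measurable_fun setT (fun w => \sum_(r < k) (\1_(A q `&` A r) w : R)%:E)%E.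
  by apply: emeasurable_sum => r.
rewrite (ge0_integral_sum _ measurableT m2); last first.
  by move=> q w _; apply: sume_ge0 => r _; rewrite lee_fin indicE.
rewrite (eq_bigr (fun _ : 'I_k => (al + (k%:R - 1) * al ^+ 2)%:E)); last first.
  move=> q _; rewrite (ge0_integral_sum _ measurableT (fun r : 'I_k => mI q r)); last first.
    by move=> r w _; rewrite lee_fin indicE.
  rewrite (eq_bigr (fun r : 'I_k => (if r == q then al else al ^+ 2)%:E)); last first.
    move=> r _; rewrite integral_indic//; last exact: measurableI.
    rewrite setIT; case: eqVneq => [->|rq]; first by rewrite setIid; exact: PA.
    by apply: PAA; rewrite eq_sym.
  rewrite sumEFin (bigD1 q)//= eqxx; congr EFin; congr (_ + _).
  rewrite (eq_bigr (fun=> al ^+ 2)); last by move=> r /negbTE ->.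
  rewrite sumr_const (_ : #|_| = k.-1); last by rewrite cardC1 card_ord.
  have k0 : (0 < k)%N by apply: leq_ltn_trans (ltn_ord q).
  by rewrite -{2}(prednK k0) -natr1 addrK mulr_natl.
by rewrite sumEFin sumr_const card_ord mulr_natl.
Qed.

Lemma second_moment k : (\int[P]_w ((deviation k w) ^+ 2)%:E <= (k%:R)%:E)%E.
Proof.
have c0 : 0 <= 2 * k%:R * al by rewrite mulr_ge0// mulr_ge0.
have mh : measurable_fun setT (fun w => (2 * k%:R * al * hits k w)%:E).
  by apply/measurable_EFinP; apply: measurable_funM => //; exact: measurable_cst.
have md : measurable_fun setT (fun w => ((deviation k w) ^+ 2)%:E).
  by apply/measurable_EFinP; apply: measurable_funX; exact: measurable_deviation.
have mh2 : measurable_fun setT (fun w => ((hits k w) ^+ 2)%:E).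
  by apply/measurable_EFinP; apply: measurable_funX.
(* The negative term of the expanded square is moved to the other side, so that every integrand is
   nonnegative. *)
have E : (\int[P]_w (((deviation k w) ^+ 2)%:E + (2 * k%:R * al * hits k w)%:E) =
          \int[P]_w (((hits k w) ^+ 2)%:E + ((k%:R * al) ^+ 2)%:E))%E.
  by apply: eq_integral => w _; rewrite -!EFinD deviationE; congr EFin; ring.
have d2 w : setT w -> (0 <= ((deviation k w) ^+ 2)%:E)%E by rewrite lee_fin sqr_ge0.
have h1 w : setT w -> (0 <= (2 * k%:R * al * hits k w)%:E)%E by rewrite lee_fin mulr_ge0.
have h2 w : setT w -> (0 <= ((hits k w) ^+ 2)%:E)%E by rewrite lee_fin sqr_ge0.
have h3 (w : T) : setT w -> (0 <= ((k%:R * al) ^+ 2)%:E)%E by rewrite lee_fin sqr_ge0.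
move: E; rewrite (ge0_integralD P measurableT d2 md h1 mh) (ge0_integralD P measurableT h2 mh2 h3 (measurable_cst _)).
have -> : (\int[P]_w (2 * k%:R * al * hits k w)%:E = (2 * k%:R * al * (k%:R * al))%:E)%E.
  rewrite (eq_integral (fun w => ((2 * k%:R * al)%:E * (hits k w)%:E)%E)); last first.
    by move=> w _; rewrite EFinM.
  rewrite ge0_integralZl_EFin//; last by apply/measurable_EFinP.
    by rewrite int_hits -EFinM.
  by move=> w _; rewrite lee_fin.
rewrite int_hits_sqr integral_cst//= probability_setT mule1.
case: (\int[P]_w _)%E => [x| |] //= => -[E]; rewrite lee_fin.
have : k%:R * (al - al ^+ 2) <= k%:R * 1 :> R.
  by rewrite ler_wpM2l//; have := sqr_ge0 al; have := al1; lra.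
lra.
Qed.

Lemma cube_root k : exists m, (m ^ 3 <= k < m.+1 ^ 3)%N.
Proof.
elim: k => [|k [m /andP[h1 h2]]]; first by exists 0%N.
have [h|h] := ltnP k.+1 (m.+1 ^ 3); first by exists m; rewrite (leqW h1).
exists m.+1; rewrite h /=; apply: leq_ltn_trans h2 _.
by rewrite ltn_exp2r.
Qed.

(* Summing second moments along the cubes m^3 is enough, since the deviation moves
   by at most O(m^2) between two of them. *)
Lemma deviation_growth : {ae P, forall w, exists2 B, 0 <= B &
  forall k, `|deviation k w| <= B * k.+1%:R `^ (5 / 6)}.
Proof.
(* The second moment at m^3 is at most m^3, so these weights make the integrals summable. Almost
   sure finiteness of the sum gives deviations O(m^(5/2)) at k = m^3, the origin of the exponent
   5/6. *)
pose f m w : \bar R := ((deviation (m ^ 3) w) ^+ 2 / m.+2%:R ^+ 5)%:E.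
have f0 m w : (0 <= f m w)%E by rewrite lee_fin divr_ge0 ?sqr_ge0// exprn_ge0.
have mf m : measurable_fun setT (f m).
  apply/measurable_EFinP; apply: measurable_funM; last exact: measurable_cst.
  by apply: measurable_funX; exact: measurable_deviation.
have If m : (\int[P]_w f m w <= (m.+2%:R `^ (- 2))%:E)%E.
  have m2 : (0 : R) < m.+2%:R by rewrite ltr0n.
  rewrite /f (eq_integral (fun w => ((m.+2%:R ^+ 5)^-1%:E * ((deviation (m ^ 3) w) ^+ 2)%:E)%E)); last first.
    by move=> w _; rewrite -EFinM mulrC.
  have c0 : 0 <= (m.+2%:R ^+ 5)^-1 :> R by rewrite invr_ge0 exprn_ge0.
  have d2 w : setT w -> (0 <= ((deviation (m ^ 3) w) ^+ 2)%:E)%E by rewrite lee_fin sqr_ge0.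
  have md : measurable_fun setT (fun w => ((deviation (m ^ 3) w) ^+ 2)%:E).
    by apply/measurable_EFinP; apply: measurable_funX; exact: measurable_deviation.
  rewrite (@ge0_integralZl_EFin _ _ R P setT measurableT _ d2 md _ c0).
  apply: (@le_trans _ _ ((m.+2%:R ^+ 5)^-1%:E * ((m ^ 3)%:R)%:E)%E).
    by rewrite lee_wpmul2l ?second_moment// lee_fin invr_ge0 exprn_ge0.
  rewrite -EFinM lee_fin powRN powR_mulrn ?(ltW m2)// ler_pdivrMl ?exprn_gt0//.
  rewrite (exprD _ 3 2) -mulrA mulfV ?mulr1 ?gt_eqF ?exprn_gt0// natrX.
  by apply: lerXn2r; rewrite ?nnegrE// ler_nat -addn2 leq_addr.
have tot : (\int[P]_w \sum_(0 <= m <oo) f m w <= 1)%E.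
  rewrite integral_nneseries//.
  apply: lime_le; first by apply: is_cvg_nneseries => m _ _; apply: integral_ge0 => w _.
  near=> N.
  apply: (@le_trans _ _ (\sum_(0 <= m < N) (m.+2%:R `^ (- 2))%:E)%E).
    by apply: lee_sum => m _.
  rewrite sumEFin lee_fin.
  have h12 : 1 < 2 :> R by lra.
  have := pseries_tail h12 (leq0n N); rewrite (_ : 2 - 1 = 1 :> R); last by ring.
  by rewrite mul1r powR1.
have mS : measurable_fun setT (fun w => \sum_(0 <= m <oo) f m w)%E.
  exact: ge0_emeasurable_sum.
have S0 w : (0 <= \sum_(0 <= m <oo) f m w)%E by exact: nneseries_ge0.
have int : P.-integrable setT (fun w => \sum_(0 <= m <oo) f m w)%E.
  apply/integrableP; split => //.
  rewrite (eq_integral (fun w => \sum_(0 <= m <oo) f m w)%E); last first.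
    by move=> w _; rewrite gee0_abs.
  by apply: le_lt_trans tot _; rewrite ltry.
apply: filterS (integrable_ae measurableT int) => w /(_ I) fin.
pose B := fine (\sum_(0 <= m <oo) f m w)%E.
have B0 : 0 <= B by rewrite fine_ge0.
have fB m : (deviation (m ^ 3) w) ^+ 2 <= B * m.+2%:R ^+ 5.
  rewrite -ler_pdivrMr ?exprn_gt0// -lee_fin /B fineK//.
  apply: le_trans (nneseries_lim_ge m.+1 (fun n _ _ => f0 n w)).
  by rewrite big_nat_recr//= leeDr// sume_ge0.
pose c5 : R := 27 `^ (5 / 3); pose c2 : R := 27 `^ (2 / 3).
have c50 : 0 <= c5 := powR_ge0 _ _; have c20 : 0 <= c2 := powR_ge0 _ _.
exists (Num.sqrt (B * c5) + 3 * c2) => [|k].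
  by rewrite addr_ge0 ?sqrtr_ge0// mulr_ge0.
have [m mk] := cube_root k; have /andP[mk1 mk2] := mk.
have k0 : (0 : R) < k.+1%:R by rewrite ltr0n.
set X := k.+1%:R `^ (5 / 6).
have y3 : m.+2%:R ^+ 3 <= 27 * k.+1%:R :> R.
  rewrite -natrX -natrM ler_nat; case: (m) mk1 => [|m'] mk1; first by rewrite mulnS leq_addr.
  apply: (@leq_trans (27 * m'.+1 ^ 3)); last by rewrite leq_mul2l ltnW.
  by rewrite -[27%N]/((3 ^ 3)%N) -expnMn leq_exp2r// mulSn mulnS !addSn ltnS; lia.
have y0 : (0 : R) <= m.+2%:R by [].
have yp (s : R) i : 0 <= s -> 3 * s = i%:R -> m.+2%:R ^+ i <= 27 `^ s * k.+1%:R `^ s.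
  move=> s0 si; rewrite -powRM ?(ltW k0)// -powR_mulrn// -si powRrM.
  by apply: ge0_ler_powR; rewrite ?nnegrE ?powR_ge0 ?mulr_ge0 ?powR_mulrn// ltW.
have h1 : `|deviation (m ^ 3) w| <= Num.sqrt (B * c5) * X.
  rewrite -(ler_sqr (x := `|_|)) ?nnegrE ?mulr_ge0 ?sqrtr_ge0 ?powR_ge0// real_normK ?num_real//.
  apply: le_trans (fB m) _; rewrite exprMn sqr_sqrtr ?mulr_ge0// -mulrA ler_wpM2l//.
  have h := yp (5 / 3) 5%N; apply: le_trans (h _ _) _; [by rewrite divr_ge0|by field|].
  rewrite le_eqVlt; apply/orP; left; apply/eqP; congr (_ * _).
  by rewrite /X -powR_mulrn ?powR_ge0// -powRrM; congr powR; field.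
have h2 : (k - m ^ 3)%:R <= 3 * c2 * X.
  apply: (@le_trans _ _ (3 * m.+2%:R ^+ 2)).
    have h : k%:R < m.+1%:R ^+ 3 :> R by rewrite -natrX ltr_nat.
    rewrite natrB// natrX; move: h (ler0n R m); rewrite -[m.+2%:R]natr1 -[m.+1%:R]natr1.
    by move: (m%:R : R) => x h x0; have := mulr_ge0 x0 x0; lra.
  rewrite -mulrA ler_pM2l//; have h := yp (2 / 3) 2%N; apply: le_trans (h _ _) _; [by rewrite divr_ge0|by field|].
  rewrite ler_wpM2l//; apply: ler_powR; first by rewrite ler1n.
  lra.
have -> : deviation k w = deviation (m ^ 3) w + \sum_(m ^ 3 <= q < k) (\1_(A q) w - al).
  by rewrite /deviation -big_cat_nat.
apply: le_trans (ler_normD _ _) _; rewrite mulrDl; apply: lerD => //.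
apply: le_trans h2; apply: le_trans (ler_norm_sum _ _ _) _.
rewrite -[leRHS]mulr1 mulr_natl -sumr_const_nat; apply: ler_sum => q _.
have := al0; have := al1; rewrite indicE ler_norml; case: (_ \in _) => /=; lra.
Unshelve. all: by end_near. Qed.

End SecondMoment.

(** * The uniform distribution on the angles of the roots of unity *)

Section UniformRoots.
Variables (R : realType) (p : nat).
Local Notation n := p.+1.
Local Notation C := R[i].

Definition root_angle (i : nat) : R := i%:R * (2 * pi / n%:R).

Lemma expi_root_angle i : expi (root_angle i) = omega R n ^+ i.
Proof. by rewrite /omega expiX. Qed.

Lemma root_angle_ge0 i : 0 <= root_angle i.
Proof. by rewrite mulr_ge0// divr_ge0// mulr_ge0// pi_ge0. Qed.

Lemma root_angle_lt i : (i < n)%N -> root_angle i < 2 * pi.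
Proof.
move=> iN; rewrite /root_angle mulrCA gtr_pMr ?mulr_gt0 ?pi_gt0//.
by rewrite ltr_pdivrMr// mul1r ltr_nat.
Qed.

Lemma root_angle_inj : injective root_angle.
Proof.
have h : 2 * pi / n%:R != 0 :> R by rewrite gt_eqF// divr_gt0// mulr_gt0// pi_gt0.
by move=> i i' /(mulIf h)/eqP; rewrite eqr_nat => /eqP.
Qed.

Let inv_n : {nonneg R} := (n%:R^-1)%:nng.

(** A scaled sum of point masses, so that the measure structure and the integration lemmas are
    inherited. *)
Definition uniform_roots : set R -> \bar R :=
  mscale inv_n (msum (fun i => dirac (root_angle i)) n).

HB.instance Definition _ := Measure.on uniform_roots.

Lemma uniform_rootsE (B : set R) :
  uniform_roots B = (n%:R^-1 * \sum_(i < n) (root_angle i \in B)%:R)%:E.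
Proof.
rewrite /uniform_roots /mscale /= /msum EFinM -sumEFin; congr (_ * _)%E.
Qed.

Let uniform_roots_setT : uniform_roots setT = 1%E.
Proof.
rewrite uniform_rootsE (eq_bigr (fun=> 1)); last by move=> i _; rewrite in_setT.
by rewrite sumr_const card_ord mulVf// pnatr_eq0.
Qed.

HB.instance Definition _ :=
  Measure_isProbability.Build _ _ _ uniform_roots uniform_roots_setT.

Definition root_distribution : probability R R := uniform_roots.

Lemma root_distributionE (B : set R) :
  root_distribution B = (n%:R^-1 * \sum_(i < n) (root_angle i \in B)%:R)%:E.
Proof. exact: uniform_rootsE. Qed.

Let ge0_integral_roots (D : set R) (g : R -> R) : measurable D ->
  (forall i, (i < n)%N -> D (root_angle i)) -> (forall x, 0 <= g x) -> measurable_fun setT g ->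
  (\int[root_distribution]_(x in D) (g x)%:E = (n%:R^-1 * \sum_(i < n) g (root_angle i))%:E)%E.
Proof.
move=> mD xD g0 mg.
have mgD : measurable_fun D (fun x => (g x)%:E).
  by apply: measurable_funTS; exact/measurable_EFinP.
have g0D x : D x -> (0 <= (g x)%:E)%E by rewrite lee_fin.
rewrite (ge0_integral_mscale _ mD inv_n mgD g0D) (ge0_integral_measure_sum _ mD g0D mgD) EFinM -sumEFin.
congr (_ * _)%E; apply: eq_bigr => i _.
by rewrite integral_dirac// diracE mem_set ?mul1e//; exact: xD.
Qed.

Lemma Rintegral_roots (D : set R) (g : R -> R) : measurable D ->
  (forall i, (i < n)%N -> D (root_angle i)) -> measurable_fun setT g ->
  Rintegral root_distribution D g = n%:R^-1 * \sum_(i < n) g (root_angle i).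
Proof.
move=> mD xD mg; rewrite /Rintegral integralE.
have pE x : (EFin \o g)^\+%E x = (Num.max (g x) 0)%:E by rewrite funeposE /= EFin_max.
have nE x : (EFin \o g)^\-%E x = (Num.max (- g x) 0)%:E by rewrite funenegE /= EFin_max.
rewrite (eq_integral (fun x => (Num.max (g x) 0)%:E)); last by move=> x _; exact: pE.
rewrite [X in (_ - X)%E](eq_integral (fun x => (Num.max (- g x) 0)%:E)); last by move=> x _; exact: nE.
rewrite (@ge0_integral_roots D (fun x => Num.max (g x) 0))//; last 2 first.
- by move=> x; rewrite le_max lexx orbT.
- by apply: measurable_maxr.
rewrite (@ge0_integral_roots D (fun x => Num.max (- g x) 0))//; last 2 first.
- by move=> x; rewrite le_max lexx orbT.
- by apply: measurable_maxr => //; exact: measurable_funN.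
rewrite -EFinB /= -mulrBr -sumrB; congr (_ * _); apply: eq_bigr => i _.
by case: (leP (g (root_angle i)) 0); case: (leP (- g (root_angle i)) 0); lra.
Qed.

Lemma complex_integral_roots m : (0 < m)%N -> (m < n)%N ->
  complex_integral root_distribution `[0, 2 * pi[%classic (fun t => expi (m%:R * t)) = 0.
Proof.
move=> m0 mn; have xD i : (i < n)%N -> `[0, 2 * pi[%classic (root_angle i).
  by move=> iN; rewrite /= in_itv /= root_angle_ge0 root_angle_lt.
have mx : measurable_fun setT (fun t : R => m%:R * t).
  by apply: measurable_funM; [exact: measurable_cst|exact: measurable_id].
have S : \sum_(i < n) expi (m%:R * root_angle i) = 0 :> C.
  apply: etrans (prim_sum (i := m) (omega_prim R (ltn0Sn p)) _); last by rewrite gtnNdvd.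
  by apply: eq_bigr => i _; rewrite -expi_root_angle -expiX.
rewrite /complex_integral !Rintegral_roots//; last 2 first.
- by apply: (measurableT_comp _ mx); apply: continuous_measurable_fun; exact: continuous_sin.
- by apply: (measurableT_comp _ mx); apply: continuous_measurable_fun; exact: continuous_cos.
have Im_sum (F : 'I_n -> C) : complex.Im (\sum_(i < n) F i) = \sum_(i < n) complex.Im (F i).
  by elim/big_ind2 : _ => // x1 y1 x2 y2 <- <-; rewrite ImD.
by rewrite -Re_sum -Im_sum S !mulr0.
Qed.

End UniformRoots.

(** * Discrepancies of independent random directions *)

Section RandomDiscrepancy.
Variables (disp : measure_display) (T : measurableType disp) (R : realType).
Variables (P : probability T R) (theta : nat -> {RV P >-> R}) (p : nat).
Local Notation n := p.+1.
Hypothesis ind : mutually_independent theta.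
Hypothesis idd : identically_distributed theta (root_distribution R p).

Let hit (i : 'I_n) k : set T := theta k @^-1` [set root_angle R p i].

Let measurable_theta k (B : set R) : measurable B -> measurable (theta k @^-1` B).
Proof. by move=> mB; rewrite -[X in measurable X]setTI; exact: measurable_funP. Qed.

Let hit_measurable i k : measurable (hit i k).
Proof. exact: measurable_theta. Qed.

Let hit_prob i k : P (hit i k) = (n%:R^-1)%:E.
Proof.
have := idd k (measurable_set1 (root_angle R p i)); rewrite /distribution /pushforward => ->.
rewrite root_distributionE (bigD1 i)//= big1 => [|q qi].
  by rewrite mem_set// addr0 mulr1.
case: (boolP (_ \in _)) => //; rewrite inE /= => /root_angle_inj/val_inj e.
by rewrite e eqxx in qi.
Qed.

Let hit_pair i k m : k != m -> P (hit i k `&` hit i m) = (n%:R^-1 ^+ 2)%:E.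
Proof.
move=> km; have := @ind [fset k; m]%fset (fun=> [set root_angle R p i]) (fun=> measurable_set1 _).
have kn : k \notin [fset m]%fset by rewrite inE.
rewrite bigcap_fsetU1 big_fsetU1//= big_seq_fset1.
rewrite (_ : \bigcap_(q in [set` [fset m]%fset]) _ = hit i m); last first.
  by rewrite bigcap_fset big_seq_fset1.
by rewrite -!/(hit i _) !hit_prob -EFinM expr2 => <-.
Qed.

(** Only the distribution of the angles is prescribed, so they are angles of roots merely outside a
    null set. *)
Lemma ae_root_angle : {ae P, forall w, forall k, exists i : 'I_n, theta k w = root_angle R p i}.
Proof.
apply: ae_foralln => k; pose U : set R := [set x | exists i : 'I_n, x = root_angle R p i].
have mU : measurable U.
  rewrite (_ : U = \bigcup_(i in [set: 'I_n]) [set root_angle R p i]); last first.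
    by apply/seteqP; split => x; [case=> i ->; exists i|case=> i _ ->; exists i].
  by apply: fin_bigcup_measurable => // i _; exact: measurable_set1.
exists (theta k @^-1` (~` U)); split.
- by apply: measurable_theta; exact: measurableC.
- apply: etrans (idd k (measurableC mU)) _.
  rewrite root_distributionE big1 ?mulr0// => i _.
  by rewrite memNset//= => h; apply: h; exists i.
by move=> w /= h u; apply: h; case: u => i ->; exists i.
Qed.

Lemma ae_discrepancy_growth : {ae P, forall w, exists j : nat -> 'I_n,
  (forall k, theta k w = root_angle R p (j k)) /\
  exists2 B, 0 <= B & forall i k, `|discrepancy R j i k| <= B * k.+1%:R `^ (5 / 6)}.
Proof.
have n1 : n%:R^-1 <= 1 :> R by rewrite invf_le1 ?ltr0n// ler1n.
have n0 : 0 <= n%:R^-1 :> R by rewrite invr_ge0.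
have dev (i : 'I_n) := deviation_growth (hit_measurable i) n0 n1 (hit_prob i) (hit_pair i).
(* [ae_foralln] quantifies over natural numbers; [inord] extends the family of directions to
   them. *)
have devs := ae_foralln (fun i : nat => dev (inord i)).
apply: filterS2 ae_root_angle devs => w /choice[j jE] hB.
exists j; split=> //.
have /fin_all_exists2[B B0 hb] : forall i : 'I_n, exists2 B : R, 0 <= B &
    forall k, `|deviation (hit i) (n%:R^-1 : R) k w| <= B * k.+1%:R `^ (5 / 6).
  by move=> i; have := hB i; rewrite inord_val.
exists (\sum_i B i) => [|i k]; first by apply: sumr_ge0 => i _; exact: B0.
have -> : discrepancy R j i k = deviation (hit i) n%:R^-1 k w.
  apply: eq_bigr => q _; congr (_ - _); rewrite indicE; congr (_%:R); congr nat_of_bool.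
  apply/eqP/idP => [<-|]; first by rewrite inE /hit /= jE.
  by rewrite inE /hit /= jE => /root_angle_inj/val_inj.
apply: le_trans (hb i k) _; rewrite ler_wpM2r ?powR_ge0// (bigD1 i)//= lerDl.
by apply: sumr_ge0 => q _; exact: B0.
Qed.

End RandomDiscrepancy.

Theorem corollary9p2 (R : realType) (rho : R) (hrho : 2^-1 < rho)
    (hrho1 : rho != 1) :
  exists Delta : probability R R,
    Delta `[0, 2 * pi[%classic = 1%E /\
    (rho \is a Num.nat ->
       complex_integral Delta `[0, 2 * pi[%classic (fun t => expi (rho * t)) = 0) /\
    exists J : set R,
      [/\ open J, is_interval J, J !=set0 & J `<=` `]0, +oo[%classic] /\
      forall (l : nat -> R) (D : R),
        (forall k, 0 < l k) ->
        nondecreasing_seq l ->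
        has_density rho l D ->
        J D ->
        forall (d : measure_display) (T : measurableType d)
          (P : probability T R) (theta : nat -> {RV P >-> R}),
          mutually_independent theta ->
          identically_distributed theta Delta ->
          {ae P, forall w : T,
             let lam := randomization l (fun k => theta k w) in
             ~ zero_set rho lam /\ ~ uniqueness_set rho lam}.
Proof.
have rho0 : 0 < rho by lra.
pose p := Num.truncn rho.
have /andP[prho rhon] : p%:R <= rho < p.+1%:R by apply: truncn_itv; exact: ltW.
(* The hypotheses on rho enter here: 1 < 2 rho when p = 0, rho > 1 when p = 1, and p + 1 < 2 p for
   larger p. *)
have n2rho : p.+1%:R < 2 * rho.
  move: prho rhon; case: p => [|[|q]] prho rhon; first by lra.
    by rewrite -[2%:R]/2; move: prho; rewrite le_eqVlt eq_sym (negbTE hrho1) /=; lra.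
  have : 0 <= q%:R :> R by rewrite ler0n.
  by move: prho; rewrite -!natr1; lra.
have a1 : 1 < p.+1%:R / rho by rewrite ltr_pdivlMr// mul1r.
have c0 := logconst_gt0 a1; set c := logconst _ in c0.
have nR : (0 : R) < p.+1%:R by rewrite ltr0n.
have nc0 : 0 < p.+1%:R / c by rewrite divr_gt0.
have [eta eta0 hu] := balanced_not_unique rho0 prho rhon n2rho.
have nc1 : p.+1%:R / c < p.+1%:R / c * (1 + eta) by rewrite ltr_pMr//; lra.
exists (root_distribution R p); split; last split.
- rewrite root_distributionE (eq_bigr (fun=> 1)).
    by rewrite sumr_const card_ord mulVf// pnatr_eq0.
  by move=> i _; rewrite mem_set//= in_itv /= root_angle_ge0 root_angle_lt.
(* An integral rho equals its floor, and 0 < rho < n makes the sum of the rho-th powers of the n-th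
   roots of unity vanish. *)
- move=> /natrP[m mE]; have pm : p = m by rewrite /p mE natrK.
  have m0 : (0 < m)%N by rewrite -(ltr_nat R) -mE.
  by rewrite mE pm; apply: complex_integral_roots.
(* Above n / c the set is too dense for a zero set; [eta] tells how far above it a nonzero function
   can still be constructed. *)
exists `]p.+1%:R / c, p.+1%:R / c * (1 + eta)[%classic; split.
  split; [exact: interval_open|exact: interval_is_interval| |].
    exists ((p.+1%:R / c + p.+1%:R / c * (1 + eta)) / 2).
    by rewrite /= in_itv /= !midf_lt.
  by move=> x /=; rewrite !in_itv /= andbT => /andP[h _]; exact: lt_trans h.
move=> l D l0 lnd dens; rewrite /= in_itv /= => /andP[D1 D2] d T P theta ind idd.
have D0 : 0 < D := lt_trans nc0 D1.
apply: filterS (ae_discrepancy_growth ind idd) => w [j [jE [B B0 hB]]].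
set lam := randomization _ _.
have pw := omega_prim R (ltn0Sn p).
have lamE k : lam k = (l k)%:C * omega R p.+1 ^+ j k.
  by rewrite /lam /randomization jE expi_root_angle.
split.
- apply: (dense_not_zero_set rho0 D0 l0 lnd dens (ltn0Sn p) rhon pw).
  + by move=> k; rewrite lamE nmM nmX nm_omega expr1n mulr1 nm_real ger0_norm// ltW.
  + move=> k; rewrite lamE exprMn -exprM mulnC exprM (prim_expr_order pw) expr1n mulr1.
    by rewrite -(rmorphXn (real_complex R)).
  by rewrite mulrC -ltr_pdivrMr.
(* The points are l k times powers of the root, whereas [balanced_not_unique] divides by powers;
   hence the inverse root. *)
apply: (hu (omega R p.+1)^-1 l j D lam (prim_inv pw) l0 lnd dens D1 D2).
  exact: (balanced_of_growth rho0 D0 l0 lnd dens B0 hB).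
by move=> k; rewrite lamE exprVn invrK.
Qed.
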